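(* Let $\mathcal{L}=\mathcal{L}_0-\mathcal{I}$ be the Lévy-type operator described in the context, where $\Sigma$ is bounded and Lipschitz with constants $\sigma_0,\sigma_1$, the Lévy measure satisfies the bounds with constants $\lambda,\Lambda,\sigma$, and $\lambda_0+\lambda>0$. Assume that the continuous vector field $b$ is such that there exist $\gamma\in(2-\sigma,2)$ with $\gamma>1$ and $\alpha,R>0$ with $b(t,x)\cdot x\ge\alpha|x|^\gamma$ for all $|x|\ge R$, $t>0$, and that either of the following conditions holds: (i) $\lambda_0>0$ or $\sigma\in(1,2)$, and there exists $c_0>0$ such that $(b(t,x)-b(t,y))\cdot(x-y)\ge-c_0|x-y|$ for all $x,y\in\mathbb{R}^d$, $t>0$; (ii) $\lambda_0=0$ and $\sigma\in(0,1]$, and there exist $\delta\in(0,1)$, $c_0>0$ such that $(b(t,x)-b(t,y))\cdot(x-y)\ge-c_0|x-y|(|x-y|\wedge1)^{1-\sigma+\delta}$ for all $x,y\in\mathbb{R}^d$, $t>0$. Let $u_0$ be continuous on $\mathbb{R}^d$ and let $u$ be a viscosity solution of $$\partial_tu+\mathcal{L}[u]+b(t,x)\cdot Du=0\ \text{ in }(0,T)\times\mathbb{R}^d,\qquad u(0,x)=u_0(x)\ \text{ in }\mathbb{R}^d,$$ such that $|u(t,x)|\le C(1+|x|)^m$ for some $m\in(0,\sigma)$ and $C>0$ (uniformly in time). Then, for any $k\in(0,\sigma)$ with $k>2-\gamma$ and $u_0\in L^\infty(\langle x\rangle^{-k})$, and for any $\bar k$ with $k<\bar k<\sigma$, there exists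 a positive constant $M>0$ (depending on $\alpha,\gamma,\sigma,(\lambda+\lambda_0)^{-1},\sigma_0,\sigma_1,\Lambda,c_0,d,k,\bar k$) such that $$[u(t)]_{\langle x\rangle^{\bar k}}\le M(1+t)^{-q}[u_0]_{\langle x\rangle^k}\quad\text{for all }t\in(0,T),\qquad q=\frac{\bar k-k}{2-\gamma}.$$
   Context: $\langle x\rangle:=\sqrt{1+|x|^2}$, $a\wedge b=\min(a,b)$. $L^\infty(\langle x\rangle^{-k})$ is the space of measurable $u$ with $u\langle x\rangle^{-k}\in L^\infty(\mathbb{R}^d)$. The weighted oscillation seminorm is $[u]_{\langle x\rangle^k}:=\sup_{x,y\in\mathbb{R}^d}\frac{|u(x)-u(y)|}{\langle x\rangle^k+\langle y\rangle^k}$. Operators: $\mathcal{L}_0[u]=-\lambda_0\Delta u-\mathrm{tr}(\Sigma(x)\Sigma^*(x)D^2u)$ with $\lambda_0\ge0$ and $\Sigma:\mathbb{R}^d\to\mathbb{R}^{d\times\ell}$ satisfying $\|\Sigma(x)\|\le\sigma_0$, $\|\Sigma(x)-\Sigma(y)\|\le\sigma_1|x-y|$. $\mathcal{I}(x,[u])=\int_{\mathbb{R}^d}\{u(x+z)-u(x)-(Du(x)\cdot z)\mathbf{1}_{|z|\le1}\}\,\nu(dz)$, where $\nu$ is absolutely continuous and, for some $\lambda,\Lambda\ge0$, $\sigma\in(0,2)$, $\frac{\lambda}{|z|^{d+\sigma}}\le\frac{d\nu}{dz}\le\frac{\Lambda}{|z|^{d+\sigma}}$ for all $z$. $\mathcal{L}[u]=\mathcal{L}_0[u]-\mathcal{I}(x,[u])$.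 Viscosity solution: $u\in C^0([0,T]\times\mathbb{R}^d)$, $|u|\le C\langle x\rangle^{m}$ for some $m\in(0,\sigma)$, $u(0,\cdot)=u_0$, and for every $\chi\in C^{1,2}((0,T)\times\mathbb{R}^d)$ with $|\chi|\le C\langle x\rangle^{k'}$ for some $k'\in(0,\sigma)$, at every global maximum (resp. minimum) point $(t_0,x_0)\in(0,T)\times\mathbb{R}^d$ of $u-\chi$ one has $\partial_t\chi+\mathcal{L}[\chi]+b\cdot D\chi\le0$ (resp. $\ge0$) at $(t_0,x_0)$.
   Formalization: The constant M is also allowed to depend on the radius R of the coercivity condition, which the stated list of dependencies omits; a bound uniform in R is false, since as R grows the drift can vanish on ever larger balls and the solution approaches the heat flow. *)

(* Defs.v *)
From HB Require Import structures.
From mathcomp Require Import all_boot all_order all_algebra.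
From mathcomp Require Import all_classical all_reals all_analysis.
Set Implicit Arguments.
Unset Strict Implicit.
Unset Printing Implicit Defensive.
Import Order.TTheory GRing.Theory Num.Theory.
Import numFieldNormedType.Exports.
Local Open Scope classical_set_scope.
Local Open Scope ring_scope.

Definition measure_rV_display : measure_display -> measure_display.
Proof. exact. Qed.

Section measurable_rV.
Context {dT : measure_display} {T : sigmaRingType dT} (n : nat).

Let coors : 'I_n -> 'rV[T]_n -> T := fun i x => x ord0 i.

Let rV_set0 : g_sigma_preimage coors set0.
Proof. exact: sigma_algebra0. Qed.

Let rV_setC A : g_sigma_preimage coors A -> g_sigma_preimage coors (~` A).
Proof. exact: sigma_algebraC. Qed.

Let rV_bigcup (F : _^nat) : (forall i, g_sigma_preimage coors (F i)) ->
  g_sigma_preimage coors (\bigcup_i (F i)).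
Proof. exact: sigma_algebra_bigcup. Qed.

(* The product sigma-algebra; for T = R it is the Borel sigma-algebra of the
   usual topology. *)
HB.instance Definition _ := @isMeasurable.Build (measure_rV_display dT)
  'rV[T]_n (g_sigma_preimage coors) rV_set0 rV_setC rV_bigcup.

Lemma measurable_coor (i : 'I_n) :
  measurable_fun setT (fun x : 'rV[T]_n => x ord0 i).
Proof.
move=> _ Y mY; rewrite setTI; apply: sub_sigma_algebra => /=.
rewrite -bigcup_seq/=; exists i => /=; first by rewrite mem_index_enum.
by exists Y => //; rewrite setTI.
Qed.

Lemma measurable_to_rV d1 (T1 : measurableType d1) (f : T1 -> 'rV[T]_n) :
  (forall i, measurable_fun setT (fun x => f x ord0 i)) ->
  measurable_fun setT f.
Proof.
move=> mf.
suff S : g_sigma_preimage coors `<=` image_set_system setT f measurable.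
  by move=> _ A /S; rewrite /image_set_system/= setTI.
apply: smallest_sub.
  exact/sigma_algebra_image/sigma_algebra_measurable.
rewrite -bigcup_seq/=; apply: bigcup_sub => i _ _ [B mB <-].
rewrite /image_set_system/= !setTI.
by have := mf i measurableT _ mB; rewrite setTI.
Qed.

End measurable_rV.

Section lebesgue_measure_rV.
Context {R : realType}.

Definition rV_cons n (p : R * 'rV[R]_n) : 'rV[R]_n.+1 :=
  row_mx (\row_(i < 1) p.1) p.2.

Lemma rV_cons0 n (p : R * 'rV[R]_n) : rV_cons p ord0 ord0 = p.1.
Proof.
rewrite /rV_cons; have -> : ord0 = lshift n (ord0 : 'I_1) by apply/val_inj.
by rewrite (row_mxEl (\row_(i < 1) p.1)) mxE.
Qed.

Lemma rV_consS n (p : R * 'rV[R]_n) i :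
  rV_cons p ord0 (lift ord0 i) = p.2 ord0 i.
Proof.
rewrite /rV_cons; have -> : lift ord0 i = rshift 1 i by apply/val_inj.
by rewrite (row_mxEr (\row_(i < 1) p.1)).
Qed.

Lemma measurable_rV_cons n : measurable_fun setT (@rV_cons n).
Proof.
apply: measurable_to_rV => i; case: (unliftP ord0 i) => [j|] ->.
  rewrite (_ : (fun _ => _) = (fun v : 'rV[R]_n => v ord0 j) \o snd); last first.
    by apply/funext => p; rewrite rV_consS.
  exact: measurableT_comp (measurable_coor j) _.
rewrite (_ : (fun _ => _) = fst)//.
by apply/funext => p; rewrite rV_cons0.
Qed.

Section step.
Context (n : nat) (m : {sigma_finite_measure set 'rV[R]_n -> \bar R}).

Definition lebesgue_rV_step : set 'rV[R]_n.+1 -> \bar R :=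
  pushforward (lebesgue_measure \x m)%E (@rV_cons n).

HB.instance Definition _ := Measure.copy lebesgue_rV_step
  (measure_function_pushforward__canonical__measure_function_Measure
     (lebesgue_measure \x m)%E (@measurable_rV_cons n)).


Let lebesgue_rV_step_sigma_finite : sigma_finite setT lebesgue_rV_step.
Proof.
have /sigma_finiteP[F [TF ndF Foo]] := sigma_finiteT (@lebesgue_measure R).
have /sigma_finiteP[G [TG ndG Goo]] := sigma_finiteT m.
pose hd (v : 'rV[R]_n.+1) : R * 'rV[R]_n :=
  (v ord0 ord0, \row_i v ord0 (lift ord0 i)).
have mhd : measurable_fun setT hd.
  apply/measurable_fun_pairP; split; first exact: measurable_coor.
  apply: measurable_to_rV => i /=.
  rewrite (_ : (fun _ => _) = (fun v : 'rV[R]_n.+1 => v ord0 (lift ord0 i))).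
    exact: measurable_coor.
  by apply/funext => v; rewrite mxE.
have hdK : cancel (@rV_cons n) hd.
  move=> [a v]; rewrite /hd rV_cons0; congr (_, _).
  by apply/rowP => i; rewrite mxE rV_consS.
exists (fun k => hd @^-1` (F k `*` G k)).
  rewrite -preimage_bigcup; apply/esym; rewrite -subTset => v _ /=.
  have [i _ Fi] : (\bigcup_i F i) (hd v).1 by rewrite -TF.
  have [j _ Gj] : (\bigcup_i G i) (hd v).2 by rewrite -TG.
  exists (maxn i j) => //; split.
    by move: Fi; exact/subsetPset/ndF/leq_maxl.
  by move: Gj; exact/subsetPset/ndG/leq_maxr.
move=> k; have [mF Fk] := Foo k; have [mG Gk] := Goo k.
have mFG : measurable (F k `*` G k) by exact: measurableX.
split; first by rewrite -[X in measurable X]setTI; exact: mhd.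
rewrite /lebesgue_rV_step /pushforward -comp_preimage.
rewrite (_ : hd \o _ = id); last by apply/funext => p; exact: hdK.
by rewrite preimage_id product_measure1E// lte_mul_pinfty// ge0_fin_numE.
Qed.

HB.instance Definition _ := Measure_isSigmaFinite.Build _ _ _
  lebesgue_rV_step lebesgue_rV_step_sigma_finite.

End step.

Fixpoint lebesgue_rV n : {sigma_finite_measure set 'rV[R]_n -> \bar R} :=
  if n is n'.+1 then lebesgue_rV_step (lebesgue_rV n') else \d_(0 : 'rV[R]_0).

Lemma lebesgue_rV_box n (a b : 'I_n -> R) : (forall i, a i <= b i) ->
  lebesgue_rV n [set x | forall i, a i <= x ord0 i <= b i] =
  (\prod_i (b i - a i))%:E.
Proof.
elim: n a b => [|n IH] a b ab.
  rewrite big_ord0 /= diracE mem_set//; by case.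
rewrite big_ord_recl /= /lebesgue_rV_step /pushforward.
set B := [set x : 'rV[R]_n |
  forall i, a (lift ord0 i) <= x ord0 i <= b (lift ord0 i)].
rewrite (_ : _ @^-1` _ = `[a ord0, b ord0] `*` B); last first.
  apply/seteqP; split => [[y v] /= h|[y v] /= [h1 h2] i].
    split=> [|i]; first by have := h ord0; rewrite rV_cons0 in_itv.
    by have := h (lift ord0 i); rewrite rV_consS.
  case: (unliftP ord0 i) => [j|] ->; first by rewrite rV_consS; exact: h2.
  by rewrite rV_cons0; move: h1; rewrite in_itv.
rewrite product_measure1E//=.
  rewrite IH// lebesgue_measure_itv/= lte_fin.
  have := ab ord0; rewrite le_eqVlt => /predU1P[->|->].
    by rewrite ltxx subrr mul0r mul0e.
  by rewrite -EFinB -EFinM.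
rewrite (_ : B = \bigcap_(i in [set: 'I_n])
  ((fun x : 'rV[R]_n => x ord0 i) @^-1` `[a (lift ord0 i), b (lift ord0 i)])).
  apply: fin_bigcap_measurable => [|i _]; first exact: finite_finset.
  by rewrite -[X in measurable X]setTI; exact: measurable_coor.
by apply/seteqP; split => [x h i _|x h i] /=; [|have := h i Logic.I];
  rewrite /= in_itv/=.
Qed.

End lebesgue_measure_rV.

Section euclidean.
Context {R : realType}.

(* The library norm `|x| on 'rV[R]_d is the sup norm. It induces the right
   topology, but the structural conditions are about the Euclidean norm. *)
Definition dotv d (x y : 'rV[R]_d) : R := \sum_i x ord0 i * y ord0 i.

Definition enorm d (x : 'rV[R]_d) : R := Num.sqrt (dotv x x).

Definition japanese d (x : 'rV[R]_d) : R := Num.sqrt (1 + enorm x ^+ 2).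

(* Hilbert-Schmidt norm. Replacing it by the operator norm rescales the bounds
   by at most Num.sqrt d%:R, uniformly in l; the sup norm of 'M[R]_(d, l) would
   not have this property. *)
Definition frob d l (A : 'M[R]_(d, l)) : R := Num.sqrt (\tr (A *m A^T)).

Definition grad d (f : 'rV[R]_d -> R) (x : 'rV[R]_d) : 'rV[R]_d :=
  \row_i 'D_(delta_mx ord0 i) f x.

Definition hess d (f : 'rV[R]_d -> R) (x : 'rV[R]_d) : 'M[R]_d :=
  \matrix_(i, j) 'D_(delta_mx ord0 j) (fun y => 'D_(delta_mx ord0 i) f y) x.

Definition laplacian d (f : 'rV[R]_d -> R) (x : 'rV[R]_d) : R := \tr (hess f x).

End euclidean.

Section weighted_spaces.
Context {R : realType} (d : nat).

Definition weighted_Linfty (k : R) (f : 'rV[R]_d -> R) : Prop :=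
  measurable_fun setT f /\
  finite_norm (lebesgue_rV d) +oo%E (fun x => f x * japanese x `^ (- k)).

Definition wosc (k : R) (f : 'rV[R]_d -> R) : \bar R :=
  ereal_sup [set (`|f p.1 - f p.2| /
                  (japanese p.1 `^ k + japanese p.2 `^ k))%:E
            | p in [set: 'rV[R]_d * 'rV[R]_d]].

End weighted_spaces.

Section operators.
Context {R : realType} (d : nat).

Definition bounded_lipschitz l (sigma0 sigma1 : R)
    (Sigma : 'rV[R]_d -> 'M[R]_(d, l)) : Prop :=
  (forall x, frob (Sigma x) <= sigma0) /\
  (forall x y, frob (Sigma x - Sigma y) <= sigma1 * enorm (x - y)).

(* The density is only constrained at z != 0, where the two bounds make sense;
   its value at 0 has no influence on nu when 0 < d. *)
Definition levy_measure (sigma lambda Lambda : R)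
    (nu : {measure set 'rV[R]_d -> \bar R}) : Prop :=
  nu `<< lebesgue_rV d /\
  exists g : 'rV[R]_d -> R,
    [/\ measurable_fun setT g,
        (forall A, measurable A ->
          nu A = (\int[lebesgue_rV d]_(z in A) (g z)%:E)%E) &
        (forall z, z != 0 ->
          lambda / enorm z `^ (d%:R + sigma) <= g z /\
          g z <= Lambda / enorm z `^ (d%:R + sigma))].

Definition op_L0 l (lambda0 : R) (Sigma : 'rV[R]_d -> 'M[R]_(d, l))
    (f : 'rV[R]_d -> R) (x : 'rV[R]_d) : R :=
  - lambda0 * laplacian f x - \tr (Sigma x *m (Sigma x)^T *m hess f x).

Definition op_I (nu : {measure set 'rV[R]_d -> \bar R})
    (f : 'rV[R]_d -> R) (x : 'rV[R]_d) : R :=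
  \int[nu]_z (f (x + z) - f x - dotv (grad f x) z * (enorm z <= 1)%R%:R).

Definition op_L l (lambda0 : R) (Sigma : 'rV[R]_d -> 'M[R]_(d, l))
    (nu : {measure set 'rV[R]_d -> \bar R})
    (f : 'rV[R]_d -> R) (x : 'rV[R]_d) : R :=
  op_L0 lambda0 Sigma f x - op_I nu f x.

End operators.

Section viscosity.
Context {R : realType} (d : nat).
Implicit Types (T sigma : R) (u chi : R -> 'rV[R]_d -> R).

Definition cylinder T : set (R * 'rV[R]_d) := `]0, T[ `*` setT.

(* C^{1,2}((0,T) x R^d); values of chi outside the cylinder are irrelevant. *)
Definition C12 T chi : Prop :=
  [/\ {in cylinder T, continuous (fun p => chi p.1 p.2)},
      {in cylinder T, forall p, derivable (fun t => chi t p.2) p.1 1} /\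
      {in cylinder T, continuous (fun p => derive1 (fun t => chi t p.2) p.1)},
      (forall i, {in cylinder T, forall p,
         derivable (chi p.1) p.2 (delta_mx ord0 i)}) /\
      {in cylinder T, continuous (fun p => grad (chi p.1) p.2)} &
      (forall i j, {in cylinder T, forall p,
         derivable (fun y => 'D_(delta_mx ord0 i) (chi p.1) y) p.2
                   (delta_mx ord0 j)}) /\
      {in cylinder T, continuous (fun p => hess (chi p.1) p.2)}].

Definition subcritical_growth sigma (I : set R) u : Prop :=
  exists m C : R, 0 < m < sigma /\
    forall t x, I t -> `|u t x| <= C * japanese x `^ m.

Definition test_function T sigma chi : Prop :=
  C12 T chi /\ subcritical_growth sigma `]0, T[ chi.

Definition max_point T (w : R -> 'rV[R]_d -> R) (t0 : R) (x0 : 'rV[R]_d) :=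
  0 < t0 < T /\ forall t x, 0 < t < T -> w t x <= w t0 x0.

Definition min_point T (w : R -> 'rV[R]_d -> R) (t0 : R) (x0 : 'rV[R]_d) :=
  0 < t0 < T /\ forall t x, 0 < t < T -> w t0 x0 <= w t x.

Definition residual (L : ('rV[R]_d -> R) -> 'rV[R]_d -> R)
    (b : R -> 'rV[R]_d -> 'rV[R]_d) chi (t : R) (x : 'rV[R]_d) : R :=
  derive1 (fun s => chi s x) t + L (chi t) x + dotv (b t x) (grad (chi t) x).

Definition viscosity_solution T sigma
    (L : ('rV[R]_d -> R) -> 'rV[R]_d -> R)
    (b : R -> 'rV[R]_d -> 'rV[R]_d) (u0 : 'rV[R]_d -> R) u : Prop :=
  [/\ {within `[0, T] `*` setT,
        continuous (fun p : R * 'rV[R]_d => u p.1 p.2)},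
      subcritical_growth sigma `[0, T] u,
      (forall x, u 0 x = u0 x),
      (forall chi t0 x0, test_function T sigma chi ->
         max_point T (fun t x => u t x - chi t x) t0 x0 ->
         residual L b chi t0 x0 <= 0) &
      (forall chi t0 x0, test_function T sigma chi ->
         min_point T (fun t x => u t x - chi t x) t0 x0 ->
         0 <= residual L b chi t0 x0)].

End viscosity.

Section drift.
Context {R : realType} (d : nat).
Implicit Type b : R -> 'rV[R]_d -> 'rV[R]_d.

Definition coercive_drift (alpha gamma radius : R) b : Prop :=
  forall t x, 0 < t -> radius <= enorm x ->
    alpha * enorm x `^ gamma <= dotv (b t x) x.

Definition drift_cond_i (lambda0 sigma c0 : R) b : Prop :=
  (0 < lambda0 \/ 1 < sigma < 2) /\
  forall t x y, 0 < t ->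
    - c0 * enorm (x - y) <= dotv (b t x - b t y) (x - y).

Definition drift_cond_ii (lambda0 sigma c0 : R) b : Prop :=
  [/\ lambda0 = 0, 0 < sigma <= 1 &
      exists2 delta : R, 0 < delta < 1 &
      forall t x y, 0 < t ->
        - c0 * enorm (x - y) *
          Num.min (enorm (x - y)) 1 `^ (1 - sigma + delta)
        <= dotv (b t x - b t y) (x - y)].

End drift.

(* Main.v *)
(** The difference u(t,x) - u(t,y) is compared with a multiple delta(t) of the weight
    W(x,y) = phi(x - y) + V(x) + V(y), where V is a Lyapunov function of order <x>^k.

    At an interior contact point the coercivity of the drift contributes V^(1 - beta/k), with
    beta = 2 - gamma; this dominates the diffusion and the jumps when x or y is large.  In a
    bounded region the strict gain comes from one of two couplings.  If lambda0 > 0, phi is concave and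
    the isotropic noise is reflected across x - y, which also beats the one-sided Lipschitz defect of
    the drift.  If lambda > 0, phi is constant, and a positive mass of jumps sends both points to a common
    cube, where u(t,.) - u(t,.) = 0; no regularity of the drift is then involved.

    With exponent k and delta constant this bounds the oscillation at all times.  With exponent kbar and
    delta(t) = D (1 + t)^(-q), that bound says that V^(beta/kbar) is at most of order 1 + t at a contact
    point, so that the term q/(1 + t) delta W is dominated by the contribution of the drift.

    Instead of Alexandrov's theorem and the matrix inequality of the theorem on sums, only the trace
    inequality for two coupled frames is needed.  It follows by averaging sup-convolutions along random
    walks in the directions of the frames, for which the quadratic penalty is explicit. *)
Require Import Defs.
From HB Require Import structures.
From mathcomp Require Import all_boot all_order all_algebra.
From mathcomp Require Import all_classical all_reals all_analysis.
From mathcomp Require Import measurable_realfun.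
From mathcomp Require Import ring lra.
Set Implicit Arguments.
Unset Strict Implicit.
Unset Printing Implicit Defensive.
Import Order.TTheory GRing.Theory Num.Theory.
Import numFieldNormedType.Exports.
Local Open Scope classical_set_scope.
Local Open Scope ring_scope.

(** The order of choices shapes the averaging argument: the number of steps must be fixed before the
    blow-up scale [h] at which the sup-convolutions are formed. This calls for a mean value
    inequality that is uniform over a class of functions with prescribed growth and Lipschitz
    bounds. Finitely many smooth majorants cover such a class, and their Taylor moduli survive
    averaging whatever the number of steps.

    Solutions are tested only against global smooth functions of growth below [sigma], while the
    blow-up produces quadratic jets valid on tiny balls. A jet is therefore glued to a smooth
    majorant of the solution, close to it in the weight <x>^m2; letting the gap vanish puts the
    solution itself into the jumps of size at least r.

    The final constant may depend on lambda + lambda0 but not on how the sum is split. One of the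
    two is at least half of it and selects the coupling, and one amplitude A serves both, since
    phi(r) = A (2 - exp(- th r)) becomes the constant A for th = 0.

    Jumps raise <x>^k by order <x>^max(0, k-1), the drift gains order <x>^(k - (2 - gamma)); gamma >
    1 and k > 2 - gamma make the former negligible. *)

(** * Euclidean norm, compactness and uniform continuity *)

Section euclidean_norm.
Context {R : realType} {d : nat}.
Implicit Types x y z v w : 'rV[R]_d.

Lemma dotvC x y : dotv x y = dotv y x.
Proof. by rewrite /dotv; apply: eq_bigr => i _; rewrite mulrC. Qed.

Lemma dotvDl x y z : dotv (x + y) z = dotv x z + dotv y z.
Proof. by rewrite /dotv -big_split /=; apply: eq_bigr => i _; rewrite mxE mulrDl. Qed.

Lemma dotvZl (a : R) x y : dotv (a *: x) y = a * dotv x y.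
Proof. by rewrite /dotv big_distrr /=; apply: eq_bigr => i _; rewrite mxE mulrA. Qed.

Lemma dotvNl x y : dotv (- x) y = - dotv x y.
Proof. by rewrite -scaleN1r dotvZl mulN1r. Qed.

Lemma dotvBl x y z : dotv (x - y) z = dotv x z - dotv y z.
Proof. by rewrite dotvDl dotvNl. Qed.

Lemma dotvDr x y z : dotv x (y + z) = dotv x y + dotv x z.
Proof. by rewrite ![dotv x _]dotvC dotvDl. Qed.

Lemma dotvZr (a : R) x y : dotv x (a *: y) = a * dotv x y.
Proof. by rewrite ![dotv x _]dotvC dotvZl. Qed.

Lemma dotvNr x y : dotv x (- y) = - dotv x y.
Proof. by rewrite ![dotv x _]dotvC dotvNl. Qed.

Lemma dotvBr x y z : dotv x (y - z) = dotv x y - dotv x z.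
Proof. by rewrite dotvDr dotvNr. Qed.

Lemma dotv0l x : dotv 0 x = 0.
Proof. by rewrite -(scale0r 0) dotvZl mul0r. Qed.

Lemma dotv0r x : dotv x 0 = 0.
Proof. by rewrite dotvC dotv0l. Qed.

Definition dotvE := (dotvDl, dotvDr, dotvZl, dotvZr, dotvNl, dotvNr, dotv0l, dotv0r).

Lemma dotv_ge0 x : 0 <= dotv x x.
Proof. by rewrite /dotv sumr_ge0// => i _; rewrite -expr2 sqr_ge0. Qed.

Lemma enorm_ge0 x : 0 <= enorm x.
Proof. exact: sqrtr_ge0. Qed.

Lemma enorm_sqr x : enorm x ^+ 2 = dotv x x.
Proof. by rewrite /enorm sqr_sqrtr// dotv_ge0. Qed.

Lemma enorm0 : enorm (0 : 'rV[R]_d) = 0.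
Proof. by rewrite /enorm dotv0l sqrtr0. Qed.

Lemma coord_le_enorm x i : `|x ord0 i| <= enorm x.
Proof.
rewrite -sqrtr_sqr /enorm ler_wsqrtr// /dotv (bigD1 i)//= expr2 lerDl sumr_ge0//.
by move=> j _; rewrite -expr2 sqr_ge0.
Qed.

Lemma enorm_eq0 x : (enorm x == 0) = (x == 0).
Proof.
apply/eqP/eqP => [x0|->]; last exact: enorm0.
apply/rowP => i; have := coord_le_enorm x i.
by rewrite x0 normr_le0 => /eqP ->; rewrite mxE.
Qed.

Lemma enormZ (a : R) x : enorm (a *: x) = `|a| * enorm x.
Proof.
by rewrite /enorm dotvZl dotvZr mulrA -expr2 sqrtrM ?sqr_ge0// sqrtr_sqr.
Qed.

Lemma enormN x : enorm (- x) = enorm x.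
Proof. by rewrite -scaleN1r enormZ normrN1 mul1r. Qed.

Lemma enormBC x y : enorm (x - y) = enorm (y - x).
Proof. by rewrite -enormN opprB. Qed.

Lemma cauchy_schwarz x y : `|dotv x y| <= enorm x * enorm y.
Proof.
have [/eqP x0|xn0] := eqVneq (enorm x) 0.
  by move: x0; rewrite enorm_eq0 => /eqP ->; rewrite dotv0l normr0 enorm0 mul0r.
have xp : 0 < enorm x by rewrite lt_neqAle eq_sym xn0 enorm_ge0.
rewrite -(@ler_pXn2r _ 2)// ?nnegrE ?mulr_ge0 ?enorm_ge0//.
rewrite real_normK ?num_real// exprMn !enorm_sqr.
have X : 0 < dotv x x by rewrite -enorm_sqr exprn_gt0.
have := dotv_ge0 (dotv x x *: y - dotv x y *: x).
rewrite !dotvE (dotvC y x) => h.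
have {}h : 0 <= dotv x x * (dotv x x * dotv y y - dotv x y ^+ 2).
  by move: h; congr (0 <= _); ring.
by move: h; rewrite pmulr_rge0// subr_ge0.
Qed.

Lemma dotv_le x y : dotv x y <= enorm x * enorm y.
Proof. exact: le_trans (ler_norm _) (cauchy_schwarz x y). Qed.

Lemma dotv_ge x y : - (enorm x * enorm y) <= dotv x y.
Proof. by have /ler_normlP[] := cauchy_schwarz x y; rewrite lerNl. Qed.

Lemma enormD_sqr x y : enorm (x + y) ^+ 2 = enorm x ^+ 2 + 2 * dotv x y + enorm y ^+ 2.
Proof. by rewrite !enorm_sqr !dotvE (dotvC y x); ring. Qed.

Lemma enormB_sqr x y : enorm (x - y) ^+ 2 = enorm x ^+ 2 - 2 * dotv x y + enorm y ^+ 2.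
Proof. by rewrite enormD_sqr dotvNr enormN; ring. Qed.

Lemma enormD x y : enorm (x + y) <= enorm x + enorm y.
Proof.
rewrite -(@ler_pXn2r _ 2)// ?nnegrE ?addr_ge0 ?enorm_ge0//.
rewrite enormD_sqr; have := dotv_le x y; lra.
Qed.

Lemma enormB x y : enorm (x - y) <= enorm x + enorm y.
Proof. by rewrite -(enormN y) enormD. Qed.

Lemma enormB_trans y x z : enorm (x - z) <= enorm (x - y) + enorm (y - z).
Proof. by apply: le_trans (enormD _ _); rewrite addrA subrK. Qed.

Lemma enorm_le_add x y : enorm x <= enorm y + enorm (x - y).
Proof. by rewrite -{1}(subrK y x) addrC (le_trans (enormD _ _)). Qed.

Lemma enorm_lip x y : `|enorm x - enorm y| <= enorm (x - y).
Proof.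
rewrite ler_norml; have := enorm_le_add x y; have := enorm_le_add y x.
by rewrite (enormBC y x); lra.
Qed.

Lemma mxnorm_le_enorm x : `|x| <= enorm x.
Proof.
rewrite /Num.norm/= mx_normrE; apply/bigmax_leP; split => [|[i j] _] /=; first exact: enorm_ge0.
by rewrite ord1; exact: coord_le_enorm.
Qed.

Lemma coord_le_mxnorm x i : `|x ord0 i| <= `|x|.
Proof.
rewrite [leRHS]/Num.norm/= mx_normrE.
exact: (@le_bigmax _ _ _ _ (fun ij : 'I_1 * 'I_d => `|x ij.1 ij.2|) (ord0, i)).
Qed.

Lemma enorm_le_mxnorm x : enorm x <= d.+1%:R * `|x|.
Proof.
rewrite -(@ler_pXn2r _ 2)// ?nnegrE ?mulr_ge0 ?enorm_ge0//.
rewrite enorm_sqr exprMn.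
apply: (@le_trans _ _ (\sum_(i < d) `|x| ^+ 2)).
  apply: ler_sum => i _; rewrite -expr2 -real_normK ?num_real//.
  by rewrite lerXn2r ?nnegrE// coord_le_mxnorm.
rewrite sumr_const card_ord -[leLHS]mulr_natl ler_wpM2r ?sqr_ge0//.
by rewrite -natrX ler_nat (leq_trans (leqnSn d))// expnS leq_pmulr// expn_gt0.
Qed.

Lemma nbhs_enormP x (P : set 'rV[R]_d) :
  nbhs x P <-> exists2 e : R, 0 < e & forall y, enorm (y - x) < e -> P y.
Proof.
split=> [/nbhs_ballP[e /= e0 h]|[e e0 h]].
  exists e => // y ye; apply: h; rewrite -ball_normE /= -opprB normrN.
  exact: le_lt_trans (mxnorm_le_enorm _) ye.
apply/nbhs_ballP; exists (e / d.+1%:R) => /=; first by rewrite divr_gt0.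
move=> y; rewrite -ball_normE /= -opprB normrN ltr_pdivlMr// mulrC => ye.
exact/h/(le_lt_trans (enorm_le_mxnorm _)).
Qed.

Lemma continuous_enormP (f : 'rV[R]_d -> R) :
  continuous f <-> forall x e, 0 < e ->
    exists2 r : R, 0 < r & forall y, enorm (y - x) < r -> `|f y - f x| < e.
Proof.
split=> [cf x e e0|h x].
  have /cvgrPdist_lt/(_ _ e0)/nbhs_enormP[r r0 hr] := cf x.
  by exists r => // y /hr; rewrite distrC.
have ff : Filter (nbhs (x : 'rV[R]_d)) by exact: nbhs_filter.
apply/cvgrPdist_lt => e e0; apply/nbhs_enormP.
have [r r0 hr] := h x e e0.
by exists r => // y /hr; rewrite distrC.
Qed.

Lemma continuous_enorm : continuous (@enorm R d).
Proof.
apply/continuous_enormP => x e e0; exists e => // y; exact/le_lt_trans/enorm_lip.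
Qed.

Lemma compact_enorm_le (L : R) : compact [set x : 'rV[R]_d | enorm x <= L].
Proof.
apply: bounded_closed_compact.
  exists L; split; first exact: num_real.
  by move=> M LM x /= xL; exact/(le_trans (mxnorm_le_enorm x))/(le_trans xL)/ltW.
rewrite (_ : mkset _ = @enorm R d @^-1` [set t | t <= L])//.
apply: closed_comp => [x _|]; first exact: continuous_enorm.
exact: closed_le.
Qed.

Lemma finite_net (L r : R) : 0 < r ->
  exists s : seq 'rV[R]_d, forall x, enorm x <= L -> exists2 c, c \in s & enorm (x - c) < r.
Proof.
move=> r0; have := @compact_enorm_le L; rewrite compact_cover.
move=> /(_ _ setT (fun c => [set x | enorm (x - c) < r])) [].
- move=> c _; rewrite openE => x /= xc.
  apply/nbhs_enormP; exists (r - enorm (x - c)); first by rewrite subr_gt0.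
  by move=> y yx /=; have := enormB_trans x y c; lra.
- by move=> x _; exists x => //=; rewrite subrr enorm0.
move=> D' _ h; exists (finmap.enum_fset D') => x /h[c /= cD cx].
by exists c.
Qed.

End euclidean_norm.

(** The radius is the parameter of a near-covering along the filter of positive numbers tending to
    0, so compactness yields a radius common to all points without extracting a finite subcover. *)
Lemma heine_cantor {R : realType} (T : pseudoMetricType R) (A : set T) (f : T -> R) (e : R) :
  compact A -> {within A, continuous f} -> 0 < e ->
  exists2 r : R, 0 < r & forall x y, A x -> A y -> ball x r y -> `|f x - f y| < e.
Proof.
move=> /compact_near_coveringP cA /subspace_continuousP cf e0.
have := cA R (0^'+) (fun r x => A x -> forall y, A y -> ball x r y -> `|f x - f y| < e) _ _.
case.
  move=> x Ax.
  have e20 : 0 < e / 2 by rewrite divr_gt0.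
  have /cvgrPdist_lt/(_ _ e20)/nbhs_ballP[r /= r0 hr] := cf x Ax.
  exists (ball x (r / 2), [set t | 0 < t < r / 2]) => /=.
    split; first by apply: nbhsx_ballx; rewrite divr_gt0.
    exists (r / 2) => /=; first by rewrite divr_gt0.
    by move=> y /= + y0; rewrite sub0r normrN gtr0_norm// y0 => ->.
  move=> [x' t] /= [xx' /andP[t0 tr]] Ax' y Ay x'y.
  have h1 : `|f x - f x'| < e / 2.
    by apply: hr => //; apply: le_ball xx'; lra.
  have h2 : `|f x - f y| < e / 2.
    apply: hr => //; apply: (@le_ball _ _ _ (r / 2 + t)); first by lra.
    exact: ball_triangle xx' x'y.
  rewrite (splitr e) -(subrKA (f x)) (le_lt_trans (ler_normD _ _))//.
  by rewrite ltrD// distrC.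
move=> t /= t0 ht; exists (t / 2); first by rewrite divr_gt0.
move=> x y Ax Ay xy; apply: (ht (t / 2)) => //=; last by rewrite divr_gt0.
by rewrite sub0r normrN gtr0_norm ?divr_gt0//; lra.
Qed.

Section uniform_continuity.
Context {R : realType} {d : nat}.
Implicit Types x y : 'rV[R]_d.

Lemma ball_enorm x y (r : R) : enorm (x - y) < r -> ball x r y.
Proof. by rewrite -ball_normE /=; exact/le_lt_trans/mxnorm_le_enorm. Qed.

Lemma unif_continuous_rV (f : 'rV[R]_d -> R) (L e : R) : continuous f -> 0 < e ->
  exists2 r : R, 0 < r & forall x y, enorm x <= L -> enorm y <= L -> enorm (x - y) < r ->
    `|f x - f y| < e.
Proof.
move=> cf e0.
have [r r0 h] := heine_cantor (@compact_enorm_le R d L) (continuous_subspaceT cf) e0.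
by exists r => // x y xL yL /ball_enorm; exact: h.
Qed.

Lemma unif_continuous_time (T : R) (u : R -> 'rV[R]_d -> R) (L e : R) :
  {within `[0, T] `*` setT, continuous (fun p => u p.1 p.2)} -> 0 < e ->
  exists2 r : R, 0 < r & forall t s x y, 0 <= t <= T -> 0 <= s <= T ->
    enorm x <= L -> enorm y <= L -> `|t - s| < r -> enorm (x - y) < r ->
    `|u t x - u s y| < e.
Proof.
move=> cu e0.
have cA := compact_setX (@segment_compact _ 0 T) (@compact_enorm_le R d L).
have {}cu : {within `[0, T] `*` [set x | enorm x <= L], continuous (fun p => u p.1 p.2)}.
  by apply: continuous_subspaceW cu => p [/= p1 p2].
have [r r0 h] := heine_cantor cA cu e0.
exists r => // t s x y tT sT xL yL ts xy.
apply: (h (t, x) (s, y)) => //; [split => //=; by rewrite in_itv..|].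
by split => /=; [exact: ts|exact: ball_enorm].
Qed.

Lemma continuous_bounded (f : 'rV[R]_d -> R) (L : R) : continuous f ->
  exists2 M : R, 0 < M & forall x, enorm x <= L -> `|f x| <= M.
Proof.
move=> cf.
have [L0|L0] := ltP L 0.
  by exists 1 => // x xL; have := enorm_ge0 x; lra.
have : compact (f @` [set x | enorm x <= L]).
  exact/continuous_compact/compact_enorm_le/continuous_subspaceT.
move=> /compact_bounded[M [_ /(_ (`|M| + 1))]] h.
exists (`|M| + 1); first by rewrite ltr_wpDl.
move=> x xL; apply: h => /=; first by rewrite (le_lt_trans (ler_norm _))// ltrDl.
by exists x.
Qed.

Lemma coercive_max (f : 'rV[R]_d -> R) (L : R) : continuous f ->
  (forall x, L < enorm x -> f x <= f 0) -> 0 <= L ->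
  exists2 x, enorm x <= L & forall y, f y <= f x.
Proof.
move=> cf h L0.
have [|x xL hx] := @compact_EVT_max _ R f [set x | enorm x <= L] _
  (@compact_enorm_le _ _ L) (continuous_subspaceT cf).
  by exists 0 => /=; rewrite enorm0.
move: xL; rewrite inE /= => xL.
exists x => // y; have [yL|yL] := leP (enorm y) L; first by apply: hx; rewrite inE.
by apply: le_trans (h _ yL) (hx _ _); rewrite inE /= enorm0.
Qed.

End uniform_continuity.

(** * Quadratic forms and twice differentiable functions *)

Section quadratic_form.
Context {R : realType} {d : nat}.
Implicit Types (H : 'M[R]_d) (v w : 'rV[R]_d).

Definition qf H v w : R := (v *m H *m w^T) ord0 ord0.

Lemma qfE H v w : qf H v w = \sum_i \sum_j v ord0 i * H i j * w ord0 j.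
Proof.
rewrite /qf mxE exchange_big /=; apply: eq_bigr => j _.
by rewrite !mxE big_distrl.
Qed.

Lemma qfDl H v v' w : qf H (v + v') w = qf H v w + qf H v' w.
Proof. by rewrite /qf !mulmxDl mxE. Qed.

Lemma qfDr H v w w' : qf H v (w + w') = qf H v w + qf H v w'.
Proof. by rewrite /qf linearD /= mulmxDr mxE. Qed.

Lemma qfZl H a v w : qf H (a *: v) w = a * qf H v w.
Proof. by rewrite /qf -!scalemxAl mxE. Qed.

Lemma qfZr H a v w : qf H v (a *: w) = a * qf H v w.
Proof. by rewrite /qf linearZ /= -scalemxAr mxE. Qed.

Lemma qfNl H v w : qf H (- v) w = - qf H v w.
Proof. by rewrite -scaleN1r qfZl mulN1r. Qed.

Lemma qfNr H v w : qf H v (- w) = - qf H v w.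
Proof. by rewrite -scaleN1r qfZr mulN1r. Qed.

Lemma qfDm H H' v w : qf (H + H') v w = qf H v w + qf H' v w.
Proof. by rewrite /qf mulmxDr mulmxDl mxE. Qed.

Lemma qfZm a H v w : qf (a *: H) v w = a * qf H v w.
Proof. by rewrite /qf -scalemxAr -scalemxAl mxE. Qed.

Lemma qfNm H v w : qf (- H) v w = - qf H v w.
Proof. by rewrite -scaleN1r qfZm mulN1r. Qed.

Lemma qf0m v w : qf 0 v w = 0.
Proof. by rewrite /qf mulmx0 mul0mx mxE. Qed.

Lemma qf_scalar a v w : qf a%:M v w = a * dotv v w.
Proof.
rewrite -scalemx1 qfZm /qf mulmx1 mxE /dotv; congr (_ * _).
by apply: eq_bigr => i _; rewrite mxE.
Qed.

Lemma qf_delta H i j : qf H (delta_mx ord0 i) (delta_mx ord0 j) = H i j.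
Proof.
rewrite qfE (bigD1 i)//= (bigD1 j)//= !mxE !eqxx mul1r mulr1.
rewrite big1 => [|k kj]; last by rewrite mxE eqxx (negPf kj) mulr0.
rewrite addr0 big1 ?addr0// => k ki; apply: big1 => l _.
by rewrite !mxE eqxx (negPf ki) mul0r mul0r.
Qed.

Definition mabs H : R := \sum_i \sum_j `|H i j|.

Lemma mabs_ge0 H : 0 <= mabs H.
Proof. by apply: sumr_ge0 => i _; apply: sumr_ge0. Qed.

Lemma qf_le H v w : `|qf H v w| <= mabs H * (enorm v * enorm w).
Proof.
rewrite qfE (le_trans (ler_norm_sum _ _ _))// /mabs mulr_suml ler_sum// => i _.
rewrite (le_trans (ler_norm_sum _ _ _))// mulr_suml ler_sum// => j _.
rewrite !normrM (mulrC `|v _ _|) -mulrA ler_wpM2l//.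
by rewrite ler_pM// coord_le_enorm.
Qed.

End quadratic_form.

(** One number plays two roles below: as a radius, and through its inverse as a bound. Finite
    families thus get common moduli and common bounds at the same time. *)
Lemma common_radius {R : realType} (I : eqType) (s : seq I) (P : I -> R -> Prop) :
  (forall i r r', 0 < r' -> r' <= r -> P i r -> P i r') ->
  (forall i, i \in s -> exists2 r, 0 < r & P i r) ->
  exists2 r : R, 0 < r & forall i, i \in s -> P i r.
Proof.
move=> hP; elim: s => [|a s IH] h; first by exists 1.
have [r r0 Pr] := h a (mem_head a s).
have [r' r'0 Pr'] : exists2 r, 0 < r & forall i, i \in s -> P i r.
  by apply: IH => i si; apply: h; rewrite inE si orbT.
exists (Num.min r r'); first by rewrite lt_min r0.
have m0 : 0 < Num.min r r' by rewrite lt_min r0.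
move=> i; rewrite inE => /predU1P[->|/Pr' h']; first by apply: hP Pr; rewrite // ge_min lexx.
by apply: hP h' => //; rewrite ge_min lexx orbT.
Qed.

Section matrix_continuity.
Context {R : realType} {d : nat}.

Lemma unif_continuous_mx (H : 'rV[R]_d -> 'M[R]_d) (L e : R) :
  (forall i j, continuous (fun x => H x i j)) -> 0 < e ->
  exists2 r : R, 0 < r & forall x y, enorm x <= L -> enorm y <= L -> enorm (x - y) < r ->
    mabs (H x - H y) <= e.
Proof.
move=> cH e0.
have e'0 : 0 < e / (d.+1 * d.+1)%:R by rewrite divr_gt0// ltr0n muln_gt0.
have [|ij _|r r0 hr] := @common_radius R _ (enum [set: 'I_d * 'I_d])
  (fun ij r => forall x y, enorm x <= L -> enorm y <= L -> enorm (x - y) < r ->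
    `|H x ij.1 ij.2 - H y ij.1 ij.2| < e / (d.+1 * d.+1)%:R).
- by move=> ij r r' r'0 rr' h x y xL yL xy; apply: h => //; exact: lt_le_trans xy rr'.
- exact: unif_continuous_rV.
exists r => // x y xL yL xy.
apply: (@le_trans _ _ (\sum_(i < d) \sum_(j < d) e / (d.+1 * d.+1)%:R)).
  apply: ler_sum => i _; apply: ler_sum => j _; rewrite !mxE.
  by apply/ltW/(hr (i, j)) => //; rewrite mem_enum inE.
rewrite !sumr_const !card_ord -mulrnA -[leLHS]mulr_natr mulrAC -mulrA ler_piMr ?ltW//.
rewrite ltr_pdivrMr ?mul1r ?ltr0n ?muln_gt0// ltr_nat.
by rewrite ltn_mul.
Qed.

Lemma bounded_mx (H : 'rV[R]_d -> 'M[R]_d) (L : R) :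
  (forall i j, continuous (fun x => H x i j)) ->
  exists2 M : R, 0 < M & forall x, enorm x <= L -> mabs (H x) <= M.
Proof.
move=> cH.
have [|ij _|r r0 hr] := @common_radius R _ (enum [set: 'I_d * 'I_d])
  (fun ij r => forall x, enorm x <= L -> `|H x ij.1 ij.2| <= r^-1).
- move=> ij r r' r'0 rr' h x xL; apply: le_trans (h x xL) _.
  by rewrite lef_pV2 ?posrE// (lt_le_trans r'0).
- have [M M0 hM] := continuous_bounded L (cH ij.1 ij.2).
  by exists M^-1; rewrite ?invr_gt0// invrK.
exists (\sum_(i < d) \sum_(j < d) r^-1 + 1).
  by rewrite ltr_wpDl// sumr_ge0// => i _; rewrite sumr_ge0// => j _; rewrite invr_ge0 ltW.
move=> x xL; rewrite ler_wpDr//; apply: ler_sum => i _; apply: ler_sum => j _.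
by apply: (hr (i, j)) => //; rewrite mem_enum inE.
Qed.

End matrix_continuity.

Section twice_differentiable.
Context {R : realType} {d : nat}.
Implicit Types (f : 'rV[R]_d -> R) (g : 'rV[R]_d -> 'rV[R]_d) (H : 'rV[R]_d -> 'M[R]_d).

(** With a quadratic remainder a derivative is checked by algebra alone; this covers polynomials,
    quadratic forms and the truncated powers used for cut-offs. *)
Lemma is_derive_quadratic_error (V : normedModType R) (f : V -> R) (x v : V) (df C : R) :
  (forall h : R, `|h| <= 1 -> `|f (h *: v + x) - f x - h * df| <= C * h ^+ 2) ->
  is_derive x v f df.
Proof.
move=> hf.
suff cf : h^-1 *: ((f \o shift x) (h *: v) - f x) @[h --> 0^'] --> df.
  by apply: DeriveDef; [apply/cvg_ex; exists df|exact/cvg_lim].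
apply/cvgrPdist_lt => e e0.
have C0 : 0 <= C by have := hf 1; rewrite normr1 expr1n mulr1 => /(_ (lexx _)); exact: le_trans.
have C1 : 0 < C + 1 by rewrite ltr_wpDl.
exists (Num.min 1 (e / (C + 1))) => /=; first by rewrite lt_min ltr01 divr_gt0.
move=> h /=; rewrite sub0r normrN lt_min => /andP[h1 he] hn0.
have hp : 0 < `|h| by rewrite normr_gt0.
have -> : df - h^-1 *: (f (h *: v + x) - f x) = - (h^-1 * (f (h *: v + x) - f x - h * df)).
  by rewrite -[_ *: _]/(h^-1 * _); field.
rewrite normrN normrM normfV mulrC ltr_pdivrMr//.
apply: le_lt_trans (hf h (ltW h1)) _.
rewrite -real_normK ?num_real// expr2 mulrA ltr_pM2r//.
apply: (@le_lt_trans _ _ ((C + 1) * `|h|)); first by rewrite ler_wpM2r// lerDl.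
by rewrite mulrC -ltr_pdivlMr.
Qed.

Lemma is_derive_line (V : normedModType R) (f : V -> R) (x v : V) (df : R) :
  is_derive x v f df <-> is_derive (0 : R) 1 (fun h : R => f (h *: v + x)) df.
Proof.
have E : 'D_v f x = 'D_1 (fun h : R => f (h *: v + x)) 0.
  rewrite /derive; set g1 := fun h => h^-1 *: _; set g2 := fun h => h^-1 *: _.
  suff -> : g1 = g2 by [].
  by rewrite funeqE /g1 /g2 => h /=; rewrite addr0 scale0r add0r [_%:A]mulr1.
split=> -[df1 df2]; apply: DeriveDef.
- exact: (derivable1P f x v).1.
- by rewrite -E.
- exact: (derivable1P f x v).2.
- by rewrite E.
Qed.

(** Gradient and Hessian are explicit witnesses, so they can be computed with instead of being
    recovered from limits. Only directional derivatives enter, together with the continuity of all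
    terms; [H] is given as a matrix without a symmetry clause. *)
Definition C2 f g H := [/\ forall x v, is_derive x v f (dotv (g x) v),
  forall x v w, is_derive x v (fun y => dotv (g y) w) (qf (H x) w v),
  continuous f, forall w, continuous (fun x => dotv (g x) w) &
  forall i j, continuous (fun x => H x i j)].

Lemma eq_C2 f f' g g' H H' : f =1 f' -> g =1 g' -> H =1 H' -> C2 f g H -> C2 f' g' H'.
Proof. by move=> /funext -> /funext -> /funext ->. Qed.

Lemma C2_cst (c : R) : C2 (fun=> c) (fun=> 0) (fun=> 0).
Proof.
split=> [x v|x v w|x|w x|i j x]; try exact: cst_continuous.
- by rewrite dotv0l; exact: is_derive_cst.
- by rewrite qf0m (_ : (fun=> _) = cst 0); [exact: is_derive_cst|apply/funext => ?; rewrite dotv0l].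
Qed.

Lemma continuousDf f f' : continuous f -> continuous f' -> continuous (fun x => f x + f' x).
Proof. by move=> cf cf' x; exact: (continuousD (cf x) (cf' x)). Qed.

Lemma continuousMf f f' : continuous f -> continuous f' -> continuous (fun x => f x * f' x).
Proof. by move=> cf cf' x; exact: (continuousM (cf x) (cf' x)). Qed.

Lemma continuous_compf f (phi : R -> R) : continuous f -> (forall x, {for f x, continuous phi}) ->
  continuous (fun x => phi (f x)).
Proof. by move=> cf cp x; apply: continuous_comp; [exact: cf|exact: cp]. Qed.

Lemma is_deriveDf f f' x v (a b : R) : is_derive x v f a -> is_derive x v f' b ->
  is_derive x v (fun y => f y + f' y) (a + b).
Proof. by move=> ha hb; exact: is_deriveD. Qed.

Lemma is_deriveMf f f' x v (a b : R) : is_derive x v f a -> is_derive x v f' b ->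
  is_derive x v (fun y => f y * f' y) (f x * b + f' x * a).
Proof. by move=> ha hb; exact: is_deriveM. Qed.

Lemma is_derive_compf f (phi : R -> R) x v (a b : R) : is_derive x v f a ->
  is_derive (f x) 1 phi b -> is_derive x v (fun y => phi (f y)) (b * a).
Proof.
move=> /is_derive_line ha hb; apply/is_derive_line.
apply: (@is_derive1_comp R phi (fun h : R => f (h *: v + x)) 0 b a) => //.
by rewrite scale0r add0r.
Qed.

Lemma C2_add f g H f' g' H' : C2 f g H -> C2 f' g' H' ->
  C2 (fun x => f x + f' x) (fun x => g x + g' x) (fun x => H x + H' x).
Proof.
move=> [h1 h2 h3 h4 h5] [k1 k2 k3 k4 k5]; split=> [x v|x v w||w|i j].
- by rewrite dotvDl; exact: is_deriveDf.
- rewrite qfDm (_ : (fun y => _) = (fun y => dotv (g y) w + dotv (g' y) w)); first exact: is_deriveDf.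
  by apply/funext => y; rewrite dotvDl.
- exact: continuousDf.
- rewrite (_ : (fun y => _) = (fun y => dotv (g y) w + dotv (g' y) w)); first exact: continuousDf.
  by apply/funext => y; rewrite dotvDl.
- rewrite (_ : (fun y => _) = (fun y => H y i j + H' y i j)); first exact: continuousDf.
  by apply/funext => y; rewrite mxE.
Qed.

Lemma qf_outer (a b v w : 'rV[R]_d) : qf (a^T *m b) v w = dotv a v * dotv b w.
Proof.
rewrite qfE /dotv big_distrl /=; apply: eq_bigr => i _.
rewrite big_distrr /=; apply: eq_bigr => j _.
by rewrite mxE big_ord1 !mxE; ring.
Qed.

Lemma coord_dotv (a : 'rV[R]_d) i : a ord0 i = dotv a (delta_mx ord0 i).
Proof.
rewrite /dotv (bigD1 i)//= big1 => [|j ji]; first by rewrite mxE !eqxx mulr1 addr0.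
by rewrite mxE eqxx (negPf ji) mulr0.
Qed.

Lemma C2_mul f g H f' g' H' : C2 f g H -> C2 f' g' H' ->
  C2 (fun x => f x * f' x) (fun x => f x *: g' x + f' x *: g x)
     (fun x => f x *: H' x + f' x *: H x + ((g x)^T *m g' x + (g' x)^T *m g x)).
Proof.
move=> [h1 h2 h3 h4 h5] [k1 k2 k3 k4 k5].
have E w : (fun y => dotv (f y *: g' y + f' y *: g y) w) =
    (fun y => f y * dotv (g' y) w + f' y * dotv (g y) w).
  by apply/funext => y; rewrite !dotvE.
split=> [x v|x v w||w|i j].
- by rewrite !dotvE; exact: is_deriveMf.
- rewrite E !qfDm !qfZm !qf_outer.
  apply: (@is_derive_eq _ _ _ _ _ _ _ _ (is_deriveDf
    (is_deriveMf (h1 x v) (k2 x v w)) (is_deriveMf (k1 x v) (h2 x v w)))).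
  by ring.
- exact: continuousMf.
- by rewrite E; apply: continuousDf; exact: continuousMf.
- rewrite (_ : (fun y => _) = (fun y => (f y * H' y i j + f' y * H y i j) +
    (dotv (g y) (delta_mx ord0 i) * dotv (g' y) (delta_mx ord0 j) +
     dotv (g' y) (delta_mx ord0 i) * dotv (g y) (delta_mx ord0 j)))); last first.
    by apply/funext => y; rewrite !mxE !big_ord1 !mxE !coord_dotv.
  by do !apply: continuousDf => //; apply: continuousMf.
Qed.

Lemma C2_scale c f g H : C2 f g H -> C2 (fun x => c * f x) (fun x => c *: g x) (fun x => c *: H x).
Proof.
move=> /(C2_mul (C2_cst c)); apply: eq_C2 => x //; first by rewrite scaler0 addr0.
by rewrite scaler0 trmx0 mul0mx mulmx0 !addr0.
Qed.

Lemma C2_comp (phi phi1 phi2 : R -> R) f g H :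
  (forall x, is_derive (f x) 1 phi (phi1 (f x))) ->
  (forall x, is_derive (f x) 1 phi1 (phi2 (f x))) ->
  (forall x, {for f x, continuous phi}) -> (forall x, {for f x, continuous phi1}) ->
  (forall x, {for f x, continuous phi2}) ->
  C2 f g H ->
  C2 (fun x => phi (f x)) (fun x => phi1 (f x) *: g x)
     (fun x => phi1 (f x) *: H x + phi2 (f x) *: ((g x)^T *m g x)).
Proof.
move=> p1 p2 c0 c1 c2 [h1 h2 h3 h4 h5].
have E w : (fun y => dotv (phi1 (f y) *: g y) w) = (fun y => phi1 (f y) * dotv (g y) w).
  by apply/funext => y; rewrite !dotvE.
split=> [x v|x v w||w|i j].
- by rewrite dotvZl; exact: is_derive_compf.
- rewrite E qfDm !qfZm qf_outer.
  apply: (@is_derive_eq _ _ _ _ _ _ _ _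
    (is_deriveMf (is_derive_compf (h1 x v) (p2 x)) (h2 x v w))).
  by ring.
- exact: continuous_compf.
- by rewrite E; apply: continuousMf => //; exact: continuous_compf.
- rewrite (_ : (fun y => _) = (fun y => phi1 (f y) * H y i j + phi2 (f y) *
    (dotv (g y) (delta_mx ord0 i) * dotv (g y) (delta_mx ord0 j)))); last first.
    by apply/funext => y; rewrite !mxE !big_ord1 !mxE !coord_dotv.
  apply: continuousDf; apply: continuousMf => //; first exact: continuous_compf.
    exact: continuous_compf.
  exact: continuousMf.
Qed.

Lemma continuous_dotvl (w : 'rV[R]_d) : continuous (fun x : 'rV[R]_d => dotv x w).
Proof.
apply/continuous_enormP => x e e0; exists (e / (enorm w + 1)).
  by rewrite divr_gt0// ltr_wpDl// enorm_ge0.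
move=> y; rewrite ltr_pdivlMr ?ltr_wpDl ?enorm_ge0// -dotvBl => h.
apply: le_lt_trans (cauchy_schwarz _ _) (le_lt_trans _ h).
by rewrite ler_wpM2l ?enorm_ge0// lerDl.
Qed.

Lemma continuous_sub_cst (c : 'rV[R]_d) f : continuous f -> continuous (fun x : 'rV[R]_d => f (x - c)).
Proof.
move=> /continuous_enormP cf; apply/continuous_enormP => x e e0.
have [r r0 hr] := cf (x - c) e e0; exists r => // y yx; apply: hr.
by rewrite opprB addrA subrK.
Qed.

Lemma C2_sqdist (c : 'rV[R]_d) :
  C2 (fun x => enorm (x - c) ^+ 2) (fun x => 2 *: (x - c)) (fun=> 2%:M).
Proof.
split=> [x v|x v w||w|i j].
- apply: (@is_derive_quadratic_error _ _ _ _ _ (enorm v ^+ 2)) => h _.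
  rewrite -[h *: v + x - c]addrA (enormD_sqr (h *: v)) enormZ exprMn real_normK ?num_real// !dotvE !(dotvC v).
  by rewrite ger0_norm; [|rewrite -[leLHS]addr0]; have := mulr_ge0 (sqr_ge0 (enorm v)) (sqr_ge0 h); lra.
- rewrite qf_scalar; apply: (@is_derive_quadratic_error _ _ _ _ _ 0) => h _.
  by rewrite !dotvE (dotvC w) mul0r normr_le0; apply/eqP; ring.
- apply: (@continuous_sub_cst c (fun x => enorm x ^+ 2)) => x.
  by apply: (continuousM (continuous_enorm (x:=x)) (continuous_enorm (x:=x))).
- apply: (@continuous_sub_cst c (fun x => dotv (2 *: x) w)).
  rewrite (_ : (fun y => _) = (fun y : 'rV[R]_d => dotv y (2 *: w))); first exact: continuous_dotvl.
  by apply/funext => y; rewrite !dotvE.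
- exact: cst_continuous.
Qed.

Lemma is_derive_along (f : 'rV[R]_d -> R) (x v : 'rV[R]_d) (df t : R) :
  is_derive (t *: v + x) v f df -> is_derive t (1 : R) (fun t : R => f (t *: v + x)) df.
Proof.
move=> /is_derive_line h; apply/is_derive_line.
move: h; congr is_derive; apply/funext => h.
by rewrite addrA -scalerDl [_%:A]mulr1.
Qed.

Lemma is_derive1_continuous (f : R -> R) (t df : R) : is_derive t 1 f df -> {for t, continuous f}.
Proof. by move=> [h _]; apply: differentiable_continuous; exact/derivable1_diffP. Qed.

Lemma C2_taylor f g H (x v : 'rV[R]_d) : C2 f g H -> exists2 th : R, 0 <= th <= 1 &
  f (x + v) = f x + dotv (g x) v + 2^-1 * qf (H (x + th *: v)) v v.
Proof.
move=> [h1 h2 h3 h4 h5].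
set c := f (x + v) - f x - dotv (g x) v.
(* Subtracting the quadratic that makes the values at 0 and 1 agree puts Rolle in force; at the
   resulting point the mean value theorem for the directional derivative identifies [c] with half
   the second derivative. *)
pose psi (t : R) := f (t *: v + x) + - (dotv (g x) v * t + c * (t * t)).
have dpsi (t : R) : is_derive t 1 psi (dotv (g (t *: v + x)) v - (dotv (g x) v + c * (t + t))).
  have h := is_derive_along (h1 (t *: v + x) v).
  apply: is_deriveD; apply: is_deriveN; apply: is_deriveD.
    by rewrite -[X in is_derive _ _ _ X]mulr1; exact: is_deriveZ.
  apply: is_deriveZ; apply: (@is_derive_eq _ _ _ _ _ _ _ _ (is_deriveM _ _)).
  by rewrite /= -![_ *: _]/(_ * _); ring.
have cpsi : {within `[0, 1], continuous psi}.
  by apply: continuous_subspaceT => t; exact: is_derive1_continuous (dpsi t).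
have psi01 : psi 0 = psi 1.
  by rewrite /psi scale0r scale1r add0r (addrC v) /c; ring.
have [t t01 [_ dt]] := Rolle ltr01 (fun t _ => (dpsi t).(ex_derive)) cpsi psi01.
have := dpsi t => -[_]; rewrite dt => E.
have dg (s : R) : is_derive s 1 (fun s : R => dotv (g (s *: v + x)) v) (qf (H (s *: v + x)) v v).
  by apply: (@is_derive_along (fun y => dotv (g y) v)); exact: h2.
have [t0 t1] : 0 < t /\ t < 1 by move: t01; rewrite in_itv /= => /andP[].
have cg : {within `[0, t], continuous (fun s : R => dotv (g (s *: v + x)) v)}.
  by apply: continuous_subspaceT => s; exact: is_derive1_continuous (dg s).
have [s s0t] := MVT t0 (fun s _ => dg s) cg.
rewrite subr0 scale0r add0r => E2.
have [s0 st] : 0 < s /\ s < t by move: s0t; rewrite in_itv /= => /andP[].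
exists s; first by apply/andP; split; lra.
have : t * (qf (H (s *: v + x)) v v - 2 * c) = 0 by rewrite mulrBr (mulrC t) -E2; lra.
move=> /eqP; rewrite mulf_eq0 gt_eqF//= subr_eq0 => /eqP E3.
by rewrite (addrC x (s *: v)) E3 /c; lra.
Qed.

(** Lets a glued function inherit the jet of the piece it agrees with near x: the correction
    vanishes there, hence so do its gradient and Hessian. *)
Lemma C2_eq0_near f g H (x : 'rV[R]_d) (r : R) : C2 f g H -> 0 < r ->
  (forall y, enorm (y - x) < r -> f y = 0) -> g x = 0 /\ H x = 0.
Proof.
move=> [h1 h2 _ _ _] r0 f0.
have key (k : 'rV[R]_d -> R) (y v : 'rV[R]_d) (a : R) :
    (forall z, enorm (z - x) < r -> k z = 0) -> enorm (y - x) < r -> is_derive y v k a -> a = 0.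
  move=> k0 yr ha; suff hb : is_derive y v k 0 by case: ha => _ <-; case: hb.
  have [->|vn0] := eqVneq v 0; first exact: is_derive0.
  have nb : nbhs y (fun z => cst 0 z = k z).
    apply/nbhs_enormP; exists (r - enorm (y - x)); first by rewrite subr_gt0.
    by move=> z zy; rewrite k0//; have := enormB_trans y z x; lra.
  exact: near_eq_is_derive nb (is_derive_cst 0 y v).
have g0 y : enorm (y - x) < r -> g y = 0.
  move=> yr; apply/rowP => i; rewrite mxE coord_dotv.
  exact: (key f y _ _ f0 yr (h1 y _)).
have xr : enorm (x - x) < r by rewrite subrr enorm0.
split; first exact: g0.
apply/matrixP => i j; rewrite mxE -qf_delta.
apply: (key (fun y => dotv (g y) (delta_mx ord0 i)) x (delta_mx ord0 j)) => // y yL.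
by rewrite g0// dotv0l.
Qed.

Lemma C2_eq0 f g H (L : R) : C2 f g H -> (forall x, L < enorm x -> f x = 0) ->
  forall x, L < enorm x -> g x = 0 /\ H x = 0.
Proof.
move=> hf f0 x xL; apply: (C2_eq0_near (r := enorm x - L) hf); first by rewrite subr_gt0.
by move=> y yx; apply: f0; have := enorm_le_add x y; rewrite enormBC; lra.
Qed.

Lemma C2_grad f g H x : C2 f g H -> grad f x = g x.
Proof.
by move=> [h1 _ _ _ _]; apply/rowP => i; rewrite mxE coord_dotv; case: (h1 x (delta_mx ord0 i)).
Qed.

Lemma C2_hess f g H x : C2 f g H -> hess f x = H x.
Proof.
move=> [h1 h2 _ _ _]; apply/matrixP => i j; rewrite mxE -qf_delta.
rewrite (_ : (fun y => _) = (fun y => dotv (g y) (delta_mx ord0 i))).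
  by case: (h2 x (delta_mx ord0 j) (delta_mx ord0 i)).
by apply/funext => y; case: (h1 y (delta_mx ord0 i)).
Qed.

End twice_differentiable.

(** * Smooth cut-offs and smooth majorants *)

Section bump_functions.
Context {R : realType} {d : nat}.

Definition isC2 (f : 'rV[R]_d -> R) := exists g H, C2 f g H.

(** The third power is the smallest integer power of the positive part that is twice continuously
    differentiable; cut-offs made from it have derivatives accessible to real arithmetic. *)
Definition pos3 (s : R) := Num.max s 0 ^+ 3.

Lemma pos3_ge0 s : 0 <= pos3 s.
Proof. by rewrite exprn_ge0// le_max lexx orbT. Qed.

Lemma pos3_le0 s : s <= 0 -> pos3 s = 0.
Proof. by move=> s0; rewrite /pos3 max_r// expr0n. Qed.

Lemma pos3_1 : pos3 1 = 1.
Proof. by rewrite /pos3 max_l// expr1n. Qed.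

Lemma pos3_le1 s : s <= 1 -> pos3 s <= 1.
Proof. by move=> s1; rewrite /pos3 exprn_ile1// ?le_max ?lexx ?orbT// ge_max s1 ler01. Qed.

Lemma pos3_ge1 s : 1 <= s -> 1 <= pos3 s.
Proof. by move=> s1; rewrite /pos3 exprn_ege1// le_max s1. Qed.

Lemma is_derive_pos3 (s : R) : is_derive s 1 pos3 (3 * Num.max s 0 ^+ 2).
Proof.
apply: (@is_derive_quadratic_error _ _ _ _ _ _ (3 * `|s| + 4)) => h /ler_normlP[h1 h2].
rewrite [_%:A]mulr1 /pos3; have h20 := sqr_ge0 h.
have sa := ler_norm s; have a0 := normr_ge0 s; move: (`|s|) sa a0 => a sa a0.
have p1 : 0 <= a * h ^+ 2 by exact: mulr_ge0.
have p2 : 0 <= (a - s) * h ^+ 2 by apply: mulr_ge0 => //; rewrite subr_ge0.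
have p3 : 0 <= (1 - h) * h ^+ 2 by apply: mulr_ge0 => //; rewrite subr_ge0.
have p4 : 0 <= (1 + h) * h ^+ 2 by apply: mulr_ge0 => //; lra.
have [s0|s0] := leP 0 s; have [sh|sh] := leP 0 (h + s); rewrite ler_norml.
- rewrite (_ : _ - _ = 3 * s * h ^+ 2 + h * h ^+ 2); last by ring.
  have p5 : 0 <= s * h ^+ 2 by exact: mulr_ge0.
  by apply/andP; split; lra.
- rewrite (_ : _ - _ = - (s * s ^+ 2) - 3 * s ^+ 2 * h); last by ring.
  have p5 : s ^+ 2 <= h ^+ 2 by nra.
  have p6 : 0 <= s * s ^+ 2 by rewrite mulr_ge0// sqr_ge0.
  have p7 : 0 <= (1 + h) * s ^+ 2 by rewrite mulr_ge0 ?sqr_ge0//; lra.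
  have p8 : 0 <= (- h - s) * s ^+ 2 by rewrite mulr_ge0 ?sqr_ge0//; lra.
  by apply/andP; split; lra.
- rewrite !expr0n /= !(mulr0, subr0).
  have p5 : (h + s) ^+ 2 <= h ^+ 2 by nra.
  have p6 : (h + s) ^+ 3 <= (h + s) ^+ 2 by rewrite exprS ler_piMl ?sqr_ge0//; lra.
  have p7 : 0 <= (h + s) ^+ 3 by rewrite exprn_ge0.
  by apply/andP; split; lra.
- rewrite !expr0n /= !(mulr0, subr0).
  by apply/andP; split; lra.
Qed.

Lemma is_derive_sqrpos (s : R) :
  is_derive s 1 (fun s => 3 * Num.max s 0 ^+ 2) (6 * Num.max s 0).
Proof.
apply: (@is_derive_quadratic_error _ _ _ _ _ _ 10) => h /ler_normlP[h1 h2].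
rewrite [_%:A]mulr1; have h20 := sqr_ge0 h.
by have [s0|s0] := leP 0 s; have [sh|sh] := leP 0 (h + s); rewrite ler_norml;
  apply/andP; split; nra.
Qed.

Lemma isC2_add f f' : isC2 f -> isC2 f' -> isC2 (fun x => f x + f' x).
Proof. by move=> [g [H h]] [g' [H' h']]; do 2!eexists; exact: C2_add h h'. Qed.

Lemma isC2_mul f f' : isC2 f -> isC2 f' -> isC2 (fun x => f x * f' x).
Proof. by move=> [g [H h]] [g' [H' h']]; do 2!eexists; exact: C2_mul h h'. Qed.

Lemma isC2_cst c : isC2 (fun=> c).
Proof. by do 2!eexists; exact: C2_cst. Qed.

Lemma isC2_sqdist c : isC2 (fun x => enorm (x - c) ^+ 2).
Proof. by do 2!eexists; exact: C2_sqdist. Qed.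

Lemma isC2_opp f : isC2 f -> isC2 (fun x => - f x).
Proof.
move=> h; rewrite (_ : (fun x => _) = (fun x => -1 * f x)).
  exact: isC2_mul (isC2_cst _) h.
by apply/funext => x; rewrite mulN1r.
Qed.

Lemma isC2_pos3 f : isC2 f -> isC2 (fun x => pos3 (f x)).
Proof.
move=> [g [H h]]; do 2!eexists.
apply: (C2_comp (phi1 := fun s => 3 * Num.max s 0 ^+ 2) (phi2 := fun s => 6 * Num.max s 0)) h.
- by move=> x; exact: is_derive_pos3.
- by move=> x; exact: is_derive_sqrpos.
- by move=> x; exact: is_derive1_continuous (is_derive_pos3 _).
- by move=> x; exact: is_derive1_continuous (is_derive_sqrpos _).
- move=> x; apply: continuousM; first exact: cst_continuous.
  by apply: continuous_max; [exact: cvg_id|exact: cvg_cst].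
Qed.

(* Equal to 1 on the ball of radius r / 2 and to 0 outside the ball of radius r. *)
Definition plateau (c : 'rV[R]_d) (r : R) (x : 'rV[R]_d) : R :=
  pos3 (1 - pos3 (4 / r ^+ 2 * enorm (x - c) ^+ 2 - 1)).

Lemma isC2_plateau c r : isC2 (plateau c r).
Proof.
apply: isC2_pos3; apply: isC2_add; first exact: isC2_cst.
apply/isC2_opp/isC2_pos3/isC2_add; last exact: isC2_cst.
by apply: isC2_mul; [exact: isC2_cst|exact: isC2_sqdist].
Qed.

Lemma plateau_ge0 c r x : 0 <= plateau c r x.
Proof. exact: pos3_ge0. Qed.

Lemma plateau_le1 c r x : plateau c r x <= 1.
Proof. by apply: pos3_le1; rewrite gerBl pos3_ge0. Qed.

Lemma plateau1 c r x : 0 < r -> enorm (x - c) <= r / 2 -> plateau c r x = 1.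
Proof.
move=> r0 xr; rewrite /plateau (@pos3_le0 (_ - 1)) ?subr0 ?pos3_1//.
rewrite subr_le0 mulrAC ler_pdivrMr ?exprn_gt0// mul1r.
have := enorm_ge0 (x - c); nra.
Qed.

Lemma plateau0 c r x : 0 < r -> r <= enorm (x - c) -> plateau c r x = 0.
Proof.
move=> r0 xr; rewrite /plateau pos3_le0// subr_le0 pos3_ge1//.
rewrite lerBrDr mulrAC ler_pdivlMr ?exprn_gt0//.
nra.
Qed.

End bump_functions.

Section japanese_bracket.
Context {R : realType} {d : nat}.
Implicit Types x y : 'rV[R]_d.

Lemma japanese_ge1 x : 1 <= japanese x.
Proof. by rewrite -[leLHS]sqrtr1 ler_wsqrtr// lerDl sqr_ge0. Qed.

Lemma japanese_gt0 x : 0 < japanese x.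
Proof. exact: lt_le_trans ltr01 (japanese_ge1 x). Qed.

Lemma japanese_sqr x : japanese x ^+ 2 = 1 + enorm x ^+ 2.
Proof. by rewrite sqr_sqrtr// addr_ge0// sqr_ge0. Qed.

Lemma enorm_le_japanese x : enorm x <= japanese x.
Proof.
rewrite -(@ler_pXn2r _ 2)// ?nnegrE ?enorm_ge0 ?(ltW (japanese_gt0 x))//.
by rewrite japanese_sqr lerDr.
Qed.

Lemma japanese_le x : japanese x <= 1 + enorm x.
Proof.
rewrite -(@ler_pXn2r _ 2)// ?nnegrE ?addr_ge0 ?enorm_ge0 ?(ltW (japanese_gt0 x))//.
by rewrite japanese_sqr; have := enorm_ge0 x; nra.
Qed.

Lemma japanese_powE x (m : R) : japanese x `^ m = (1 + enorm x ^+ 2) `^ (m / 2).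
Proof.
by rewrite /japanese -powR12_sqrt ?addr_ge0 ?sqr_ge0// -powRrM mulrC.
Qed.

Lemma isC2_japanese (m : R) : isC2 (fun x => japanese x `^ m).
Proof.
rewrite (_ : (fun x => _) = (fun x => (1 + enorm (x - 0) ^+ 2) `^ (m / 2))); last first.
  by apply/funext => x; rewrite japanese_powE subr0.
have [g [H h]] : isC2 (fun x : 'rV[R]_d => 1 + enorm (x - 0) ^+ 2).
  by apply: isC2_add; [exact: isC2_cst|exact: isC2_sqdist].
have p x : 0 < 1 + enorm (x - 0) ^+ 2 by rewrite ltr_pwDl// sqr_ge0.
set a := m / 2.
have dp (b c x : R) : 0 < x -> is_derive x 1 (fun s => b * s `^ c) (b * c * x `^ (c - 1)).
  by move=> x0; rewrite -mulrA; apply: is_deriveZ; exact: is_derive1_powR.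
have dp1 (c x : R) : 0 < x -> is_derive x 1 (fun s => s `^ c) (c * x `^ (c - 1)).
  exact: is_derive1_powR.
do 2!eexists; apply: (C2_comp (phi := fun s => s `^ a) (phi1 := fun s => a * s `^ (a - 1))
  (phi2 := fun s => a * (a - 1) * s `^ (a - 1 - 1))) h => x.
- exact: dp1.
- exact: dp.
- exact: is_derive1_continuous (dp1 _ _ (p x)).
- exact: is_derive1_continuous (dp _ _ _ (p x)).
- exact: is_derive1_continuous (dp _ _ _ (p x)).
Qed.

End japanese_bracket.

Section smooth_majorants.
Context {R : realType} {d : nat}.
Implicit Types (u Q F : 'rV[R]_d -> R).

Lemma value_grid (M e : R) : 0 < e -> exists s : seq R,
  forall a, `|a| <= M -> exists2 v, v \in s & a + e <= v <= a + 2 * e.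
Proof.
move=> e0.
exists [seq - M + e * k%:R | k <- iota 0 (Num.truncn (2 * M / e)).+4].
move=> a /ler_normlP[a1 a2].
have z0 : 0 <= (a + M) / e by rewrite divr_ge0 ?(ltW e0)//; lra.
have M0 : 0 <= 2 * M / e by rewrite divr_ge0 ?(ltW e0)//; lra.
have := truncn_itv z0; have := truncn_itv M0.
set n := Num.truncn _; set k := Num.truncn _ => /andP[n1 n2] /andP[k1 k2].
(* As [k] is the integer part of (a + M) / e, advancing by two cells instead of one leaves a margin
   of at least [e] above [a]. *)
exists (- M + e * k.+2%:R).
  apply/mapP; exists k.+2 => //; rewrite mem_iota /= add0n !ltnS.
  rewrite leqW// -ltnS -(ltr_nat R); apply: (le_lt_trans k1); apply: le_lt_trans n2 => {k1 k2 n1}.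
  by rewrite ler_pM2r ?invr_gt0//; lra.
move: k1 k2; rewrite ler_pdivlMr// ltr_pdivrMr// -!natr1 => k1 k2.
by apply/andP; split; nra.
Qed.

(* Brackets an equicontinuous class of functions by finitely many smooth
   majorants, so that all their Taylor moduli are uniform over the class. *)
Lemma smooth_brackets Q (L M r e : R) : isC2 Q -> 0 < r <= 1 -> 0 < e ->
  exists s : seq ('rV[R]_d -> R),
    (forall F, F \in s -> isC2 F /\ exists L', forall x, L' < enorm x -> F x = Q x) /\
    forall u, (forall x, u x <= Q x) -> (forall x, enorm x <= L + 2 -> `|u x| <= M) ->
      (forall x y, enorm x <= L + 2 -> enorm y <= L + 2 -> enorm (x - y) <= r -> `|u x - u y| <= e) ->
      exists2 F, F \in s & forall x, [/\ u x <= F x, F x <= Num.max (Q x) (u x + 3 * e) &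
        (enorm x <= L -> F x <= u x + 3 * e)].
Proof.
move=> hQ /andP[r0 r1] e0.
have r20 : 0 < r / 2 by rewrite divr_gt0.
have [net hnet] := @finite_net R d L (r / 2) r20.
have [vs hvs] := value_grid M e0.
pose cs := [seq c <- net | enorm c <= L + 1].
(* Induction over the centres of a net: each centre enlarges by one half-ball the region where the
   majorant is within 3e of u. Blending with a plateau keeps the earlier bounds, because on the ball
   of radius r the grid value lies between u and u + 3e. Only finitely many values occur at each
   centre, so the family stays finite. *)
suff [s [hs hs2]] : exists s : seq ('rV[R]_d -> R),
    (forall F, F \in s -> isC2 F /\ exists L', forall x, L' < enorm x -> F x = Q x) /\
    forall u, (forall x, u x <= Q x) -> (forall x, enorm x <= L + 2 -> `|u x| <= M) ->
      (forall x y, enorm x <= L + 2 -> enorm y <= L + 2 -> enorm (x - y) <= r -> `|u x - u y| <= e) ->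
      exists2 F, F \in s & forall x, [/\ u x <= F x, F x <= Num.max (Q x) (u x + 3 * e) &
        ((exists2 c, c \in cs & enorm (x - c) <= r / 2) -> F x <= u x + 3 * e)].
  exists s; split => // u u1 u2 u3; have [F Fs hF] := hs2 u u1 u2 u3.
  exists F => // x; have [h1 h2 h3] := hF x; split=> // xL; apply: h3.
  have [c cn xc] := hnet x xL; exists c; last exact: ltW.
  by rewrite mem_filter cn andbT; have := enorm_le_add c x; rewrite enormBC; lra.
have : forall c, c \in cs -> enorm c <= L + 1 by move=> c; rewrite mem_filter => /andP[].
elim: cs => [_|c cs IH hcs].
  exists [:: Q]; split=> [F|u u1 u2 u3].
    by rewrite inE => /eqP ->; split=> //; exists 0.
  exists Q; first by rewrite inE.
  by move=> x; split=> // [|[c]//]; rewrite le_max lexx.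
have [s [hs hs2]] : exists s : seq ('rV[R]_d -> R),
    (forall F, F \in s -> isC2 F /\ exists L', forall x, L' < enorm x -> F x = Q x) /\
    forall u, (forall x, u x <= Q x) -> (forall x, enorm x <= L + 2 -> `|u x| <= M) ->
      (forall x y, enorm x <= L + 2 -> enorm y <= L + 2 -> enorm (x - y) <= r -> `|u x - u y| <= e) ->
      exists2 F, F \in s & forall x, [/\ u x <= F x, F x <= Num.max (Q x) (u x + 3 * e) &
        ((exists2 c, c \in cs & enorm (x - c) <= r / 2) -> F x <= u x + 3 * e)].
  by apply: IH => c' c's; apply: hcs; rewrite inE c's orbT.
exists [seq (fun x => plateau c r x * v + (1 - plateau c r x) * F x) | v <- vs, F <- s]; split.
  move=> _ /allpairsP[[v F] /= [vv Fs ->]]; have [hF [L' hL']] := hs F Fs; split.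
    apply: isC2_add; apply: isC2_mul => //; [exact: isC2_plateau|exact: isC2_cst|].
    by apply: isC2_add; [exact: isC2_cst|apply/isC2_opp/isC2_plateau].
  exists (Num.max L' (enorm c + r)) => x; rewrite gt_max => /andP[xL' xc].
  rewrite plateau0 ?hL'// ?subr0 ?mul0r ?mul1r ?add0r//.
  by have := enorm_le_add x c; lra.
move=> u u1 u2 u3; have [F Fs hF] := hs2 u u1 u2 u3.
have cL : enorm c <= L + 1 by apply: hcs; rewrite mem_head.
have [|v vv /andP[v1 v2]] := hvs (u c); first by apply: u2; lra.
exists (fun x => plateau c r x * v + (1 - plateau c r x) * F x); first exact: allpairs_f.
move=> x; have [F1 F2 F3] := hF x.
have K0 := plateau_ge0 c r x; have K1 := plateau_le1 c r x.
have [xc|xc] := leP r (enorm (x - c)).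
  rewrite plateau0// subr0 mul0r mul1r add0r; split=> // -[c']; rewrite inE.
  by move=> /predU1P[-> xc'|c's xc']; [lra|apply: F3; exists c'].
have vu : u x <= v <= u x + 3 * e.
  have : `|u x - u c| <= e by apply: u3; have := enorm_le_add x c; lra.
  by move=> /ler_normlP[? ?]; apply/andP; split; lra.
move: vu => /andP[vu1 vu2].
move: (plateau c r x) K0 K1 (@plateau1 R d c r x r0) => k k0 k1 kp.
split.
- by nra.
- have vm : v <= Num.max (Q x) (u x + 3 * e) by rewrite le_max vu2 orbT.
  by move: (Num.max _ _) vm F2 => m vm F2; nra.
- move=> [c']; rewrite inE => /predU1P[-> /kp ->|c's xc']; first by rewrite mul1r subrr mul0r addr0.
  by have ? : F x <= u x + 3 * e by [apply: F3; exists c']; nra.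
Qed.

End smooth_majorants.

(** * Random-walk averages and the trace inequality for coupled frames *)

Section averaging.
Context {R : realType} (V W : lmodType R) (m : nat) (a : 'I_m -> V).
Implicit Types (F G : V -> W) (s : R).

(** One step of the symmetric random walk with increments plus or minus [s *: a i]. The values lie
    in any module, so that gradients and Hessians can be averaged along with the function. *)
Definition avg s F (x : V) : W :=
  (2 * m%:R)^-1 *: \sum_i (F (x + s *: a i) + F (x - s *: a i)).

Lemma avgD s F G : avg s (fun x => F x + G x) = fun x => avg s F x + avg s G x.
Proof.
apply/funext => x; rewrite /avg -scalerDr -big_split /=; congr (_ *: _).
by apply: eq_bigr => i _; rewrite addrACA.
Qed.

Lemma iter_avgD s n F G :
  iter n (avg s) (fun x => F x + G x) = fun x => iter n (avg s) F x + iter n (avg s) G x.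
Proof. by elim: n => //= n ->; rewrite avgD. Qed.

Lemma avg_cst s (c : W) : (0 < m)%N -> avg s (fun=> c) = fun=> c.
Proof.
move=> m0; apply/funext => x; rewrite /avg sumr_const card_ord -mulr2n -mulrnA.
rewrite -(scaler_nat (2 * m)) scalerA natrM mulVf ?scale1r//.
by rewrite mulf_neq0// pnatr_eq0// -lt0n.
Qed.

End averaging.

Section real_averaging.
Context {R : realType} (V : lmodType R) (m : nat) (a : 'I_m -> V) (m0 : (0 < m)%N).
Implicit Types (F G : V -> R) (s : R).
Local Notation avg := (@avg R V R^o m a).

Let mp : 0 < (2 * m%:R)^-1 :> R.
Proof. by rewrite invr_gt0 mulr_gt0// ltr0n. Qed.

Lemma avg_le s F G : (forall x, F x <= G x) -> forall x, avg s F x <= avg s G x.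
Proof.
move=> FG x; rewrite /avg -![_ *: _]/(_ * _) ler_wpM2l ?(ltW mp)//.
by apply: ler_sum => i _; rewrite lerD.
Qed.

Lemma iter_avg_le s n F G : (forall x, F x <= G x) ->
  forall x, iter n (avg s) F x <= iter n (avg s) G x.
Proof. by move=> FG; elim: n => //= n IH x; exact: avg_le. Qed.

Lemma iter_avg_cst s n (c : R) : iter n (avg s) (fun=> c) = fun=> c.
Proof. by elim: n => //= n ->; exact: avg_cst. Qed.

Lemma avg_diff s F x : avg s F x - F x =
  (2 * m%:R)^-1 * \sum_i (F (x + s *: a i) + F (x - s *: a i) - 2 * F x).
Proof.
have := congr1 (fun f => f x) (@avg_cst R V R^o m a s (- F x) m0).
rewrite /= => {1}<-; rewrite /avg -scalerDr -big_split /=.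
by congr (_ * _); apply: eq_bigr => i _; ring.
Qed.

Lemma avgZ s (c : R) F : avg s (fun x => c * F x) = fun x => c * avg s F x.
Proof.
apply/funext => x; rewrite /avg -![_ *: _]/(_ * _) mulrCA; congr (_ * _).
by rewrite big_distrr /=; apply: eq_bigr => i _; rewrite mulrDr.
Qed.

Lemma iter_avgZ s n (c : R) F : iter n (avg s) (fun x => c * F x) = fun x => c * iter n (avg s) F x.
Proof. by elim: n => //= n ->; rewrite avgZ. Qed.

Lemma iter_avg_growth s n F (c : R) : 0 <= c -> (forall x, avg s F x <= c * F x) ->
  forall x, iter n (avg s) F x <= c ^+ n * F x.
Proof.
move=> c0 h; elim: n => [|n IH] x; first by rewrite expr0 mul1r.
rewrite iterS; apply: le_trans (avg_le _ IH x) _.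
by rewrite avgZ exprSr -mulrA ler_wpM2l// exprn_ge0.
Qed.

End real_averaging.

Section mean_value_arithmetic.
Context {R : realType}.

Lemma jet_coeff_le (M K e s q : R) : - (K * s) <= q -> q <= K * s ->
  0 <= (M - K - 2) * s -> 0 <= (1 - e) * s -> 0 <= e * s -> 0 <= s ->
  - (M * s) <= q + 2 * e * s <= M * s.
Proof. by move=> *; apply/andP; split; lra. Qed.

Lemma radius_bounds (rho X B p : R) : 0 <= rho -> 0 <= X -> 0 <= B -> 0 <= p ->
  [/\ rho <= rho + X + B + 3 * p + 2, X + B + 3 * p <= rho + X + B + 3 * p + 2,
      p + 2 <= rho + X + B + 3 * p + 2 & p <= rho + X + B + 3 * p + 2].
Proof. by move=> *; split; lra. Qed.

Lemma far_majorant (C s u e T : R) : 0 < e -> - (C * s) <= u -> 0 <= (2 * C + 1) * s -> (2 * C + 1) * s <= T ->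
  ((C + 1) * s <= u + 3 * e + T) && (u + 3 * e <= u + 3 * e + T).
Proof. by move=> *; apply/andP; split; lra. Qed.

End mean_value_arithmetic.

Section mean_value.
Context {R : realType} {d m : nat} (a : 'I_m -> 'rV[R]_d) (m0 : (0 < m)%N) (A : R)
  (hA : forall i, enorm (a i) ^+ 2 <= A).
Implicit Types (u F : 'rV[R]_d -> R).

(* The rate m / n makes n steps of avg amount to the heat semigroup of
   (1/2) sum_i (a_i . D)^2 at time 1. *)
Definition step n : R := Num.sqrt (m%:R / n%:R).

Lemma step_sqr n : step n ^+ 2 = m%:R / n%:R.
Proof. by rewrite sqr_sqrtr. Qed.

Lemma A_ge0 : 0 <= A.
Proof. by case: m a m0 hA => // k a' _ h; exact: le_trans (sqr_ge0 _) (h ord0). Qed.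

Lemma sum_sqr_le : \sum_i enorm (a i) ^+ 2 <= m%:R * A.
Proof.
by apply: le_trans (ler_sum _ (fun i _ => hA i)) _; rewrite sumr_const card_ord mulr_natl.
Qed.

Local Notation T n := (avg (W := R^o) a (step n)).

Lemma avg_increment_le n F x (c : R) : (0 < n)%N ->
  (forall i, F (x + step n *: a i) + F (x - step n *: a i) - 2 * F x <= 2 * step n ^+ 2 * c) ->
  T n F x <= F x + (m%:R / n%:R) * c.
Proof.
move=> n0 h; rewrite addrC -lerBlDr avg_diff//.
have mp : 0 < 2 * m%:R :> R by rewrite mulr_gt0// ltr0n.
rewrite ler_pdivrMl//; apply: le_trans (ler_sum _ (fun i _ => h i)) _.
by rewrite sumr_const card_ord -mulr_natl step_sqr; lra.
Qed.

Lemma avg_increment_ge n F x (c : 'I_m -> R) : (0 < n)%N ->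
  (forall i, step n ^+ 2 * c i <= F (x + step n *: a i) + F (x - step n *: a i) - 2 * F x) ->
  F x + (2 * n%:R)^-1 * \sum_i c i <= T n F x.
Proof.
move=> n0 h; rewrite addrC -lerBrDr avg_diff//.
have mp : 0 < 2 * m%:R :> R by rewrite mulr_gt0// ltr0n.
rewrite ler_pdivlMl//; apply: le_trans (ler_sum _ (fun i _ => h i)).
rewrite -big_distrr /= step_sqr le_eqVlt; apply/orP; left; apply/eqP; field.
by rewrite pnatr_eq0 -lt0n.
Qed.

(** The drift of the square is m A / n per step, so that up to [n] steps move a quadratic by a
    bounded amount, independent of [n]; this keeps all iterates comparable with the quadratic they
    started from. *)
Lemma iter_avg_sqr n (C : R) j x : (0 < n)%N -> 0 <= C ->
  C * (1 + enorm x ^+ 2) <= iter j (T n) (fun x => C * (1 + enorm x ^+ 2)) x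
    <= C * (1 + enorm x ^+ 2) + j%:R * (m%:R / n%:R * (C * A)).
Proof.
move=> n0 C0; set Q := fun x : 'rV[R]_d => _.
have inc z i : Q (z + step n *: a i) + Q (z - step n *: a i) - 2 * Q z =
    2 * step n ^+ 2 * (C * enorm (a i) ^+ 2).
  rewrite /Q enormB_sqr enormD_sqr enormZ exprMn real_normK ?num_real//; ring.
have mn : 0 <= m%:R / n%:R :> R by rewrite divr_ge0.
have s2 : 0 <= 2 * step n ^+ 2 by rewrite mulr_ge0// sqr_ge0.
have up z : T n Q z <= Q z + m%:R / n%:R * (C * A).
  apply: avg_increment_le => // i; rewrite inc ler_wpM2l//.
  by rewrite ler_wpM2l.
have lo z : Q z <= T n Q z.
  apply: le_trans (_ : Q z + (2 * n%:R)^-1 * \sum_(i < m) 0 <= _); first by rewrite big1// mulr0 addr0.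
  apply: avg_increment_ge => // i.
  by rewrite inc mulr0; exact: mulr_ge0 s2 (mulr_ge0 C0 (sqr_ge0 _)).
elim: j => [|j IH] in x *; first by rewrite mul0r addr0 lexx.
rewrite iterS; apply/andP; split.
  by apply: le_trans (lo x) (avg_le a m0 _ _ _) => y; have /andP[] := IH y.
apply: le_trans (_ : T n (fun y => Q y + j%:R * (m%:R / n%:R * (C * A))) x <= _).
  by apply: avg_le => // y; have /andP[] := IH y.
have QE : Q x = C * (1 + enorm x ^+ 2) by [].
by rewrite avgD avg_cst// -natr1; have := up x; rewrite QE; lra.
Qed.

(** Each step multiplies the fourth-order weight by at most 1 + K / n, and (1 + K / n)^n is at most
    exp K. Such a moment, of higher order than the functions averaged, makes the tails of the walk
    negligible uniformly in [n]. *)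
Lemma iter_avg_quartic n x : (0 < n)%N ->
  iter n (T n) (fun x => (1 + enorm x ^+ 2) ^+ 2) x <=
  expR (m%:R * (6 * A + m%:R * A ^+ 2)) * (1 + enorm x ^+ 2) ^+ 2.
Proof.
move=> n0; set K := m%:R * _; set W := fun x : 'rV[R]_d => _.
have A0 := A_ge0.
have np : 0 < n%:R :> R by rewrite ltr0n.
have K0 : 0 <= K / n%:R.
  by rewrite divr_ge0// mulr_ge0// addr_ge0// mulr_ge0// sqr_ge0.
have h z : T n W z <= (1 + K / n%:R) * W z.
  rewrite mulrDl mul1r (_ : K / n%:R * W z = m%:R / n%:R * ((6 * A + m%:R * A ^+ 2) * W z)); last first.
    by rewrite /K; field; rewrite gt_eqF.
  apply: avg_increment_le => // i.
  rewrite /W enormB_sqr enormD_sqr enormZ exprMn real_normK ?num_real// dotvZr.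
  have := cauchy_schwarz z (a i); rewrite -(@ler_pXn2r _ 2)// ?nnegrE ?mulr_ge0 ?enorm_ge0//.
  rewrite real_normK ?num_real// exprMn.
  have s2m : step n ^+ 2 <= m%:R.
    by rewrite step_sqr ler_pdivrMr// -[leLHS]mulr1 ler_wpM2l// ler1n.
  have := hA i; have := sqr_ge0 (enorm z); have := sqr_ge0 (enorm (a i)); have := sqr_ge0 (step n).
  move: s2m; rewrite -[step n ^+ 2]/(step n ^+ 2).
  set q := enorm z ^+ 2; set al := enorm (a i) ^+ 2; set be := dotv _ _ => s2m s0 al0 q0 alA bq.
  have -> : (1 + (q + 2 * (step n * be) + step n ^+ 2 * al)) ^+ 2 +
    (1 + (q - 2 * (step n * be) + step n ^+ 2 * al)) ^+ 2 - 2 * (1 + q) ^+ 2 =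
    2 * step n ^+ 2 * (2 * (1 + q) * al + step n ^+ 2 * al ^+ 2 + 4 * be ^+ 2) by ring.
  move: (step n ^+ 2) s2m s0 => s sm s0.
  rewrite ler_wpM2l ?mulr_ge0//.
  have q1 : 1 + q <= (1 + q) ^+ 2 by nra.
  have q2 : 1 <= (1 + q) ^+ 2 by nra.
  have h1 : 2 * (1 + q) * al <= 2 * A * (1 + q) ^+ 2.
    apply: le_trans (_ : 2 * A * (1 + q) <= _); last by rewrite ler_wpM2l ?mulr_ge0.
    by nra.
  have h2 : 4 * be ^+ 2 <= 4 * A * (1 + q) ^+ 2.
    apply: le_trans (_ : 4 * A * (1 + q) <= _); last by rewrite ler_wpM2l ?mulr_ge0.
    by nra.
  have h3 : s * al ^+ 2 <= m%:R * A ^+ 2 * (1 + q) ^+ 2.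
    apply: le_trans (_ : m%:R * A ^+ 2 <= _); last first.
      by rewrite -[leLHS]mulr1 ler_wpM2l// mulr_ge0// sqr_ge0.
    by apply: ler_pM; rewrite ?sqr_ge0// lerXn2r.
  by lra.
apply: le_trans (iter_avg_growth m0 _ _ h x) _; first by rewrite addr_ge0.
rewrite ler_wpM2r ?sqr_ge0//.
apply: le_trans (_ : expR (K / n%:R) ^+ n <= _).
  by rewrite lerXn2r ?nnegrE ?addr_ge0 ?expR_ge0// expR_ge1Dx.
by rewrite -expRM_natl mulrC divfK// gt_eqF.
Qed.

(** All estimates are uniform in the base point, hence inherited by averages with the same [K], [e]
    and [r], whatever the number of steps. *)
Definition taylor2 F (g : 'rV[R]_d -> 'rV[R]_d) (H : 'rV[R]_d -> 'M[R]_d) (K e r : R) :=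
  [/\ forall x v, `|F (x + v) - F x - dotv (g x) v| <= K * enorm v ^+ 2,
      forall x v, enorm v <= r ->
        `|F (x + v) - F x - dotv (g x) v - 2^-1 * qf (H x) v v| <= e * enorm v ^+ 2,
      forall x v w, enorm v <= r -> `|qf (H (x + v)) w w - qf (H x) w w| <= e * enorm w ^+ 2 &
      forall x w, `|qf (H x) w w| <= K * enorm w ^+ 2].

Lemma avg_abs_le s F (c : R) x : (forall y, `|F y| <= c) -> `|avg (W := R^o) a s F x| <= c.
Proof.
move=> h; rewrite ler_norml; have := @avg_cst R _ R^o m a s c m0; have := @avg_cst R _ R^o m a s (- c) m0.
move=> /(congr1 (fun f => f x)) {1}<- /(congr1 (fun f => f x)) {2}<-.
by apply/andP; split; apply: avg_le => // y; have := h y; rewrite ler_norml => /andP[].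
Qed.

Lemma avg_dotv s (g : 'rV[R]_d -> 'rV[R]_d) x v :
  dotv (avg a s g x) v = avg (W := R^o) a s (fun y => dotv (g y) v) x.
Proof.
rewrite /avg dotvZl; congr (_ * _); elim/big_ind2 : _ => [|p q p' q' <- <-|i _].
- by rewrite dotv0l.
- by rewrite dotvDl.
- by rewrite dotvDl.
Qed.

Lemma avg_qf s (H : 'rV[R]_d -> 'M[R]_d) x v w :
  qf (avg a s H x) v w = avg (W := R^o) a s (fun y => qf (H y) v w) x.
Proof.
rewrite /avg qfZm; congr (_ * _); elim/big_ind2 : _ => [|p q p' q' <- <-|i _].
- by rewrite qf0m.
- by rewrite qfDm.
- by rewrite qfDm.
Qed.

Lemma avg_shift s F x v : avg (W := R^o) a s F (x + v) = avg (W := R^o) a s (fun y => F (y + v)) x.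
Proof. by rewrite /avg; congr (_ *: _); apply: eq_bigr => i _; rewrite !(addrAC x v). Qed.

Lemma avgB s F G x : avg (W := R^o) a s F x - avg (W := R^o) a s G x =
  avg (W := R^o) a s (fun y => F y - G y) x.
Proof.
rewrite (avgD (W := R^o) a s F (fun y => - G y)); congr (_ + _).
rewrite /avg -scalerN -sumrN; congr (_ *: _); apply: eq_bigr => i _.
by rewrite opprD.
Qed.

Lemma taylor2_avg s F g H K e r : taylor2 F g H K e r ->
  taylor2 (avg (W := R^o) a s F) (avg a s g) (avg a s H) K e r.
Proof.
move=> [h1 h2 h3 h4]; split=> [x v|x v vr|x v w vr|x w].
- by rewrite avg_dotv avg_shift !avgB; apply: avg_abs_le => y; exact: h1.
- rewrite avg_dotv avg_shift !avgB avg_qf -[2^-1 * _](congr1 (fun f => f x) (avgZ _ _ _ _)) avgB.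
  by apply: avg_abs_le => y; exact: h2.
- by rewrite !avg_qf (avg_shift _ (fun y => qf (H y) w w)) avgB; apply: avg_abs_le => y; exact: h3.
- by rewrite avg_qf; apply: avg_abs_le => y; exact: h4.
Qed.

Lemma taylor2_iter s F g H K e r j : taylor2 F g H K e r ->
  taylor2 (iter j (avg (W := R^o) a s) F) (iter j (avg a s) g) (iter j (avg a s) H) K e r.
Proof. by move=> h; elim: j => //= j IH; exact: taylor2_avg. Qed.

Lemma taylor2_le F g H K K' e r r' : K <= K' -> r' <= r ->
  taylor2 F g H K e r -> taylor2 F g H K' e r'.
Proof.
move=> KK rr [h1 h2 h3 h4]; split=> [x v|x v vr|x v w vr|x w].
- by apply: le_trans (h1 x v) _; rewrite ler_wpM2r ?sqr_ge0.
- by apply: h2; exact: le_trans rr.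
- by apply: h3; exact: le_trans rr.
- by apply: le_trans (h4 x w) _; rewrite ler_wpM2r ?sqr_ge0.
Qed.

Lemma taylor2_continuous F g H K e r : taylor2 F g H K e r -> continuous F.
Proof.
move=> [h1 _ _ _]; apply/continuous_enormP => x t t0.
have K0 : 0 <= `|K| + enorm (g x) + 1 by rewrite !addr_ge0 ?enorm_ge0.
exists (Num.min 1 (t / (`|K| + enorm (g x) + 1))).
  by rewrite lt_min ltr01 divr_gt0// ltr_wpDl// addr_ge0 ?enorm_ge0.
move=> y; rewrite lt_min ltr_pdivlMr ?ltr_wpDl ?addr_ge0 ?enorm_ge0// => /andP[y1 y2].
have := h1 x (y - x); rewrite (addrC x) subrK; set v := y - x in y1 y2 *.
have v0 := enorm_ge0 v; have := cauchy_schwarz (g x) v; have := ler_norm K.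
have := normr_ge0 K; have := enorm_ge0 (g x).
move: (enorm v) (enorm (g x)) (`|K|) (dotv _ _) v0 y1 y2 => p q k b v0 y1 y2 q0 k0 Kk.
move=> /ler_normlP[b1 b2] /ler_normlP[c1 c2].
have p2 : p ^+ 2 <= p by nra.
have h3 : 0 <= (k - K) * p ^+ 2 by rewrite mulr_ge0 ?sqr_ge0// subr_ge0.
have h4 : 0 <= k * (p - p ^+ 2) by rewrite mulr_ge0// subr_ge0.
by rewrite ltr_norml; apply/andP; split; lra.
Qed.

(** Outside a ball [F] is the quadratic [Q], whose Hessian is constant, so the modulus of continuity
    of the Hessian on a compact set is one on the whole space. *)
Lemma isC2_taylor2 F Q (C e : R) : isC2 F -> Q = (fun x => C * (1 + enorm x ^+ 2)) ->
  (exists L', forall x, L' < enorm x -> F x = Q x) -> 0 < e ->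
  exists g H, exists2 r : R, 0 < r & taylor2 F g H r^-1 e r /\ forall x, `|F x - Q x| <= r^-1.
Proof.
move=> [g [H hF]] QE [L' hL] e0.
have hQ : C2 Q (fun x => C *: (2 *: x)) (fun=> C *: 2%:M).
  rewrite QE; apply: C2_scale; apply: (eq_C2 _ _ _ (C2_add (C2_cst 1) (C2_sqdist 0))) => x.
  - by rewrite subr0.
  - by rewrite add0r subr0.
  - by rewrite add0r.
have hD : C2 (fun x => F x - Q x) (fun x => g x - C *: (2 *: x)) (fun x => H x - C *: 2%:M).
  apply: (eq_C2 _ _ _ (C2_add hF (C2_scale (-1) hQ))) => x; by rewrite ?mulN1r ?scaleN1r.
have hH x : L' < enorm x -> H x = C *: 2%:M.
  move=> xL; have [_ /eqP] := C2_eq0 hD (fun x xL => etrans (congr1 (fun z => z - Q x) (hL x xL)) (subrr _)) xL.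
  by rewrite subr_eq0 => /eqP.
have [_ _ cF _ cH] := hF.
have [_ _ cD _ _] := hD.
have [M1 M10 hM1] := bounded_mx (`|L'| + 1) cH.
have [M2 M20 hM2] := continuous_bounded (`|L'| + 1) cD.
have [r r0 hr] := unif_continuous_mx (`|L'| + 3) cH e0.
have LL := ler_norm L'.
set M := M1 + mabs (C *: 2%:M : 'M[R]_d) + M2.
have m2 := mabs_ge0 (C *: 2%:M : 'M[R]_d).
have Mp : 0 < M by rewrite /M; lra.
have hMM x : mabs (H x) <= M.
  have [xL|xL] := leP (enorm x) (`|L'| + 1); first by have := hM1 x xL; rewrite /M; lra.
  by rewrite hH ?/M; lra.
have hDM x : `|F x - Q x| <= M.
  have [xL|xL] := leP (enorm x) (`|L'| + 1); first by have := hM2 x xL; rewrite /M; lra.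
  by rewrite hL ?subrr ?normr0 ?(ltW Mp)//; lra.
set p := Num.min (Num.min 1 (r / 2)) M^-1.
have p0 : 0 < p by rewrite !lt_min ltr01 divr_gt0// invr_gt0.
have pM : M <= p^-1 by rewrite -[M]invrK lef_pV2 ?posrE ?invr_gt0// ge_min lexx orbT.
have p1 : p <= 1 by rewrite !ge_min lexx.
have pr : p < r by rewrite !gt_min (_ : r / 2 < r) ?orbT//; lra.
have T3 x v w : enorm v <= p -> `|qf (H (x + v)) w w - qf (H x) w w| <= e * enorm w ^+ 2.
  move=> vp; rewrite -qfNm -qfDm.
  have [xL|xL] := leP (enorm x) (`|L'| + 2).
    apply: le_trans (qf_le _ _ _) _; rewrite expr2 ler_wpM2r ?mulr_ge0 ?enorm_ge0//.
    by apply: hr; rewrite ?(addrC x) ?addrK//; have := enormD v x; lra.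
  have := enorm_le_add x (x + v); rewrite opprD addrA subrr add0r enormN => xv.
  have [x1 x2] : L' < enorm x /\ L' < enorm (x + v) by split; lra.
  by rewrite !hH// subrr qf0m normr0 mulr_ge0 ?sqr_ge0 ?(ltW e0).
have half_le (y z : R) : `|y| <= z -> `|2^-1 * y| <= z.
  by rewrite !ler_norml => /andP[y1 y2]; apply/andP; split; lra.
exists g, H, p => //; split; last by move=> x; exact: le_trans (hDM x) pM.
have T4 x w : `|qf (H x) w w| <= p^-1 * enorm w ^+ 2.
  apply: le_trans (qf_le _ _ _) _; rewrite expr2 ler_wpM2r ?mulr_ge0 ?enorm_ge0//.
  exact: le_trans (hMM x) pM.
split=> //.
- move=> x v; have [th th01 ->] := C2_taylor x v hF.
  rewrite (_ : _ - _ = 2^-1 * qf (H (x + th *: v)) v v); last by ring.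
  exact/half_le/T4.
- move=> x v vp; have [th th01 ->] := C2_taylor x v hF.
  rewrite (_ : _ - _ = 2^-1 * (qf (H (x + th *: v)) v v - qf (H x) v v)); last by ring.
  have /andP[t0 t1] := th01; apply/half_le/T3.
  by rewrite enormZ ger0_norm//; have := enorm_ge0 v; nra.
Qed.

Definition contact u (K f : R) := forall xi p X, enorm xi <= K -> enorm p <= K ->
  (forall w, `|qf X w w| <= K * enorm w ^+ 2) ->
  (forall x, enorm (x - xi) <= K^-1 ->
     u x <= u xi + dotv p (x - xi) + 2^-1 * qf X (x - xi) (x - xi)) ->
  f <= \sum_i qf X (a i) (a i).

(** A discrete comparison principle. Where u minus the next iterate is maximal, that iterate touches
    u from above, so the contact property bounds its Hessian from below; passing from the previous
    iterate to it then raises the value by f / (2n) up to errors. The loss 5e collects 2e for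
    turning the Taylor bound into an exact quadratic, e for comparing the Hessians of two successive
    iterates and 2e for the Taylor expansion of the averaging step. *)
Lemma avg_contact_decrease n u F g H (K e r C f M : R) : (0 < n)%N -> 0 < r -> 0 <= e <= 1 ->
  (forall i, enorm (step n *: a i) <= r) ->
  taylor2 F g H K e r -> 0 <= C -> 0 <= K -> continuous u -> contact u M f ->
  (forall x, u x <= C * (1 + enorm x ^+ 2)) -> - C <= u 0 -> (forall x, u x <= F x) ->
  (forall x, `|F x - (C + 1) * (1 + enorm x ^+ 2)| <= K) ->
  let B := m%:R * (C + 1) * A in let rho := 2 * K + 2 * C + 1 + B in
  rho <= M -> (C + 1) * (2 * rho + 1) + B + 3 * K <= M -> K + 2 <= M -> r^-1 <= M ->
  forall j, (j <= n)%N -> forall x,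
    u x - iter j (T n) F x <= - (j%:R * (2 * n%:R)^-1 * (f - 5 * e * (m%:R * A))).
Proof.
move=> n0 r0 /andP[e0 e1] sr tF C0 K0 cu hu uC u0 uF FQ B rho M1 M2 M3 M4.
have A0 := A_ge0; have B0 : 0 <= B by rewrite !mulr_ge0// addr_ge0.
have rho0 : 0 <= rho by rewrite /rho; lra.
have np : 0 < n%:R :> R by rewrite ltr0n.
pose Q (x : 'rV[R]_d) := (C + 1) * (1 + enorm x ^+ 2).
have C10 : 0 <= C + 1 by lra.
have bnd j x : (j <= n)%N -> Q x - K <= iter j (T n) F x <= Q x + B + K.
  move=> jn; have /andP[q1 q2] := iter_avg_sqr j x n0 C10.
  apply/andP; split.
    apply: le_trans (_ : iter j (T n) (fun x => Q x + - K) x <= _).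
      by rewrite iter_avgD iter_avg_cst// lerD2r.
    by apply: iter_avg_le => // y; have := FQ y; rewrite -/(Q y) ler_norml => /andP[]; lra.
  apply: le_trans (_ : iter j (T n) (fun x => Q x + K) x <= _).
    by apply: iter_avg_le => // y; have := FQ y; rewrite -/(Q y) ler_norml => /andP[]; lra.
  rewrite iter_avgD iter_avg_cst// lerD2r (le_trans q2)// -/(Q x) lerD2l.
  rewrite (_ : _ * _ = j%:R / n%:R * B); last by rewrite /B; field; rewrite gt_eqF.
  by rewrite ler_piMl// ler_pdivrMr// mul1r ler_nat.
elim=> [_ x|j IH jn x]; first by rewrite !mul0r oppr0 subr_le0.
have {}IH := IH (ltnW jn).
set G' := iter j.+1 (T n) F; set G := iter j (T n) F in IH.
have tG : taylor2 G (iter j (avg a (step n)) g) (iter j (avg a (step n)) H) K e r by exact: taylor2_iter.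
have tG' : taylor2 G' (iter j.+1 (avg a (step n)) g) (iter j.+1 (avg a (step n)) H) K e r by exact: taylor2_iter.
set h := iter j _ H in tG; set g' := iter _ _ g in tG'; set h' := iter _ _ H in tG'.
have [xi xirho hxi] : exists2 xi, enorm xi <= rho & forall y, u y - G' y <= u xi - G' xi.
  apply: coercive_max => //.
    apply: continuousDf => //; move: (taylor2_continuous tG') => cG y; exact: (continuousN (cG y)).
  move=> y yrho; have /andP[q1 _] := bnd j.+1 y jn; have /andP[_ q2] := bnd j.+1 0 jn.
  have := uC y; move: q1 q2; rewrite -/G' /Q enorm0 expr0n /= => q1 q2.
  have : enorm y <= 1 + enorm y ^+ 2 by have := sqr_ge0 (enorm y - 1); have := sqr_ge0 (enorm y); nra.
  by move: yrho; rewrite /rho; lra.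
apply: le_trans (hxi x) _ => {x}.
have [t1 t2 t3 t4] := tG; have [t1' t2' t3' t4'] := tG'.
(* A unit move along the gradient changes the iterate by the length of the gradient up to [K], and
   the iterates stay close to a quadratic on bounded sets. *)
have gM : enorm (g' xi) <= M.
  have [->|gn0] := eqVneq (g' xi) 0; first by rewrite enorm0; lra.
  have gp : 0 < enorm (g' xi) by rewrite lt_neqAle eq_sym enorm_eq0 gn0 enorm_ge0.
  set v := (enorm (g' xi))^-1 *: g' xi.
  have v1 : enorm v = 1 by rewrite enormZ ger0_norm ?invr_ge0 ?enorm_ge0// mulVf// gt_eqF.
  have gv : dotv (g' xi) v = enorm (g' xi).
    by rewrite dotvZr -enorm_sqr expr2 mulKf// gt_eqF.
  have := t1' xi v; rewrite gv v1 ler_norml => /andP[q _].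
  have /andP[q1 _] := bnd j.+1 xi jn; have /andP[_ q2] := bnd j.+1 (xi + v) jn.
  move: q1 q2; rewrite -!/G' /Q enormD_sqr v1 => q1 q2.
  have : dotv xi v <= rho by apply: le_trans (dotv_le _ _) _; rewrite v1 mulr1.
  by move: M2 => *; nra.
(* Adding 2e to the diagonal absorbs the Taylor error e |v|^2, so the expansion of the iterate is a
   genuine quadratic above u near [xi]. *)
have fX : f <= \sum_i qf (h' xi + (2 * e)%:M) (a i) (a i).
  apply: (hu xi (g' xi)) => //.
  - exact: le_trans xirho M1.
  - move=> w; rewrite qfDm qf_scalar -enorm_sqr.
    have := t4' xi w; rewrite !ler_norml => /andP[q1 q2].
    have := sqr_ge0 (enorm w); have := mulr_ge0 e0 (sqr_ge0 (enorm w)).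
    have : 0 <= (1 - e) * enorm w ^+ 2 by rewrite mulr_ge0 ?sqr_ge0// subr_ge0.
    have : 0 <= (M - K - 2) * enorm w ^+ 2 by rewrite mulr_ge0 ?sqr_ge0//; lra.
    exact: jet_coeff_le q1 q2.
  - move=> x xr; have := hxi x.
    have := t2' xi (x - xi); rewrite (addrC xi) subrK qfDm qf_scalar -enorm_sqr => q.
    have /q : enorm (x - xi) <= r by apply: le_trans xr _; rewrite -[r]invrK lef_pV2 ?posrE ?invr_gt0//; lra.
    rewrite ler_norml => /andP[_ q2].
    by move: q2; clear -m0 hA; lra.
(* The Hessian of the new iterate at [xi] is an average of Hessians of the old one at points within
   [r] of [xi]. *)
have hh i : qf (h' xi) (a i) (a i) <= qf (h xi) (a i) (a i) + e * enorm (a i) ^+ 2.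
  rewrite -lerBlDl /h' iterS -/h avg_qf.
  have E : qf (h xi) (a i) (a i) = avg (W := R^o) a (step n) (fun=> qf (h xi) (a i) (a i)) xi by rewrite avg_cst.
  rewrite {1}E avgB; apply: le_trans (ler_norm _) _.
  rewrite /avg normrM ger0_norm ?invr_ge0 ?mulr_ge0//.
  rewrite ler_pdivrMl ?mulr_gt0 ?ltr0n//.
  apply: le_trans (ler_norm_sum _ _ _) _.
  apply: le_trans (_ : \sum_(k < m) (e * enorm (a i) ^+ 2) *+ 2 <= _); last first.
    by rewrite sumr_const card_ord -mulrnA -[leLHS]mulr_natr natrM mulrC.
  apply: ler_sum => k _; apply: le_trans (ler_normD _ _) _.
  by rewrite mulr2n lerD// t3 ?enormN.
have := @avg_increment_ge n G xi (fun i => qf (h xi) (a i) (a i) - 2 * e * enorm (a i) ^+ 2) n0.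
rewrite -/(G' xi) sumrB => /(_ _)/wrap[].
  move=> i; have := t2 xi (step n *: a i) (sr i).
  have := t2 xi (- (step n *: a i)); rewrite enormN => /(_ (sr i)).
  rewrite dotvNr !qfNl !qfNr opprK !qfZl !qfZr !enormZ !exprMn real_normK ?num_real//.
  rewrite !ler_norml => /andP[p1 p2] /andP[p3 p4].
  by move: p1 p3; clear -m0 hA; lra.
rewrite -big_distrr /= => q; have := IH xi.
have := sum_sqr_le.
move: fX; under eq_bigr do rewrite qfDm qf_scalar -enorm_sqr; rewrite big_split /= -big_distrr /=.
have : \sum_i qf (h' xi) (a i) (a i) <= \sum_i qf (h xi) (a i) (a i) + e * \sum_i enorm (a i) ^+ 2.
  by rewrite big_distrr /= -big_split /=; exact: ler_sum.
set S := \sum_i enorm (a i) ^+ 2 in q *; set Y := \sum_i qf (h xi) _ _ in q *; set Y' := \sum_i qf (h' xi) _ _.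
move=> q1 q2 q3 q4.
have eS : e * S <= e * (m%:R * A) by rewrite ler_wpM2l.
have i0 : 0 <= (2 * n%:R)^-1 :> R by rewrite invr_ge0 mulr_ge0.
have fY : f - 5 * e * (m%:R * A) <= Y - 2 * e * S by lra.
rewrite -natr1 mulrDl mul1r mulrDl opprD.
move: q4 (ler_wpM2l i0 fY); rewrite -[T n G xi]/(G' xi) in q *.
move: (_ * (Y - 2 * e * S)) (_^-1 * (f - _)) (_ / _ * _) q => y z w q q4 yz.
by move: q q4 yz; clear -m0 hA; lra.
Qed.

(** [N] and [M] are chosen before [u]: the function is replaced by one of finitely many smooth
    majorants with common Taylor moduli, and the discrete comparison runs on that majorant. This
    uniformity is what later allows functions depending on the blow-up scale. *)
Lemma mean_value (C e : R) : 0 <= C -> 0 < e -> exists2 N : nat, (0 < N)%N & exists2 M : R, 0 < M &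
  forall n u f, (N <= n)%N -> continuous u -> (forall x, `|u x| <= C * (1 + enorm x ^+ 2)) ->
  (forall x y, `|u x - u y| <= C * (1 + enorm x + enorm y) * enorm (x - y)) ->
  contact u M f -> u 0 + f / 2 - e <= iter n (T n) u 0.
Proof.
move=> C0 e0; have A0 := A_ge0.
pose e1 : R := Num.min 1 (e / (10 * (m%:R * A) + 1)).
have mA : 0 <= m%:R * A by rewrite mulr_ge0.
have e10 : 0 < e1 by rewrite lt_min ltr01 divr_gt0// ltr_wpDl// mulr_ge0.
have e1A : 10 * e1 * (m%:R * A) <= e.
  have : e1 <= e / (10 * (m%:R * A) + 1) by rewrite ge_min lexx orbT.
  by rewrite ler_pdivlMr ?ltr_wpDl ?mulr_ge0//; nra.
set E := expR (m%:R * (6 * A + m%:R * A ^+ 2)).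
have Ep : 0 < E by exact: expR_gt0.
(* Beyond radius [L] the majorant is known only up to a quadratic; the fourth moment of the walk,
   bounded by [E], makes that region cost at most e / 4. *)
pose L : R := 1 + 4 * (2 * C + 1) * E / e.
have C21 : 0 < 2 * C + 1 by lra.
have L1 : 1 <= L by rewrite lerDl divr_ge0 ?(ltW e0)// !mulr_ge0// ltW.
have LE : (2 * C + 1) / (1 + L ^+ 2) * E <= e / 4.
  have L2 : 0 < 1 + L ^+ 2 by rewrite ltr_wpDr ?sqr_ge0.
  rewrite mulrAC ler_pdivrMr//.
  have : e * (L - 1) = 4 * (2 * C + 1) * E by rewrite /L; field; rewrite gt_eqF.
  have : e * (L - 1) <= e * (1 + L ^+ 2) by rewrite ler_wpM2l ?(ltW e0)//; nra.
  lra.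
pose e3 := e / 12; have e30 : 0 < e3 by rewrite divr_gt0.
pose r : R := Num.min 1 (e3 / (C * (1 + 2 * (L + 2)) + 1)).
have den : 0 < C * (1 + 2 * (L + 2)) + 1 by rewrite ltr_wpDl// mulr_ge0//; lra.
have r01 : 0 < r <= 1 by rewrite lt_min ltr01 divr_gt0//= ge_min lexx.
have rE : C * (1 + 2 * (L + 2)) * r <= e3.
  have : r <= e3 / (C * (1 + 2 * (L + 2)) + 1) by rewrite ge_min lexx orbT.
  by rewrite ler_pdivlMr//; move: r01 => /andP[]; nra.
pose Q (x : 'rV[R]_d) := (C + 1) * (1 + enorm x ^+ 2).
have hQ : isC2 Q.
  apply: isC2_mul; first exact: isC2_cst.
  apply: isC2_add; first exact: isC2_cst.
  rewrite (_ : (fun x => _) = (fun x => enorm (x - 0) ^+ 2)); first exact: isC2_sqdist.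
  by apply/funext => x; rewrite subr0.
have [LF [hLF hu]] := smooth_brackets L (C * (1 + (L + 2) ^+ 2)) hQ r01 e30.
have [F p p' p'0 pp' [g [H [tF FQ]]]|F /hLF[hF1 hF2]|p p0 hp] := common_radius (s := LF)
  (P := fun F p => exists g H, taylor2 F g H p^-1 e1 p /\ forall x, `|F x - Q x| <= p^-1).
- have pV : p^-1 <= p'^-1 by rewrite lef_pV2 ?posrE// (lt_le_trans p'0).
  exists g, H; split; first exact: taylor2_le tF.
  by move=> x; exact: le_trans (FQ x) pV.
- by have [g [H [p p0 h]]] := isC2_taylor2 hF1 (erefl Q) hF2 e10; exists p => //; exists g, H.
have pV0 : 0 <= p^-1 by rewrite invr_ge0 ltW.
exists (Num.truncn (m%:R * A / p ^+ 2)).+1 => //.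
set B := m%:R * (C + 1) * A; set rho := 2 * p^-1 + 2 * C + 1 + B.
have B0 : 0 <= B by rewrite !mulr_ge0// addr_ge0.
have rho0 : 0 <= rho by rewrite /rho; lra.
have Cr : 0 <= (C + 1) * (2 * rho + 1) by rewrite mulr_ge0//; lra.
exists (rho + (C + 1) * (2 * rho + 1) + B + 3 * p^-1 + 2); first by lra.
move=> n u f nN cu uC uL cont.
have n0 : (0 < n)%N by exact: leq_trans nN.
have np : 0 < n%:R :> R by rewrite ltr0n.
have sr i : enorm (step n *: a i) <= p.
  rewrite -(@ler_pXn2r _ 2)// ?nnegrE ?enorm_ge0 ?(ltW p0)//.
  rewrite enormZ exprMn real_normK ?num_real// step_sqr.
  apply: le_trans (_ : m%:R / n%:R * A <= _); first by rewrite ler_wpM2l// divr_ge0.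
  rewrite mulrAC ler_pdivrMr// -ler_pdivrMl ?exprn_gt0// mulrC.
  have /truncn_itv/andP[_ h] : 0 <= m%:R * A / p ^+ 2 by rewrite divr_ge0// sqr_ge0.
  by apply: le_trans (ltW h) _; rewrite ler_nat.
have [x|x xL|x y xL yL xy|F FL hF] := hu u.
- by have := uC x; rewrite ler_norml /Q => /andP[_]; have := sqr_ge0 (enorm x); lra.
- apply: le_trans (uC x) _; rewrite ler_wpM2l// lerD2l lerXn2r ?nnegrE ?enorm_ge0//.
  by rewrite addr_ge0//; lra.
- apply: le_trans (uL x y) (le_trans _ rE).
  by apply: ler_pM; rewrite ?mulr_ge0 ?addr_ge0 ?enorm_ge0// ler_wpM2l//; lra.
have [g [H [tF FQ]]] := hp F FL.
have e101 : 0 <= e1 <= 1 by rewrite (ltW e10) ge_min lexx.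
have uC1 x : u x <= C * (1 + enorm x ^+ 2) by have := uC x; rewrite ler_norml => /andP[].
have u0 : - C <= u 0.
  by have := uC 0; rewrite enorm0 expr0n addr0 mulr1 ler_norml => /andP[].
have uF x : u x <= F x by have [] := hF x.
have [T1 T2 T3 T4] := radius_bounds rho0 Cr B0 pV0.
have := avg_contact_decrease n0 p0 e101 sr tF C0 pV0 cu cont uC1 u0 uF FQ.
cbv zeta; rewrite -/B -/rho => /(_ _ _ _ _ n (leqnn n) 0)/wrap[//|//|//|//|].
rewrite (_ : n%:R * _ = 2^-1); last by field; rewrite gt_eqF.
move=> h.
have FT x : F x <= u x + 3 * e3 + (2 * C + 1) / (1 + L ^+ 2) * (1 + enorm x ^+ 2) ^+ 2.
  have [_ F1 F2] := hF x.
  have L2 : 0 < 1 + L ^+ 2 by rewrite ltr_wpDr ?sqr_ge0.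
  have [xL|xL] := leP (enorm x) L.
    have : 0 <= (2 * C + 1) / (1 + L ^+ 2) * (1 + enorm x ^+ 2) ^+ 2.
      by rewrite mulr_ge0 ?sqr_ge0// divr_ge0// ltW.
    by have := F2 xL; lra.
  apply: le_trans F1 _.
  have : (2 * C + 1) * (1 + enorm x ^+ 2) <= (2 * C + 1) / (1 + L ^+ 2) * (1 + enorm x ^+ 2) ^+ 2.
    rewrite -[leRHS]mulrA ler_wpM2l ?(ltW C21)// ler_pdivlMl// [leRHS]expr2 ler_wpM2r//.
      by rewrite addr_ge0// sqr_ge0.
    by rewrite lerD2l lerXn2r ?nnegrE ?enorm_ge0 ?(ltW xL)//; lra.
  have := uC x; rewrite ler_norml => /andP[q _].
  have : 0 <= (2 * C + 1) * (1 + enorm x ^+ 2).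
    by rewrite mulr_ge0 ?(ltW C21)// addr_ge0// sqr_ge0.
  by rewrite ge_max /Q; exact: far_majorant e30 q.
have := iter_avg_le a m0 (step n) n FT 0.
rewrite (iter_avgD (W := R^o) a (step n) n (fun x => u x + 3 * e3)) (iter_avgD (W := R^o) a (step n) n u).
rewrite iter_avg_cst//.
rewrite iter_avgZ.
have := iter_avg_quartic 0 n0; rewrite -/E enorm0 expr0n addr0 expr1n mulr1 => hE.
have : (2 * C + 1) / (1 + L ^+ 2) * iter n (T n) (fun x => (1 + enorm x ^+ 2) ^+ 2) 0 <= e / 4.
  by apply: le_trans LE; rewrite ler_wpM2l// divr_ge0 ?(ltW C21)// addr_ge0 ?sqr_ge0.
by rewrite /e3; lra.
Qed.

End mean_value.

(** * Coupled walks, sup-convolutions and the trace inequality *)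

Section pair_quadratics.
Context {R : realType} {d : nat}.
Implicit Types (x y : 'rV[R]_d).

(** The shape of the second-order bound of a doubled weight: scalar terms from the two Lyapunov
    functions and a form in the difference from phi. *)
Definition qf2 (c1 c2 : R) (S : 'M[R]_d) x y : R :=
  c1 * enorm x ^+ 2 + c2 * enorm y ^+ 2 + qf S (x - y) (x - y).

Lemma qf2_parallelogram c1 c2 S x y h k :
  qf2 c1 c2 S (x + h) (y + k) + qf2 c1 c2 S (x - h) (y - k) - 2 * qf2 c1 c2 S x y = 2 * qf2 c1 c2 S h k.
Proof.
rewrite /qf2 !enormD_sqr !enormN !dotvNr opprD (addrACA x h) opprB (addrC k) (addrACA x (- h)).
rewrite (_ : - h + k = - (h - k)); last by rewrite opprB addrC.
by rewrite !(qfDl _ (x - y)) !(qfDr _ _ (x - y)) !qfNl !qfNr; ring.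
Qed.

Lemma qf2Z c1 c2 S (t : R) x y : qf2 c1 c2 S (t *: x) (t *: y) = t ^+ 2 * qf2 c1 c2 S x y.
Proof.
by rewrite /qf2 -scalerBr qfZl qfZr !enormZ !exprMn real_normK ?num_real//; ring.
Qed.

Lemma young (e M p q : R) : 0 < e -> 2 * M * (p * q) <= e * p ^+ 2 + M ^+ 2 / e * q ^+ 2.
Proof.
move=> e0; rewrite -(ler_pM2r e0) [leRHS]mulrDl.
rewrite (_ : M ^+ 2 / e * q ^+ 2 * e = M ^+ 2 * q ^+ 2); last by field; rewrite gt_eqF.
by have := sqr_ge0 (e * p - M * q); lra.
Qed.

Lemma qf_perturb (S : 'M[R]_d) (e : R) x h : 0 < e ->
  qf S (x + h) (x + h) <= qf S x x + e * enorm x ^+ 2 + (mabs S ^+ 2 / e + mabs S) * enorm h ^+ 2.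
Proof.
move=> e0; rewrite !qfDl !qfDr.
have := qf_le S x h; have := qf_le S h x; have := qf_le S h h.
rewrite !ler_norml => /andP[_ h1] /andP[_ h2] /andP[_ h3].
by have := young (mabs S) (enorm x) (enorm h) e0; lra.
Qed.

Lemma qf2_perturb c1 c2 S (e : R) : 0 < e -> exists2 M : R, 0 <= M & forall x y h k,
  qf2 c1 c2 S (x + h) (y + k) <= qf2 (c1 + e) (c2 + e) S x y + M * (enorm h ^+ 2 + enorm k ^+ 2).
Proof.
move=> e0; pose e1 := e / 4; have e10 : 0 < e1 by rewrite divr_gt0.
have ee : e = 4 * e1 by rewrite /e1; lra.
have Z0 : 0 <= mabs S ^+ 2 / e1 + mabs S by rewrite addr_ge0 ?mabs_ge0// divr_ge0 ?sqr_ge0 ?(ltW e10).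
have Y1 : 0 <= `|c1| ^+ 2 / e1 + `|c1| by rewrite addr_ge0// divr_ge0 ?sqr_ge0 ?(ltW e10).
have Y2 : 0 <= `|c2| ^+ 2 / e1 + `|c2| by rewrite addr_ge0// divr_ge0 ?sqr_ge0 ?(ltW e10).
exists ((`|c1| ^+ 2 / e1 + `|c1|) + (`|c2| ^+ 2 / e1 + `|c2|) + 2 * (mabs S ^+ 2 / e1 + mabs S)).
  by apply: addr_ge0; [exact: addr_ge0|exact: mulr_ge0].
move=> x y h k; rewrite /qf2 opprD addrACA.
have := qf_perturb S (x - y) (h - k) e10.
have sc (c : R) (u v : 'rV[R]_d) : c * enorm (u + v) ^+ 2 <=
    c * enorm u ^+ 2 + e1 * enorm u ^+ 2 + (`|c| ^+ 2 / e1 + `|c|) * enorm v ^+ 2.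
  rewrite enormD_sqr.
  have : c * (2 * dotv u v) <= 2 * `|c| * (enorm u * enorm v).
    rewrite mulrCA -mulrA ler_wpM2l// (le_trans (ler_norm _))// normrM ler_wpM2l//.
    exact: cauchy_schwarz.
  have : c * enorm v ^+ 2 <= `|c| * enorm v ^+ 2 by rewrite ler_wpM2r ?sqr_ge0// ler_norm.
  by have := young `|c| (enorm u) (enorm v) e10; lra.
have := sc c1 x h; have := sc c2 y k.
have sqB (u v : 'rV[R]_d) : enorm (u - v) ^+ 2 <= 2 * enorm u ^+ 2 + 2 * enorm v ^+ 2.
  by rewrite enormB_sqr; have := sqr_ge0 (enorm (u + v)); rewrite enormD_sqr; lra.
have := mulr_ge0 (ltW e10) (sqr_ge0 (enorm x)); have := mulr_ge0 (ltW e10) (sqr_ge0 (enorm y)).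
have := ler_wpM2l (ltW e10) (sqB x y); have := ler_wpM2l Z0 (sqB h k).
have := mulr_ge0 Y1 (sqr_ge0 (enorm k)); have := mulr_ge0 Y2 (sqr_ge0 (enorm h)).
move: (mabs S ^+ 2 / e1 + mabs S) (`|c1| ^+ 2 / e1 + _) (`|c2| ^+ 2 / e1 + _) Z0 Y1 Y2 => Z Y Y' *.
by rewrite ee; lra.
Qed.

End pair_quadratics.

Section pair_averaging.
Context {R : realType} {d m : nat} (a b : 'I_m -> 'rV[R]_d) (m0 : (0 < m)%N).

(** The coupling of the two frames: a single walk on pairs, whose marginals are the walks along [a]
    and along [b]. *)
Definition pairs (i : 'I_m) : 'rV[R]_d * 'rV[R]_d := (a i, b i).
Local Notation T n := (avg (W := R^o) pairs (step (m := m) n)).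

Lemma iter_avg_fst s n (F : 'rV[R]_d -> R) z :
  iter n (avg (W := R^o) pairs s) (fun p => F p.1) z = iter n (avg (W := R^o) a s) F z.1.
Proof. by elim: n z => //= n IH z; rewrite (_ : iter n _ _ = fun p => iter n (avg (W := R^o) a s) F p.1)//; apply/funext => p; exact: IH. Qed.

Lemma iter_avg_snd s n (F : 'rV[R]_d -> R) z :
  iter n (avg (W := R^o) pairs s) (fun p => F p.2) z = iter n (avg (W := R^o) b s) F z.2.
Proof. by elim: n z => //= n IH z; rewrite (_ : iter n _ _ = fun p => iter n (avg (W := R^o) b s) F p.2)//; apply/funext => p; exact: IH. Qed.

(** By the parallelogram identity every step adds the same constant to a quadratic form, so its
    average is exact for each [n]; no limit in [n] is taken on the right-hand side of the trace
    inequality. *)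
Lemma iter_avg_qf2 c1 c2 S n : (0 < n)%N ->
  iter n (T n) (fun p => qf2 c1 c2 S p.1 p.2) (0, 0) = \sum_i qf2 c1 c2 S (a i) (b i).
Proof.
move=> n0; set q := fun p : _ * _ => _; set Sg := \sum_i _.
have np : 0 < n%:R :> R by rewrite ltr0n.
have h z : T n q z = q z + n%:R^-1 * Sg.
  have := avg_diff pairs m0 (step (m := m) n) q z.
  rewrite (eq_bigr (fun i => 2 * step (m := m) n ^+ 2 * qf2 c1 c2 S (a i) (b i))) => [|i _]; last first.
    by rewrite /q /= qf2_parallelogram qf2Z mulrA.
  rewrite -big_distrr /= -/Sg step_sqr => E; apply/eqP; rewrite addrC -subr_eq E; apply/eqP.
  by field; rewrite gt_eqF// pnatr_eq0 -lt0n.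
suff E j z : iter j (T n) q z = q z + j%:R * (n%:R^-1 * Sg).
  by rewrite E mulrA divff ?gt_eqF// mul1r /q /= -(scale0r (0 : 'rV[R]_d)) qf2Z expr0n mul0r add0r.
elim: j => [|j IH] in z *; first by rewrite mul0r addr0.
rewrite iterS (_ : iter j _ _ = fun z => q z + j%:R * (n%:R^-1 * Sg)); last exact/funext.
rewrite (avgD (W := R^o) pairs _ q) (avg_cst (W := R^o))// h -natr1; ring.
Qed.

End pair_averaging.

Section sup_convolution.
Context {R : realType} {d : nat}.
Implicit Types (w : R -> 'rV[R]_d -> R).

Definition box (rho : R) : set (R * 'rV[R]_d) := [set p | `|p.1| <= rho /\ enorm p.2 <= rho].

(** Sup-convolution in the blown-up variable y / h. The maximum also runs over time, which thereby
    disappears from the function to be averaged. *)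
Lemma sup_convolution w (rho c h : R) : 0 < rho ->
  {within box rho, continuous (fun p => w p.1 p.2)} -> 0 < h ->
  exists U : 'rV[R]_d -> R,
  (forall xi t y, `|t| <= rho -> enorm y <= rho ->
     w t y / h ^+ 2 - c / 2 * enorm (h^-1 *: y - xi) ^+ 2 <= U xi) /\
  (forall xi, exists t y, [/\ `|t| <= rho, enorm y <= rho &
     U xi = w t y / h ^+ 2 - c / 2 * enorm (h^-1 *: y - xi) ^+ 2]).
Proof.
move=> rho0 cw h0.
pose f xi (p : R * 'rV[R]_d) := w p.1 p.2 / h ^+ 2 - c / 2 * enorm (h^-1 *: p.2 - xi) ^+ 2.
have cB : compact (box rho).
  have := compact_setX (@segment_compact _ (- rho) rho) (@compact_enorm_le R d rho).
  congr compact; apply/seteqP; split=> -[t y] /= [h1 h2]; split=> //.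
    by rewrite /= ler_norml; move: h1; rewrite in_itv.
  by rewrite /= in_itv /=; move: h1; rewrite /= ler_norml.
have B0 : box rho !=set0 by exists (0, 0); rewrite /box /= normr0 enorm0 (ltW rho0).
have cf xi : {within box rho, continuous (f xi)}.
  have cn : continuous (fun p : R * 'rV[R]_d => enorm (h^-1 *: p.2 - xi)).
    move=> p; apply: (continuous_comp (f := fun p : R * 'rV[R]_d => h^-1 *: p.2 - xi)); last exact: continuous_enorm.
    by apply: cvgB; [apply: cvgZr; exact: cvg_snd|exact: cvg_cst].
  move=> p; apply: cvgB.
    by apply: cvgM; [exact: cw|exact: cvg_cst].
  apply: cvgM; first exact: cvg_cst.
  by apply: cvgM; exact: (continuous_subspaceT cn).
have /choice[m hm] : forall xi, exists p, box rho p /\ forall p', box rho p' -> f xi p' <= f xi p.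
  move=> xi; have [p pB hp] := compact_EVT_max B0 cB (cf xi).
  by exists p; split; [move: pB; rewrite inE|move=> p' p'B; apply: hp; rewrite inE].
exists (fun xi => f xi (m xi)); split=> [xi t y tr yr|xi].
  by have [_ /(_ (t, y))] := hm xi; apply.
by have [[h1 h2] _] := hm xi; exists (m xi).1, (m xi).2.
Qed.

(** None of the bounds on [U] depends on [h], as the uniform mean value inequality requires. Since
    [c] dominates the quadratic growth of w, a maximizer stays within 3 |xi| in the blown-up
    variable, which localizes contact points at distance O(h). *)
Lemma sup_convolution_bounds w (rho c C h : R) (U : 'rV[R]_d -> R) : 0 < rho -> 0 < h ->
  0 <= C -> 8 * C + 1 <= c ->
  (forall t y, `|t| <= rho -> enorm y <= rho -> w t y <= C * enorm y ^+ 2) -> w 0 0 = 0 ->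
  (forall xi t y, `|t| <= rho -> enorm y <= rho ->
     w t y / h ^+ 2 - c / 2 * enorm (h^-1 *: y - xi) ^+ 2 <= U xi) ->
  (forall xi, exists t y, [/\ `|t| <= rho, enorm y <= rho &
     U xi = w t y / h ^+ 2 - c / 2 * enorm (h^-1 *: y - xi) ^+ 2]) ->
  [/\ 0 <= U 0, forall xi, `|U xi| <= 4 * c * (1 + enorm xi ^+ 2),
    forall xi eta, `|U xi - U eta| <= 4 * c * (1 + enorm xi + enorm eta) * enorm (xi - eta) &
    forall xi, exists t y, [/\ `|t| <= rho, enorm y <= rho, enorm y <= 3 * enorm xi * h,
       - (c / 2 * enorm xi ^+ 2) <= w t y / h ^+ 2 &
       U xi = w t y / h ^+ 2 - c / 2 * enorm (h^-1 *: y - xi) ^+ 2]].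
Proof.
move=> rho0 h0 C0 Cc wC w0 U1 U2.
have h20 : 0 < h ^+ 2 by rewrite exprn_gt0.
have lo xi : - (c / 2 * enorm xi ^+ 2) <= U xi.
  have := U1 xi 0 0; rewrite normr0 enorm0 w0 mul0r scaler0 !sub0r enormN; apply; exact: ltW.
have W t y : `|t| <= rho -> enorm y <= rho -> w t y / h ^+ 2 <= C * enorm (h^-1 *: y) ^+ 2.
  move=> tr yr; rewrite ler_pdivrMr// enormZ exprMn real_normK ?num_real//.
  apply: le_trans (wC t y tr yr) _; rewrite le_eqVlt; apply/orP; left; apply/eqP.
  by field; rewrite gt_eqF.
have key xi : exists t y, [/\ `|t| <= rho, enorm y <= rho, enorm (h^-1 *: y) <= 3 * enorm xi,
    U xi <= 2 * C * enorm xi ^+ 2 &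
    U xi = w t y / h ^+ 2 - c / 2 * enorm (h^-1 *: y - xi) ^+ 2].
  have [t [y [tr yr E]]] := U2 xi; exists t, y.
  have := W t y tr yr; have := lo xi; have := enorm_le_add (h^-1 *: y) xi.
  move: E; set z := enorm (h^-1 *: y); set v := enorm (_ - xi); set p := enorm xi => E.
  have p0 : 0 <= p by exact: enorm_ge0.
  have v0 : 0 <= v by exact: enorm_ge0.
  have z0 : 0 <= z by exact: enorm_ge0.
  move=> zpv lx wz.
  have z2 : z ^+ 2 <= 2 * v ^+ 2 + 2 * p ^+ 2 by have := sqr_ge0 (v - p); nra.
  have Cz := ler_wpM2l C0 z2.
  have cv : 0 <= (c - 8 * C - 1) * v ^+ 2 by rewrite mulr_ge0 ?sqr_ge0//; lra.
  have v20 := sqr_ge0 v; have p20 := sqr_ge0 p.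
  have Cv := mulr_ge0 C0 v20.
  have cp : 0 <= (c - 8 * C - 1) * p ^+ 2 by rewrite mulr_ge0 ?sqr_ge0//; lra.
  have vp : v <= 2 * p.
    have : c * v ^+ 2 <= c * (2 * p) ^+ 2 by lra.
    have cp0 : 0 < c by lra.
    by rewrite (ler_pM2l cp0) ler_pXn2r ?nnegrE ?mulr_ge0.
  split=> //; first by lra.
  by rewrite E; lra.
have c1 : 1 <= c by lra.
have p2 (xi : 'rV[R]_d) := sqr_ge0 (enorm xi).
split.
- by have := lo 0; rewrite enorm0 expr0n mulr0 oppr0.
- move=> xi; have [t [y [_ _ _ h1 _]]] := key xi; have := lo xi.
  have := mulr_ge0 C0 (p2 xi); have : 0 <= (c - 8 * C - 1) * enorm xi ^+ 2 by rewrite mulr_ge0//; lra.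
  have := p2 xi.
  by rewrite ler_norml => *; apply/andP; split; nra.
- have one xi eta : U xi - U eta <= 4 * c * (1 + enorm xi + enorm eta) * enorm (xi - eta).
    have [t [y [tr yr zp _ ->]]] := key xi; have := U1 eta t y tr yr.
    move: (h^-1 *: y) zp => z zp; rewrite !enormB_sqr.
    have zb : dotv z (xi - eta) <= 3 * enorm xi * enorm (xi - eta).
      by apply: le_trans (dotv_le _ _) _; rewrite ler_wpM2r ?enorm_ge0.
    have := dotv_ge (xi + eta) (xi - eta).
    have := enormD xi eta.
    rewrite dotvBr in zb; rewrite !dotvE (dotvC eta xi) -!enorm_sqr.
    have := enorm_ge0 (xi - eta); have := enorm_ge0 xi; have := enorm_ge0 eta; have := enorm_ge0 (xi + eta).
    move: zb; set A := enorm (xi - eta); set X := enorm xi; set Y := enorm eta; set S := enorm (xi + eta).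
    move: (dotv z xi) (dotv z eta) (w t y / _) (enorm z ^+ 2) (dotv xi eta) => a b W1 z2 xe.
    move=> ab S0 Y0 X0 A0 SXY dS.
    have SA : S * A <= (X + Y) * A by rewrite ler_wpM2r.
    have XY : Y ^+ 2 - X ^+ 2 <= (X + Y) * A by lra.
    move=> hU.
    have : c / 2 * (2 * (a - b) + (Y ^+ 2 - X ^+ 2)) <= c / 2 * (6 * X * A + (X + Y) * A).
      by rewrite ler_wpM2l//; lra.
    have XA := mulr_ge0 X0 A0; have YA := mulr_ge0 Y0 A0.
    have : c / 2 * (6 * X * A + (X + Y) * A) <= 4 * c * (1 + X + Y) * A.
      have c0 : 0 <= c by lra.
      have := mulr_ge0 c0 XA; have := mulr_ge0 c0 YA; have := mulr_ge0 c0 A0; lra.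
    by lra.
  move=> xi eta; rewrite ler_norml; have := one xi eta; have := one eta xi.
  by rewrite enormBC (addrAC 1 (enorm eta)); lra.
- move=> xi; have [t [y [tr yr zp _ E]]] := key xi; exists t, y; split=> //.
    move: zp; rewrite enormZ ger0_norm ?invr_ge0 ?(ltW h0)// ler_pdivrMl// mulrC.
    by rewrite mulrC.
  have := lo xi; rewrite E; have : 0 <= c / 2 * enorm (h^-1 *: y - xi) ^+ 2 by rewrite mulr_ge0 ?sqr_ge0//; lra.
  by lra.
Qed.

(* Blown up by h, the jets of w at its contact points are of size 1. *)
Definition subtouch m (a : 'I_m -> 'rV[R]_d) w (rho f : R) := forall K, 0 < K ->
  exists2 h0 : R, 0 < h0 & forall h t0 y0 p X, 0 < h -> h <= h0 -> `|t0| <= rho ->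
    enorm y0 <= K * h -> enorm p <= K * h -> (forall v, `|qf X v v| <= K * enorm v ^+ 2) ->
    - (K * h ^+ 2) <= w t0 y0 ->
    (forall t y, `|t| <= rho -> enorm (y - y0) <= h / K ->
       w t y <= w t0 y0 + dotv p (y - y0) + 2^-1 * qf X (y - y0) (y - y0)) ->
    f <= \sum_i qf X (a i) (a i).

(** The penalty depends only on y / h - xi. Hence a quadratic touching U at xi, moved along with the
    maximizer, touches w there; in the original variables the gradient is multiplied by [h] and the
    Hessian is unchanged. *)
Lemma contact_of_subtouch m (a : 'I_m -> 'rV[R]_d) w (rho f c C M : R) : 0 < rho -> 0 <= C ->
  8 * C + 1 <= c -> 0 < M ->
  (forall t y, `|t| <= rho -> enorm y <= rho -> w t y <= C * enorm y ^+ 2) -> w 0 0 = 0 ->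
  subtouch a w rho f ->
  exists2 h0 : R, 0 < h0 & forall h U, 0 < h -> h <= h0 ->
  (forall xi t y, `|t| <= rho -> enorm y <= rho ->
     w t y / h ^+ 2 - c / 2 * enorm (h^-1 *: y - xi) ^+ 2 <= U xi) ->
  (forall xi, exists t y, [/\ `|t| <= rho, enorm y <= rho &
     U xi = w t y / h ^+ 2 - c / 2 * enorm (h^-1 *: y - xi) ^+ 2]) -> contact a U M f.
Proof.
move=> rho0 C0 Cc M0 wC w0 sub.
pose K := 3 * M + c / 2 * M ^+ 2.
have cM : 0 <= c / 2 * M ^+ 2 by rewrite mulr_ge0 ?sqr_ge0//; lra.
have KM : 3 * M <= K by rewrite /K; lra.
have K0 : 0 < K by lra.
have [h0 h00 hsub] := sub K K0.
exists (Num.min h0 (rho / (3 * M + M^-1))).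
  by rewrite lt_min h00 divr_gt0// addr_gt0 ?mulr_gt0 ?invr_gt0.
move=> h U hp; rewrite le_min => /andP[hh0].
rewrite ler_pdivlMr ?addr_gt0 ?mulr_gt0 ?invr_gt0// => hrho U1 U2 xi p X xiM pM XM hU.
have [_ _ _ /(_ xi)[t0 [y0 [t0r y0r y0xi w0l E]]]] := sup_convolution_bounds rho0 hp C0 Cc wC w0 U1 U2.
have h20 : 0 < h ^+ 2 by rewrite exprn_gt0.
apply: (hsub h t0 y0 (h *: p) X) => //.
- by apply: le_trans y0xi _; rewrite ler_wpM2r ?(ltW hp)//; lra.
- by rewrite enormZ gtr0_norm// mulrC ler_wpM2r ?(ltW hp)//; lra.
- by move=> v; apply: le_trans (XM v) _; rewrite ler_wpM2r ?sqr_ge0//; lra.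
- move: w0l; rewrite ler_pdivlMr// => w0l; apply: le_trans w0l.
  rewrite -mulNr ler_wpM2r ?(ltW h20)// lerN2.
  have : enorm xi ^+ 2 <= M ^+ 2 by rewrite lerXn2r ?nnegrE ?enorm_ge0 ?(ltW M0).
  have c20 : 0 <= c / 2 by lra.
  by move=> /(ler_wpM2l c20); rewrite /K; lra.
- move=> t y tr yy0.
  have yM : enorm (y - y0) <= h / M.
    apply: le_trans yy0 _; rewrite ler_wpM2l ?(ltW hp)// lef_pV2 ?posrE//; lra.
  have yr : enorm y <= rho.
    have := enorm_le_add y y0; have : 3 * enorm xi * h <= 3 * M * h by rewrite ler_wpM2r ?(ltW hp)//; lra.
    by lra.
  have := U1 (xi + h^-1 *: (y - y0)) t y tr yr.
  have := hU (xi + h^-1 *: (y - y0)); rewrite (addrC xi) addrK => /(_ _)/wrap[].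
    rewrite enormZ gtr0_norm ?invr_gt0// ler_pdivrMl//.
  rewrite scalerBr opprD addrA opprB addrCA subrr addr0 -scalerBr E.
  set v := enorm (h^-1 *: y0 - xi) ^+ 2.
  rewrite !qfZl !qfZr dotvZr => h1 h2.
  have : w t y / h ^+ 2 <= (w t0 y0 + dotv (h *: p) (y - y0) + 2^-1 * qf X (y - y0) (y - y0)) / h ^+ 2.
    rewrite dotvZl.
    have -> : (w t0 y0 + h * dotv p (y - y0) + 2^-1 * qf X (y - y0) (y - y0)) / h ^+ 2 =
      w t0 y0 / h ^+ 2 + h^-1 * dotv p (y - y0) + 2^-1 * (h^-1 * (h^-1 * qf X (y - y0) (y - y0))).
      by field; rewrite gt_eqF.
    lra.
  by rewrite ler_pM2r ?invr_gt0.
Qed.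

(** The substitute for the theorem on sums. The two sup-convolutions are nonnegative at 0 and their
    sum lies below a slightly enlarged quadratic form. Averaging along the coupled walk bounds the
    left side from below by the mean value inequality on each marginal, and evaluates the right side
    exactly. *)
Lemma sum_trace_le m (a b : 'I_m -> 'rV[R]_d) w w' (rho f f' C c1 c2 : R) (S : 'M[R]_d) :
  (0 < m)%N -> 0 < rho -> 0 <= C ->
  {within box rho, continuous (fun p => w p.1 p.2)} ->
  {within box rho, continuous (fun p => w' p.1 p.2)} ->
  (forall t y, `|t| <= rho -> enorm y <= rho -> w t y <= C * enorm y ^+ 2) -> w 0 0 = 0 ->
  (forall t y, `|t| <= rho -> enorm y <= rho -> w' t y <= C * enorm y ^+ 2) -> w' 0 0 = 0 ->
  (forall t s x y, `|t| <= rho -> `|s| <= rho -> enorm x <= rho -> enorm y <= rho ->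
     w t x + w' s y <= 2^-1 * qf2 c1 c2 S x y) ->
  subtouch a w rho f -> subtouch b w' rho f' ->
  f + f' <= \sum_i qf2 c1 c2 S (a i) (b i).
Proof.
move=> m0 rho0 C0 cw cw' wC w0 wC' w0' ww' sub sub'.
pose A := \sum_i (enorm (a i) ^+ 2 + enorm (b i) ^+ 2).
have hA i : enorm (a i) ^+ 2 <= A.
  rewrite /A (bigD1 i)//= -addrA lerDl addr_ge0 ?sqr_ge0// sumr_ge0// => j _.
  by rewrite addr_ge0 ?sqr_ge0.
have hB i : enorm (b i) ^+ 2 <= A.
  rewrite /A (bigD1 i)//= (addrC (enorm (a i) ^+ 2)) -addrA lerDl addr_ge0 ?sqr_ge0// sumr_ge0// => j _.
  by rewrite addr_ge0 ?sqr_ge0.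
have A0 : 0 <= A by apply: sumr_ge0 => i _; rewrite addr_ge0 ?sqr_ge0.
suff key e : 0 < e -> f + f' <= \sum_i qf2 c1 c2 S (a i) (b i) + e * A + 4 * e.
  apply/ler_addgt0Pr => e e0.
  have := key (e / (A + 4)); rewrite divr_gt0 ?ltr_wpDl// => /(_ isT) h.
  apply: le_trans h _; rewrite -addrA lerD2l le_eqVlt; apply/orP; left; apply/eqP.
  by field; rewrite gt_eqF// ltr_wpDl.
move=> e0.
have [M' M'0 hM'] := qf2_perturb c1 c2 S e0.
(* [M'] is the price for evaluating the quadratic form at the convolution parameters instead of at
   the maximizers; a penalty at least that strong pays it. *)
pose c := 8 * C + 1 + M'.
have c0 : 0 <= 4 * c by rewrite mulr_ge0// /c; lra.
have cC : 8 * C + 1 <= c by rewrite /c; lra.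
have [N N0 [M M0 hM]] := mean_value m0 hA c0 e0.
have [N' N'0 [M2 M20 hM2]] := mean_value m0 hB c0 e0.
pose K := M + M2.
have K0 : 0 < K by rewrite addr_gt0.
have MK : M <= K by rewrite lerDl ltW.
have M2K : M2 <= K by rewrite lerDr ltW.
have [h1 h10 hh1] := contact_of_subtouch rho0 C0 cC K0 wC w0 sub.
have [h2 h20 hh2] := contact_of_subtouch rho0 C0 cC K0 wC' w0' sub'.
(* Only now is the scale chosen: the number of steps and the jet bound [K] are already fixed. *)
pose h := Num.min h1 h2.
have h0 : 0 < h by rewrite lt_min h10.
have hle1 : h <= h1 by rewrite ge_min lexx.
have hle2 : h <= h2 by rewrite ge_min lexx orbT.
have [U [U1 U2]] := sup_convolution c rho0 cw h0.
have [U' [U1' U2']] := sup_convolution c rho0 cw' h0.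
have [b1 b2 b3 _] := sup_convolution_bounds rho0 h0 C0 cC wC w0 U1 U2.
have [b1' b2' b3' _] := sup_convolution_bounds rho0 h0 C0 cC wC' w0' U1' U2'.
have contK (k : 'I_m -> 'rV[R]_d) V (g Y Y' : R) : 0 < Y -> Y <= Y' -> contact k V Y' g -> contact k V Y g.
  move=> Y0 YY hct xi p X xiY pY XY t; apply: (hct xi p X) => //; try exact: le_trans YY.
    by move=> v; apply: le_trans (XY v) _; rewrite ler_wpM2r ?sqr_ge0.
  by move=> x xY'; apply: t; apply: le_trans xY' _; rewrite lef_pV2 ?posrE// (lt_le_trans Y0).
have contU (V : 'rV[R]_d -> R) : (forall xi eta, `|V xi - V eta| <= 4 * c * (1 + enorm xi + enorm eta) * enorm (xi - eta)) -> continuous V.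
  move=> hV; apply/continuous_enormP => x t t0.
  have den : 0 < 4 * c * (1 + (enorm x + 1) + enorm x) + 1.
    by rewrite ltr_wpDl// mulr_ge0// !addr_ge0 ?enorm_ge0.
  exists (Num.min 1 (t / (4 * c * (1 + (enorm x + 1) + enorm x) + 1))); first by rewrite lt_min ltr01 divr_gt0.
  move=> y; rewrite lt_min ltr_pdivlMr// => /andP[y1 y2].
  apply: le_lt_trans (hV y x) (le_lt_trans _ y2).
  rewrite mulrC ler_wpM2l ?enorm_ge0//.
  have yx : enorm y <= enorm x + 1 by move: (enorm_le_add y x) y1; clear; lra.
  have : 4 * c * (1 + enorm y + enorm x) <= 4 * c * (1 + (enorm x + 1) + enorm x).
    by rewrite ler_wpM2l//; move: yx; clear; lra.
  by move=> le1; apply: le_trans le1 _; rewrite lerDl.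
pose n := maxn N N'.
have n0 : (0 < n)%N by rewrite leq_max N0.
have k1 := hM n U f (leq_maxl _ _) (contU _ b3) b2 b3 (contK _ _ _ _ _ M0 MK (hh1 h U h0 hle1 U1 U2)).
have k2 := hM2 n U' f' (leq_maxr _ _) (contU _ b3') b2' b3' (contK _ _ _ _ _ M20 M2K (hh2 h U' h0 hle2 U1' U2')).
have UU p : U p.1 + U' p.2 <= 2^-1 * qf2 (c1 + e) (c2 + e) S p.1 p.2.
  have [t [x [tr xr ->]]] := U2 p.1; have [s [y [sr yr ->]]] := U2' p.2.
  have hsq : 0 < h ^+ 2 by rewrite exprn_gt0.
  have := ww' t s x y tr sr xr yr.
  set x' := h^-1 *: x; set y' := h^-1 *: y.
  have -> : qf2 c1 c2 S x y = h ^+ 2 * qf2 c1 c2 S x' y'.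
    by rewrite -qf2Z /x' /y' !scalerA mulfV ?scale1r// gt_eqF.
  have := hM' p.1 p.2 (x' - p.1) (y' - p.2).
  rewrite (addrC p.1) subrK (addrC p.2) subrK.
  set A1 := enorm (x' - p.1); set A2 := enorm (y' - p.2) => q1 q2.
  have : w t x / h ^+ 2 + w' s y / h ^+ 2 <= 2^-1 * qf2 c1 c2 S x' y'.
    by rewrite -mulrDl ler_pdivrMr//; apply: le_trans q2 _; rewrite [h ^+ 2 * _]mulrC mulrA.
  have : 0 <= (c - M') * (A1 ^+ 2 + A2 ^+ 2).
    have cM : 0 <= c - M' by rewrite /c addrK addr_ge0// mulr_ge0.
    exact: mulr_ge0 cM (addr_ge0 (sqr_ge0 _) (sqr_ge0 _)).
  by move: q1; clear; lra.
have := iter_avg_le (pairs a b) m0 (step (m := m) n) n UU (0, 0).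
rewrite (iter_avgD (W := R^o) (pairs a b) _ n (fun p => U p.1)) iter_avg_fst iter_avg_snd.
rewrite iter_avgZ iter_avg_qf2//=.
have -> : \sum_i qf2 (c1 + e) (c2 + e) S (a i) (b i) = \sum_i qf2 c1 c2 S (a i) (b i) + e * A.
  by rewrite /A big_distrr -big_split /=; apply: eq_bigr => i _; rewrite /qf2; ring.
by move: k1 k2 b1 b1'; clear; lra.
Qed.

End sup_convolution.

(** * Moments of the Lévy measure *)

Section borel_rV.
Context {R : realType} {d : nat}.

(** The sigma-algebra on row vectors is the product one, while the topology comes from the sup norm;
    countably many boxes with rational centres link the two. *)
Lemma measurable_open_rV (U : set 'rV[R]_d) : open U -> measurable U.
Proof.
move=> oU.
pose bx (q : {ffun 'I_d -> rat} * nat) : set 'rV[R]_d :=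
  \bigcap_(i in [set: 'I_d]) ((fun x : 'rV[R]_d => x ord0 i) @^-1`
    `]ratr (q.1 i) - q.2.+1%:R^-1, ratr (q.1 i) + q.2.+1%:R^-1[).
have mbx q : measurable (bx q).
  apply: fin_bigcap_measurable => [|i _]; first exact: finite_finset.
  by rewrite -[X in measurable X]setTI; exact: measurable_coor.
have -> : U = \bigcup_q [set x | bx q x /\ bx q `<=` U].
  apply/seteqP; split=> [x Ux|x [q _ [bxq bU]]]; last exact: bU.
  have /nbhs_ballP[e /= e0 he] : nbhs x U by apply: open_nbhs_nbhs.
  have [n hn] : exists n, (n.+1%:R : R)^-1 < e / 2.
    have e20 : 0 < e / 2 by rewrite divr_gt0.
    exists (Num.truncn ((e / 2)^-1)); rewrite -[ltRHS]invrK ltf_pV2 ?posrE ?invr_gt0//.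
    by have /truncn_itv/andP[] : 0 <= (e / 2)^-1 by rewrite invr_ge0 (ltW e20).
  have np : (0 : R) < n.+1%:R^-1 by rewrite invr_gt0.
  have /choice[q hq] : forall i, exists q : rat, ratr q \in `](x ord0 i - n.+1%:R^-1), (x ord0 i + n.+1%:R^-1)[.
    by move=> i; apply: rat_in_itvoo; rewrite ltrD2l gtrN.
  have xq i : `|x ord0 i - ratr (q i)| < n.+1%:R^-1.
    by have := hq i; rewrite in_itv /= ltr_distlC.
  exists (finfun q, n) => //; split=> [i _ /=|y ybx].
    by rewrite in_itv /= ffunE -ltr_distl.
  apply: he; rewrite -ball_normE /= /Num.norm/= mx_normrE.
  apply/bigmax_ltP; split => // -[i j] _ /=.
  rewrite !ord1 !mxE; have := ybx j Logic.I; have := xq j; rewrite /= in_itv /= ffunE -ltr_distl.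
  move: (_^-1) hn => dd hn h1 h2; rewrite (splitr e).
  apply: le_lt_trans (ler_distD (ratr (q j)) _ _) _.
  by rewrite ltrD// ?(distrC (ratr _)); lra.
apply: countable_bigcupT_measurable => [|q]; first exact: countableP.
have [h|h] := pselect (bx q `<=` U).
  rewrite (_ : [set x | _] = bx q)//.
  by apply/seteqP; split=> x /= => [[]|].
rewrite (_ : [set x | _] = set0)//.
by apply/seteqP; split=> x /= => [[]|].
Qed.

Lemma measurable_continuous_rV (f : 'rV[R]_d -> R) : continuous f -> measurable_fun setT f.
Proof.
move=> cf mD; apply: (measurability _ (RGenOInfty.measurableE R)) => //.
move=> /= _ [_ [x ->] <-]; rewrite setTI.
apply: measurable_open_rV; apply: open_comp; first by move=> y _; exact: cf.
by rewrite set_itvE; exact: open_gt.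
Qed.

Lemma measurable_enorm : measurable_fun setT (@enorm R d).
Proof. by apply: measurable_continuous_rV; exact: continuous_enorm. Qed.

Lemma measurable_enorm_le (a : R) : measurable [set z : 'rV[R]_d | enorm z <= a].
Proof.
rewrite -[X in measurable X]setTI (_ : [set z | _] = @enorm R d @^-1` `]-oo, a]).
  exact: measurable_enorm.
by apply/seteqP; split=> x /=; rewrite in_itv.
Qed.

Lemma measurable_enorm_ge (a : R) : measurable [set z : 'rV[R]_d | a <= enorm z].
Proof.
rewrite -[X in measurable X]setTI (_ : [set z | _] = @enorm R d @^-1` `[a, +oo[).
  exact: measurable_enorm.
by apply/seteqP; split=> x /=; rewrite in_itv/= andbT.
Qed.

Lemma measurable_enorm_gt (a : R) : measurable [set z : 'rV[R]_d | a < enorm z].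
Proof.
rewrite -[X in measurable X]setTI (_ : [set z | _] = @enorm R d @^-1` `]a, +oo[).
  exact: measurable_enorm.
by apply/seteqP; split=> x /=; rewrite in_itv/= andbT.
Qed.

Lemma measurable_box (a b : 'I_d -> R) :
  measurable [set x : 'rV[R]_d | forall i, a i <= x ord0 i <= b i].
Proof.
rewrite (_ : [set x | _] = \bigcap_(i in [set: 'I_d]) ((fun x : 'rV[R]_d => x ord0 i) @^-1` `[a i, b i])).
  apply: fin_bigcap_measurable => [|i _]; first exact: finite_finset.
  by rewrite -[X in measurable X]setTI; exact: measurable_coor.
by apply/seteqP; split => [x h i _|x h i] /=; [|have := h i Logic.I]; rewrite /= in_itv/=.
Qed.

End borel_rV.

Lemma exists_pow2 {R : realType} (x : R) : exists n : nat, x <= 2 ^+ n.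
Proof.
exists (Num.truncn `|x|).+1.
have /truncn_itv/andP[_ h] : 0 <= `|x| by [].
apply: le_trans (ler_norm x) (le_trans (ltW h) _).
by rewrite -natrX ler_nat ltnW// ltn_expl.
Qed.


Lemma nneseries_geometric_le {R : realType} (c q : R) (u : (\bar R)^nat) : 0 <= c -> 0 <= q < 1 ->
  (forall n, (0 <= u n)%E) -> (forall n, (u n <= (c * q ^+ n)%:E)%E) ->
  (\sum_(0 <= i <oo) u i <= (c / (1 - q))%:E)%E.
Proof.
move=> c0 /andP[q0 q1] u0 uc.
apply: lime_le; first by apply: is_cvg_nneseries => n _ _; exact: u0.
apply: nearW => n.
apply: (@le_trans _ _ (\sum_(0 <= i < n) (c * q ^+ i)%:E)%E).
  by apply: lee_sum => i _; exact: uc.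
have q10 : 0 < 1 - q by lra.
rewrite sumEFin lee_fin -big_distrr /= ler_wpM2l//.
rewrite -[_^-1]mul1r ler_pdivlMr//.
have -> : (\sum_(0 <= i < n) q ^+ i) * (1 - q) = 1 - q ^+ n.
  elim: n => [|n IH]; first by rewrite big_nil mul0r expr0 subrr.
  by rewrite big_nat_recr//= mulrDl IH exprSr; ring.
by rewrite gerBl exprn_ge0.
Qed.

Section levy_moments.
Context {R : realType} {d : nat} (sigma lambda Lambda : R)
  (nu : {measure set 'rV[R]_d -> \bar R}).
Hypotheses (s0 : 0 < sigma) (l0 : 0 <= lambda) (L0 : 0 <= Lambda)
  (hnu : levy_measure sigma lambda Lambda nu).

Definition shell (s : R) : set 'rV[R]_d := [set z | s / 2 < enorm z /\ enorm z <= s].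

Lemma measurable_shell s : measurable (shell s).
Proof. exact: measurableI (measurable_enorm_gt _) (measurable_enorm_le _). Qed.

(** The upper bound of the density at the inner radius s / 2 times the volume (2s)^d of a cube
    containing the shell, with s^(- sigma) factored out. *)
Definition shell_cst : R := Lambda * 4 ^+ d * 2 `^ sigma.

Lemma shell_cst_ge0 : 0 <= shell_cst.
Proof. by rewrite mulr_ge0 ?powR_ge0// mulr_ge0. Qed.

Lemma nu_shell_le s : 0 < s -> (nu (shell s) <= (shell_cst * s `^ (- sigma))%:E)%E.
Proof.
move=> sp; have [_ [g [mg nuE gb]]] := hnu.
have s2 : 0 < s / 2 by rewrite divr_gt0.
rewrite nuE; last exact: measurable_shell.
apply: (@le_trans _ _ (\int[lebesgue_rV d]_(z in shell s) (Lambda / (s / 2) `^ (d%:R + sigma))%:E)%E).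
  apply: ge0_le_integral => //.
  - exact: measurable_shell.
  - move=> z [z1 z2]; rewrite lee_fin; apply: le_trans (gb z _).1; last by rewrite -enorm_eq0 gt_eqF// (lt_trans s2).
    by rewrite divr_ge0// powR_ge0.
  - by apply/measurable_EFinP; apply: measurable_funTS.
  - move=> z [z1 z2]; rewrite lee_fin; have zp : 0 < enorm z by exact: lt_trans z1.
    apply: le_trans (gb z _).2 _; first by rewrite -enorm_eq0 gt_eqF.
    rewrite ler_wpM2l// lef_pV2 ?posrE ?powR_gt0//.
    rewrite ge0_ler_powR ?nnegrE ?addr_ge0 ?(ltW z1) ?(ltW s2) ?(ltW zp) ?(ltW s0) ?(ltW (lt_trans s2 z1))//.
rewrite integral_cst; last exact: measurable_shell.
apply: (@le_trans _ _ ((Lambda / (s / 2) `^ (d%:R + sigma))%:E * ((2 * s) ^+ d)%:E)%E).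
  rewrite lee_wpmul2l ?lee_fin ?divr_ge0 ?powR_ge0//.
  have -> : (2 * s) ^+ d = \prod_(i < d) (s - - s) by rewrite prodr_const card_ord; congr (_ ^+ _); ring.
  rewrite -lebesgue_rV_box => [|i]; last by lra.
  apply: le_measure; rewrite ?inE; first exact: measurable_shell.
    exact: measurable_box.
  move=> z [_ zs] i; have := coord_le_enorm z i; rewrite -ler_norml => zi; exact: le_trans zs.
rewrite -EFinM lee_fin le_eqVlt; apply/orP; left; apply/eqP.
have s20 : s / 2 != 0 by rewrite gt_eqF.
have s'0 : s != 0 by rewrite gt_eqF.
have s2E : (s / 2) `^ sigma = s `^ sigma / 2 `^ sigma.
  rewrite powRM ?invr_ge0 ?(ltW sp)//; congr (_ * _).
  by rewrite -[2^-1]powR_inv1// -powRrM mulN1r powRN.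
rewrite /shell_cst powRD ?s20 ?implybT// powR_mulrn ?(ltW s2)// s2E powRN.
have p1 : s `^ sigma != 0 by rewrite gt_eqF// powR_gt0.
have p2 : 2 `^ sigma != 0 :> R by rewrite gt_eqF// powR_gt0.
rewrite (_ : 4 = 2 * 2 :> R); last by ring.
rewrite !exprMn exprVn; field.
by rewrite p1 p2 !expf_neq0.
Qed.

(* The shells of radii a t^j, t = 1/2 or t = 2, exhaust a ball or its complement. *)
Lemma nu_moment_shells (a t p : R) (D : set 'rV[R]_d) : 0 < a -> 0 < t -> 0 <= p -> t `^ (p - sigma) < 1 ->
  measurable D -> (forall z, D z -> 0 < enorm z -> exists j, shell (a * t ^+ j) z) -> (forall z, D z -> 0 < p \/ 0 < enorm z) ->
  (\int[nu]_(z in D) (enorm z `^ p)%:E <=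
     (shell_cst * a `^ (p - sigma) / (1 - t `^ (p - sigma)))%:E)%E.
Proof.
move=> a0 t0 p0 q1 mD cov pz.
have sj0 j : 0 < a * t ^+ j by rewrite mulr_gt0// exprn_gt0.
pose f j (z : 'rV[R]_d) : \bar R := (((a * t ^+ j) `^ p) * \1_(shell (a * t ^+ j)) z)%:E.
have f0 j z : (0 <= f j z)%E by rewrite lee_fin mulr_ge0 ?powR_ge0.
have mf j : measurable_fun D (f j).
  apply/measurable_EFinP; apply: measurable_funM => //.
  by apply: measurable_indic; exact: measurable_shell.
apply: (@le_trans _ _ (\int[nu]_(z in D) \sum_(0 <= j <oo) f j z)%E).
  apply: ge0_le_integral => //.
  - by move=> z _; rewrite lee_fin powR_ge0.
  - apply/measurable_EFinP; apply: measurable_funTS.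
    by apply: (@measurableT_comp _ _ _ _ _ _ (fun s : R => s `^ p)) => //; exact: measurable_enorm.
  - by apply: ge0_emeasurable_sum.
  - move=> z Dz; have [z0|z0] := leP (enorm z) 0.
      have /eqP E : enorm z == 0 by rewrite eq_le z0 enorm_ge0.
      have [pp|] := pz z Dz; last by rewrite E ltxx.
      by rewrite E powR0 ?gt_eqF//; apply: nneseries_ge0 => j _ _; exact: f0.
    have [j [zj1 zj2]] := cov z Dz z0.
    apply: (@le_trans _ _ (f j z)).
      rewrite lee_fin indicE mem_set// mulr1 ge0_ler_powR ?nnegrE ?enorm_ge0//.
      exact: ltW.
    apply: (@le_trans _ _ (\sum_(0 <= i < j.+1) f i z)%E); last by apply: nneseries_lim_ge.
    by rewrite big_nat_recr//= leeDr// sume_ge0.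
rewrite integral_nneseries//.
apply: nneseries_geometric_le.
- by rewrite mulr_ge0 ?powR_ge0// shell_cst_ge0.
- by rewrite powR_ge0.
- by move=> j; apply: integral_ge0 => z _; exact: f0.
move=> j; rewrite /f; under eq_integral do rewrite EFinM.
rewrite ge0_integralZl//; last 2 first.
  - by apply/measurable_EFinP; apply: measurable_indic; exact: measurable_shell.
  - by rewrite lee_fin powR_ge0.
rewrite integral_indic//; last exact: measurable_shell.
apply: (@le_trans _ _ (((a * t ^+ j) `^ p)%:E * (shell_cst * (a * t ^+ j) `^ (- sigma))%:E)%E).
  rewrite lee_wpmul2l ?lee_fin ?powR_ge0//; apply: le_trans (nu_shell_le (sj0 j)).
  by apply: le_measure; rewrite ?inE; [apply: measurableI => //; exact: measurable_shell|exact: measurable_shell|exact: subIsetl].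
rewrite -EFinM lee_fin mulrCA -powRD ?(gt_eqF (sj0 j)) ?implybT//.
rewrite powRM ?exprn_ge0 ?(ltW a0) ?(ltW t0)// -mulrA -powR_mulrn ?(ltW t0)//.
by rewrite powRAC (powR_mulrn j (powR_ge0 t (p - sigma))).
Qed.

Lemma exists_shell_inner (a : R) (z : 'rV[R]_d) : 0 < enorm z -> enorm z <= a ->
  exists j, shell (a * 2^-1 ^+ j) z.
Proof.
move=> z0 za.
have [n hn] : exists n, a * 2^-1 ^+ n < enorm z.
  have a0 : 0 < a by exact: lt_le_trans za.
  have [n hn] := exists_pow2 (2 * (a / enorm z)); exists n.
  have p2 : 0 < 2 ^+ n :> R by rewrite exprn_gt0.
  rewrite exprVn ltr_pdivrMr// mulrC -ltr_pdivrMr//; apply: lt_le_trans hn.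
  by have := divr_gt0 a0 z0; lra.
elim: n hn => [|n IH] hn; first by move: hn; rewrite expr0 mulr1; lra.
have [h|h] := ltP (a * 2^-1 ^+ n) (enorm z); first exact: IH.
by exists n; split=> //; move: hn; rewrite exprSr mulrA.
Qed.

Lemma exists_shell_outer (z : 'rV[R]_d) : 1 < enorm z -> exists j, shell (2 * 2 ^+ j) z.
Proof.
move=> z1.
have [n hn] : exists n : nat, enorm z <= 2 * 2 ^+ n.
  by have [n hn] := exists_pow2 (enorm z); exists n; have := exprn_gt0 n (ltr0Sn R 1); lra.
elim: n hn => [|n IH] hn; first by exists 0%N; split=> //; rewrite expr0 mulr1 divff.
have [h|h] := leP (enorm z) (2 * 2 ^+ n); first exact: IH.
by exists n.+1; split=> //; apply: le_lt_trans h; rewrite exprS; lra.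
Qed.

Lemma powR_lt1 (t e : R) : 0 < t -> (t < 1) && (0 < e) || (1 < t) && (e < 0) -> t `^ e < 1.
Proof.
move=> t0 h; rewrite /powR (gt_eqF t0) -expR0 ltr_expR.
case/orP: h => /andP[t1 e0]; first by rewrite pmulr_rlt0// ln_lt0// t0.
by rewrite nmulr_rlt0// ln_gt0.
Qed.

Definition levy_inner_cst (p : R) : R := shell_cst / (1 - 2^-1 `^ (p - sigma)).

Lemma levy_inner (a p : R) : 0 < a -> sigma < p ->
  (\int[nu]_(z in [set z : 'rV[R]_d | (enorm z <= a)%R]) (enorm z `^ p)%:E <=
     (levy_inner_cst p * a `^ (p - sigma))%:E)%E.
Proof.
move=> a0 sp; have p0 : 0 < p by exact: lt_trans sp.
have := @nu_moment_shells a 2^-1 p [set z | enorm z <= a] a0.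
rewrite mulrAC; apply.
- by rewrite invr_gt0.
- exact: ltW.
- by apply: powR_lt1; rewrite ?invr_gt0// subr_gt0 sp andbT; apply/orP; left; lra.
- exact: measurable_enorm_le.
- by move=> z za z0; exact: exists_shell_inner.
- by move=> z _; left.
Qed.

Definition levy_outer_cst (p : R) : R := shell_cst * 2 `^ (p - sigma) / (1 - 2 `^ (p - sigma)).

Lemma levy_outer (p : R) : 0 <= p < sigma ->
  (\int[nu]_(z in [set z : 'rV[R]_d | (1 < enorm z)%R]) (enorm z `^ p)%:E <= (levy_outer_cst p)%:E)%E.
Proof.
move=> /andP[p0 sp]; apply: nu_moment_shells => //.
- by apply: powR_lt1 => //; apply/orP; right; apply/andP; split; lra.
- exact: measurable_enorm_gt.
- by move=> z z1 _; exact: exists_shell_outer.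
- by move=> z z1; right; exact: lt_trans z1.
Qed.

End levy_moments.

Section levy_integrals.
Context {R : realType} {d : nat} (sigma lambda Lambda : R)
  (nu : {measure set 'rV[R]_d -> \bar R}).
Hypotheses (s02 : 0 < sigma < 2) (l0 : 0 <= lambda) (L0 : 0 <= Lambda)
  (hnu : levy_measure sigma lambda Lambda nu).
Implicit Types (f g : 'rV[R]_d -> R) (m : R).

Let s0 : 0 < sigma. Proof. by case/andP: s02. Qed.

(** The integrable weight that dominates every jump integrand: second order at the origin, growth m
    below [sigma] at infinity. *)
Definition lw m (z : 'rV[R]_d) : R :=
  (enorm z <= 1)%R%:R * enorm z `^ 2 + (1 < enorm z)%R%:R * enorm z `^ m.

Lemma lw_in m z : enorm z <= 1 -> lw m z = enorm z ^+ 2.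
Proof.
move=> z1; rewrite /lw z1 ltNge z1 mul1r mul0r addr0.
by rewrite powR_mulrn// enorm_ge0.
Qed.

Lemma lw_out m z : 1 < enorm z -> lw m z = enorm z `^ m.
Proof. by move=> z1; rewrite /lw z1 leNgt z1 mul1r mul0r add0r. Qed.

Lemma lw_ge0 m z : 0 <= lw m z.
Proof. by rewrite addr_ge0// mulr_ge0// powR_ge0. Qed.

Lemma measurable_bool_enorm_le (a : R) : measurable_fun setT (fun z : 'rV[R]_d => (enorm z <= a)%R%:R : R).
Proof.
rewrite (_ : (fun _ => _) = \1_[set z : 'rV[R]_d | enorm z <= a]).
  by apply: measurable_indic; exact: measurable_enorm_le.
apply/funext => z; rewrite indicE; have [h|/negP h] := boolP (enorm z <= a)%R; first by rewrite mem_set.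
by rewrite memNset.
Qed.

Lemma measurable_bool_enorm_lt (a : R) : measurable_fun setT (fun z : 'rV[R]_d => (a < enorm z)%R%:R : R).
Proof.
rewrite (_ : (fun _ => _) = \1_[set z : 'rV[R]_d | a < enorm z]).
  by apply: measurable_indic; exact: measurable_enorm_gt.
apply/funext => z; rewrite indicE; have [h|/negP h] := boolP (a < enorm z)%R; first by rewrite mem_set.
by rewrite memNset.
Qed.

Lemma measurable_bool_enorm_ge (a : R) : measurable_fun setT (fun z : 'rV[R]_d => (a <= enorm z)%R%:R : R).
Proof.
rewrite (_ : (fun _ => _) = \1_[set z : 'rV[R]_d | a <= enorm z]).
  by apply: measurable_indic; exact: measurable_enorm_ge.
apply/funext => z; rewrite indicE; have [h|/negP h] := boolP (a <= enorm z)%R; first by rewrite mem_set.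
by rewrite memNset.
Qed.

Lemma measurable_enorm_powR m : measurable_fun setT (fun z : 'rV[R]_d => enorm z `^ m).
Proof.
by apply: (@measurableT_comp _ _ _ _ _ _ (fun s : R => s `^ m)) => //; exact: measurable_enorm.
Qed.

Lemma measurable_lw m : measurable_fun setT (lw m).
Proof.
apply: measurable_funD; apply: measurable_funM.
- exact: measurable_bool_enorm_le.
- exact: measurable_enorm_powR.
- exact: measurable_bool_enorm_lt.
- exact: measurable_enorm_powR.
Qed.

Definition levy_mass m : R :=
  @levy_inner_cst R d sigma Lambda 2 + @levy_outer_cst R d sigma Lambda m.

Lemma integral_part_le (D : set 'rV[R]_d) (e : 'rV[R]_d -> bool) m (C : R) : measurable D ->
  (forall z, e z <-> D z) -> (\int[nu]_(z in D) (enorm z `^ m)%:E <= C%:E)%E ->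
  measurable_fun setT (fun z => (e z)%:R * enorm z `^ m) /\
  (\int[nu]_z ((e z)%:R * enorm z `^ m)%:E <= C%:E)%E.
Proof.
move=> mD eD h0; have E : (fun z => (e z)%:R * enorm z `^ m) = (fun z : 'rV[R]_d => enorm z `^ m) \_ D.
  apply/funext => z; rewrite patchE; case: ifPn; rewrite ?inE => h.
    by have /eD -> := h; rewrite mul1r.
  by case: (boolP (e z)) => [/eD Dz|]; [move: h; rewrite notin_setE|rewrite mul0r].
rewrite E; split.
  by apply/measurable_restrict => //; rewrite setTI; apply: measurable_funTS; exact: measurable_enorm_powR.
by move: h0; rewrite integral_mkcond restrict_EFin -E.
Qed.

Lemma integral_lw m : 0 <= m < sigma -> (\int[nu]_z (lw m z)%:E <= (levy_mass m)%:E)%E.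
Proof.
move=> ms; have /andP[_ s2] := s02.
have [||m1 h1] := integral_part_le (e := fun z => enorm z <= 1) (measurable_enorm_le 1) (m := 2)
    (C := @levy_inner_cst R d sigma Lambda 2) _ _.
- by [].
- by have := levy_inner s0 l0 L0 hnu ltr01 s2; rewrite powR1 mulr1.
have [||m2 h2] := integral_part_le (e := fun z => 1 < enorm z) (measurable_enorm_gt 1) (m := m)
    (C := @levy_outer_cst R d sigma Lambda m) _ _.
- by [].
- by have := levy_outer s0 l0 L0 hnu ms.
under eq_integral do rewrite EFinD.
rewrite ge0_integralD//.
- by rewrite EFinD leeD.
- by move=> z _; rewrite lee_fin mulr_ge0// powR_ge0.
- exact/measurable_EFinP.
- by move=> z _; rewrite lee_fin mulr_ge0// powR_ge0.
- exact/measurable_EFinP.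
Qed.

Lemma integrable_lw m : 0 <= m < sigma -> nu.-integrable setT (EFin \o lw m).
Proof.
move=> ms; apply/integrableP; split; first by apply/measurable_EFinP; exact: measurable_lw.
apply: le_lt_trans (_ : (levy_mass m)%:E < +oo)%E; last exact: ltry.
under eq_integral do rewrite /= ger0_norm ?lw_ge0//.
exact: integral_lw.
Qed.

Lemma Rintegral_lw m : 0 <= m < sigma -> \int[nu]_z lw m z <= levy_mass m.
Proof.
move=> ms; rewrite -lee_fin /Rintegral fineK; first exact: integral_lw.
exact: integrable_fin_num (integrable_lw ms).
Qed.

Lemma integrable_dom f m (C : R) : 0 <= m < sigma -> measurable_fun setT f ->
  (forall z, `|f z| <= C * lw m z) -> nu.-integrable setT (EFin \o f).
Proof.
move=> ms mf fC; apply: (@le_integrable _ _ _ _ _ _ _ (EFin \o (fun z => C * lw m z))) => //.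
- exact/measurable_EFinP.
- by move=> z _ /=; rewrite lee_fin (le_trans (fC z))// ler_norm.
- rewrite (_ : EFin \o _ = fun z => (C%:E * (EFin \o lw m) z)%E); last first.
    by apply/funext => z; rewrite /= EFinM.
  exact: integrableZl (integrable_lw ms).
Qed.

Lemma Rintegral_inner_le (r : R) (p : R) : 0 < r <= 1 -> sigma < p ->
  \int[nu]_z ((enorm z <= r)%R%:R * enorm z `^ p) <= @levy_inner_cst R d sigma Lambda p * r `^ (p - sigma) /\
  nu.-integrable setT (EFin \o (fun z : 'rV[R]_d => (enorm z <= r)%R%:R * enorm z `^ p)).
Proof.
move=> /andP[r0 r1] sp.
have [||m1 h1] := integral_part_le (e := fun z => enorm z <= r) (measurable_enorm_le r) (m := p)
    (C := @levy_inner_cst R d sigma Lambda p * r `^ (p - sigma)) _ _.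
- by [].
- by have := levy_inner s0 l0 L0 hnu r0 sp.
have hI : nu.-integrable setT (EFin \o (fun z : 'rV[R]_d => (enorm z <= r)%R%:R * enorm z `^ p)).
  apply/integrableP; split; first exact/measurable_EFinP.
  apply: le_lt_trans (_ : _ < +oo)%E; last exact: (ltry (@levy_inner_cst R d sigma Lambda p * r `^ (p - sigma))).
  under eq_integral do rewrite /= ger0_norm ?mulr_ge0 ?powR_ge0//.
  exact: h1.
by split=> //; rewrite -lee_fin /Rintegral fineK//; exact: integrable_fin_num hI.
Qed.

(* The part of the nonlocal operator that is evaluated on u itself, with p in
   place of the gradient of u. *)
Definition jump_integrand (u : 'rV[R]_d -> R) (x p : 'rV[R]_d) (r : R) (z : 'rV[R]_d) : R :=
  (r <= enorm z)%R%:R * (u (x + z) - u x - dotv p z * (enorm z <= 1)%R%:R).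

Definition jump u x p r : R := \int[nu]_z jump_integrand u x p r z.

Lemma continuous_add_cst f (x : 'rV[R]_d) : continuous f -> continuous (fun z : 'rV[R]_d => f (x + z)).
Proof.
move=> /(continuous_sub_cst (c := - x)).
rewrite (_ : (fun z : 'rV[R]_d => f (z - - x)) = (fun z : 'rV[R]_d => f (x + z)))//.
by apply/funext => z; rewrite opprK addrC.
Qed.

Lemma measurable_jump_integrand u x p r : continuous u -> measurable_fun setT (jump_integrand u x p r).
Proof.
move=> cu; apply: measurable_funM; first exact: measurable_bool_enorm_ge.
apply: measurable_funB.
  by apply: measurable_funB => //; exact: measurable_continuous_rV (continuous_add_cst _).
apply: measurable_funM; last exact: measurable_bool_enorm_le.
apply: measurable_continuous_rV.
rewrite (_ : dotv p = fun z => dotv z p); first exact: continuous_dotvl.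
by apply/funext => z; rewrite dotvC.
Qed.

Lemma japanese_add_le (x z : 'rV[R]_d) m : 0 <= m ->
  japanese (x + z) `^ m <= (2 + enorm x) `^ m * Num.max 1 (enorm z `^ m).
Proof.
move=> m0.
have x0 := enorm_ge0 x; have z0 := enorm_ge0 z.
have h : japanese (x + z) <= (2 + enorm x) * Num.max 1 (enorm z).
  apply: le_trans (japanese_le _) _; have := enormD x z.
  by have [z1|z1] := leP (enorm z) 1; nra.
apply: le_trans (_ : ((2 + enorm x) * Num.max 1 (enorm z)) `^ m <= _).
  by rewrite ge0_ler_powR ?nnegrE ?(ltW (japanese_gt0 _))// mulr_ge0 ?addr_ge0// le_max ler01.
rewrite powRM ?addr_ge0// ?le_max ?ler01// ler_wpM2l ?powR_ge0//.
by have [z1|z1] := leP (enorm z) 1; rewrite ?powR1 ?le_max ?lexx ?orbT.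
Qed.

Lemma far_lw (r : R) m z : 0 <= m -> 0 < r <= 1 -> r <= enorm z ->
  Num.max 1 (enorm z `^ m) <= r ^- 2 * lw m z.
Proof.
move=> m0 /andP[r0 r1] rz.
have r2 : 1 <= r ^- 2 by rewrite invf_ge1 ?exprn_gt0// exprn_ile1// ltW.
have [z1|z1] := leP (enorm z) 1.
  rewrite lw_in// ge_max.
  have h : 1 <= r ^- 2 * enorm z ^+ 2.
    by rewrite ler_pdivlMl ?exprn_gt0// mulr1 lerXn2r ?nnegrE ?enorm_ge0// ltW.
  by rewrite h (le_trans _ h)// (le_trans (ge0_ler_powR m0 _ _ z1)) ?nnegrE ?enorm_ge0 ?ler01 ?powR1.
rewrite lw_out// ge_max.
have h : 1 <= enorm z `^ m.
  by apply: le_trans (ge0_ler_powR m0 _ _ (ltW z1)); rewrite ?nnegrE ?enorm_ge0 ?powR1.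
by apply/andP; split; rewrite -[leLHS]mul1r; apply: ler_pM => //; rewrite powR_ge0.
Qed.

Lemma jump_integrand_dom u x p r m (C : R) : 0 <= m -> 0 < r <= 1 -> 0 <= C ->
  (forall y, `|u y| <= C * japanese y `^ m) ->
  exists2 C' : R, 0 <= C' & forall z, `|jump_integrand u x p r z| <= C' * lw m z.
Proof.
move=> m0 r01 C0 uC.
have K0 : 0 <= C * (2 + enorm x) `^ m + `|u x| + enorm p.
  by rewrite !addr_ge0 ?enorm_ge0// mulr_ge0// powR_ge0.
exists ((C * (2 + enorm x) `^ m + `|u x| + enorm p) * r ^- 2).
  by rewrite mulr_ge0// invr_ge0 exprn_ge0//; case/andP: r01 => /ltW.
move=> z; rewrite /jump_integrand; have [rz|rz] := leP r (enorm z); last first.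
  by rewrite mul0r normr0 !mulr_ge0 ?lw_ge0// invr_ge0 exprn_ge0//; case/andP: r01 => /ltW.
rewrite mul1r -mulrA; apply: le_trans (ler_wpM2l K0 (far_lw m0 r01 rz)).
set mx := Num.max _ _; have mx1 : 1 <= mx by rewrite le_max lexx.
have h1 : `|u (x + z)| <= C * (2 + enorm x) `^ m * mx.
  by apply: le_trans (uC _) _; rewrite -mulrA ler_wpM2l// japanese_add_le.
have h2 : `|dotv p z * (enorm z <= 1)%R%:R| <= enorm p * mx.
  rewrite normrM; have [z1|z1] := leP (enorm z) 1; last first.
    by rewrite normr0 mulr0 mulr_ge0 ?enorm_ge0//; lra.
  rewrite normr1 mulr1 (le_trans (cauchy_schwarz _ _))// ler_wpM2l ?enorm_ge0//; lra.
have h3 : `|u x| <= `|u x| * mx by rewrite ler_peMr.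
rewrite (le_trans (ler_normB _ _))// (le_trans (lerD (ler_normB _ _) h2))//; lra.
Qed.

End levy_integrals.

(** * Viscosity inequalities at touching points *)

Section joint_continuity.
Context {R : realType} {d : nat}.

Lemma continuous_mxP (X : topologicalType) m n (F : X -> 'M[R]_(m, n)) :
  (forall i j, continuous (fun x => F x i j)) -> continuous F.
Proof.
move=> h x; apply/cvgrPdist_lt => e e0.
have : \forall y \near x, forall ij : 'I_m * 'I_n, `|F x ij.1 ij.2 - F y ij.1 ij.2| < e.
  apply: filter_forall => ij.
  by have /cvgrPdist_lt/(_ _ e0) := h ij.1 ij.2 x.
apply: filterS => y hy; rewrite /Num.norm/= mx_normrE.
apply/bigmax_ltP; split => // ij _ /=; rewrite !mxE; exact: hy.
Qed.

Lemma continuous_sndf (f : 'rV[R]_d -> R) : continuous f -> continuous (fun p : R * 'rV[R]_d => f p.2).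
Proof.
by move=> cf p; apply: (continuous_comp (f := @snd R 'rV[R]_d)); [exact: cvg_snd|exact: cf].
Qed.

Lemma continuous_fstf (f : R -> R) : continuous f -> continuous (fun p : R * 'rV[R]_d => f p.1).
Proof.
by move=> cf p; apply: (continuous_comp (f := @fst R 'rV[R]_d)); [exact: cvg_fst|exact: cf].
Qed.

End joint_continuity.

Section separated_tests.
Context {R : realType} {d : nat} (T sigma : R).

Lemma sqdiff_continuous (N t0 : R) : continuous (fun t : R => N * (t - t0) ^+ 2).
Proof.
move=> t; apply: cvgM; first exact: cvg_cst.
by apply: cvgM; (apply: cvgB; [exact: cvg_id|exact: cvg_cst]).
Qed.

(** Test functions with an explicit time dependence. The last term vanishes to second order at [t0],
    so it contributes neither to the jet in space nor to the time derivative there, and its weight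
    [B] lets it outgrow a solution at all x once t is away from [t0]. *)
Definition sep (P B : 'rV[R]_d -> R) (a N t0 t : R) (x : 'rV[R]_d) : R :=
  P x + a * (t - t0) + N * (t - t0) ^+ 2 * B x.

Lemma C2_sep P gP HP B gB HB a N t0 t : C2 P gP HP -> C2 B gB HB ->
  C2 (sep P B a N t0 t) (fun x => gP x + N * (t - t0) ^+ 2 *: gB x)
     (fun x => HP x + N * (t - t0) ^+ 2 *: HB x).
Proof.
move=> hP hB; apply: (eq_C2 _ _ _ (C2_add (C2_add hP (C2_cst (a * (t - t0)))) (C2_scale (N * (t - t0) ^+ 2) hB))) => x //=;
by rewrite addr0.
Qed.

Lemma is_derive_sep (P B : 'rV[R]_d -> R) (a N t0 t : R) (x : 'rV[R]_d) :
  is_derive t (1 : R) (fun s => sep P B a N t0 s x) (a + 2 * N * (t - t0) * B x).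
Proof.
apply: (@is_derive_quadratic_error _ _ _ _ _ _ (`|N * B x|)) => h _.
rewrite [_%:A]mulr1 /sep (_ : _ - _ = N * B x * h ^+ 2); last by ring.
by rewrite normrM [X in _ * X]ger0_norm ?sqr_ge0.
Qed.

Lemma sep_test P gP HP B gB HB a N t0 (m C : R) : C2 P gP HP -> C2 B gB HB ->
  0 < m < sigma -> 0 < T -> 0 <= C -> 0 <= t0 <= T ->
  (forall x, `|P x| <= C * japanese x `^ m) -> (forall x, `|B x| <= C * japanese x `^ m) ->
  test_function T sigma (sep P B a N t0).
Proof.
move=> hP hB ms T0 C0 /andP[t00 t0T] PC BC.
have hS t := C2_sep a N t0 t hP hB.
have [_ _ cP cgP cHP] := hP; have [_ _ cB cgB cHB] := hB.
have cN := @sqdiff_continuous N t0.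
split; [split|].
- move=> p _; apply: (continuousD (f := fun p : R * 'rV[R]_d => P p.2 + a * (p.1 - t0))).
    apply: (continuousD (f := fun p : R * 'rV[R]_d => P p.2)); first exact: continuous_sndf.
    apply: (@continuous_fstf R d (fun t => a * (t - t0))) => t.
    by apply: cvgM; [exact: cvg_cst|apply: cvgB; [exact: cvg_id|exact: cvg_cst]].
  by apply: (continuousM (continuous_fstf cN (x := p)) (continuous_sndf cB (x := p))).
- split=> [p _|p _]; first by case: (is_derive_sep P B a N t0 p.1 p.2).
  rewrite (_ : (fun q : R * 'rV[R]_d => _) = (fun q => a + 2 * N * (q.1 - t0) * B q.2)); last first.
    by apply/funext => q; rewrite derive1E; case: (is_derive_sep P B a N t0 q.1 q.2).
  have c1 : continuous (fun t : R => 2 * N * (t - t0)).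
    by move=> t; apply: cvgM; [exact: cvg_cst|apply: cvgB; [exact: cvg_id|exact: cvg_cst]].
  apply: (continuousD (f := fun _ : R * 'rV[R]_d => a)); first exact: cst_continuous.
  exact: (continuousM (continuous_fstf c1 (x := p)) (continuous_sndf cB (x := p))).
- split=> [i p _|p _]; first by have [h _ _ _ _] := hS p.1; case: (h p.2 (delta_mx ord0 i)).
  rewrite (_ : (fun q : R * 'rV[R]_d => _) = (fun q => gP q.2 + N * (q.1 - t0) ^+ 2 *: gB q.2)); last first.
    by apply/funext => q; exact: C2_grad (hS q.1).
  apply: continuous_mxP => i j {}p.
  rewrite (_ : (fun q : R * 'rV[R]_d => _) = (fun q => dotv (gP q.2) (delta_mx ord0 j) +
     N * (q.1 - t0) ^+ 2 * dotv (gB q.2) (delta_mx ord0 j))); last first.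
    by apply/funext => q; rewrite !ord1 !mxE !coord_dotv.
  apply: (continuousD (f := fun q : R * 'rV[R]_d => dotv (gP q.2) (delta_mx ord0 j))).
    exact: (continuous_sndf (cgP (delta_mx ord0 j))).
  exact: (continuousM (continuous_fstf cN (x := p)) (continuous_sndf (cgB (delta_mx ord0 j)) (x := p))).
- split=> [i j p _|p _].
    have [h1 h2 _ _ _] := hS p.1.
    rewrite (_ : (fun y => _) = (fun y => dotv (gP y + N * (p.1 - t0) ^+ 2 *: gB y) (delta_mx ord0 i))).
      by case: (h2 p.2 (delta_mx ord0 j) (delta_mx ord0 i)).
    by apply/funext => y; case: (h1 y (delta_mx ord0 i)).
  rewrite (_ : (fun q : R * 'rV[R]_d => _) = (fun q => HP q.2 + N * (q.1 - t0) ^+ 2 *: HB q.2)); last first.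
    by apply/funext => q; exact: C2_hess (hS q.1).
  apply: continuous_mxP => i j {}p.
  rewrite (_ : (fun q : R * 'rV[R]_d => _) = (fun q => HP q.2 i j + N * (q.1 - t0) ^+ 2 * HB q.2 i j)); last first.
    by apply/funext => q; rewrite !mxE.
  apply: (continuousD (f := fun q : R * 'rV[R]_d => HP q.2 i j)).
    exact: (continuous_sndf (cHP i j)).
  exact: (continuousM (continuous_fstf cN (x := p)) (continuous_sndf (cHB i j) (x := p))).
- exists m, (C + `|a| * T + `|N| * T ^+ 2 * C); split=> // t x; rewrite /= in_itv /= => /andP[t1 t2].
  have J1 : 1 <= japanese x `^ m.
    apply: le_trans (ge0_ler_powR _ _ _ (japanese_ge1 x)); rewrite ?powR1 ?nnegrE ?(ltW (japanese_gt0 x))//.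
    by case/andP: ms => /ltW.
  have tt : `|t - t0| <= T by rewrite ler_norml; apply/andP; split; lra.
  have h1 : `|a * (t - t0)| <= `|a| * T * japanese x `^ m.
    rewrite normrM -[leLHS]mulr1; apply: ler_pM => //.
    by rewrite ler_wpM2l.
  have h2 : `|N * (t - t0) ^+ 2 * B x| <= `|N| * T ^+ 2 * C * japanese x `^ m.
    rewrite !normrM -[leRHS]mulrA; apply: ler_pM => //.
    by rewrite ler_wpM2l// -expr2 lerXn2r ?nnegrE// ltW.
  apply: le_trans (ler_normD _ _) _.
  by apply: le_trans (lerD (le_trans (ler_normD _ _) (lerD (PC x) h1)) h2) _; rewrite !mulrDl.
Qed.

End separated_tests.

Section sub_property.
Context {R : realType} {d l : nat} (sigma lambda Lambda lambda0 T : R)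
  (nu : {measure set 'rV[R]_d -> \bar R}) (Sigma : 'rV[R]_d -> 'M[R]_(d, l))
  (b : R -> 'rV[R]_d -> 'rV[R]_d).
Hypotheses (s02 : 0 < sigma < 2) (l0 : 0 <= lambda) (L0 : 0 <= Lambda)
  (hnu : levy_measure sigma lambda Lambda nu) (T0 : 0 < T).

Definition trace_form (x : 'rV[R]_d) (H : 'M[R]_d) : R :=
  lambda0 * \tr H + \tr (Sigma x *m (Sigma x)^T *m H).

Definition second_difference (P : 'rV[R]_d -> R) (x p z : 'rV[R]_d) : R :=
  P (x + z) - P x - dotv p z * (enorm z <= 1)%R%:R.

Lemma integrable_second_difference P gP HP x (m C : R) : C2 P gP HP -> 0 < m < sigma ->
  0 <= C -> (forall y, `|P y| <= C * japanese y `^ m) ->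
  nu.-integrable setT (EFin \o second_difference P x (gP x)).
Proof.
move=> hP /andP[m0 ms] C0 PC; have [h1 h2 cP cg cH] := hP.
have [M M0 hM] := bounded_mx (enorm x + 1) cH.
have r11 : (0 : R) < (1 : R) <= 1 by rewrite ltr01 lexx.
have [C' C'0 hC'] := jump_integrand_dom x (gP x) (ltW m0) r11 C0 PC.
have m0s : 0 <= m < sigma by rewrite (ltW m0).
apply: (integrable_dom s02 l0 L0 hnu (C := M + C') m0s).
  have := @measurable_jump_integrand R d P x (gP x) 0 cP; congr measurable_fun.
  by apply/funext => z; rewrite /jump_integrand enorm_ge0 mul1r.
move=> z; rewrite mulrDl.
have [z1|z1] := leP (enorm z) 1.
  apply: (@le_trans _ _ (M * lw m z)); last by rewrite lerDl mulr_ge0// lw_ge0.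
  rewrite /second_difference z1 mulr1 lw_in//.
  have [th /andP[t0 t1] ->] := C2_taylor x z hP.
  rewrite (_ : _ - _ = 2^-1 * qf (HP (x + th *: z)) z z); last by ring.
  have : `|qf (HP (x + th *: z)) z z| <= M * enorm z ^+ 2.
    apply: le_trans (qf_le _ _ _) _; rewrite -expr2 ler_wpM2r ?sqr_ge0// hM//.
    apply: le_trans (enormD _ _) _; rewrite lerD2l enormZ ger0_norm//.
    by have := enorm_ge0 z; nra.
  rewrite normrM ger0_norm//; have := normr_ge0 (qf (HP (x + th *: z)) z z); lra.
apply: (@le_trans _ _ (C' * lw m z)); last by rewrite lerDr mulr_ge0 ?lw_ge0 ?(ltW M0).
apply: le_trans (hC' z); rewrite /jump_integrand (ltW z1) mul1r /second_difference; exact: lexx.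
Qed.

(** The operator is linear, so the supersolution property of u is recorded as this property of -u; a
    single notion then serves both points of the doubling. *)
Definition sep_sub (u : R -> 'rV[R]_d -> R) : Prop :=
  forall P gP HP B gB HB a N t0 x0 m C, C2 P gP HP -> C2 B gB HB -> 0 < m < sigma -> 0 <= C ->
    (forall x, `|P x| <= C * japanese x `^ m) -> (forall x, `|B x| <= C * japanese x `^ m) ->
    0 < t0 < T ->
    (forall t x, 0 < t < T -> u t x - sep P B a N t0 t x <= u t0 x0 - sep P B a N t0 t0 x0) ->
    a - trace_form x0 (HP x0) - \int[nu]_z second_difference P x0 (gP x0) z
      + dotv (b t0 x0) (gP x0) <= 0.

Lemma residual_sep P gP HP B gB HB a N t0 x0 : C2 P gP HP -> C2 B gB HB ->
  residual (op_L lambda0 Sigma nu) b (sep P B a N t0) t0 x0 =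
  a - trace_form x0 (HP x0) - \int[nu]_z second_difference P x0 (gP x0) z
      + dotv (b t0 x0) (gP x0).
Proof.
move=> hP hB.
have E : sep P B a N t0 t0 = P.
  by apply/funext => x; rewrite /sep subrr expr0n !mulr0 mul0r !addr0.
rewrite /residual derive1E.
have -> : 'D_1 (fun s => sep P B a N t0 s x0) t0 = a.
  by case: (is_derive_sep P B a N t0 t0 x0) => _ ->; rewrite subrr mulr0 mul0r addr0.
rewrite E /op_L /op_L0 /op_I /laplacian (C2_hess x0 hP) (C2_grad x0 hP) /trace_form.
rewrite /second_difference; ring.
Qed.

Lemma viscosity_sep_sub u0 u :
  viscosity_solution T sigma (op_L lambda0 Sigma nu) b u0 u ->
  sep_sub u /\ sep_sub (fun t x => - u t x).
Proof.
move=> [_ _ _ hsub hsup]; split=> P gP HP B gB HB a N t0 x0 m C hP hB ms C0 PC BC t0T hmax.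
  rewrite -(residual_sep a N t0 x0 hP hB); apply: hsub; last by split.
  by apply: (sep_test a N hP hB ms T0 C0 _ PC BC); case/andP: t0T => /ltW -> /ltW ->.
have hP' := C2_scale (-1) hP; have hB' := C2_scale (-1) hB.
have := residual_sep (- a) N t0 x0 hP' hB'.
have -> : \int[nu]_z second_difference (fun x => -1 * P x) x0 (-1 *: gP x0) z =
    - \int[nu]_z second_difference P x0 (gP x0) z.
  rewrite -[RHS]mulN1r -(RintegralZl _ measurableT (integrable_second_difference _ hP ms C0 PC)).
  by congr Rintegral; apply/funext => z; rewrite /second_difference dotvZl; ring.
have -> : trace_form x0 (-1 *: HP x0) = - trace_form x0 (HP x0).
  by rewrite /trace_form -scalemxAr !mxtraceZ; ring.
rewrite dotvZr => E.
have : 0 <= residual (op_L lambda0 Sigma nu) b (sep (fun x => -1 * P x) (fun x => -1 * B x) (- a) N t0) t0 x0.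
  apply: hsup; last first.
    split=> // t x tT; have := hmax t x tT; rewrite /sep; lra.
  apply: (sep_test (- a) N hP' hB' ms T0 C0).
  - by case/andP: t0T => /ltW -> /ltW ->.
  - by move=> x; rewrite mulN1r normrN.
  - by move=> x; rewrite mulN1r normrN.
by rewrite E; lra.
Qed.

End sub_property.

Section quadratic_touching.
Context {R : realType} {d : nat}.
Implicit Types (x p v w : 'rV[R]_d) (X : 'M[R]_d).

Lemma qf_tr X v w : qf X^T v w = qf X w v.
Proof.
by rewrite /qf -[in RHS](trmxK (w *m X *m v^T)) [in RHS]mxE !trmx_mul trmxK mulmxA.
Qed.

Lemma dotv_mulmx X v w : dotv (v *m X) w = qf X v w.
Proof.
by rewrite /qf [RHS]mxE; apply: eq_bigr => i _; congr (_ * _); rewrite mxE.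
Qed.

Lemma qf_diff X v w :
  qf X (v + w) (v + w) - qf X v v = qf X v w + qf X w v + qf X w w.
Proof. by rewrite qfDl !qfDr; ring. Qed.

Lemma continuous_qf X (x0 : 'rV[R]_d) : continuous (fun x => qf X (x - x0) (x - x0)).
Proof.
apply/continuous_enormP => x e e0.
have K0 : 0 < mabs X * (2 * enorm (x - x0) + 1) + 1.
  by rewrite ltr_wpDl// mulr_ge0 ?mabs_ge0// addr_ge0// mulr_ge0// enorm_ge0.
exists (Num.min 1 (e / (mabs X * (2 * enorm (x - x0) + 1) + 1))).
  by rewrite lt_min ltr01 divr_gt0.
move=> y; rewrite lt_min => /andP[y1]; rewrite ltr_pdivlMr// => ye.
have -> : y - x0 = (x - x0) + (y - x) by rewrite [RHS]addrC -addrA addKr.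
set v := x - x0 in K0 ye *; set h := y - x in y1 ye *.
rewrite qf_diff.
have h1 := qf_le X v h; have h2 := qf_le X h v; have h3 := qf_le X h h.
apply: le_lt_trans ye; have m0 := mabs_ge0 X; have n0 := enorm_ge0 h; have v0 := enorm_ge0 v.
apply: (@le_trans _ _ (mabs X * (2 * enorm v + 1) * enorm h)); last by nra.
apply: le_trans (ler_normD _ _) _; apply: le_trans (lerD (ler_normD _ _) h3) _.
apply: le_trans (lerD (lerD h1 h2) (lexx _)) _.
rewrite -!mulrDr -[leRHS]mulrA ler_wpM2l//.
by have := ler_piMr n0 (ltW y1); lra.
Qed.

(** The matrix of a touching quadratic carries no symmetry condition; differentiation sees its
    symmetrization only. *)
Lemma C2_quadratic (c : R) p X x0 :
  C2 (fun x => c + dotv p (x - x0) + 2^-1 * qf X (x - x0) (x - x0))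
     (fun x => p + 2^-1 *: ((x - x0) *m (X + X^T))) (fun=> 2^-1 *: (X + X^T)).
Proof.
have cl w : continuous (fun x : 'rV[R]_d => dotv (x - x0) w).
  apply: (@continuous_sub_cst R d x0 (fun x : 'rV[R]_d => dotv x w)).
  exact: continuous_dotvl.
split.
- move=> x v; apply: (@is_derive_quadratic_error _ _ _ _ _ _ `|2^-1 * qf X v v|) => h _.
  have -> : h *: v + x - x0 = (x - x0) + h *: v by rewrite -addrA addrC.
  rewrite !dotvE dotv_mulmx !qfDm !qf_tr !qfDl !qfDr !qfZl !qfZr.
  rewrite (_ : _ - _ = 2^-1 * qf X v v * h ^+ 2); last by field.
  by rewrite normrM [X in _ * X]ger0_norm ?sqr_ge0.
- move=> x v w; apply: (@is_derive_quadratic_error _ _ _ _ _ _ 0) => h _.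
  have -> : h *: v + x - x0 = (x - x0) + h *: v by rewrite -addrA addrC.
  rewrite !dotvE !dotv_mulmx !qfZm !qfDm !qf_tr !qfDl !qfDr !qfZl !qfZr.
  by rewrite (_ : _ - _ = 0) ?normr0 ?mul0r//; ring.
- apply: continuousDf.
    apply: continuousDf; first exact: cst_continuous.
    by under eq_fun do rewrite dotvC; exact: cl.
  by apply: continuousMf; [exact: cst_continuous|exact: continuous_qf].
- move=> w; rewrite (_ : (fun x => _) =
    (fun x => dotv p w + 2^-1 * dotv (x - x0) (w *m (X + X^T))))//.
    apply: continuousDf; first exact: cst_continuous.
    by apply: continuousMf; [exact: cst_continuous|exact: cl].
  apply/funext => x; rewrite dotvDl dotvZl dotv_mulmx; congr (_ + _ * _).
  by rewrite dotvC dotv_mulmx !qfDm !qf_tr addrC.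
- by move=> i j; exact: cst_continuous.
Qed.

End quadratic_touching.

Section frames.
Context {R : realType} {d l : nat} (lambda0 : R) (Sigma : 'rV[R]_d -> 'M[R]_(d, l)).

(** Turns the trace against a Gram matrix into a sum over directions, the form in which the random
    walks enter. *)
Lemma sum_qf_rows n (A : 'M[R]_(n, d)) H :
  \sum_i qf H (row i A) (row i A) = \tr (A^T *m A *m H).
Proof.
rewrite -mulmxA mxtrace_mulC /mxtrace; apply: eq_bigr => i _.
rewrite /qf -row_mul [LHS]mxE [RHS]mxE; apply: eq_bigr => j _.
by rewrite [row i (_ *m _) _ _]mxE [(row i A)^T _ _]mxE [row i A _ _]mxE [A^T _ _]mxE.
Qed.

Lemma trace_formE x H : trace_form lambda0 Sigma x H =
  \tr ((lambda0%:M + Sigma x *m (Sigma x)^T) *m H).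
Proof. by rewrite /trace_form mulmxDl mxtraceD mul_scalar_mx mxtraceZ. Qed.

Lemma trace_form_sym x (X : 'M[R]_d) :
  trace_form lambda0 Sigma x (2^-1 *: (X + X^T)) = trace_form lambda0 Sigma x X.
Proof.
have E : trace_form lambda0 Sigma x X^T = trace_form lambda0 Sigma x X.
  rewrite !trace_formE -mxtrace_tr trmx_mul trmxK mxtrace_mulC; congr (\tr (_ *m _)).
  by rewrite linearD /= tr_scalar_mx trmx_mul trmxK.
move: E; rewrite !trace_formE -scalemxAr mxtraceZ mulmxDr mxtraceD => ->.
by field.
Qed.

End frames.

Section weighted_moduli.
Context {R : realType} {d : nat}.
Implicit Types (x y : 'rV[R]_d) (f : 'rV[R]_d -> R).

Lemma japanese_pow_ge1 x (m : R) : 0 <= m -> 1 <= japanese x `^ m.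
Proof.
move=> m0; apply: le_trans (ge0_ler_powR m0 _ _ (japanese_ge1 x)); first by rewrite powR1.
  by rewrite nnegrE.
by rewrite nnegrE (ltW (japanese_gt0 x)).
Qed.

Lemma japanese_pow_le x (m m2 : R) : m <= m2 -> japanese x `^ m <= japanese x `^ m2.
Proof. by move=> mm; rewrite ler_powR// japanese_ge1. Qed.

Lemma weight_absorb (C e m m2 : R) : 0 <= m < m2 -> 0 <= C -> 0 < e ->
  exists2 L : R, 0 < L & forall x, L <= enorm x -> C * japanese x `^ m <= e * japanese x `^ m2.
Proof.
move=> /andP[m0 mm] C0 e0; have q0 : 0 < m2 - m by rewrite subr_gt0.
exists ((C / e + 1) `^ (m2 - m)^-1); first by rewrite powR_gt0// ltr_wpDl// divr_ge0// ltW.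
move=> x Lx; have J0 := japanese_gt0 x.
have h : C / e <= japanese x `^ (m2 - m).
  apply: (@le_trans _ _ (C / e + 1)); first by rewrite lerDl.
  have -> : C / e + 1 = ((C / e + 1) `^ (m2 - m)^-1) `^ (m2 - m).
    by rewrite -powRrM mulVf ?gt_eqF// powRr1// addr_ge0// divr_ge0// ltW.
  apply: ge0_ler_powR; rewrite ?nnegrE ?powR_ge0 ?(ltW J0) ?(ltW q0)//.
  exact: le_trans Lx (enorm_le_japanese x).
have -> : m2 = m + (m2 - m) by ring.
rewrite powRD ?(gt_eqF J0) ?implybT// mulrCA [leLHS]mulrC ler_wpM2l ?powR_ge0//.
by rewrite mulrC -ler_pdivrMr.
Qed.

(** Continuity is uniform on compact sets only; far out the larger power of the weight absorbs both
    values, which makes the modulus global at the price of that weight. *)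
Lemma weighted_modulus (T C m m2 e : R) (u : R -> 'rV[R]_d -> R) : 0 <= m < m2 -> 0 <= C -> 0 < e ->
  {within `[0, T] `*` setT, continuous (fun p => u p.1 p.2)} ->
  (forall t x, 0 <= t <= T -> `|u t x| <= C * japanese x `^ m) ->
  exists2 r : R, 0 < r & forall t s x y, 0 <= t <= T -> 0 <= s <= T ->
    `|t - s| < r -> enorm (x - y) < r -> `|u t x - u s y| <= e * japanese x `^ m2.
Proof.
move=> mm C0 e0 cu uC; have /andP[m0 mm2] := mm.
have C3 : 0 <= C + C * 2 `^ m by rewrite addr_ge0// mulr_ge0// powR_ge0.
have [L L0 hL] := weight_absorb mm C3 e0.
have [r r0 hr] := unif_continuous_time (L + 1) cu e0.
exists (Num.min 1 r); first by rewrite lt_min ltr01.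
move=> t s x y tT sT; rewrite !lt_min => /andP[_ ts] /andP[xy1 xy].
have [Lx|xL] := leP L (enorm x).
  apply: le_trans (hL _ Lx); apply: le_trans (ler_normB _ _) _; rewrite mulrDl.
  apply: lerD; first exact: uC.
  apply: le_trans (uC _ _ sT) _; rewrite -mulrA ler_wpM2l//.
  rewrite -powRM ?(ltW (japanese_gt0 x))//; apply: ge0_ler_powR => //.
  - by rewrite nnegrE (ltW (japanese_gt0 y)).
  - by rewrite nnegrE mulr_ge0// (ltW (japanese_gt0 x)).
  rewrite -(ler_pXn2r (ltn0Sn 1)) ?nnegrE ?mulr_ge0 ?(ltW (japanese_gt0 _))//.
  rewrite exprMn !japanese_sqr.
  have h := enorm_le_add y x; rewrite enormBC in h.
  have : enorm y ^+ 2 <= (enorm x + 1) ^+ 2.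
    by rewrite lerXn2r ?nnegrE ?addr_ge0 ?enorm_ge0//; lra.
  by have := sqr_ge0 (enorm x - 1); have := sqr_ge0 (enorm x); rewrite sqrrB sqrrD; lra.
apply: (@le_trans _ _ e); last by rewrite ler_peMr ?(ltW e0)// japanese_pow_ge1// (le_trans m0)// ltW.
apply/ltW/hr => //; first by rewrite (le_trans (ltW xL))// lerDl.
by have := enorm_le_add y x; rewrite enormBC; lra.
Qed.

(** The smooth brackets are exact on a large ball and equal to a multiple of the weight outside;
    there f and the additive constant are already small compared with the weight. *)
Lemma weighted_majorant f (C m m2 e : R) : 0 <= m < m2 -> 0 <= C -> 0 < e -> continuous f ->
  (forall x, `|f x| <= C * japanese x `^ m) ->
  exists2 P, isC2 P & forall x, f x + e * japanese x `^ m2 <= P x <= f x + 4 * e * japanese x `^ m2.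
Proof.
move=> mm C0 e0 cf fC; have /andP[m0 mm2] := mm.
have m20 : 0 <= m2 by rewrite (le_trans m0)// ltW.
have [L1 L10 hL1] := weight_absorb mm C0 e0.
pose K := C * (1 + L1) `^ m.
have K0 : 0 <= K by rewrite mulr_ge0// powR_ge0.
have fK x : f x <= e * japanese x `^ m2 + K.
  apply: le_trans (le_trans (ler_norm _) (fC x)) _.
  have [Lx|xL] := leP L1 (enorm x); first by rewrite (le_trans (hL1 _ Lx))// lerDl.
  apply: (@le_trans _ _ K); last by rewrite lerDr mulr_ge0 ?powR_ge0 ?(ltW e0).
  rewrite ler_wpM2l//; apply: ge0_ler_powR; rewrite ?nnegrE ?(ltW (japanese_gt0 x)) ?addr_ge0 ?(ltW L10)//.
  by apply: le_trans (japanese_le x) _; rewrite lerD2l ltW.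
have m2p : (0 : R) <= (0 : R) < m2 by rewrite lexx (le_lt_trans m0).
have [L2 L20 hL2] := weight_absorb m2p (addr_ge0 K0 C0) e0.
pose L := L1 + L2.
pose B x := japanese x `^ m2; have hB : isC2 B := isC2_japanese m2.
pose w x := f x + e * B x.
have cB : continuous B by have [g [H []]] := hB.
have cw : continuous w.
  by apply: continuousDf => //; apply: continuousMf => //; exact: cst_continuous.
have e30 : 0 < e / 3 by rewrite divr_gt0.
have [r r0 hr] := unif_continuous_rV (L + 2) cw e30.
have [M M0 hM] := continuous_bounded (L + 2) cw.
pose r' := Num.min (r / 2) 1.
have r'01 : 0 < r' <= 1 by rewrite lt_min ltr01 divr_gt0//= ge_min lexx orbT.
pose Q x := 2 * e * B x + K.
have hQ : isC2 Q by apply: isC2_add; [apply: isC2_mul; [exact: isC2_cst|]|exact: isC2_cst].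
have [s [hs hF]] := smooth_brackets L M hQ r'01 e30.
have [|||F Fs hFw] := hF w.
- by move=> x; have := fK x; rewrite /w /Q /B; lra.
- exact: hM.
- move=> x y xL yL xy; apply/ltW/hr => //; apply: le_lt_trans xy _.
  by rewrite gt_min; apply/orP; left; lra.
exists F; first by case: (hs F Fs).
move=> x; have [h1 h2 h3] := hFw x; rewrite -/(B x); apply/andP; split; first exact: h1.
have B1 : 1 <= B x by exact: japanese_pow_ge1.
have eB : e <= e * B x by rewrite ler_peMr// ltW.
have [xL|Lx] := leP (enorm x) L.
  by have := h3 xL; rewrite /w; lra.
apply: le_trans h2 _; rewrite ge_max; apply/andP; split; last by rewrite /w; lra.
have xL1 : L1 <= enorm x by move: Lx; rewrite /L; lra.
have xL2 : L2 <= enorm x by move: Lx; rewrite /L; lra.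
have := hL1 _ xL1; have := hL2 _ xL2; rewrite powRr0 mulr1 -/(B x).
by have := fC x; rewrite ler_norml => /andP[]; rewrite /Q; lra.
Qed.

End weighted_moduli.

Section jet_tests.
Context {R : realType} {d : nat}.
Implicit Types (x p : 'rV[R]_d) (X : 'M[R]_d) (f : 'rV[R]_d -> R).

Lemma dist_le_width (t s A : R) : 0 <= t <= A -> 0 <= s <= A -> `|t - s| <= A.
Proof. by move=> /andP[? ?] /andP[? ?]; rewrite ler_norml; apply/andP; split; lra. Qed.

Lemma exists_larger_exponent (m sigma : R) : 0 < m -> m < sigma ->
  exists m2, [/\ 0 <= m < m2, 0 <= m2 < sigma & 0 < m2 < sigma].
Proof. by move=> *; exists ((m + sigma) / 2); split; apply/andP; split; lra. Qed.

Lemma le_of_small_error (x y c : R) : (forall e, 0 < e -> x <= y + e * c) -> x <= y.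
Proof.
move=> h; apply/ler_addgt0Pr => e e0.
have c0 : 0 < `|c| + 1 by rewrite ltr_wpDl.
apply: le_trans (h (e / (`|c| + 1)) _) _; first by rewrite divr_gt0.
rewrite lerD2l mulrAC ler_pdivrMr// ler_wpM2l ?(ltW e0)//.
by have := ler_norm c; lra.
Qed.

Lemma le_mix (z a c v : R) : 0 <= z <= 1 -> v <= a -> v <= c -> v <= z * a + (1 - z) * c.
Proof.
move=> /andP[z0 z1] va vc; have h1 := ler_wpM2l z0 va.
have h2 : (1 - z) * v <= (1 - z) * c by rewrite ler_wpM2l// subr_ge0.
by apply: le_trans (lerD h1 h2); rewrite le_eqVlt; apply/orP; left; apply/eqP; ring.
Qed.

Lemma mix_le (z a c v : R) : 0 <= z <= 1 -> a <= v -> c <= v -> z * a + (1 - z) * c <= v.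
Proof.
move=> z01 av cv; have := @le_mix z (- a) (- c) (- v) z01.
by rewrite !lerN2 => /(_ av cv); rewrite !mulrN -opprD lerN2.
Qed.

Definition jet (c : R) p X x0 x : R := c + dotv p (x - x0) + 2^-1 * qf X (x - x0) (x - x0).

Lemma jet_center c p X x0 : jet c p X x0 x0 = c.
Proof. by rewrite /jet subrr dotv0r /qf !mul0mx mxE mulr0 !addr0. Qed.

Lemma jet_bound c p X x0 (r K : R) x : 0 <= K -> (forall v, `|qf X v v| <= K * enorm v ^+ 2) ->
  r <= 1 -> enorm (x - x0) <= r -> `|jet c p X x0 x| <= `|c| + enorm p + K.
Proof.
move=> K0 XK r1 xr; rewrite /jet.
have h1 := cauchy_schwarz p (x - x0); have h2 := XK (x - x0).
have n0 := enorm_ge0 (x - x0); have p0 := enorm_ge0 p.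
have n1 : enorm (x - x0) <= 1 by exact: le_trans r1.
have h3 : enorm p * enorm (x - x0) <= enorm p by rewrite ler_piMr.
have h4 : K * enorm (x - x0) ^+ 2 <= K by rewrite ler_piMr// exprn_ile1.
apply: le_trans (ler_normD _ _) _; rewrite normrM ger0_norm//.
have h5 := ler_normD c (dotv p (x - x0)); have h6 := normr_ge0 (qf X (x - x0) (x - x0)).
by clear -h1 h2 h3 h4 h5 h6; lra.
Qed.

(** Turns a quadratic that touches on a small ball into an admissible global test function with
    exactly that jet: a cut-off glues it to a smooth majorant of f within 4e of f in the weight. *)
Lemma exists_jet_test f (C m m2 e r K : R) x0 p X : 0 <= m < m2 -> 0 <= C -> 0 < e ->
  0 < r <= 1 -> 0 <= K -> continuous f -> (forall x, `|f x| <= C * japanese x `^ m) ->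
  (forall v, `|qf X v v| <= K * enorm v ^+ 2) ->
  (forall x, enorm (x - x0) <= r -> f x <= jet (f x0) p X x0 x) ->
  let B := fun x : 'rV[R]_d => japanese x `^ m2 in
  exists P gP HP, [/\ C2 P gP HP, gP x0 = p, HP x0 = 2^-1 *: (X + X^T),
    exists2 M, 0 <= M & forall x, `|P x| <= M * B x &
    [/\ forall x, enorm (x - x0) <= r / 2 -> P x = jet (f x0) p X x0 x,
      forall x, r <= enorm (x - x0) -> f x + e * B x <= P x <= f x + 4 * e * B x,
      forall x, enorm (x - x0) < r -> P x <= jet (f x0) p X x0 x + 4 * e * B x &
      forall x v a, enorm (x - x0) < r -> v <= jet (f x0) p X x0 x + a ->
        v <= f x + e * B x + a -> v <= P x + a]].
Proof.
move=> mm C0 e0 r01 K0 cf fC XK hj B; have /andP[r0 r1] := r01.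
have m20 : 0 <= m2 by case/andP: mm => /le_trans h /ltW /h.
have B1 x : 1 <= B x := japanese_pow_ge1 x m20.
have B0 x : 0 <= B x := le_trans ler01 (B1 x).
have [P hP Pf] := weighted_majorant mm C0 e0 cf fC.
have hJ := C2_quadratic (f x0) p X x0; rewrite -/(jet _ _ _ _) in hJ.
pose J := jet (f x0) p X x0.
have [z [hz z01 zin zout]] : exists z, [/\ isC2 z, forall x, 0 <= z x <= 1,
    forall x, enorm (x - x0) <= r / 2 -> z x = 1 & forall x, r <= enorm (x - x0) -> z x = 0].
  exists (plateau x0 r); split; first exact: isC2_plateau.
  - by move=> x; rewrite plateau_ge0 plateau_le1.
  - by move=> x; exact: plateau1.
  - by move=> x; exact: plateau0.
(* Writing the blend as the jet plus a correction that vanishes near [x0] makes the derivatives at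
   [x0] those of the jet. *)
pose D x := (1 - z x) * (P x - J x).
have [gD [HD hD]] : isC2 D.
  apply: isC2_mul; first by apply: isC2_add; [exact: isC2_cst|exact: isC2_opp].
  by apply: isC2_add => //; apply: isC2_opp; do 2!eexists; exact: hJ.
have [gD0 HD0] : gD x0 = 0 /\ HD x0 = 0.
  apply: (C2_eq0_near (r := r / 2) hD); first by rewrite divr_gt0.
  by move=> y yr; rewrite /D zin ?(ltW yr)// subrr mul0r.
have E x : J x + D x = z x * J x + (1 - z x) * P x by rewrite /D; ring.
have Pb x : `|P x| <= (C + 4 * e) * B x.
  have fB : `|f x| <= C * B x.
    by apply: le_trans (fC x) _; rewrite ler_wpM2l// japanese_pow_le//; case/andP: mm => _ /ltW.
  have /andP[P1 P2] := Pf x; have eB : 0 <= e * B x by rewrite mulr_ge0// ltW.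
  move: P1 P2 eB fB; rewrite !ler_norml -/(B x); move: (P x) (f x) (B x) => q w s.
  by clear => h1 h2 h3 /andP[h4 h5]; apply/andP; split; lra.
have JB x : enorm (x - x0) <= r -> `|J x| <= `|f x0| + enorm p + K by exact: jet_bound.
pose M := `|f x0| + enorm p + K + (C + 4 * e).
have M1 : 0 <= `|f x0| + enorm p + K by rewrite !addr_ge0// enorm_ge0.
have M2 : 0 <= C + 4 * e by rewrite addr_ge0// mulr_ge0// ltW.
exists (fun x => J x + D x), (fun x => p + 2^-1 *: ((x - x0) *m (X + X^T)) + gD x),
  (fun x => 2^-1 *: (X + X^T) + HD x).
split.
- exact: C2_add hJ hD.
- by rewrite gD0 subrr mul0mx scaler0 !addr0.
- by rewrite HD0 addr0.
- exists M; first by rewrite addr_ge0.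
  move=> x; have hP1 : `|P x| <= M * B x by apply: le_trans (Pb x) _; rewrite ler_wpM2r// lerDr.
  have [xr|rx] := leP (enorm (x - x0)) r; last by rewrite E zout ?(ltW rx)// mul0r add0r subr0 mul1r.
  have hJ1 : `|J x| <= M * B x.
    apply: le_trans (JB _ xr) _; apply: (@le_trans _ _ M); first by rewrite lerDl.
    by rewrite ler_peMr// addr_ge0.
  move: hP1 hJ1; rewrite E !ler_norml => /andP[p1 p2] /andP[j1 j2].
  by apply/andP; split; [exact: le_mix|exact: mix_le].
- split.
  + by move=> x xr; rewrite /D zin// subrr mul0r addr0.
  + by move=> x rx; rewrite E zout// mul0r add0r subr0 mul1r; exact: Pf.
  + move=> x xr; rewrite E; apply: mix_le => //; first by rewrite lerDl !mulr_ge0// ltW.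
    have /andP[_ h] := Pf x; apply: le_trans h _; rewrite lerD2r; exact/hj/ltW.
  + move=> x v a xr h1 h2; rewrite E -lerBlDr; apply: le_mix => //; first by rewrite lerBlDr.
    by rewrite lerBlDr (le_trans h2)// lerD2r; case/andP: (Pf x).
Qed.

Lemma continuous_slice (T t : R) (u : R -> 'rV[R]_d -> R) : 0 <= t <= T ->
  {within `[0, T] `*` setT, continuous (fun q => u q.1 q.2)} -> continuous (u t).
Proof.
move=> tT cu; apply/continuous_enormP => x e e0.
have [r r0 hr] := unif_continuous_time (enorm x + 1) cu e0.
exists (Num.min 1 r); first by rewrite lt_min ltr01.
move=> y; rewrite lt_min => /andP[y1 y2]; apply: hr => //.
- by have := enorm_le_add y x; lra.
- by rewrite lerDl.
- by rewrite subrr normr0.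
Qed.

(** A dichotomy: for t away from [t0] a large [N] beats the growth of u and of the spatial part of
    the test; for t near [t0] the weighted modulus of continuity replaces u at time t by u at
    [t0]. *)
Lemma exists_time_penalty (T t0 C M m m2 e r a Ca : R) (u : R -> 'rV[R]_d -> R) : 0 <= m < m2 ->
  0 <= C -> 0 < e -> 0 < r -> 0 <= M -> 0 <= Ca -> 0 < t0 < T ->
  {within `[0, T] `*` setT, continuous (fun q => u q.1 q.2)} ->
  (forall t x, 0 <= t <= T -> `|u t x| <= C * japanese x `^ m) ->
  let B := fun x : 'rV[R]_d => japanese x `^ m2 in
  exists2 N, Ca <= N & forall t x, 0 < t < T ->
    (forall P : R, `|P| <= M * B x -> u t x <= P + a * (t - t0) + N * (t - t0) ^+ 2 * B x) \/
    (`|t - t0| <= r /\ u t x <= u t0 x + e * B x + a * (t - t0)).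
Proof.
move=> mm C0 e0 r0 M0 Ca0 t0T cu uC B; have /andP[t00 t0T'] := t0T.
have T0 : 0 < T by exact: lt_trans t0T'.
have t0T2 : 0 <= t0 <= T by rewrite (ltW t00) ltW.
have m20 : 0 <= m2 by case/andP: mm => /le_trans h /ltW /h.
have B1 x : 1 <= B x := japanese_pow_ge1 x m20.
have B0 x : 0 <= B x := le_trans ler01 (B1 x).
have e20 : 0 < e / 2 by rewrite divr_gt0.
have [rho1 rho10 hrho] := weighted_modulus mm C0 e20 cu uC.
pose rho := Num.min (rho1 / 2) (Num.min r (e / 2 / (`|a| + 1))).
have a10 : 0 < `|a| + 1 by rewrite ltr_wpDl.
have rho0 : 0 < rho by rewrite !lt_min r0 !divr_gt0.
pose N := Ca + (C + M + `|a| * T) / rho ^+ 2.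
have aT0 : 0 <= `|a| * T by rewrite mulr_ge0 ?(ltW T0).
have q0 : 0 <= (C + M + `|a| * T) / rho ^+ 2.
  by apply: divr_ge0; [apply: addr_ge0 => //; exact: addr_ge0|exact: sqr_ge0].
have N0 : 0 <= N by rewrite addr_ge0.
exists N; first by rewrite lerDl.
move=> t x tT; have tT2 : 0 <= t <= T by case/andP: tT => /ltW -> /ltW ->.
have [rt|tr] := leP rho `|t - t0|; [left=> P PM|right].
  have h : C + M + `|a| * T <= N * (t - t0) ^+ 2.
    have E : N * rho ^+ 2 = Ca * rho ^+ 2 + (C + M + `|a| * T).
      by rewrite /N mulrDl divfK// expf_neq0// gt_eqF.
    apply: (@le_trans _ _ (N * rho ^+ 2)); first by rewrite E lerDr mulr_ge0// sqr_ge0.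
    rewrite ler_wpM2l// -(real_normK (num_real (t - t0))).
    by rewrite lerXn2r ?nnegrE ?(ltW rho0).
  have := ler_wpM2r (B0 x) h.
  have aTB : `|a| * T <= `|a| * T * B x by rewrite ler_peMr.
  have aT : `|a * (t - t0)| <= `|a| * T by rewrite normrM ler_wpM2l// dist_le_width.
  have uB : `|u t x| <= C * B x.
    by apply: le_trans (uC t x tT2) _; rewrite ler_wpM2l// japanese_pow_le//; case/andP: mm => _ /ltW.
  move: uB PM aT; rewrite !ler_norml => /andP[_ h1] /andP[h2 _] /andP[h3 _] h4.
  clear -h1 h2 h3 h4 aTB; move: (N * (t - t0) ^+ 2 * B x) (`|a| * T) (B x) (u t x) (a * (t - t0)) h1 h2 h3 h4 aTB.
  by clear => q aT Bx ut at0; lra.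
have hr1 : rho <= rho1 / 2 by rewrite ge_min lexx.
have hr2 : rho <= r by rewrite !ge_min lexx orbT.
have hr3 : rho <= e / 2 / (`|a| + 1) by rewrite !ge_min lexx !orbT.
have tr1 := lt_le_trans tr hr1; have tr3 := lt_le_trans tr hr3.
split; first exact: ltW (lt_le_trans tr hr2).
have h1 : `|u t x - u t0 x| <= e / 2 * B x.
  apply: hrho => //; last by rewrite subrr enorm0.
  by apply: lt_trans tr1 _; rewrite ltr_pdivrMr// ltr_pMr// ltr1n.
have h2 : `|a * (t - t0)| <= e / 2.
  rewrite normrM; apply: (@le_trans _ _ ((`|a| + 1) * `|t - t0|)).
    by rewrite ler_wpM2r// lerDl.
  by rewrite mulrC -ler_pdivlMr// ltW.
have eB : e <= e * B x by rewrite ler_peMr// ltW.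
move: h1 h2; rewrite !ler_norml => /andP[_ h1] /andP[h2 _].
by move: (u t x) (u t0 x) (B x) (a * (t - t0)) h1 h2 eB; clear; move=> *; lra.
Qed.

Lemma second_difference_le (P f : 'rV[R]_d -> R) (r K m2 C3 e : R) x0 p X z :
  let B := fun x : 'rV[R]_d => japanese x `^ m2 in
  0 < r <= 1 -> 0 <= K -> 0 <= e -> 0 <= C3 -> (forall v, `|qf X v v| <= K * enorm v ^+ 2) ->
  (forall z, r / 2 <= enorm z -> B (x0 + z) <= C3 * lw m2 z) ->
  (forall x, enorm (x - x0) <= r / 2 -> P x = jet (f x0) p X x0 x) ->
  (forall x, r <= enorm (x - x0) -> f x + e * B x <= P x <= f x + 4 * e * B x) ->
  (forall x, enorm (x - x0) < r -> P x <= jet (f x0) p X x0 x + 4 * e * B x) ->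
  second_difference P x0 p z <= K * ((enorm z <= r)%R%:R * enorm z `^ 2)
    + jump_integrand f x0 p r z + 4 * e * C3 * lw m2 z.
Proof.
move=> B /andP[r0 r1] K0 e0 C30 XK hC3 P1 P2 P3.
have Px0 : P x0 = f x0 by rewrite P1 ?jet_center// subrr enorm0 ltW// divr_gt0.
rewrite /second_difference Px0 /jump_integrand powR_mulrn ?enorm_ge0//.
have xz : x0 + z - x0 = z by rewrite addrC addKr.
have e40 : 0 <= 4 * e by rewrite mulr_ge0.
have lz := lw_ge0 m2 z; have ez : 0 <= 4 * e * C3 * lw m2 z by rewrite (mulr_ge0 (mulr_ge0 e40 C30)).
have Kz : 0 <= K * enorm z ^+ 2 by rewrite mulr_ge0// sqr_ge0.
have qz : 2^-1 * qf X z z <= K * enorm z ^+ 2.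
  have h := XK z; rewrite ler_norml in h; case/andP: h => _.
  by move: Kz; clear; lra.
have JE : jet (f x0) p X x0 (x0 + z) = f x0 + dotv p z + 2^-1 * qf X z z by rewrite /jet xz.
have h2 : r / 2 <= enorm z -> 4 * e * B (x0 + z) <= 4 * e * C3 * lw m2 z.
  by move=> rz; rewrite -[leRHS]mulrA (ler_wpM2l e40)// hC3.
have [rz|zr] := leP r (enorm z).
  have /andP[_ h] : f (x0 + z) + e * B (x0 + z) <= P (x0 + z) <= f (x0 + z) + 4 * e * B (x0 + z).
    by apply: P2; rewrite xz.
  have {}h2 : 4 * e * B (x0 + z) <= 4 * e * C3 * lw m2 z by apply: h2; clear -r0 rz; lra.
  have : 0 <= K * ((enorm z <= r)%R%:R * enorm z ^+ 2) by rewrite mulr_ge0// mulr_ge0// sqr_ge0.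
  rewrite mul1r; move: (dotv p z * _) (K * _) (4 * e * C3 * _) (4 * e * B _) h h2 => q1 q2 q3 q4.
  by clear; lra.
have z1 : (enorm z <= 1)%R by clear -zr r1; lra.
rewrite (ltW zr) z1 mul0r mul1r mulr1 addr0.
have [zr2|rz2] := leP (enorm z) (r / 2).
  by rewrite P1 ?xz// JE; move: (4 * e * C3 * lw m2 z) ez qz => q; clear; lra.
have {}h2 := h2 (ltW rz2); have := P3 (x0 + z); rewrite xz => /(_ zr); rewrite JE.
by move: (4 * e * C3 * lw m2 z) (4 * e * B _) h2 ez qz => q1 q2; clear; lra.
Qed.

End jet_tests.

Section nonlocal_inequality.
Context {R : realType} {d l : nat} (sigma lambda Lambda lambda0 T : R)
  (nu : {measure set 'rV[R]_d -> \bar R}) (Sigma : 'rV[R]_d -> 'M[R]_(d, l))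
  (b : R -> 'rV[R]_d -> 'rV[R]_d).
Hypotheses (s02 : 0 < sigma < 2) (l0 : 0 <= lambda) (L0 : 0 <= Lambda)
  (hnu : levy_measure sigma lambda Lambda nu).

Lemma integrable_add (f g : 'rV[R]_d -> R) : nu.-integrable setT (EFin \o f) ->
  nu.-integrable setT (EFin \o g) -> nu.-integrable setT (EFin \o (fun z => f z + g z)).
Proof.
move=> hf hg; have := integrableD measurableT hf hg.
by congr (integrable _ _ _); apply/funext => z.
Qed.

Lemma integrable_scale c (f : 'rV[R]_d -> R) : nu.-integrable setT (EFin \o f) ->
  nu.-integrable setT (EFin \o (fun z => c * f z)).
Proof.
move=> hf; have := integrableZl measurableT c hf.
by congr (integrable _ _ _); apply/funext => z.
Qed.

Lemma Rintegral_le_combination (f f1 f2 f3 : 'rV[R]_d -> R) (c1 c3 : R) :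
  nu.-integrable setT (EFin \o f) -> nu.-integrable setT (EFin \o f1) ->
  nu.-integrable setT (EFin \o f2) -> nu.-integrable setT (EFin \o f3) ->
  (forall z, f z <= c1 * f1 z + f2 z + c3 * f3 z) ->
  \int[nu]_z f z <= c1 * (\int[nu]_z f1 z) + \int[nu]_z f2 z + c3 * (\int[nu]_z f3 z).
Proof.
move=> h h1 h2 h3 le.
rewrite -(RintegralZl c1 measurableT h1) -(RintegralZl c3 measurableT h3).
have h1' := integrable_scale c1 h1; have h3' := integrable_scale c3 h3.
rewrite -(RintegralD measurableT h1' h2) -(RintegralD measurableT (integrable_add h1' h2) h3').
by apply: le_Rintegral => //; exact: integrable_add (integrable_add h1' h2) h3'.
Qed.

(** The test function is within 4e of u in the weight at distance at least r, so the jumps of size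
    at least [r] are taken on u itself as e tends to 0. Within [r] the quadratic jet costs [K] times
    the second moment of the small jumps. *)
Lemma nonlocal_sub u (m C : R) t0 x0 a Ca p X (r K : R) :
  sep_sub sigma lambda0 T nu Sigma b u -> 0 < m < sigma -> 0 <= C ->
  {within `[0, T] `*` setT, continuous (fun q => u q.1 q.2)} ->
  (forall t x, 0 <= t <= T -> `|u t x| <= C * japanese x `^ m) ->
  0 < t0 < T -> 0 < r <= 1 -> 0 <= Ca -> 0 <= K ->
  (forall v, `|qf X v v| <= K * enorm v ^+ 2) ->
  (forall t x, 0 < t < T -> `|t - t0| <= r -> enorm (x - x0) <= r ->
     u t x <= jet (u t0 x0) p X x0 x + (a * (t - t0) + Ca * (t - t0) ^+ 2)) ->
  a + dotv (b t0 x0) p <= trace_form lambda0 Sigma x0 X + jump nu (u t0) x0 p r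
    + K * (@levy_inner_cst R d sigma Lambda 2 * r `^ (2 - sigma)).
Proof.
move=> hu /andP[m0 ms] C0 cu uC t0T r01 Ca0 K0 XK hloc.
have /andP[r0 r1] := r01; have /andP[t00 t0T'] := t0T.
have t0T2 : 0 <= t0 <= T by rewrite (ltW t00) ltW.
have cut := continuous_slice t0T2 cu.
(* A weight strictly stronger than the growth of u, yet still integrable at infinity for the
   jumps. *)
have [m2 [mm2 m2s m2s']] : exists m2, [/\ 0 <= m < m2, 0 <= m2 < sigma & 0 < m2 < sigma].
  exact: exists_larger_exponent m0 ms.
have m20 : 0 <= m2 by case/andP: m2s.
pose B x := japanese (x : 'rV[R]_d) `^ m2.
have B1 x : 1 <= B x := japanese_pow_ge1 x m20.
have B0 x : 0 <= B x := le_trans ler01 (B1 x).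
have r20 : 0 < r / 2 <= 1 by apply/andP; split; lra.
pose C3 := (2 + enorm x0) `^ m2 * (r / 2) ^- 2.
have C30 : 0 <= C3 by rewrite mulr_ge0 ?powR_ge0// invr_ge0 exprn_ge0; lra.
have hC3 z : r / 2 <= enorm z -> B (x0 + z) <= C3 * lw m2 z.
  move=> rz; apply: le_trans (japanese_add_le _ _ m20) _.
  by rewrite /C3 -mulrA ler_wpM2l ?powR_ge0// far_lw.
apply: (@le_of_small_error _ _ _ (4 * C3 * levy_mass (d := d) sigma Lambda m2)) => e e0.
have hj x : enorm (x - x0) <= r -> u t0 x <= jet (u t0 x0) p X x0 x.
  move=> xr; have := hloc t0 x t0T; rewrite subrr normr0 expr0n !mulr0 !addr0.
  by apply=> //; exact: ltW.
have [P [gP [HP [hP gPE HPE [M M0 PM] [P1 P2 P3 P4]]]]] :=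
  exists_jet_test mm2 C0 e0 r01 K0 cut (fun x => uC t0 x t0T2) XK hj.
have [gB [HB hB]] : isC2 B := isC2_japanese m2.
have [N CN hN] := exists_time_penalty a mm2 C0 e0 r0 M0 Ca0 t0T cu uC.
have Px0 : P x0 = u t0 x0.
  by rewrite P1 ?jet_center// subrr enorm0; case/andP: r20 => /ltW.
have sep0 : sep P B a N t0 t0 x0 = u t0 x0 by rewrite /sep Px0 subrr expr0n !mulr0 mul0r !addr0.
have hmax t x : 0 < t < T -> u t x - sep P B a N t0 t x <= u t0 x0 - sep P B a N t0 t0 x0.
  move=> tT; rewrite sep0 subrr subr_le0 /sep.
  have [h|[tr h]] := hN t x tT; first exact: (h _ (PM x)).
  have NB : Ca * (t - t0) ^+ 2 <= N * (t - t0) ^+ 2 * B x.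
    apply: (@le_trans _ _ (N * (t - t0) ^+ 2)); first by rewrite ler_wpM2r// sqr_ge0.
    by rewrite ler_peMr// mulr_ge0 ?sqr_ge0// (le_trans Ca0).
  apply: (@le_trans _ _ (P x + a * (t - t0) + Ca * (t - t0) ^+ 2)); last by rewrite lerD2l.
  rewrite -addrA; have C0t : 0 <= Ca * (t - t0) ^+ 2 by rewrite mulr_ge0// sqr_ge0.
  have h' : u t x <= u t0 x + e * B x + (a * (t - t0) + Ca * (t - t0) ^+ 2).
    by rewrite addrA; apply: le_trans h _; rewrite lerDl.
  have [rx|xr] := leP r (enorm (x - x0)).
    by apply: le_trans h' _; rewrite lerD2r; case/andP: (P2 x rx).
  by apply: P4 => //; apply: hloc => //; exact: ltW.
have MM : 0 <= M + 1 by rewrite addr_ge0.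
have PM' x : `|P x| <= (M + 1) * B x 
  by apply: le_trans (PM x) _; rewrite (ler_wpM2r (B0 x))// lerDl.
have BM' x : `|B x| <= (M + 1) * B x by rewrite ger0_norm// ler_peMl// lerDr.
have := hu _ _ _ _ _ _ a N t0 x0 m2 _ hP hB m2s' MM PM' BM' t0T hmax.
rewrite gPE HPE trace_form_sym => hsub.
have iP := integrable_second_difference s02 l0 L0 hnu x0 hP m2s' MM PM'.
rewrite gPE in iP.
have s2 : sigma < 2 by case/andP: s02.
have [I1 i1] := Rintegral_inner_le s02 l0 L0 hnu r01 s2.
have uB y : `|u t0 y| <= C * B y.
  by apply: le_trans (uC t0 y t0T2) _; rewrite ler_wpM2l// japanese_pow_le//; case/andP: mm2 => _ /ltW.
have [C' C'0 hC'] := jump_integrand_dom x0 p m20 r01 C0 uB.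
have i2 := integrable_dom s02 l0 L0 hnu m2s (measurable_jump_integrand x0 p r cut) hC'.
have i3 := integrable_lw s02 l0 L0 hnu m2s.
have := Rintegral_le_combination (c1 := K) (c3 := 4 * e * C3) iP i1 i2 i3.
rewrite -/(jump nu (u t0) x0 p r) => hI.
have I3 := Rintegral_lw s02 l0 L0 hnu m2s.
have {}hI : \int[nu]_z second_difference P x0 p z <=
   K * (@levy_inner_cst R d sigma Lambda 2 * r `^ (2 - sigma)) + jump nu (u t0) x0 p r
   + e * (4 * C3 * levy_mass (d := d) sigma Lambda m2).
  apply: (le_trans (hI _)); last first.
    rewrite lerD ?lerD2r ?ler_wpM2l//.
    rewrite (_ : e * _ = 4 * e * C3 * levy_mass (d := d) sigma Lambda m2); last by ring.
    by rewrite (ler_wpM2l _ I3)// mulr_ge0// mulr_ge0// ltW.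
  by move=> z; apply: second_difference_le; rewrite ?(ltW e0).
by move: hsub hI; move: (\int[nu]_z second_difference P x0 p z) => I; lra.
Qed.

End nonlocal_inequality.

(** * Blow-up of the nonlocal terms and doubling of variables *)

Section small_parameters.
Context {R : realType}.

Definition small (P : R -> Prop) := exists2 h0 : R, 0 < h0 & forall h, 0 < h -> h <= h0 -> P h.

Lemma small_and P Q : small P -> small Q -> small (fun h => P h /\ Q h).
Proof.
move=> [a a0 ha] [b b0 hb]; exists (Num.min a b); first by rewrite lt_min a0.
by move=> h h0; rewrite le_min => /andP[h1 h2]; split; [exact: ha|exact: hb].
Qed.

Lemma small_powR (c th e : R) : 0 < th -> 0 < e -> small (fun h => c * h `^ th <= e).
Proof.
move=> th0 e0; have c0 : 0 < `|c| + 1 by rewrite ltr_wpDl.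
exists ((e / (`|c| + 1)) `^ th^-1); first by rewrite powR_gt0// divr_gt0.
move=> h h0 hh; apply: (@le_trans _ _ ((`|c| + 1) * h `^ th)).
  by rewrite ler_wpM2r ?powR_ge0//; have := ler_norm c; lra.
rewrite mulrC -ler_pdivlMr//.
have -> : e / (`|c| + 1) = ((e / (`|c| + 1)) `^ th^-1) `^ th.
  by rewrite -powRrM mulVf ?gt_eqF// powRr1// divr_ge0// ltW.
by apply: ge0_ler_powR => //; rewrite ?nnegrE ?powR_ge0// ltW.
Qed.

Lemma small_linear (c e : R) : 0 < e -> small (fun h => c * h <= e).
Proof.
move=> e0; have [h0 h00 H] := small_powR c ltr01 e0.
by exists h0 => // h h1 h2; have := H h h1 h2; rewrite powRr1// ltW.
Qed.

Lemma shift_in_range (t T ta : R) : `|ta| <= Num.min t (T - t) -> 0 <= t + ta <= T.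
Proof.
rewrite le_min !ler_norml => /andP[/andP[h1 _] /andP[_ h2]].
by apply/andP; split; lra.
Qed.

Lemma far_absorb (f1 f2 A B Q v v0 w w0 P q : R) : 0 <= f1 -> 0 <= f2 -> v - w <= A ->
  - B <= v0 - w0 -> - q <= B -> A <= Q -> B <= Q ->
  v - v0 - (P + q) <= f1 + f2 + (w - w0 - P) + 3 * Q.
Proof. by move=> *; lra. Qed.

Lemma absorb_halves (a A x c j e : R) : a <= A -> x <= e / 2 -> c <= e / 2 -> a + x + j + c <= j + A + e.
Proof. by move=> *; lra. Qed.

End small_parameters.

Section pointwise_continuity.
Context {R : realType} {d : nat}.

Lemma continuous_pairP (f : R * 'rV[R]_d -> R) (p : R * 'rV[R]_d) :
  (forall e, 0 < e -> exists2 r : R, 0 < r & forall s y, `|s - p.1| < r -> enorm (y - p.2) < r ->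
     `|f (s, y) - f p| < e) -> {for p, continuous f}.
Proof.
move=> h; apply/cvgrPdist_lt => e e0; have [r r0 hr] := h e e0.
have r'0 : 0 < r / d.+1%:R by rewrite divr_gt0// ltr0n.
exists (ball p.1 (r / d.+1%:R), ball p.2 (r / d.+1%:R)).
  by split; exact: nbhsx_ballx.
move=> -[s y] [/= h1 h2].
rewrite distrC; apply: hr => /=.
  rewrite distrC; apply: lt_le_trans h1 _; rewrite ler_pdivrMr ?ltr0n//.
  by rewrite ler_peMr ?(ltW r0)// ler1n.
apply: le_lt_trans (enorm_le_mxnorm _) _; rewrite mulrC -ltr_pdivlMr ?ltr0n//.
by move: h2; rewrite -ball_normE /= -opprB normrN.
Qed.

Lemma continuous_shift (T t : R) (x : 'rV[R]_d) (u : R -> 'rV[R]_d -> R) p :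
  {within `[0, T] `*` setT, continuous (fun q => u q.1 q.2)} -> 0 < t + p.1 < T ->
  {for p, continuous (fun q => u (t + q.1) (x + q.2))}.
Proof.
move=> cu /andP[t0 tT]; apply: continuous_pairP => e e0.
have [r r0 hr] := unif_continuous_time (enorm (x + p.2) + 1) cu e0.
exists (Num.min (Num.min r 1) (Num.min (t + p.1) (T - (t + p.1)))).
  by rewrite !lt_min r0 ltr01 t0 subr_gt0.
move=> s y; rewrite !lt_min => /andP[/andP[s1 _] /andP[s3 s4]] /andP[/andP[y1 y2] _].
have E : x + y - (x + p.2) = y - p.2 by rewrite opprD addrACA subrr add0r.
have E2 : t + s - (t + p.1) = s - p.1 by ring.
move: s3; rewrite ltr_norml => /andP[s3 _]; move: s4; rewrite ltr_norml => /andP[_ s4].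
apply: hr => /=; rewrite ?E ?E2//.
- by apply/andP; split; lra.
- by apply/andP; split; lra.
- by have := enorm_le_add (x + y) (x + p.2); rewrite E; lra.
- by rewrite lerDl.
Qed.

Lemma drift_modulus (b : R -> 'rV[R]_d -> 'rV[R]_d) t x (e : R) :
  {in [set p : R * 'rV[R]_d | 0 < p.1], continuous (fun p => b p.1 p.2)} -> 0 < t -> 0 < e ->
  exists2 r : R, 0 < r & forall s y, `|s - t| < r -> enorm (y - x) < r -> enorm (b s y - b t x) <= e.
Proof.
move=> cb t0 e0; have D0 : 0 < d.+1%:R :> R by rewrite ltr0n.
have e'0 : 0 < e / d.+1%:R by rewrite divr_gt0.
have /cvgrPdist_lt/(_ _ e'0)/nbhs_ballP[r r0 hr] := cb (t, x) (mem_set t0).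
exists r => // s y st yx; apply: le_trans (enorm_le_mxnorm _) _.
rewrite mulrC -ler_pdivlMr// -opprB normrN; apply: ltW.
apply: (hr (s, y)); split => /=; first by rewrite /ball /= distrC.
by apply: ball_enorm; rewrite enormBC.
Qed.

Lemma continuous_sumf (I : Type) (s : seq I) (F : I -> 'rV[R]_d -> R) :
  (forall i, continuous (F i)) -> continuous (fun x => \sum_(i <- s) F i x).
Proof.
move=> cF; elim: s => [|i s IH].
  by rewrite (_ : (fun x => _) = fun=> 0)//; [exact: cst_continuous|apply/funext => x; rewrite big_nil].
rewrite (_ : (fun x => _) = (fun x => F i x + \sum_(j <- s) F j x)); first exact: continuousDf.
by apply/funext => x; rewrite big_cons.
Qed.

Lemma entry_le_frob l (A : 'M[R]_(d, l)) i j : `|A i j| <= frob A.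
Proof.
rewrite /frob -sqrtr_sqr ler_wsqrtr// /mxtrace (bigD1 i)//= mxE (bigD1 j)//= mxE -expr2 -addrA lerDl.
apply: addr_ge0; first by apply: sumr_ge0 => k _; rewrite mxE -expr2 sqr_ge0.
by apply: sumr_ge0 => k _; rewrite mxE; apply: sumr_ge0 => k' _; rewrite mxE -expr2 sqr_ge0.
Qed.

Definition gram l (lambda0 : R) (Sigma : 'rV[R]_d -> 'M[R]_(d, l)) x : 'M[R]_d :=
  lambda0%:M + Sigma x *m (Sigma x)^T.

Lemma continuous_gram l (lambda0 sigma0 sigma1 : R) (Sigma : 'rV[R]_d -> 'M[R]_(d, l)) i j :
  bounded_lipschitz sigma0 sigma1 Sigma -> continuous (fun x => gram lambda0 Sigma x i j).
Proof.
move=> [_ hS]; have cS i' k : continuous (fun x => Sigma x i' k).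
  apply/continuous_enormP => x e e0; have c0 : 0 < `|sigma1| + 1 by rewrite ltr_wpDl.
  exists (e / (`|sigma1| + 1)); first by rewrite divr_gt0.
  move=> y; rewrite ltr_pdivlMr// => yx.
  have -> : Sigma y i' k - Sigma x i' k = (Sigma y - Sigma x) i' k by rewrite !mxE.
  apply: le_lt_trans (entry_le_frob _ _ _) _; apply: le_lt_trans (hS _ _) _; apply: le_lt_trans yx.
  by rewrite mulrC ler_wpM2l ?enorm_ge0//; have := ler_norm sigma1; lra.
rewrite (_ : (fun x => _) = (fun x => (lambda0%:M : 'M[R]_d) i j + \sum_k Sigma x i k * Sigma x j k)).
  by apply: continuousDf; [exact: cst_continuous|apply: continuous_sumf => k; exact: continuousMf].
by apply/funext => x; rewrite !mxE; congr (_ + _); apply: eq_bigr => k _; rewrite !mxE.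
Qed.

(** Symmetry of [D] allows X to be replaced by its symmetric part, the only part its quadratic form
    controls; polarization along e_j + e_i and e_j - e_i bounds the entries. *)
Lemma trace_mul_le (D X : 'M[R]_d) (K : R) : D^T = D ->
  (forall v, `|qf X v v| <= K * enorm v ^+ 2) -> `|\tr (D *m X)| <= K * mabs D.
Proof.
move=> Ds XK; pose Y i j := (X i j + X j i) / 2.
have E : \tr (D *m X) = \sum_i \sum_j D i j * Y j i.
  have E1 : \tr (D *m X) = \sum_i \sum_j D i j * X j i.
    by rewrite /mxtrace; apply: eq_bigr => i _; rewrite mxE.
  have E2 : \tr (D *m X) = \sum_i \sum_j D i j * X i j.
    rewrite E1 exchange_big; apply: eq_bigr => i _; apply: eq_bigr => j _.
    by rewrite -[in LHS]Ds mxE.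
  rewrite -[LHS]mul1r (_ : 1 = 2^-1 + 2^-1); last by field.
  rewrite mulrDl {1}E1 E2 !mulr_sumr -big_split; apply: eq_bigr => i _.
  by rewrite !mulr_sumr -big_split; apply: eq_bigr => j _; rewrite /Y /=; field.
rewrite E /mabs mulr_sumr; apply: le_trans (ler_norm_sum _ _ _) _; apply: ler_sum => i _.
rewrite mulr_sumr; apply: le_trans (ler_norm_sum _ _ _) _; apply: ler_sum => j _.
rewrite normrM mulrC ler_wpM2r//.
have nrm (v : 'rV[R]_d) : enorm v ^+ 2 = dotv v v := enorm_sqr v.
pose e (k : 'I_d) : 'rV[R]_d := delta_mx ord0 k.
have EY : Y j i = 4^-1 * (qf X (e j + e i) (e j + e i) - qf X (e j - e i) (e j - e i)).
  by rewrite /Y !qfDl !qfDr !qfNl !qfNr !qf_delta; field.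
have h1 := XK (e j + e i); have h2 := XK (e j - e i).
have n1 (k : 'I_d) : dotv (e k) (e k) = 1 by rewrite -coord_dotv /e mxE !eqxx.
rewrite EY; move: h1 h2; rewrite enormD_sqr enormB_sqr !nrm !n1.
move: (qf X _ _) (qf X (e j - e i) _) (dotv (e j) (e i)) => a c g.
rewrite !ler_norml => /andP[h1 h2] /andP[h3 h4]; apply/andP; split; clear -h1 h2 h3 h4; nra.
Qed.

End pointwise_continuity.

Section jump_integrand_shift.
Context {R : realType} {d : nat}.

(** The contact point has moved by O(h) and is touched only on a ball of radius h / K. For h / K <=
    |z| < r1 the one-sided quadratic bound replaces the touching; for |z| >= r1 the weighted modulus
    compares the two integrands. *)
Lemma jump_integrand_shift_le (u u' : 'rV[R]_d -> R) x y0 p q rho r1 h K C2 eta m2 th z :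
  1 <= K -> 0 < h -> h <= r1 -> 0 < r1 <= 1 -> 0 <= C2 -> 0 <= m2 -> 0 < eta -> 0 < th < 1 ->
  K * h <= eta -> enorm y0 <= K * h -> enorm q <= K * h -> K * h + r1 <= rho ->
  (forall z, `|u' (x + y0 + z) - u (x + z)| <= eta * japanese (x + z) `^ m2) ->
  (forall y, enorm y <= rho ->
     u' (x + y) - u' (x + y0) - dotv p (y - y0) <= C2 * enorm y ^+ 2 + K * h ^+ 2) ->
  jump_integrand u' (x + y0) (p + q) (h / K) z <=
    (2 * C2 * ((enorm z <= r1)%R%:R * enorm z `^ 2) +
      (2 * C2 * K ^+ 2 + 2 * K) * K `^ (2 - th) * h `^ th * ((enorm z <= r1)%R%:R * enorm z `^ (2 - th)))
    + jump_integrand u x p r1 z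
    + 3 * eta * ((2 + enorm x) `^ m2 * r1 ^- 2) * lw m2 z.
Proof.
move=> K1 h0 hr1 /andP[r10 r11] C20 m20 eta0 /andP[th0 th1] Khe y0K qK Krho hu hw.
have K0 : 0 <= K by exact: le_trans K1.
have hK : h / K <= h by rewrite ler_pdivrMr ?(lt_le_trans ltr01)// ler_peMr// ltW.
pose b := (enorm z <= r1)%R%:R : R.
have b0 : 0 <= b by rewrite /b ler0n.
have M0 : 0 <= (2 * C2 * K ^+ 2 + 2 * K) * K `^ (2 - th) * h `^ th.
  by rewrite mulr_ge0 ?powR_ge0// mulr_ge0 ?powR_ge0// addr_ge0 ?mulr_ge0 ?sqr_ge0.
set MM := (2 * C2 * K ^+ 2 + _) * _ * _ in M0 *.
have eta3 : 0 <= 3 * eta * ((2 + enorm x) `^ m2 * r1 ^- 2).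
  have e30 : 0 <= 3 * eta by rewrite mulr_ge0// ltW.
  have r1i : 0 <= r1 ^- 2 by rewrite invr_ge0 exprn_ge0// ltW.
  by rewrite (mulr_ge0 e30)// (mulr_ge0 _ r1i)// powR_ge0.
have f3 : 0 <= 3 * eta * ((2 + enorm x) `^ m2 * r1 ^- 2) * lw m2 z by rewrite (mulr_ge0 eta3)// lw_ge0.
have f1 : 0 <= 2 * C2 * (b * enorm z `^ 2) by rewrite mulr_ge0 ?mulr_ge0 ?powR_ge0.
have f2 : 0 <= MM * (b * enorm z `^ (2 - th)) by rewrite (mulr_ge0 M0)// mulr_ge0 ?powR_ge0.
rewrite -/b /jump_integrand.
have [zr1|rz1] := ltP (enorm z) r1.
  have [hz|zh] := leP (h / K) (enorm z); last first.
    by rewrite /= !mul0r addr0 !addr_ge0.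
  rewrite (_ : (enorm z <= 1)%R = true); last first.
    by apply/idP; exact: le_trans (ltW zr1) r11.
  rewrite /= mul0r addr0 mul1r mulr1 (_ : b = 1) ?mul1r; last by rewrite /b (ltW zr1).
  apply: (@le_trans _ _ (2 * C2 * enorm z `^ 2 + MM * enorm z `^ (2 - th))); last by rewrite lerDl.
  have z0 : 0 < enorm z by apply: lt_le_trans hz; rewrite divr_gt0// (lt_le_trans ltr01).
  have hs : h <= K * enorm z by rewrite mulrC -ler_pdivrMr// (lt_le_trans ltr01).
  have yz : enorm (y0 + z) <= rho by have := enormD y0 z; clear -zr1 y0K Krho; lra.
  have := hw _ yz; rewrite [y0 + z - y0]addrC addKr addrA => E.
  have Eq : - dotv q z <= K * h * enorm z.
    have := dotv_ge q z; have := ler_wpM2r (ltW z0) qK; clear; lra.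
  have En : enorm (y0 + z) ^+ 2 <= 2 * enorm z ^+ 2 + 2 * (K * h) ^+ 2.
    have h1 : enorm (y0 + z) <= K * h + enorm z by apply: le_trans (enormD _ _) _; rewrite lerD2r.
    have h2 : enorm (y0 + z) ^+ 2 <= (K * h + enorm z) ^+ 2.
      by rewrite lerXn2r ?nnegrE ?addr_ge0 ?enorm_ge0 ?mulr_ge0// ltW.
    have h3 := sqr_ge0 (K * h - enorm z); move: h2 h3; rewrite sqrrD sqrrB; clear; lra.
  (* Errors of order h |z| are not integrable against the jump measure when sigma >= 1. As h <= K
     |z| here, a power of h can be traded for a power of |z|, leaving |z|^(2 - th) with a factor
     h^th. *)
  have EP : h * (K * enorm z) <= K `^ (2 - th) * h `^ th * enorm z `^ (2 - th).
    have -> : K `^ (2 - th) * h `^ th * enorm z `^ (2 - th) = h `^ th * (K * enorm z) `^ (2 - th).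
      by rewrite powRM// ?(ltW z0)//; ring.
    have s0 : 0 < K * enorm z by rewrite mulr_gt0// (lt_le_trans ltr01).
    have -> : (K * enorm z) `^ (2 - th) = (K * enorm z) `^ (1 - th) * (K * enorm z).
      rewrite -{3}(powRr1 (ltW s0)) -powRD; last by rewrite (gt_eqF s0) implybT.
      by congr (_ `^ _); ring.
    rewrite [leRHS]mulrA ler_wpM2r ?(ltW s0)//.
    have Eh : h `^ th * h `^ (1 - th) = h.
      rewrite -powRD; last by rewrite (gt_eqF h0) implybT.
      by rewrite addrC subrK powRr1// ltW.
    rewrite -{1}Eh ler_wpM2l ?powR_ge0//; apply: ge0_ler_powR => //.
    - by rewrite subr_ge0 ltW.
    - by rewrite nnegrE ltW.
    - by rewrite nnegrE ltW.
  have hh : h ^+ 2 <= h * (K * enorm z) by rewrite expr2 ler_wpM2l// ltW.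
  have hMM : (2 * C2 * K ^+ 2 + 2 * K) * (h * (K * enorm z)) <= MM * enorm z `^ (2 - th).
    rewrite /MM -!mulrA ler_wpM2l//; last by rewrite !mulrA; move: EP; rewrite !mulrA.
    by rewrite addr_ge0 ?mulr_ge0 ?sqr_ge0.
  rewrite powR_mulrn ?(ltW z0)//.
  have C2n := ler_wpM2l C20 En.
  have a1 : C2 * (2 * (K * h) ^+ 2) <= 2 * C2 * K ^+ 2 * (h * (K * enorm z)).
    rewrite (_ : C2 * _ = 2 * C2 * K ^+ 2 * h ^+ 2); last by ring.
    by rewrite ler_wpM2l// mulr_ge0 ?sqr_ge0// mulr_ge0.
  have a2 : K * h ^+ 2 <= K * (h * (K * enorm z)) by rewrite ler_wpM2l.
  have a3 : K * h * enorm z <= K * (h * (K * enorm z)).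
    rewrite -mulrA ler_wpM2l// ler_wpM2l ?(ltW h0)//; rewrite ler_peMl// ltW//.
  rewrite dotvDl; move: hMM C2n a1 a2 a3 Eq E; rewrite mulrDr mulrDl -[2 * K * _]mulrA.
  move: (u' _) (u' (x + y0)) (dotv p z) (dotv q z) (C2 * enorm (y0 + z) ^+ 2) => A1 A2 A3 A4 A5.
  move: (MM * _) (2 * C2 * K ^+ 2 * _) (K * (h * _)) (C2 * (2 * (K * h) ^+ 2)) => A6 A7 A8 A9.
  clear; lra.
have hz : h / K <= enorm z by exact: le_trans hK (le_trans hr1 rz1).
rewrite hz !mul1r.
have far : Num.max 1 (enorm z `^ m2) <= r1 ^- 2 * lw m2 z by apply: far_lw; rewrite ?r10.
have W0 : 0 <= (2 + enorm x) `^ m2 by rewrite powR_ge0.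
have b1 : japanese (x + z) `^ m2 <= (2 + enorm x) `^ m2 * (r1 ^- 2 * lw m2 z).
  by apply: le_trans (japanese_add_le _ _ m20) _; rewrite ler_wpM2l.
have b2 : japanese x `^ m2 <= (2 + enorm x) `^ m2 * (r1 ^- 2 * lw m2 z).
  apply: (@le_trans _ _ ((2 + enorm x) `^ m2 * 1)); last first.
    by rewrite ler_wpM2l// (le_trans _ far)// le_max lexx.
  rewrite mulr1; apply: ge0_ler_powR; rewrite ?nnegrE ?addr_ge0 ?enorm_ge0 ?(ltW (japanese_gt0 x))//.
  by apply: le_trans (japanese_le x) _; rewrite lerD2r ler1n.
have J1 := japanese_pow_ge1 x m20.
have E1 := hu z; have E2 := hu 0; rewrite !addr0 in E2.
have Eq : - (dotv q z * (enorm z <= 1)%R%:R) <= eta * japanese x `^ m2.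
  apply: (@le_trans _ _ eta); last by rewrite ler_peMr// ltW.
  have [z1|_] := leP (enorm z) 1; last by rewrite mulr0 oppr0 ltW.
  rewrite mulr1; apply: le_trans (le_trans Khe _) => //.
  have := dotv_ge q z; have : enorm q * enorm z <= K * h by rewrite (le_trans _ qK)// ler_piMr ?enorm_ge0.
  by clear; lra.
have c1 := ler_wpM2l (ltW eta0) b1; have c2 := ler_wpM2l (ltW eta0) b2.
rewrite dotvDl [(_ + _) * _%:R]mulrDl; move: E1 E2; rewrite !ler_norml => /andP[_ E1] /andP[E2 _].
have -> : 3 * eta * ((2 + enorm x) `^ m2 * r1 ^- 2) * lw m2 z =
  3 * (eta * ((2 + enorm x) `^ m2 * (r1 ^- 2 * lw m2 z))) by ring.
exact: far_absorb E1 E2 Eq c1 c2.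
Qed.

End jump_integrand_shift.

Section jump_shift.
Context {R : realType} {d : nat} (sigma lambda Lambda T : R)
  (nu : {measure set 'rV[R]_d -> \bar R}).
Hypotheses (s02 : 0 < sigma < 2) (l0 : 0 <= lambda) (L0 : 0 <= Lambda)
  (hnu : levy_measure sigma lambda Lambda nu).

Local Notation cin := (@levy_inner_cst R d sigma Lambda).


Lemma levy_inner_cst_ge0 p : sigma < p -> 0 <= cin p.
Proof.
move=> sp; apply: divr_ge0; first exact: shell_cst_ge0.
rewrite subr_ge0 ltW//; apply: powR_lt1; first by rewrite invr_gt0.
by rewrite invf_lt1// ltr1n subr_gt0 sp.
Qed.

(** Upper semicontinuity of the jump term along the blow-up, uniformly over all contact points at
    distance O(h). The excess is the contribution of the jumps below [r1], which is made small
    afterwards through [r1]. *)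
Lemma jump_shift_le (u : R -> 'rV[R]_d -> R) t x p (m C rho r1 K C2 e : R) :
  1 <= K -> 0 < r1 <= 1 -> 0 <= C2 -> 0 < e -> r1 < rho -> 0 < t < T ->
  0 < m < sigma -> 0 <= C ->
  {within `[0, T] `*` setT, continuous (fun q => u q.1 q.2)} ->
  (forall t x, 0 <= t <= T -> `|u t x| <= C * japanese x `^ m) ->
  small (fun h => forall ta y0 q, `|ta| <= K * h -> enorm y0 <= K * h -> enorm q <= K * h ->
    (forall y, enorm y <= rho -> u (t + ta) (x + y) - u (t + ta) (x + y0) - dotv p (y - y0)
       <= C2 * enorm y ^+ 2 + K * h ^+ 2) ->
    jump nu (u (t + ta)) (x + y0) (p + q) (h / K)
      <= jump nu (u t) x p r1 + 2 * C2 * (cin 2 * r1 `^ (2 - sigma)) + e).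
Proof.
move=> K1 r101 C20 e0 r1rho t0T /andP[m0 ms] C0 cu uC; have /andP[r10 r11] := r101.
have /andP[t00 tT] := t0T; have t0T2 : 0 <= t <= T by rewrite (ltW t00) ltW.
have [m2 [mm2 m2s]] : exists m2, 0 <= m < m2 /\ 0 <= m2 < sigma.
  by have [m2 [h1 h2 _]] := exists_larger_exponent m0 ms; exists m2.
have m20 : 0 <= m2 by case/andP: m2s.
(* Half of the room below 2: the exponent 2 - th still exceeds sigma, while h^th tends to 0. *)
pose th := (2 - sigma) / 2; have /andP[s0 s2] := s02.
have th01 : 0 < th < 1 by apply/andP; rewrite /th; split; lra.
have sth : sigma < 2 - th by rewrite /th; lra.
have th0 : 0 < th by case/andP: th01.
have [I1 i1] := Rintegral_inner_le s02 l0 L0 hnu r101 s2.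
have [I2 i2] := Rintegral_inner_le s02 l0 L0 hnu r101 sth.
have I3 := Rintegral_lw s02 l0 L0 hnu m2s; have i3 := integrable_lw s02 l0 L0 hnu m2s.
set g1 := fun z : 'rV[R]_d => (enorm z <= r1)%R%:R * enorm z `^ 2 in I1 i1.
set g2 := fun z : 'rV[R]_d => (enorm z <= r1)%R%:R * enorm z `^ (2 - th) in I2 i2.
pose C3 := (2 + enorm x) `^ m2 * r1 ^- 2.
have C30 : 0 <= C3 by apply: mulr_ge0; [exact: powR_ge0|rewrite invr_ge0 exprn_ge0// ltW].
pose mass := levy_mass (d := d) sigma Lambda m2.
have mass0 : 0 <= mass by apply: le_trans I3; apply: Rintegral_ge0 => z _; exact: lw_ge0.
pose eta := e / 2 / (3 * C3 * mass + 1).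
have D0 : 0 < 3 * C3 * mass + 1 by rewrite ltr_wpDl// mulr_ge0// mulr_ge0.
have eta0 : 0 < eta by rewrite !divr_gt0.
have etaE : 3 * eta * C3 * mass <= e / 2.
  rewrite (_ : 3 * eta * C3 * mass = (e / 2) * (3 * C3 * mass / (3 * C3 * mass + 1))); last by rewrite /eta; ring.
  by rewrite ler_piMr ?divr_ge0 ?(ltW e0)// ler_pdivrMr// mul1r lerDl.
have [rho1 rho10 hrho] := weighted_modulus mm2 C0 eta0 cu uC.
pose M := (2 * C2 * K ^+ 2 + 2 * K) * K `^ (2 - th).
have e20 : 0 < e / 2 by rewrite divr_gt0.
have rr : 0 < rho - r1 by rewrite subr_gt0.
have rho20 : 0 < rho1 / 2 by rewrite divr_gt0.
have rho12 : rho1 / 2 < rho1 by rewrite ltr_pdivrMr// ltr_pMr// ltr1n.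
have r1h : small (fun h => h <= r1) by exists r1.
have tt : 0 < Num.min t (T - t) by rewrite lt_min t00 subr_gt0.
have [h0 h00 H] := small_and (small_and (small_and r1h (small_linear K eta0))
    (small_and (small_linear K rr) (small_linear K rho20)))
  (small_and (small_powR (M * (cin (2 - th) * r1 `^ (2 - th - sigma))) th0 e20) (small_linear K tt)).
exists h0 => // h h1 /(H h h1)[[[hr1 hK1] [hK2 hK3]] [hM ht]] ta y0 q taK y0K qK hw.
have K0 : 0 < K by exact: lt_le_trans K1.
have tta : 0 <= t + ta <= T.
  exact: shift_in_range (le_trans taK ht).
have hrho1 z : `|u (t + ta) (x + y0 + z) - u t (x + z)| <= eta * japanese (x + z) `^ m2.
  rewrite -normrN opprB; apply: hrho => //.
    rewrite opprD addrA subrr sub0r normrN; exact: le_lt_trans taK (le_lt_trans hK3 rho12).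
  rewrite (_ : _ - _ = - y0) ?enormN; first exact: le_lt_trans y0K (le_lt_trans hK3 rho12).
  by rewrite [x + y0 + z]addrAC opprD addrA subrr add0r.
have hK2' : K * h + r1 <= rho by rewrite -lerBrDr.
have hw2 := hw; have pt z := @jump_integrand_shift_le R d (u t) (u (t + ta)) x y0 p q rho r1 h K C2 eta m2 th z
  K1 h1 hr1 r101 C20 m20 eta0 th01 hK1 y0K qK hK2' hrho1 hw.
have hKr : 0 < h / K <= 1.
  by rewrite divr_gt0//= ler_pdivrMr// mul1r (le_trans hr1)// (le_trans r11).
have uB t' y : 0 <= t' <= T -> `|u t' y| <= C * japanese y `^ m2.
  by move=> t'T; apply: le_trans (uC _ _ t'T) _; rewrite ler_wpM2l// japanese_pow_le//; case/andP: mm2 => _ /ltW.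
have [C' _ hC'] := jump_integrand_dom (x + y0) (p + q) m20 hKr C0 (fun y => uB _ y tta).
have [C'' _ hC''] := jump_integrand_dom x p m20 r101 C0 (fun y => uB _ y t0T2).
have mj' := measurable_jump_integrand (x + y0) (p + q) (h / K) (continuous_slice tta cu).
have mj := measurable_jump_integrand x p r1 (continuous_slice t0T2 cu).
have ij' := integrable_dom s02 l0 L0 hnu m2s mj' hC'.
have ij := integrable_dom s02 l0 L0 hnu m2s mj hC''.
have i12 := integrable_add (integrable_scale (2 * C2) i1) (integrable_scale (M * h `^ th) i2).
have := Rintegral_le_combination (c1 := 1) (c3 := 3 * eta * C3) ij' i12 ij i3.
rewrite -/(jump nu (u t) x p r1) -/(jump nu (u (t + ta)) (x + y0) (p + q) (h / K)) => hI.
have {hI} hI : jump nu (u (t + ta)) (x + y0) (p + q) (h / K) <= (2 * C2 * \int[nu]_z g1 z +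
    M * h `^ th * \int[nu]_z g2 z) + jump nu (u t) x p r1 + 3 * eta * C3 * \int[nu]_z lw m2 z.
  apply: (le_trans (hI _)); first by move=> z; rewrite mul1r; exact: pt.
  rewrite mul1r (RintegralD measurableT (integrable_scale (2 * C2) i1) (integrable_scale (M * h `^ th) i2)).
  by rewrite (RintegralZl _ measurableT i1) (RintegralZl _ measurableT i2).
apply: le_trans hI _.
have a1 : 2 * C2 * \int[nu]_z g1 z <= 2 * C2 * (cin 2 * r1 `^ (2 - sigma)).
  by apply: ler_wpM2l I1; rewrite mulr_ge0.
have M0 : 0 <= M.
  by apply: mulr_ge0; [rewrite addr_ge0 ?mulr_ge0 ?sqr_ge0// ltW|exact: powR_ge0].
have a2 : M * h `^ th * \int[nu]_z g2 z <= e / 2.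
  apply: le_trans hM; rewrite -mulrA -[leRHS]mulrA ler_wpM2l// mulrC ler_wpM2r ?powR_ge0//.
have a3 : 3 * eta * C3 * \int[nu]_z lw m2 z <= e / 2.
  by apply: le_trans etaE; apply: ler_wpM2l I3; rewrite mulr_ge0// mulr_ge0// ltW.
exact: absorb_halves.
Qed.

End jump_shift.

Section arithmetic.
Context {R : realType}.

Lemma square_bound (W s A B C C' : R) : - C' <= W -> W <= - s + A -> A <= B -> C' <= C ->
  s <= B + C.
Proof. by move=> *; lra. Qed.

Lemma touching_arith (us ut u0 Q A B C D pz px py qz qx qy : R) :
  us - ut - A - B - (pz - px) <= u0 - ut - C - D - py + (qz - qx - qy) + Q ->
  us <= u0 + (pz - px - py + (qz - qx - qy)) + Q + (A + B - C - D).
Proof. by move=> *; lra. Qed.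

Lemma increment_arith (s ut u1 u0 A B py p0 y K K' : R) : 0 <= s ->
  - K' <= u0 - ut - A - B - p0 -> K' <= K -> u1 - ut - A - B - py <= - s + y ->
  u1 - u0 - (py - p0) <= y + K.
Proof. by move=> *; lra. Qed.

Lemma three_bounds (a b c e x y z : R) : - x <= a -> x <= e -> - y <= b -> y <= c ->
  z - e - c <= z + a + b.
Proof. by move=> *; lra. Qed.

Lemma final_arith (a t bp bq j j' J S S' k e X Y : R) :
  a + t + bq <= S' + j' + k -> j' <= j + J + e -> S' <= S + e -> k <= e -> bp - e - Y <= bq ->
  - X <= t -> X + Y <= e -> a + bp - j - J - 5 * e <= S.
Proof. by move=> *; lra. Qed.

Lemma doubling_arith (w w' x x' a a' C t2 s2 p p' q : R) :
  w + w' <= x + x' + a + a' + C * (t2 + s2) + p + p' + q ->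
  w - x - a - (C + 1) * t2 - p + (w' - x' - a' - (C + 1) * s2 - p') <= q - t2 - s2.
Proof. by move=> *; lra. Qed.

Lemma doubling_arith2 (a a' p p' j j' J e S : R) :
  a + p - j - J - 5 * e + (a' + p' - j' - J - 5 * e) <= S ->
  a + a' + p + p' <= S + j + j' + (J + J) + e * 10.
Proof. by move=> *; lra. Qed.

Lemma half_quadratic d (c1 c2 : R) (S : 'M[R]_d) h :
  2^-1 * (c1 * enorm h ^+ 2 + qf S h h) <= 2^-1 * (`|c1| + `|c2| + mabs S) * enorm h ^+ 2.
Proof.
rewrite -mulrA ler_wpM2l// !mulrDl lerD//; last first.
  by apply: le_trans (ler_norm _) _; rewrite expr2; exact: qf_le.
apply: (@le_trans _ _ (`|c1| * enorm h ^+ 2)); first by rewrite ler_wpM2r ?sqr_ge0// ler_norm.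
by rewrite lerDl mulr_ge0// sqr_ge0.
Qed.

End arithmetic.

Section doubling.
Context {R : realType} {d l : nat} (sigma lambda Lambda lambda0 sigma0 sigma1 T : R)
  (nu : {measure set 'rV[R]_d -> \bar R}) (Sigma : 'rV[R]_d -> 'M[R]_(d, l))
  (b : R -> 'rV[R]_d -> 'rV[R]_d).
Hypotheses (s02 : 0 < sigma < 2) (l0 : 0 <= lambda) (L0 : 0 <= Lambda)
  (hnu : levy_measure sigma lambda Lambda nu) (hS : bounded_lipschitz sigma0 sigma1 Sigma)
  (cb : {in [set p : R * 'rV[R]_d | 0 < p.1], continuous (fun p => b p.1 p.2)}).

Local Notation cin := (@levy_inner_cst R d sigma Lambda).
Local Notation gram := (gram lambda0 Sigma).

Definition growth m C (u : R -> 'rV[R]_d -> R) := [/\ 0 < m < sigma, 0 <= C,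
  {within `[0, T] `*` setT, continuous (fun q => u q.1 q.2)} &
  forall t x, 0 <= t <= T -> `|u t x| <= C * japanese x `^ m].

Lemma gram_sym x : (gram x)^T = gram x.
Proof. by rewrite /gram linearD /= tr_scalar_mx trmx_mul trmxK. Qed.

Lemma trace_modulus x (K e : R) : 0 <= K -> 0 < e -> exists2 r : R, 0 < r & forall x0 X,
  enorm (x0 - x) < r -> (forall v, `|qf X v v| <= K * enorm v ^+ 2) ->
  trace_form lambda0 Sigma x0 X <= trace_form lambda0 Sigma x X + e.
Proof.
move=> K0 e0; have e'0 : 0 < e / (K + 1) by rewrite divr_gt0// ltr_wpDl.
have [r r0 hr] := unif_continuous_mx (enorm x + 1) (fun i j => @continuous_gram R d l lambda0 sigma0 sigma1 Sigma i j hS) e'0.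
exists (Num.min r 1); first by rewrite lt_min r0 ltr01.
move=> x0 X; rewrite lt_min => /andP[xr x1] XK.
rewrite !trace_formE -/(gram x0) -/(gram x) -lerBlDl -raddfB -mulmxBl.
apply: le_trans (ler_norm _) _; apply: le_trans (trace_mul_le _ XK) _.
  by rewrite linearB /= !gram_sym.
have x0L : enorm x0 <= enorm x + 1.
  by apply: le_trans (enorm_le_add x0 x) _; rewrite lerD2l ltW.
have xL : enorm x <= enorm x + 1 by rewrite lerDl.
have := hr _ _ x0L xL xr; rewrite ler_pdivlMr ?ltr_wpDl// mulrC; apply: le_trans.
by rewrite ler_wpM2r ?mabs_ge0// lerDl.
Qed.

(** The viscosity inequality holds at contact points that converge to (t, x) with h. Five terms are
    passed to the limit at cost e each: the trace, the jumps, the jet inside the small ball, the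
    change of the drift, and the remaining O(h) terms. *)
Lemma subtouch_of_sub n (A : 'M[R]_(n, d)) u m C t x a p (Ca rho C2 r1 e : R) :
  sep_sub sigma lambda0 T nu Sigma b u -> growth m C u -> 0 < t < T ->
  0 < rho -> (forall ta, `|ta| <= rho -> 0 < t + ta < T) -> 0 < r1 <= 1 -> r1 < rho -> 0 <= C2 ->
  0 <= Ca -> 0 < e -> A^T *m A = gram x ->
  let w := fun ta y => u (t + ta) (x + y) - u t x - a * ta - Ca * ta ^+ 2 - dotv p y in
  (forall ta y, `|ta| <= rho -> enorm y <= rho -> w ta y <= - ta ^+ 2 + C2 * enorm y ^+ 2) ->
  subtouch (fun i => row i A) w rho
    (a + dotv (b t x) p - jump nu (u t) x p r1 - 2 * C2 * (cin 2 * r1 `^ (2 - sigma)) - 5 * e).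
Proof.
move=> hu [ms C0 cu uC] t0T rho0 trho r101 r1rho C20 Ca0 e0 AG w hw K' K'0.
have /andP[r10 r11] := r101; have /andP[t00 tT] := t0T; have /andP[s0 s2] := s02.
pose K1 := Num.max K' 1; have K11 : 1 <= K1 by rewrite le_max lexx orbT.
(* Comparing the lower bound of w at the contact with the upper bound, which contains - ta^2, gives
   ta^2 <= [K] h^2; the contact time is therefore also at distance O(h). *)
pose K := C2 * K1 ^+ 2 + K1.
have K1K : K1 <= K by rewrite lerDr mulr_ge0// sqr_ge0.
have Kge1 : 1 <= K by exact: le_trans K1K.
have K0 : 0 < K by exact: lt_le_trans Kge1.
have K10 : 0 < K1 by exact: lt_le_trans K11.
have K'K1 : K' <= K1 by rewrite le_max lexx.
have K'K : K' <= K by exact: le_trans K1K.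
have p0 := enorm_ge0 p; have p1 : 0 < enorm p + 1 by rewrite ltr_wpDl.
have [rb rb0 hrb] := drift_modulus x cb t00 (divr_gt0 e0 p1).
have [rt rt0 hrt] := trace_modulus x (ltW K0) e0.
have e'0 : 0 < Num.min e (Num.min 1 (Num.min (rb / 2) (Num.min (rt / 2) rho))).
  by rewrite !lt_min e0 ltr01 rho0 !divr_gt0.
pose Bx := enorm (b t x) + e / (enorm p + 1).
have Bx0 : 0 <= Bx by rewrite addr_ge0 ?enorm_ge0// divr_ge0// ltW.
pose M := 1 + K + (2 * Ca * K + Bx * K).
have q0 : 0 <= Bx * K by rewrite mulr_ge0// ltW.
have q1 : 0 <= 2 * Ca * K by rewrite mulr_ge0 ?(ltW K0)// mulr_ge0.
have s2' : 0 < 2 - sigma by rewrite subr_gt0.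
have [h0 h00 H] := small_and (small_and (small_linear M e'0)
    (small_powR (K * cin 2) s2' e0))
  (jump_shift_le s02 l0 L0 hnu x p Kge1 r101 C20 e0 r1rho t0T ms C0 cu uC).
exists h0 => // h ta y0 q X h1 /(H h h1)[[hM hc] hj] taR y0K qK XK wlow touch.
move: hM; rewrite !le_min => /andP[hMe /andP[hM1 /andP[hMb /andP[hMt hMr]]]].
have h1' := ltW h1.
have Mh (c : R) : c <= M -> c * h <= M * h by move=> cM; rewrite ler_wpM2r.
have KM : 1 + K <= M by rewrite /M lerDl addr_ge0.
have KhM : (1 + K) * h <= M * h := Mh _ KM.
have y0K1 : enorm y0 <= K1 * h by apply: le_trans y0K _; rewrite ler_wpM2r.
have {}y0K : enorm y0 <= K * h by apply: le_trans y0K _; rewrite ler_wpM2r.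
have {}qK : enorm q <= K * h by apply: le_trans qK _; rewrite ler_wpM2r.
have XK' v : `|qf X v v| <= K * enorm v ^+ 2 by apply: le_trans (XK v) _; rewrite ler_wpM2r ?sqr_ge0.
have hh : h + K * h <= M * h by rewrite -{1}[h]mul1r -mulrDl.
have KhMh : K * h <= M * h by apply: le_trans hh; rewrite lerDr.
have hMh : h <= M * h by apply: le_trans hh; rewrite lerDl mulr_ge0// ltW.
have y0rho := le_trans y0K (le_trans KhMh hMr).
have wup := hw _ _ taR y0rho.
have taK : `|ta| <= K * h.
  rewrite -(ler_pXn2r (ltn0Sn 1)) ?nnegrE ?mulr_ge0 ?(ltW K0)//.
  rewrite real_normK ?num_real//; apply: (@le_trans _ _ (K * h ^+ 2)).
    have y0sq : enorm y0 ^+ 2 <= (K1 * h) ^+ 2.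
      by rewrite lerXn2r ?nnegrE ?enorm_ge0// mulr_ge0// ltW.
    have t1 := ler_wpM2l C20 y0sq; have t2 : K' * h ^+ 2 <= K1 * h ^+ 2 by rewrite ler_wpM2r ?sqr_ge0.
    rewrite /K mulrDl (_ : C2 * K1 ^+ 2 * h ^+ 2 = C2 * (K1 * h) ^+ 2); last by ring.
    exact: (square_bound wlow wup t1 t2).
  by rewrite exprMn ler_wpM2r ?sqr_ge0// expr2 ler_peMl// ltW.
have hKh : h / K <= h by rewrite ler_pdivrMr// ler_peMr.
have hr01 : 0 < h / K <= 1 by rewrite divr_gt0//= (le_trans hKh)// (le_trans hMh).
have tt0 := trho _ taR.
have tt0' : 0 <= t + ta <= T by case/andP: tt0 => /ltW -> /ltW ->.
have hloc s z : 0 < s < T -> `|s - (t + ta)| <= h / K -> enorm (z - (x + y0)) <= h / K ->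
   u s z <= jet (u (t + ta) (x + y0)) (p + q) X (x + y0) z +
     ((a + 2 * Ca * ta) * (s - (t + ta)) + Ca * (s - (t + ta)) ^+ 2).
  move=> sT st zx.
  have srho : `|s - t| <= rho.
    have -> : s - t = (s - (t + ta)) + ta by ring.
    apply: le_trans (ler_normD _ _) _; apply: le_trans (lerD (le_trans st hKh) taK) _.
    exact: le_trans hh hMr.
  have zz : z - x - y0 = z - (x + y0) by rewrite opprD addrA.
  have zK' : enorm (z - x - y0) <= h / K'.
    by rewrite zz; apply: le_trans zx _; rewrite ler_wpM2l// lef_pV2 ?posrE.
  have := touch (s - t) (z - x) srho zK'.
  rewrite /w /jet [x + (z - x)]addrC subrK (_ : t + (s - t) = s); last by ring.
  rewrite dotvDl -zz !dotvBr; set Q := 2^-1 * qf _ _ _; clearbody Q.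
  have -> : (a + 2 * Ca * ta) * (s - (t + ta)) + Ca * (s - (t + ta)) ^+ 2 =
    a * (s - t) + Ca * (s - t) ^+ 2 - a * ta - Ca * ta ^+ 2 by ring.
  exact: touching_arith.
have key := nonlocal_sub s02 l0 L0 hnu hu ms C0 cu uC tt0 hr01 Ca0 (ltW K0) XK' hloc.
have {}hj : jump nu (u (t + ta)) (x + y0) (p + q) (h / K) <=
    jump nu (u t) x p r1 + 2 * C2 * (cin 2 * r1 `^ (2 - sigma)) + e.
  apply: hj => // y yrho; have := hw _ _ taR yrho.
  have : K' * h ^+ 2 <= K * h ^+ 2 by rewrite ler_wpM2r ?sqr_ge0.
  rewrite /w in wlow *; rewrite dotvBr; move: wlow.
  exact: increment_arith (sqr_ge0 ta).
have y0x : x + y0 - x = y0 by rewrite addrC addKr.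
have htr : trace_form lambda0 Sigma (x + y0) X <= \sum_i qf X (row i A) (row i A) + e.
  rewrite sum_qf_rows AG -trace_formE; apply: hrt XK'; rewrite y0x.
  apply: le_lt_trans y0K _; apply: le_lt_trans KhMh _; apply: le_lt_trans hMt _.
  by rewrite ltr_pdivrMr// ltr_pMr// ltr1n.
have hK : K * (cin 2 * (h / K) `^ (2 - sigma)) <= e.
  apply: le_trans hc; rewrite mulrA ler_wpM2l//.
    by apply: mulr_ge0; [exact: ltW|exact: levy_inner_cst_ge0].
  apply: ge0_ler_powR; rewrite ?nnegrE ?divr_ge0 ?(ltW K0) ?(ltW s2')//.
have hb : enorm (b (t + ta) (x + y0) - b t x) <= e / (enorm p + 1).
  have rb2 : rb / 2 < rb by rewrite ltr_pdivrMr// ltr_pMr// ltr1n.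
  apply: hrb; rewrite ?y0x; last exact: le_lt_trans (le_trans y0K (le_trans KhMh hMb)) rb2.
  rewrite (_ : t + ta - t = ta); last by ring.
  exact: le_lt_trans (le_trans taK (le_trans KhMh hMb)) rb2.
have hbp : dotv (b t x) p - e - Bx * K * h <= dotv (b (t + ta) (x + y0)) (p + q).
  have E : dotv (b (t + ta) (x + y0)) (p + q) = dotv (b t x) p +
     dotv (b (t + ta) (x + y0) - b t x) p + dotv (b (t + ta) (x + y0)) q.
    by rewrite dotvDr dotvBl; ring.
  have b1 := dotv_ge (b (t + ta) (x + y0) - b t x) p.
  have b2 : enorm (b (t + ta) (x + y0) - b t x) * enorm p <= e.
    apply: (@le_trans _ _ (e / (enorm p + 1) * enorm p)); first by rewrite ler_wpM2r.
    by rewrite -mulrA ler_piMr ?(ltW e0)// mulrC ler_pdivrMr// mul1r lerDl.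
  have b3 := dotv_ge (b (t + ta) (x + y0)) q.
  have b4 : enorm (b (t + ta) (x + y0)) * enorm q <= Bx * K * h.
    rewrite -mulrA; apply: ler_pM; rewrite ?enorm_ge0//.
    by apply: le_trans (enorm_le_add _ (b t x)) _; rewrite lerD2l.
  by rewrite E; exact: (three_bounds _ b1 b2 b3 b4).
have hta : - (2 * Ca * K * h) <= 2 * Ca * ta.
  rewrite lerNl -mulrN -[leRHS]mulrA; apply: ler_wpM2l; first by rewrite mulr_ge0.
  by apply: le_trans taK; rewrite -normrN ler_norm.
have hMe' : 2 * Ca * K * h + Bx * K * h <= e.
  apply: le_trans hMe; rewrite -mulrDl Mh// /M lerDr addr_ge0// ltW//.
exact: (final_arith key hj htr hK hbp hta hMe').
Qed.

Lemma continuous_perturbation u t x a Ca p q :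
  {within `[0, T] `*` setT, continuous (fun q => u q.1 q.2)} -> 0 < t + q.1 < T ->
  {for q, continuous (fun q : R * 'rV[R]_d =>
     u (t + q.1) (x + q.2) - u t x - a * q.1 - Ca * q.1 ^+ 2 - dotv p q.2)}.
Proof.
move=> cu tq.
have c1 : continuous (fun q : R * 'rV[R]_d => a * q.1).
  apply: (@continuous_fstf R d (fun t => a * t)) => s.
  by apply: cvgM; [exact: cvg_cst|exact: cvg_id].
have c2 : continuous (fun q : R * 'rV[R]_d => Ca * q.1 ^+ 2).
  apply: (@continuous_fstf R d (fun t => Ca * t ^+ 2)) => s.
  by apply: cvgM; [exact: cvg_cst|apply: cvgM; exact: cvg_id].
have c3 : continuous (fun q : R * 'rV[R]_d => dotv p q.2).
  by apply: (@continuous_sndf R d (fun y => dotv p y)); under eq_fun do rewrite dotvC; exact: continuous_dotvl.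
apply: (continuousB (f := fun q : R * 'rV[R]_d => u (t + q.1) (x + q.2) - u t x - a * q.1 - Ca * q.1 ^+ 2)); last exact: c3.
apply: (continuousB (f := fun q : R * 'rV[R]_d => u (t + q.1) (x + q.2) - u t x - a * q.1)); last exact: c2.
apply: (continuousB (f := fun q : R * 'rV[R]_d => u (t + q.1) (x + q.2) - u t x)); last exact: c1.
apply: (continuousB (f := fun q : R * 'rV[R]_d => u (t + q.1) (x + q.2))); last exact: cst_continuous.
exact: continuous_shift.
Qed.

Lemma range_radius t s : 0 < t < T -> 0 < s < T -> exists2 r : R, 0 < r &
  forall ta, `|ta| <= r -> 0 < t + ta < T /\ 0 < s + ta < T.
Proof.
move=> /andP[t0 tT] /andP[s0 sT].
exists (Num.min (Num.min (t / 2) ((T - t) / 2)) (Num.min (s / 2) ((T - s) / 2))).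
  by rewrite !lt_min !divr_gt0// subr_gt0.
move=> ta; rewrite !le_min => /andP[/andP[h1 h2] /andP[h3 h4]].
move: h1 h2 h3 h4; rewrite !ler_norml => /andP[h1 _] /andP[_ h2] /andP[h3 _] /andP[_ h4].
by split; apply/andP; split; lra.
Qed.

(** The nonlocal two-point inequality in trace form. The frames are arbitrary up to their Gram
    matrices, and this freedom is what a coupling of the noises exploits. The error in r comes from
    the jumps below r and vanishes since sigma < 2. *)
Lemma doubling n (A A' : 'M[R]_(n, d)) (u v : R -> 'rV[R]_d -> R) m C m' C' t s x y p p'
    (a a' Ca c1 c2 rho : R) (S : 'M[R]_d) : (0 < n)%N ->
  sep_sub sigma lambda0 T nu Sigma b u -> sep_sub sigma lambda0 T nu Sigma b v ->
  growth m C u -> growth m' C' v ->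
  0 < t < T -> 0 < s < T -> 0 < rho -> 0 <= Ca ->
  A^T *m A = gram x -> A'^T *m A' = gram y ->
  (forall ta sa h k, `|ta| <= rho -> `|sa| <= rho -> enorm h <= rho -> enorm k <= rho ->
     0 < t + ta < T -> 0 < s + sa < T ->
     u (t + ta) (x + h) + v (s + sa) (y + k) <= u t x + v s y + a * ta + a' * sa
       + Ca * (ta ^+ 2 + sa ^+ 2) + dotv p h + dotv p' k + 2^-1 * qf2 c1 c2 S h k) ->
  exists2 r0 : R, 0 < r0 <= 1 & exists M : R, forall r, 0 < r <= r0 ->
    a + a' + dotv (b t x) p + dotv (b s y) p' <=
    \sum_i qf2 c1 c2 S (row i A) (row i A') + jump nu (u t) x p r + jump nu (v s) y p' r
    + M * r `^ (2 - sigma).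
Proof.
move=> n0 hu hv gu gv tT sT rho0 Ca0 AG AG' hmax.
have [r1 r10 hr1] := range_radius tT sT.
pose rh := Num.min rho r1; have rh0 : 0 < rh by rewrite lt_min rho0.
have rhr : rh <= rho by rewrite ge_min lexx.
have trh ta : `|ta| <= rh -> 0 < t + ta < T /\ 0 < s + ta < T.
  by move=> h; apply: hr1; apply: le_trans h _; rewrite ge_min lexx orbT.
pose C2 := 2^-1 * (`|c1| + `|c2| + mabs S).
have C20 : 0 <= C2 by rewrite mulr_ge0// addr_ge0 ?mabs_ge0// addr_ge0.
exists (Num.min (rh / 2) 1).
  by rewrite lt_min ltr01 divr_gt0//= ge_min lexx orbT.
exists (2 * (2 * C2) * cin 2) => r /andP[r0]; rewrite le_min => /andP[rrh r11].
have r01 : 0 < r <= 1 by rewrite r0.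
have rrho : r < rh by apply: le_lt_trans rrh _; rewrite ltr_pdivrMr// ltr_pMr// ltr1n.
(* One unit more than [Ca]: the surplus - ta^2 forces the contact times of the blow-up to
   converge. *)
pose w ta h := u (t + ta) (x + h) - u t x - a * ta - (Ca + 1) * ta ^+ 2 - dotv p h.
pose w' ta h := v (s + ta) (y + h) - v s y - a' * ta - (Ca + 1) * ta ^+ 2 - dotv p' h.
have Ca1 : 0 <= Ca + 1 by rewrite addr_ge0.
have n0' : enorm (0 : 'rV[R]_d) <= rh by rewrite enorm0 ltW.
have a0' : `|0 : R| <= rh by rewrite normr0 ltW.
have ww ta sa h k : `|ta| <= rh -> `|sa| <= rh -> enorm h <= rh -> enorm k <= rh ->
    w ta h + w' sa k <= 2^-1 * qf2 c1 c2 S h k - ta ^+ 2 - sa ^+ 2.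
  move=> h1 h2 h3 h4; have [t1 _] := trh _ h1; have [_ s1] := trh _ h2.
  have := hmax ta sa h k (le_trans h1 rhr) (le_trans h2 rhr) (le_trans h3 rhr) (le_trans h4 rhr) t1 s1.
  by rewrite /w /w'; move: (2^-1 * _); exact: doubling_arith.
have w0 : w 0 0 = 0 by rewrite /w !addr0 subrr expr0n !mulr0 dotv0r !subr0.
have w'0 : w' 0 0 = 0 by rewrite /w' !addr0 subrr expr0n !mulr0 dotv0r !subr0.
have q1 h : 2^-1 * qf2 c1 c2 S h 0 <= C2 * enorm h ^+ 2.
  by rewrite /qf2 enorm0 expr0n mulr0 addr0 subr0; apply: half_quadratic.
have q2 k : 2^-1 * qf2 c1 c2 S 0 k <= C2 * enorm k ^+ 2.
  rewrite /qf2 enorm0 expr0n mulr0 add0r sub0r qfNl qfNr opprK /C2 [`|c1| + _]addrC.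
  exact: half_quadratic.
have hw ta h : `|ta| <= rh -> enorm h <= rh -> w ta h <= - ta ^+ 2 + C2 * enorm h ^+ 2.
  move=> h1 h2; have := ww ta 0 h 0 h1 a0' h2 n0'; rewrite w'0 addr0 expr0n subr0.
  by move=> h3; apply: le_trans h3 _; rewrite addrC lerD2l q1.
have hw' sa k : `|sa| <= rh -> enorm k <= rh -> w' sa k <= - sa ^+ 2 + C2 * enorm k ^+ 2.
  move=> h1 h2; have := ww 0 sa 0 k a0' h1 n0' h2; rewrite w0 add0r expr0n subr0.
  by move=> h3; apply: le_trans h3 _; rewrite addrC lerD2l q2.
have [gu1 gu2 cu gu4] := gu; have [gv1 gv2 cv gv4] := gv.
have cw : {within box rh, continuous (fun q : R * 'rV[R]_d => w q.1 q.2)}.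
  apply: continuous_in_subspaceT => q; rewrite inE => -[q1' _].
  by apply: continuous_perturbation => //; case: (trh _ q1').
have cw' : {within box rh, continuous (fun q : R * 'rV[R]_d => w' q.1 q.2)}.
  apply: continuous_in_subspaceT => q; rewrite inE => -[q1' _].
  by apply: continuous_perturbation => //; case: (trh _ q1').
apply: (@le_of_small_error _ _ _ 10) => e e0.
have st := subtouch_of_sub hu gu tT rh0 (fun ta h => (trh ta h).1) r01 rrho C20 Ca1 e0 AG hw.
have st' := subtouch_of_sub hv gv sT rh0 (fun ta h => (trh ta h).2) r01 rrho C20 Ca1 e0 AG' hw'.
have hw2 ta h : `|ta| <= rh -> enorm h <= rh -> w ta h <= C2 * enorm h ^+ 2.
  by move=> h1 h2; apply: le_trans (hw _ _ h1 h2) _; rewrite gerDr oppr_le0 sqr_ge0.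
have hw2' ta h : `|ta| <= rh -> enorm h <= rh -> w' ta h <= C2 * enorm h ^+ 2.
  by move=> h1 h2; apply: le_trans (hw' _ _ h1 h2) _; rewrite gerDr oppr_le0 sqr_ge0.
have ww2 ta sa h k : `|ta| <= rh -> `|sa| <= rh -> enorm h <= rh -> enorm k <= rh ->
    w ta h + w' sa k <= 2^-1 * qf2 c1 c2 S h k.
  move=> h1 h2 h3 h4; apply: le_trans (ww _ _ _ _ h1 h2 h3 h4) _.
  by rewrite -addrA gerDl -opprD oppr_le0 addr_ge0 ?sqr_ge0.
have := sum_trace_le n0 rh0 C20 cw cw' hw2 w0 hw2' w'0 ww2 st st'.
rewrite (_ : 2 * (2 * C2) * cin 2 * _ = 2 * C2 * (cin 2 * r `^ (2 - sigma)) + 2 * C2 * (cin 2 * r `^ (2 - sigma))); last by ring.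
exact: doubling_arith2.
Qed.

End doubling.

(** * Lyapunov functions *)

Section power_arithmetic.
Context {R : realType}.

Lemma lyap_hessian_arith (a P Q V D X e s rad : R) : 0 < a -> a <= 1 / 3 -> 0 <= P ->
  P * s ^+ 4 <= 1 -> 0 <= Q -> 0 <= V -> 0 <= e -> X <= e + rad ^+ 2 -> e <= s ^+ 2 -> 1 <= s ->
  D ^+ 2 <= X * V ->
  a * P * (3 * e ^+ 2 * (2 * V) + 6 * e * (2 * D * (2 * D))) +
  a * (a - 1) * Q * ((0 + 3 * e ^+ 2 * (2 * D)) * (0 + 3 * e ^+ 2 * (2 * D))) <=
  (30 + 24 * rad ^+ 2) * V.
Proof.
move=> a0 a1 P0 P4 Q0 V0 e0 Xe es s1 cs.
have s0 : 0 <= s by lra.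
have s21 : 1 <= s ^+ 2 by rewrite exprn_ege1.
have e2 : e ^+ 2 <= s ^+ 4 by rewrite (exprM s 2 2) lerXn2r// nnegrE exprn_ge0.
have e1 : e <= s ^+ 4 by apply: le_trans es _; rewrite ler_weXn2l.
have Pe2 : P * e ^+ 2 <= 1 by apply: le_trans P4; rewrite ler_wpM2l.
have Pe1 : P * e <= 1 by apply: le_trans P4; rewrite ler_wpM2l.
have Pe0 : 0 <= P * e by rewrite mulr_ge0.
have eD : P * e * D ^+ 2 <= (1 + rad ^+ 2) * V.
  apply: (@le_trans _ _ (P * e * ((e + rad ^+ 2) * V))).
    by rewrite ler_wpM2l// (le_trans cs)// ler_wpM2r.
  rewrite mulrA ler_wpM2r// mulrDr.
  rewrite (_ : P * e * e = P * e ^+ 2); last by ring.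
  by rewrite lerD// ler_piMl// sqr_ge0.
have Pe2V : P * e ^+ 2 * V <= V by rewrite ler_piMl.
have T2 : a * (a - 1) * Q * ((0 + 3 * e ^+ 2 * (2 * D)) * (0 + 3 * e ^+ 2 * (2 * D))) <= 0.
  rewrite -expr2 mulr_le0_ge0 ?sqr_ge0// mulr_le0_ge0// mulr_ge0_le0 ?(ltW a0)//; lra.
rewrite (_ : a * P * _ = a * (6 * (P * e ^+ 2 * V) + 24 * (P * e * D ^+ 2))); last by ring.
have PV0 : 0 <= P * e ^+ 2 * V by rewrite mulr_ge0// mulr_ge0// sqr_ge0.
have PD0 : 0 <= P * e * D ^+ 2 by rewrite mulr_ge0// sqr_ge0.
have : a * (6 * (P * e ^+ 2 * V) + 24 * (P * e * D ^+ 2)) <= 6 * (P * e ^+ 2 * V) + 24 * (P * e * D ^+ 2).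
  have S0 : 0 <= 6 * (P * e ^+ 2 * V) + 24 * (P * e * D ^+ 2) by lra.
  by rewrite ler_piMl//; lra.
have eD' : P * e * D ^+ 2 <= V + rad ^+ 2 * V by rewrite -{1}[V]mul1r -mulrDl.
rewrite (_ : (30 + 24 * rad ^+ 2) * V = 30 * V + 24 * (rad ^+ 2 * V)); last by ring.
move: T2 eD' Pe2V PV0 PD0; move: (P * e ^+ 2 * V) (P * e * D ^+ 2) (rad ^+ 2 * V) (a * (a - 1) * Q * _).
move=> A1 A2 A3 A4; move: (a * (6 * A1 + 24 * A2)) => A5.
by clear; lra.
Qed.

Lemma half_le_powR (c : R) : c <= 1 -> 2^-1 <= 2^-1 `^ c.
Proof.
move=> c1; have -> : 2^-1 `^ c = (2 `^ c)^-1 :> R.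
  by rewrite -{1}(@powR_inv1 _ 2)// -powRrM mulN1r powRN.
rewrite lef_pV2 ?posrE ?powR_gt0//; apply: (@le_trans _ _ (2 `^ 1)); last by rewrite powRr1.
by rewrite ler_powR// ler1n.
Qed.

(** If b <= a, expand (1 + b / a)^kap, at most 1 + 3 b / a for kap <= 2, which leaves a^(kap - 1) b;
    if a < b, everything is of order b^kap. The point is the lower power of a in front of the
    increment. *)
Lemma powR_add_le (kap a b : R) : 0 < kap <= 2 -> 1 <= a -> 1 <= b ->
  (a + b) `^ kap <= a `^ kap + 4 * (a `^ Num.max 0 (kap - 1) * b `^ kap).
Proof.
move=> /andP[k0 k2] a1 b1; have a0 : 0 < a by lra. have b0 : 0 < b by lra.
have am1 : 1 <= a `^ Num.max 0 (kap - 1).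
  by rewrite -(powRr0 a) ler_powR// le_max lexx.
have [ab|ba] := ltP a b.
  apply: (@le_trans _ _ (4 * b `^ kap)); last first.
    apply: (@le_trans _ _ (4 * (a `^ Num.max 0 (kap - 1) * b `^ kap))); last by rewrite lerDr powR_ge0.
    by rewrite ler_wpM2l// ler_peMl// powR_ge0.
  apply: (@le_trans _ _ ((2 * b) `^ kap)).
    by apply: ge0_ler_powR; rewrite ?nnegrE; lra.
  rewrite powRM ?(ltW b0)// ler_wpM2r ?powR_ge0//.
  apply: (@le_trans _ _ (2 `^ 2%:R)); first by rewrite ler_powR// ler1n.
  by rewrite powR_mulrn// -natrX.
have z01 : 0 <= b / a <= 1 by rewrite divr_ge0 ?(ltW a0) ?(ltW b0)//= ler_pdivrMr// mul1r.
have /andP[z0 z1] := z01.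
have -> : a + b = a * (1 + b / a) by field; rewrite gt_eqF.
rewrite powRM ?(ltW a0) ?addr_ge0//.
have h : (1 + b / a) `^ kap <= 1 + 3 * (b / a).
  apply: (@le_trans _ _ ((1 + b / a) `^ 2%:R)); first by rewrite ler_powR// lerDl.
  rewrite powR_mulrn ?addr_ge0//; move: (b / a) z0 z1 => z z0 z1.
  have : z ^+ 2 <= z by rewrite expr2 ler_piMl.
  by rewrite sqrrD; lra.
apply: (@le_trans _ _ (a `^ kap * (1 + 3 * (b / a)))); first by rewrite ler_wpM2l ?powR_ge0.
rewrite mulrDr mulr1 lerD2l.
rewrite (_ : a `^ kap * (3 * (b / a)) = 3 * (a `^ (kap - 1) * b)); last first.
  rewrite powRD; last by rewrite (gt_eqF a0) implybT.
  by rewrite powR_inv1 ?(ltW a0)//; field; rewrite gt_eqF.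
apply: ler_pM => //; rewrite ?mulr_ge0 ?powR_ge0 ?(ltW b0)//; first by rewrite ler_nat.
have [k1|k1] := leP 1 kap.
  apply: ler_pM; rewrite ?powR_ge0 ?(ltW b0)//; first by rewrite ler_powR// le_max lexx orbT.
  by rewrite -{1}(powRr1 (ltW b0)) ler_powR.
apply: (@le_trans _ _ (b `^ kap)); last by rewrite ler_peMl ?powR_ge0.
have E : b `^ kap = b `^ (kap - 1) * b.
  rewrite powRD; last by rewrite (gt_eqF b0) implybT.
  by rewrite powR_inv1 ?(ltW b0)// divfK// gt_eqF.
rewrite E ler_wpM2r ?(ltW b0)//.
rewrite -[kap - 1]opprB !powRN lef_pV2 ?posrE ?powR_gt0//.
by apply: ge0_ler_powR; rewrite ?nnegrE; lra.
Qed.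

End power_arithmetic.

Section lyapunov.
Context {R : realType} {d : nat} (rad : R) (rad0 : 0 < rad).
Implicit Types (x h : 'rV[R]_d) (kap a : R).

(** Cubed in the base, so that the Lyapunov function is twice differentiable across the sphere of
    radius [rad] and constant inside. The base is of order |x|^6 at infinity, hence the exponent kap
    / 6 below. *)
Definition excess x : R := Num.max (enorm x ^+ 2 - rad ^+ 2) 0.

Definition lbase x : R := 1 + excess x ^+ 3.

(* Comparable to the power kap of the Japanese bracket, but constant where the
   coercivity of the drift is not assumed. *)
Definition lyap kap x : R := lbase x `^ (kap / 6).

Definition glyap kap x : 'rV[R]_d :=
  (kap * lbase x `^ (kap / 6 - 1) * excess x ^+ 2) *: x.

Lemma excess_ge0 x : 0 <= excess x. Proof. by rewrite le_max lexx orbT. Qed.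

Lemma lbase_ge1 x : 1 <= lbase x.
Proof. by rewrite lerDl exprn_ge0// excess_ge0. Qed.

Lemma lbase_gt0 x : 0 < lbase x. Proof. exact: lt_le_trans (lbase_ge1 x). Qed.

Lemma lyap_gt0 kap x : 0 < lyap kap x. Proof. by rewrite powR_gt0// lbase_gt0. Qed.

Lemma lyapD kap a x : lyap (kap + a) x = lyap kap x * lyap a x.
Proof. by rewrite /lyap mulrDl powRD// (gt_eqF (lbase_gt0 x)) implybT. Qed.

Lemma lyap0 x : lyap 0 x = 1. Proof. by rewrite /lyap mul0r powRr0. Qed.

Lemma ler_lyap kap a x : kap <= a -> lyap kap x <= lyap a x.
Proof. by move=> ka; rewrite /lyap ler_powR ?lbase_ge1// ler_wpM2r. Qed.

Lemma lyap_ge1 kap x : 0 <= kap -> 1 <= lyap kap x.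
Proof. by move=> k0; rewrite -(lyap0 x) ler_lyap. Qed.

Lemma lyap_powE kap x : lyap kap x = lyap 1 x `^ kap.
Proof. by rewrite /lyap -powRrM; congr (_ `^ _); field. Qed.

Lemma lyap_nat n x : lyap n%:R x = lyap 1 x ^+ n.
Proof. by rewrite lyap_powE powR_mulrn// ltW// lyap_gt0. Qed.

Lemma lyap6 x : lyap 1 x ^+ 6 = lbase x.
Proof.
rewrite -lyap_nat /lyap (_ : 6%:R / 6 = 1) ?powRr1//; last by field.
exact: ltW (lbase_gt0 x).
Qed.

Lemma excess_le x : excess x <= lyap 1 x ^+ 2.
Proof.
rewrite -(ler_pXn2r (ltn0Sn 2)) ?nnegrE ?excess_ge0 ?exprn_ge0 ?(ltW (lyap_gt0 _ _))//.
by rewrite -exprM lyap6 /lbase lerDr.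
Qed.

Lemma sqr_le_excess x : enorm x ^+ 2 <= excess x + rad ^+ 2.
Proof. by rewrite -lerBlDr le_max lexx. Qed.

Lemma enorm_le_lyap x : enorm x <= lyap 1 x + rad.
Proof.
have s0 := ltW (lyap_gt0 1 x).
rewrite -(ler_pXn2r (ltn0Sn 1)) ?nnegrE ?enorm_ge0 ?addr_ge0 ?(ltW rad0)//.
apply: le_trans (sqr_le_excess x) _; have := excess_le x.
have : 0 <= lyap 1 x * rad by rewrite mulr_ge0// ltW.
by rewrite sqrrD; lra.
Qed.

Lemma lyap1_le_japanese x : lyap 1 x <= japanese x.
Proof.
rewrite -(ler_pXn2r (ltn0Sn 5)) ?nnegrE ?(ltW (lyap_gt0 _ _)) ?(ltW (japanese_gt0 _))//.
rewrite lyap6 /lbase (exprM _ 2 3) japanese_sqr.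
have e0 := excess_ge0 x; have : excess x <= enorm x ^+ 2.
  by rewrite ge_max sqr_ge0 andbT gerBl sqr_ge0.
move: (excess x) (enorm x ^+ 2) e0 => e y e0 ey.
have y0 : 0 <= y by exact: le_trans ey.
have : e ^+ 3 <= y ^+ 3 by rewrite lerXn2r.
have y2 : 0 <= y ^+ 2 by rewrite sqr_ge0.
rewrite (_ : (1 + y) ^+ 3 = 1 + 3 * y + 3 * y ^+ 2 + y ^+ 3); last by ring.
by lra.
Qed.

Lemma lyap_le_japanese kap x : 0 <= kap -> lyap kap x <= japanese x `^ kap.
Proof.
move=> k0; rewrite lyap_powE; apply: ge0_ler_powR => //; rewrite ?nnegrE ?(ltW (lyap_gt0 _ _)) ?(ltW (japanese_gt0 _))//.
exact: lyap1_le_japanese.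
Qed.

Lemma japanese_le_lyap kap x : 0 <= kap -> japanese x `^ kap <= (2 + rad) `^ kap * lyap kap x.
Proof.
move=> k0; have s1 := lyap_ge1 x ler01; have r0 := ltW rad0.
rewrite [lyap kap x]lyap_powE -powRM ?addr_ge0 ?(ltW (lyap_gt0 _ _))//.
apply: ge0_ler_powR; rewrite ?nnegrE ?mulr_ge0 ?addr_ge0 ?(ltW (lyap_gt0 _ _)) ?(ltW (japanese_gt0 _))//.
apply: le_trans (japanese_le x) _; have := enorm_le_lyap x.
have h : rad <= rad * lyap 1 x by rewrite ler_peMr.
by move=> h1; rewrite mulrDl; lra.
Qed.

Lemma C2_lyap kap : 0 < kap <= 2 -> exists H, C2 (lyap kap) (glyap kap) H /\
  forall x v, qf (H x) v v <= (30 + 24 * rad ^+ 2) * enorm v ^+ 2.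
Proof.
move=> /andP[k0 k2]; pose a := kap / 6.
pose f0 x := enorm (x - 0) ^+ 2 + - rad ^+ 2.
have h0 := C2_add (C2_sqdist (0 : 'rV[R]_d)) (C2_cst (- rad ^+ 2)).
have cm (c : R) : continuous (fun s : R => c * Num.max s 0).
  move=> s; apply: cvgM; first exact: cvg_cst.
  by apply: (@continuous_max _ _ id (cst 0)); [exact: cvg_id|exact: cvg_cst].
have h1 := C2_comp (phi := @pos3 R) (phi1 := fun s => 3 * Num.max s 0 ^+ 2)
  (phi2 := fun s => 6 * Num.max s 0) (fun x => is_derive_pos3 (f0 x)) (fun x => is_derive_sqrpos (f0 x))
  (fun x => is_derive1_continuous (is_derive_pos3 (f0 x)))
  (fun x => is_derive1_continuous (is_derive_sqrpos (f0 x))) (fun x => cm 6 (f0 x)) h0.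
have h2 := C2_add (C2_cst 1) h1.
have dp (b c x : R) : 0 < x -> is_derive x 1 (fun s => b * s `^ c) (b * c * x `^ (c - 1)).
  by move=> x0; rewrite -mulrA; apply: is_deriveZ; exact: is_derive1_powR.
have dp1 (c x : R) : 0 < x -> is_derive x 1 (fun s => s `^ c) (c * x `^ (c - 1)).
  exact: is_derive1_powR.
have exE x : Num.max (f0 x) 0 = excess x by rewrite /f0 subr0.
have bE x : 1 + pos3 (f0 x) = lbase x by rewrite /pos3 exE.
have p x : 0 < 1 + pos3 (f0 x) by rewrite bE lbase_gt0.
have h3 := C2_comp (phi := fun s => s `^ a) (phi1 := fun s => a * s `^ (a - 1))
  (phi2 := fun s => a * (a - 1) * s `^ (a - 1 - 1)) (fun x => dp1 _ _ (p x)) (fun x => dp _ _ _ (p x))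
  (fun x => is_derive1_continuous (dp1 _ _ (p x))) (fun x => is_derive1_continuous (dp _ _ _ (p x)))
  (fun x => is_derive1_continuous (dp _ _ _ (p x))) h2.
eexists; split.
  apply: (eq_C2 _ _ (fun=> erefl) h3) => x /=; first by rewrite bE.
  rewrite bE exE /glyap add0r addr0 subr0 !scalerA; congr (_ *: _).
  by rewrite /a; field.
move=> x v /=; rewrite bE exE !(qfDm, qfZm, qf0m, qf_scalar, qf_outer) !dotvE add0r !addr0 subr0.
rewrite -enorm_sqr; move: (excess_ge0 x) (sqr_le_excess x) (excess_le x) (lyap_ge1 x ler01).
have cs : dotv x v ^+ 2 <= enorm x ^+ 2 * enorm v ^+ 2.
  by rewrite -exprMn -(real_normK (num_real (dotv x v))) lerXn2r ?nnegrE ?mulr_ge0 ?enorm_ge0 ?cauchy_schwarz.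
have a01 : 0 < a <= 1 / 3 by rewrite /a; apply/andP; split; lra.
have P0 : 0 <= lbase x `^ (a - 1) by exact: powR_ge0.
have P4 : lbase x `^ (a - 1) * lyap 1 x ^+ 4 <= 1.
  rewrite (_ : lbase x `^ (a - 1) = lyap (kap - 6) x); last by rewrite /lyap /a; congr (_ `^ _); field.
  by rewrite -lyap_nat -lyapD -[leRHS](lyap0 x) ler_lyap//; lra.
have Q0 : 0 <= lbase x `^ (a - 1 - 1) by exact: powR_ge0.
have V0 : 0 <= enorm v ^+ 2 by exact: sqr_ge0.
move: a01 P0 P4 Q0 V0 cs.
move: (lbase x `^ (a - 1)) (lbase x `^ (a - 1 - 1)) (enorm v ^+ 2) (dotv x v) (enorm x ^+ 2) (excess x) (lyap 1 x).
move=> P Q V D X e s /andP[a0 a1] P0 P4 Q0 V0 cs e0 Xe es s1.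
exact: (lyap_hessian_arith a0 a1 P0 P4 Q0 V0 e0 Xe es s1 cs).
Qed.

Lemma lyap_taylor kap x h : 0 < kap <= 2 ->
  lyap kap (x + h) <= lyap kap x + dotv (glyap kap x) h + (15 + 12 * rad ^+ 2) * enorm h ^+ 2.
Proof.
move=> k02; have [H [hC hH]] := C2_lyap k02; have [th _ ->] := C2_taylor x h hC.
by rewrite lerD2l; have := hH (x + th *: h) h; lra.
Qed.

Lemma lyap_far kap x h : 0 < kap <= 2 -> 1 <= enorm h ->
  lyap kap (x + h) <= lyap kap x + 4 * (2 + rad) ^+ 2 * lyap (Num.max 0 (kap - 1)) x * enorm h `^ kap.
Proof.
move=> /andP[k0 k2] h1; have r0 := ltW rad0; pose b := (2 + rad) * enorm h.
have sb : lyap 1 (x + h) <= lyap 1 x + b.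
  apply: le_trans (lyap1_le_japanese _) _; apply: le_trans (japanese_le _) _.
  have := enormD x h; have := enorm_le_lyap x.
  have : rad <= rad * enorm h by rewrite ler_peMr.
  by rewrite /b mulrDl; lra.
have s1 := lyap_ge1 x ler01; have s0 := ltW (lyap_gt0 1 x).
have b1 : 1 <= b by rewrite /b; have : rad <= rad * enorm h by [rewrite ler_peMr]; rewrite mulrDl; lra.
rewrite [lyap kap (x + h)]lyap_powE [lyap kap x]lyap_powE [lyap (Num.max _ _) x]lyap_powE.
apply: (@le_trans _ _ ((lyap 1 x + b) `^ kap)).
  by apply: ge0_ler_powR; rewrite ?nnegrE ?addr_ge0 ?(ltW (lyap_gt0 _ _))//; lra.
apply: le_trans (powR_add_le _ s1 b1) _; first by rewrite k0.
rewrite lerD2l; set A := lyap 1 x `^ Num.max _ _.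
rewrite (_ : 4 * (2 + rad) ^+ 2 * A * _ = 4 * (A * ((2 + rad) ^+ 2 * enorm h `^ kap))); last by ring.
rewrite ler_wpM2l// ler_wpM2l ?powR_ge0//.
rewrite /b powRM ?addr_ge0 ?enorm_ge0// ler_wpM2r ?powR_ge0//.
by rewrite -powR_mulrn ?addr_ge0// ler_powR//; lra.
Qed.

(** Three regimes: inside the ball the gradient vanishes; for excess below 1 the base is at most 2
    and the subtracted constant suffices; beyond, excess^2 |x|^gamma is at least half of
    [lbase]^(2/3 + gamma/6), and this exponent together with kap / 6 - 1 makes (kap - (2 - gamma)) /
    6. *)
Lemma lyap_drift alpha gamma kap x bv : 0 < alpha -> 1 < gamma < 2 -> 2 - gamma < kap <= 2 ->
  (rad <= enorm x -> alpha * enorm x `^ gamma <= dotv bv x) ->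
  kap * alpha / 2 * lyap (kap - (2 - gamma)) x - kap * alpha <= dotv bv (glyap kap x).
Proof.
move=> al0 /andP[g1 g2] /andP[kb k2] hb; have k0 : 0 < kap by lra.
have e0 := excess_ge0 x; have L1 := lbase_ge1 x.
have ka0 : 0 < kap * alpha by rewrite mulr_gt0.
rewrite /glyap dotvZr.
have [ez|epos] := leP (excess x) 0.
  have -> : excess x = 0 by apply/eqP; rewrite eq_le ez e0.
  rewrite expr0n mulr0 mul0r subr_le0.
  have : lyap (kap - (2 - gamma)) x = 1.
    by rewrite /lyap /lbase (_ : excess x = 0) ?expr0n ?addr0 ?powR1//; apply/eqP; rewrite eq_le ez e0.
  by move=> ->; lra.
have radx : rad <= enorm x.
  rewrite leNgt; apply/negP => xr; move: epos; rewrite /excess lt_max ltxx orbF subr_gt0.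
  by rewrite ltr_pXn2r ?nnegrE ?enorm_ge0 ?(ltW rad0)// ltNge (ltW xr).
have bx := hb radx.
have bx0 : 0 <= dotv bv x by apply: le_trans bx; rewrite mulr_ge0 ?powR_ge0// ltW.
have P0 : 0 <= lbase x `^ (kap / 6 - 1) by exact: powR_ge0.
have [e1|e1] := leP 1 (excess x); last first.
  have h : lyap (kap - (2 - gamma)) x <= 2.
    apply: (@le_trans _ _ (2 `^ 1)); last by rewrite powRr1.
    apply: (@le_trans _ _ (lbase x `^ 1)); first by rewrite ler_powR//; lra.
    rewrite !powRr1 ?(le_trans ler01 L1)// /lbase; have : excess x ^+ 3 <= 1 by rewrite exprn_ile1// ltW.
    by lra.
  apply: (@le_trans _ _ 0).
    have : kap * alpha / 2 * lyap (kap - (2 - gamma)) x <= kap * alpha / 2 * 2.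
      by rewrite ler_wpM2l// divr_ge0// ltW.
    by rewrite divfK ?pnatr_eq0// subr_le0.
  by rewrite !mulr_ge0 ?sqr_ge0// ltW.
have L2 : lbase x / 2 <= excess x ^+ 3.
  have : 1 <= excess x ^+ 3 by rewrite exprn_ege1.
  by rewrite /lbase; lra.
have L0 := lbase_gt0 x; have L20 : 0 < lbase x / 2 by rewrite divr_gt0.
have key : 2^-1 * lbase x `^ (2 / 3 + gamma / 6) <= excess x ^+ 2 * enorm x `^ gamma.
  have xg : excess x `^ (gamma / 2) <= enorm x `^ gamma.
    have -> : enorm x `^ gamma = (enorm x ^+ 2) `^ (gamma / 2).
      by rewrite -powR_mulrn ?enorm_ge0// -powRrM; congr (_ `^ _); field.
    apply: ge0_ler_powR; rewrite ?nnegrE ?sqr_ge0//; first by lra.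
    by rewrite /excess ge_max sqr_ge0 andbT gerBl sqr_ge0.
  apply: (@le_trans _ _ (excess x ^+ 2 * excess x `^ (gamma / 2))); last first.
    by rewrite ler_wpM2l ?sqr_ge0.
  have -> : excess x ^+ 2 * excess x `^ (gamma / 2) = (excess x ^+ 3) `^ (2 / 3 + gamma / 6).
    rewrite -!powR_mulrn// -powRrM -powRD; last by rewrite (gt_eqF epos) implybT.
    by congr (_ `^ _); field.
  apply: (@le_trans _ _ ((lbase x / 2) `^ (2 / 3 + gamma / 6))).
    rewrite powRM ?invr_ge0 ?(ltW L0)// mulrC ler_wpM2l ?powR_ge0//.
    by apply: half_le_powR; lra.
  by apply: ge0_ler_powR; rewrite ?nnegrE ?exprn_ge0 ?(ltW L20)//; lra.
have -> : lyap (kap - (2 - gamma)) x = lbase x `^ (kap / 6 - 1) * lbase x `^ (2 / 3 + gamma / 6).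
  rewrite /lyap -powRD; last by rewrite (gt_eqF L0) implybT.
  by congr (_ `^ _); field.
apply: (@le_trans _ _ (kap * lbase x `^ (kap / 6 - 1) * excess x ^+ 2 * (alpha * enorm x `^ gamma))); last first.
  by rewrite ler_wpM2l// !mulr_ge0 ?sqr_ge0// ltW.
have : kap * alpha * lbase x `^ (kap / 6 - 1) * (2^-1 * lbase x `^ (2 / 3 + gamma / 6)) <=
   kap * alpha * lbase x `^ (kap / 6 - 1) * (excess x ^+ 2 * enorm x `^ gamma).
  by rewrite ler_wpM2l// mulr_ge0// ltW.
rewrite (_ : kap * lbase x `^ (kap / 6 - 1) * excess x ^+ 2 * (alpha * enorm x `^ gamma) =
  kap * alpha * lbase x `^ (kap / 6 - 1) * (excess x ^+ 2 * enorm x `^ gamma)); last by ring.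
rewrite (_ : kap * alpha / 2 * _ = kap * alpha * lbase x `^ (kap / 6 - 1) * (2^-1 * lbase x `^ (2 / 3 + gamma / 6))); last by field.
by lra.
Qed.

(** Small jumps see the bounded Hessian, large ones the power inequality. The factor max(0, kap - 1)
    stays below the exponent kap - (2 - gamma) gained from the drift when gamma > 1 and kap > 2 -
    gamma. *)
Lemma lyap_jump kap x z : 0 < kap <= 2 ->
  lyap kap (x + z) - lyap kap x - dotv (glyap kap x) z * (enorm z <= 1)%R%:R <=
  (15 + 12 * rad ^+ 2 + 4 * (2 + rad) ^+ 2) * lyap (Num.max 0 (kap - 1)) x * lw kap z.
Proof.
move=> k02; set L := lyap (Num.max _ _) x.
have L1 : 1 <= L by apply: lyap_ge1; rewrite le_max lexx.
have L0 : 0 <= L by exact: le_trans L1.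
have c1 : 0 <= 15 + 12 * rad ^+ 2 by rewrite addr_ge0// mulr_ge0// sqr_ge0.
have c2 : 0 <= 4 * (2 + rad) ^+ 2 by rewrite mulr_ge0// sqr_ge0.
rewrite -mulrA mulrDl; have [z1|z1] := leP (enorm z) 1.
  rewrite mulr1 lw_in//; have h := lyap_taylor x z k02.
  have h2 : (15 + 12 * rad ^+ 2) * enorm z ^+ 2 <= (15 + 12 * rad ^+ 2) * (L * enorm z ^+ 2).
    by rewrite ler_wpM2l// ler_peMl ?sqr_ge0.
  have h3 : 0 <= 4 * (2 + rad) ^+ 2 * (L * enorm z ^+ 2) by rewrite (mulr_ge0 c2)// mulr_ge0// sqr_ge0.
  by lra.
rewrite mulr0 subr0 lw_out//; have h := lyap_far x k02 (ltW z1); rewrite -/L -mulrA in h.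
have h3 : 0 <= (15 + 12 * rad ^+ 2) * (L * enorm z `^ kap).
  by rewrite (mulr_ge0 c1)// mulr_ge0// powR_ge0.
by lra.
Qed.

End lyapunov.

(** * Reflection and merging couplings *)

Section frame_sums.
Context {R : realType} {d : nat}.

Lemma trmxD m n (A B : 'M[R]_(m, n)) : (A + B)^T = A^T + B^T.
Proof. by apply/matrixP => i j; rewrite !mxE. Qed.

Lemma trmxB m n (A B : 'M[R]_(m, n)) : (A - B)^T = A^T - B^T.
Proof. by apply/matrixP => i j; rewrite !mxE. Qed.

Lemma trmxZ m n c (A : 'M[R]_(m, n)) : (c *: A)^T = c *: A^T.
Proof. by apply/matrixP => i j; rewrite !mxE. Qed.

Lemma trace_gram_ge0 m n (A : 'M[R]_(m, n)) : 0 <= \tr (A *m A^T).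
Proof.
rewrite /mxtrace; apply: sumr_ge0 => i _; rewrite mxE; apply: sumr_ge0 => j _.
by rewrite mxE -expr2 sqr_ge0.
Qed.

Lemma frob_sqr m n (A : 'M[R]_(m, n)) : frob A ^+ 2 = \tr (A *m A^T).
Proof. by rewrite /frob sqr_sqrtr// trace_gram_ge0. Qed.

Lemma frob_ge0 m n (A : 'M[R]_(m, n)) : 0 <= frob A.
Proof. exact: sqrtr_ge0. Qed.

Lemma frobB_sqr m n (A B : 'M[R]_(m, n)) :
  frob (A - B) ^+ 2 <= 2 * frob A ^+ 2 + 2 * frob B ^+ 2.
Proof.
rewrite !frob_sqr; have := trace_gram_ge0 (A + B).
rewrite trmxB trmxD !mulmxDl !mulmxDr !mulNmx !mulmxN !mxtraceD !(raddfN (@mxtrace _ _)) /=.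
by lra.
Qed.

Lemma sum_enorm_rows n (A : 'M[R]_(n, d)) : \sum_i enorm (row i A) ^+ 2 = \tr (A^T *m A).
Proof.
rewrite -[A^T *m A]mulmx1 -sum_qf_rows; apply: eq_bigr => i _.
by rewrite qf_scalar mul1r enorm_sqr.
Qed.

Lemma sum_qf2_rows n (A A' : 'M[R]_(n, d)) c1 c2 S :
  \sum_i qf2 c1 c2 S (row i A) (row i A') =
  c1 * \tr (A^T *m A) + c2 * \tr (A'^T *m A') + \tr ((A - A')^T *m (A - A') *m S).
Proof.
rewrite -!sum_enorm_rows -sum_qf_rows !mulr_sumr -!big_split /=; apply: eq_bigr => i _.
by rewrite /qf2 linearB.
Qed.

(** Directions of the noise at one point: the isotropic part turned by [O], followed by the columns
    of [B]. Every orthogonal [O] gives the same Gram matrix, so the isotropic noises at two points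
    may be coupled by any orthogonal map. *)
Definition frame l (c : R) (O : 'M[R]_d) (B : 'M[R]_(d, l)) : 'M[R]_(d + l, d) :=
  col_mx (c *: O) B^T.

Lemma frame_gram l c O (B : 'M[R]_(d, l)) :
  (frame c O B)^T *m frame c O B = (c ^+ 2) *: (O^T *m O) + B *m B^T.
Proof.
rewrite /frame tr_col_mx mul_row_col trmxK trmxZ -scalemxAl -scalemxAr scalerA.
by rewrite expr2.
Qed.

Lemma frameB l c O O' (B B' : 'M[R]_(d, l)) : frame c O B - frame c O' B' = frame c (O - O') (B - B').
Proof. by rewrite /frame opp_col_mx add_col_mx -scalerN -scalerDr !linearB. Qed.

Lemma trace_gram_le l (lambda0 sigma0 sigma1 : R) (Sigma : 'rV[R]_d -> 'M[R]_(d, l)) x :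
  bounded_lipschitz sigma0 sigma1 Sigma -> 0 <= \tr (gram lambda0 Sigma x) - lambda0 * d%:R <= sigma0 ^+ 2.
Proof.
move=> [h0 _]; rewrite /gram mxtraceD mxtrace_scalar -[_ *+ _]mulr_natr addrAC subrr add0r trace_gram_ge0 /=.
by rewrite -frob_sqr lerXn2r ?nnegrE ?frob_ge0// (le_trans (frob_ge0 _) (h0 x)).
Qed.

End frame_sums.

Section reflection.
Context {R : realType} {d : nat}.
Implicit Types (v h : 'rV[R]_d).

Lemma expR_ge_sqr (x : R) : - 2 <= x -> 1 + x + x ^+ 2 / 4 <= expR x.
Proof.
move=> x2; have -> : expR x = expR (x / 2) ^+ 2.
  by rewrite expr2 -expRD; congr expR; field.
have -> : 1 + x + x ^+ 2 / 4 = (1 + x / 2) ^+ 2 by field.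
rewrite lerXn2r ?nnegrE ?expR_ge0 ?expR_ge1Dx//; lra.
Qed.

(** Here a is the radial increment and T the squared tangential one. Compared with the exact
    second-order coefficients the tangential one is enlarged and the radial one halved; this margin
    turns the expansion into an upper bound valid on a whole ball. *)
Lemma expN_increment (th r rho a T : R) : 0 < th -> 0 < r -> 0 <= rho -> 0 <= T ->
  rho ^+ 2 = r ^+ 2 + 2 * r * a + (T + a ^+ 2) -> `|a| <= r / 2 -> T <= r / 2 * r -> th * `|a| <= 1 ->
  th * T <= r ->
  - expR (- (th * rho)) <= - expR (- (th * r)) +
    expR (- (th * r)) * (th * a + 2 * th * T / r - th ^+ 2 / 4 * a ^+ 2).
Proof.
move=> th0 r0 rho0 T0 E ar Tr tha thT; pose q := T / r.
have q0 : 0 <= q by rewrite divr_ge0// ltW.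
have TE : T = q * r by rewrite /q divfK// gt_eqF.
have thq : th * q <= 1 by rewrite /q mulrA ler_pdivrMr// mul1r.
have qr : q <= r / 2 by rewrite /q ler_pdivrMr.
move: ar tha; rewrite ler_norml => /andP[ar1 ar2] tha.
have tha2 : th * a <= 1 /\ - 1 <= th * a.
  have h := normrM th a; rewrite (ger0_norm (ltW th0)) in h.
  by move: tha; rewrite -h ler_norml => /andP[h1 h2].
have [tha1 tha3] := tha2.
(* The distance grows by at most a + T / r: the exact tangential term T / (2r) is doubled, and the
   surplus absorbs the mixed terms. *)
pose b := a + q.
have b2 : a ^+ 2 + 2 * (a * q) <= b ^+ 2 by rewrite /b sqrrD; have := sqr_ge0 q; lra.
have aqr : - (q * r) <= 2 * (a * q).
  by have := mulr_ge0 q0 (_ : 0 <= 2 * a + r); rewrite mulrDr => /(_ ltac:(lra)); lra.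
have rb : rho <= r + b.
  have rb0 : 0 <= r + b by rewrite /b; lra.
  rewrite -(ler_pXn2r (ltn0Sn 1)) ?nnegrE// E [(r + b) ^+ 2]sqrrD TE.
  by have : 2 * r * b = 2 * r * a + 2 * (q * r) by [rewrite /b; ring]; have := mulr_ge0 q0 (ltW r0); lra.
apply: (@le_trans _ _ (- expR (- (th * (r + b))))).
  by rewrite lerN2 ler_expR lerN2 ler_wpM2l// ltW.
have -> : - (th * (r + b)) = - (th * r) + - (th * b) by ring.
rewrite expRD; move: (expR (- (th * r))) (expR_ge0 (- (th * r))) => X X0.
have tb : th * b <= 2 by rewrite /b mulrDr; lra.
have h := @expR_ge_sqr (- (th * b)) ltac:(lra).
have := ler_wpM2l X0 h => h2.
apply: (@le_trans _ _ (- (X * (1 + - (th * b) + (- (th * b)) ^+ 2 / 4)))); first by rewrite lerN2.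
rewrite (_ : - X + X * _ = - (X * (1 - (th * a + 2 * th * T / r - th ^+ 2 / 4 * a ^+ 2)))); last by ring.
rewrite lerN2 ler_wpM2l//.
have -> : 2 * th * T / r = 2 * (th * q) by rewrite TE; field; rewrite gt_eqF.
have thaq : - (2 * (th * q)) <= 2 * (th * a) * (th * q).
  have : 0 <= (1 + th * a) * (th * q) by rewrite mulr_ge0 ?(mulr_ge0 (ltW th0))//; lra.
  by rewrite mulrDl mul1r; lra.
rewrite sqrrN exprMn /b sqrrD; have tq := mulr_ge0 (ltW th0) q0.
have q2 : 0 <= th ^+ 2 * q ^+ 2 by rewrite mulr_ge0// sqr_ge0.
rewrite (_ : th ^+ 2 * (a ^+ 2 + a * q *+ 2 + q ^+ 2) / 4 =
  th ^+ 2 / 4 * a ^+ 2 + (2 * (th * a) * (th * q) + th ^+ 2 * q ^+ 2) / 4); last by ring.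
by move: (th ^+ 2 / 4 * a ^+ 2) => ?; lra.
Qed.

(** A matrix above the Hessian of [refl_dist], not the Hessian itself: the tangential eigenvalue is
    four times the exact one and the negative radial eigenvalue half of it. *)
Definition refl_hess (c th : R) v : 'M[R]_d :=
  (2 * c * expR (- (th * enorm v))) *:
    ((2 * th / enorm v)%:M - ((2 * th / enorm v + th ^+ 2 / 4) / enorm v ^+ 2) *: (v^T *m v)).

Definition refl_grad (c th : R) v : 'rV[R]_d :=
  (c * expR (- (th * enorm v)) * th / enorm v) *: v.

(** Between c and 2c, in particular positive at v = 0, so that a contact point cannot lie on the
    diagonal. For th = 0 it is the constant c, which lets the merging case share the same weight. *)
Definition refl_dist (c th : R) v : R := c * (2 - expR (- (th * enorm v))).

Lemma qf_refl_hess c th v w : 0 < enorm v -> qf (refl_hess c th v) w w =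
  2 * c * expR (- (th * enorm v)) * (2 * th / enorm v * enorm w ^+ 2 -
    (2 * th / enorm v + th ^+ 2 / 4) * (dotv v w / enorm v) ^+ 2).
Proof.
move=> v0; rewrite /refl_hess qfZm qfDm qfNm qfZm qf_scalar qf_outer -enorm_sqr.
by field; rewrite gt_eqF.
Qed.

Lemma refl_taylor c th v h : 0 <= c -> 0 < th -> 0 < enorm v ->
  enorm h <= enorm v / 2 -> th * enorm h <= 1 ->
  refl_dist c th (v + h) <= refl_dist c th v + dotv (refl_grad c th v) h
    + 2^-1 * qf (refl_hess c th v) h h.
Proof.
move=> c0 th0 r0 hr thh; rewrite qf_refl_hess// /refl_dist /refl_grad dotvZl.
set r := enorm v in r0 hr *; pose a := dotv v h / r; pose T := enorm h ^+ 2 - a ^+ 2.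
have h0 := enorm_ge0 h.
have ah : `|a| <= enorm h.
  rewrite /a normrM normfV (gtr0_norm r0) ler_pdivrMr// mulrC; exact: cauchy_schwarz.
have T0 : 0 <= T.
  rewrite subr_ge0 -(real_normK (num_real a)) lerXn2r ?nnegrE//.
have Th : T <= enorm h * enorm h by rewrite /T expr2 gerBl sqr_ge0.
have E : enorm (v + h) ^+ 2 = r ^+ 2 + 2 * r * a + (T + a ^+ 2).
  rewrite enormD_sqr /T /a subrK; congr (_ + _ + _); rewrite -/r.
  by field; rewrite gt_eqF.
have hr2 : enorm h <= r by lra.
have Tr : T <= r / 2 * r by apply: le_trans Th _; apply: ler_pM.
have thT : th * T <= r.
  apply: (@le_trans _ _ (th * enorm h * enorm h)); first by rewrite -mulrA ler_wpM2l// ltW.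
  by apply: le_trans hr2; rewrite ler_piMl.
have tha : th * `|a| <= 1 by apply: le_trans thh; rewrite ler_wpM2l// ltW.
have := expN_increment th0 r0 (enorm_ge0 (v + h)) T0 E (le_trans ah hr) Tr tha thT.
move: (expR (- (th * enorm (v + h)))) (expR (- (th * r))) => Y X key.
have key2 := ler_wpM2l c0 key.
have hE : enorm h ^+ 2 = T + a ^+ 2 by rewrite /T subrK.
rewrite hE -/a (_ : c * X * th / r * dotv v h = c * X * (th * a)); last by rewrite /a; ring.
have -> : 2^-1 * (2 * c * X * (2 * th / r * (T + a ^+ 2) - (2 * th / r + th ^+ 2 / 4) * a ^+ 2)) =
  c * X * (2 * th * T / r - th ^+ 2 / 4 * a ^+ 2) by field; rewrite gt_eqF.
move: key2; rewrite (_ : c * (- X + _) = - (c * X) + (c * X * (th * a) + c * X * (2 * th * T / r - th ^+ 2 / 4 * a ^+ 2))); last by ring.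
by rewrite mulrN !mulrBr; move: (c * X) (c * Y) (c * X * _) => p1 p2 p3; lra.
Qed.

Lemma refl_dist_bounds c th v : 0 <= c -> 0 <= th -> c <= refl_dist c th v <= 2 * c.
Proof.
move=> c0 th0; have e1 : expR (- (th * enorm v)) <= 1.
  by rewrite -(@expR0 R) ler_expR oppr_le0 mulr_ge0 ?enorm_ge0.
have e0 := expR_ge0 (- (th * enorm v)).
rewrite /refl_dist [2 * c]mulrC ler_wpM2l ?andbT; last 2 first.
- by [].
- by lra.
by rewrite -{1}[c]mulr1 ler_wpM2l//; lra.
Qed.

Lemma refl_dist_lip c th v h : 0 <= c -> 0 <= th ->
  `|refl_dist c th (v + h) - refl_dist c th v| <= c * th * enorm h.
Proof.
move=> c0 th0; rewrite /refl_dist -mulrBr normrM ger0_norm// -mulrA ler_wpM2l//.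
have lip (x y : R) : 0 <= x -> x <= y -> `|expR (- x) - expR (- y)| <= y - x.
  move=> x0 xy; rewrite ger0_norm ?subr_ge0 ?ler_expR ?lerN2//.
  have -> : expR (- y) = expR (- x) * expR (x - y) by rewrite -expRD; congr expR; ring.
  have e1 : expR (- x) <= 1 by rewrite -(@expR0 R) ler_expR oppr_le0.
  have e2 := expR_ge1Dx (x - y); have e0 := expR_ge0 (- x).
  have e3 : expR (x - y) <= 1 by rewrite -(@expR0 R) ler_expR subr_le0.
  apply: (@le_trans _ _ (1 - expR (x - y))); last by lra.
  by rewrite -{1}[expR (- x)]mulr1 -mulrBr ler_piMl// subr_ge0.
rewrite (_ : 2 - expR (- (th * enorm (v + h))) - (2 - expR (- (th * enorm v))) =
   expR (- (th * enorm v)) - expR (- (th * enorm (v + h)))); last by ring.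
have := enorm_lip (v + h) v; rewrite [v + h]addrC addrK [h + v]addrC => hl.
have n0 := enorm_ge0 v; have n1 := enorm_ge0 (v + h).
apply: (@le_trans _ _ (th * `|enorm (v + h) - enorm v|)); last by rewrite ler_wpM2l.
have [le|le] := leP (enorm v) (enorm (v + h)).
  have -> : `|enorm (v + h) - enorm v| = enorm (v + h) - enorm v by rewrite ger0_norm// subr_ge0.
  rewrite mulrBr; apply: lip; first exact: mulr_ge0.
  exact: ler_wpM2l.
have -> : `|enorm (v + h) - enorm v| = enorm v - enorm (v + h) by rewrite distrC ger0_norm// subr_ge0 ltW.
rewrite distrC mulrBr.
by apply: lip; [exact: mulr_ge0|apply: ler_wpM2l => //; exact: ltW].
Qed.

Definition reflection v : 'M[R]_d := 1%:M - (2 / enorm v ^+ 2) *: (v^T *m v).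

Lemma outer_sqr v : v^T *m v *m (v^T *m v) = enorm v ^+ 2 *: (v^T *m v).
Proof.
rewrite mulmxA -(mulmxA v^T v v^T) (_ : v *m v^T = (enorm v ^+ 2)%:M) ?mul_mx_scalar ?scalemxAl//.
by apply/matrixP => i j; rewrite !ord1 !mxE mulr1n enorm_sqr; apply: eq_bigr => k _; rewrite mxE.
Qed.

Lemma reflection_orthogonal v : 0 < enorm v -> (reflection v)^T *m reflection v = 1%:M.
Proof.
move=> v0; rewrite /reflection trmxB trmx1 trmxZ trmx_mul trmxK.
rewrite mulmxBl mul1mx mulmxBr mulmx1 -scalemxAl -scalemxAr outer_sqr !scalerA.
rewrite (_ : 2 / enorm v ^+ 2 * (2 / enorm v ^+ 2) * enorm v ^+ 2 = 2 / enorm v ^+ 2 + 2 / enorm v ^+ 2); last first.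
  by field; rewrite gt_eqF.
by rewrite scalerDl opprB addrK subrK.
Qed.

Lemma trace_outer_mul v (S : 'M[R]_d) : \tr (v^T *m v *m S) = qf S v v.
Proof.
by rewrite -mulmxA mxtrace_mulC /qf /mxtrace big_ord1.
Qed.

(* Reflecting the isotropic part of the noise across v gives the negative term,
   which beats the synchronous coupling of the anisotropic part. *)
Lemma reflection_sum_le l (c th s0 s1 c0 : R) v (B B' : 'M[R]_(d, l)) : 0 <= c -> 0 <= th -> 0 < enorm v ->
  frob (B - B') <= s1 * enorm v -> frob B <= s0 -> frob B' <= s0 ->
  \tr ((frame c0 1%:M B - frame c0 (reflection v) B')^T *m
       (frame c0 1%:M B - frame c0 (reflection v) B') *m refl_hess c th v) <=
  c * expR (- (th * enorm v)) * th * (4 * s1 ^+ 2 + 16 * s0 ^+ 2 - 2 * c0 ^+ 2 * th).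
Proof.
move=> c00 th0 v0 hB1 hB hB'; rewrite frameB frame_gram mulmxDl mxtraceD.
have vn0 : enorm v != 0 by rewrite gt_eqF.
have -> : (1%:M - reflection v)^T *m (1%:M - reflection v) = (4 / enorm v ^+ 2) *: (v^T *m v).
  rewrite /reflection opprB addrC subrK trmxZ trmx_mul trmxK -scalemxAl -scalemxAr outer_sqr !scalerA.
  by congr (_ *: _); field.
rewrite scalerA -scalemxAl mxtraceZ trace_outer_mul qf_refl_hess// -enorm_sqr.
set X := expR _; have X0 : 0 <= X := expR_ge0 _.
set r := enorm v in v0 vn0 hB1 X X0 *; set D := B - B'.
have -> : (c0 ^+ 2 * (4 / r ^+ 2)) * (2 * c * X * (2 * th / r * r ^+ 2 - (2 * th / r + th ^+ 2 / 4) * (r ^+ 2 / r) ^+ 2)) =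
   c * X * th * (- (2 * c0 ^+ 2 * th)) by field.
(* The synchronous part costs a multiple of |Sigma(x) - Sigma(y)|^2 / r: the Lipschitz bound
   controls it for r <= 1, the uniform bound for r > 1. *)
have D2 : frob D ^+ 2 / r <= s1 ^+ 2 + 4 * s0 ^+ 2.
  have f0 := frob_ge0 D; have s00 : 0 <= s0 := le_trans (frob_ge0 _) hB.
  have [r1|r1] := leP r 1.
    apply: (@le_trans _ _ (s1 ^+ 2)); last by rewrite lerDl mulr_ge0// sqr_ge0.
    rewrite ler_pdivrMr//; apply: (@le_trans _ _ ((s1 * r) ^+ 2)).
      by rewrite lerXn2r ?nnegrE// (le_trans f0).
    by rewrite exprMn ler_wpM2l ?sqr_ge0// expr2 ler_piMl// ltW.
  apply: (@le_trans _ _ (4 * s0 ^+ 2)); last by rewrite lerDr sqr_ge0.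
  rewrite ler_pdivrMr//; apply: le_trans (frobB_sqr _ _) _.
  have h1 : frob B ^+ 2 <= s0 ^+ 2 by rewrite lerXn2r ?nnegrE ?frob_ge0.
  have h2 : frob B' ^+ 2 <= s0 ^+ 2 by rewrite lerXn2r ?nnegrE ?frob_ge0.
  apply: (@le_trans _ _ (4 * s0 ^+ 2)); first by lra.
  by rewrite ler_peMr ?(ltW r1)// mulr_ge0// sqr_ge0.
have tD : \tr (D *m D^T *m refl_hess c th v) <= 4 * c * X * th * (frob D ^+ 2 / r).
  rewrite /refl_hess -/r -/X -scalemxAr mxtraceZ mulmxBr linearB /= mul_mx_scalar mxtraceZ.
  rewrite -scalemxAr mxtraceZ -frob_sqr.
  have t0 : 0 <= \tr (D *m D^T *m (v^T *m v)).
    rewrite mulmxA mxtrace_mulC.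
    have -> : v *m (D *m D^T *m v^T) = (v *m D) *m (v *m D)^T by rewrite trmx_mul !mulmxA.
    exact: trace_gram_ge0.
  set t := \tr _ in t0 *; set q := (2 * th / r + _) / _.
  have q0 : 0 <= q by rewrite divr_ge0 ?sqr_ge0// addr_ge0// divr_ge0 ?mulr_ge0 ?sqr_ge0// ltW.
  have c2 : 0 <= 2 * c * X by rewrite !mulr_ge0.
  apply: (@le_trans _ _ (2 * c * X * (2 * th / r * frob D ^+ 2))).
    by rewrite ler_wpM2l// gerBl mulr_ge0.
  by rewrite le_eqVlt; apply/orP; left; apply/eqP; field.
have : 4 * c * X * th * (frob D ^+ 2 / r) <= 4 * c * X * th * (s1 ^+ 2 + 4 * s0 ^+ 2).
  by rewrite ler_wpM2l// !mulr_ge0.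
rewrite (_ : 4 * c * X * th * (s1 ^+ 2 + 4 * s0 ^+ 2) = c * X * th * (4 * s1 ^+ 2 + 16 * s0 ^+ 2)); last by ring.
by rewrite !mulrDr [c * X * th * - _]mulrN; move: tD; move: (\tr _) (_ * (_ / r)) => p1 p2; lra.
Qed.

End reflection.

(** * Translation invariance and merging jumps *)

Section translation_invariance.
Context {R : realType}.

Lemma lebesgue_shift (c : R) (A : set (measurableTypeR R)) : measurable A ->
  lebesgue_measure ((fun x : measurableTypeR R => x + c) @^-1` A) = lebesgue_measure A.
Proof.
move=> mA; have mf : measurable_fun setT (fun x : measurableTypeR R => x + c : measurableTypeR R).
  by apply: measurable_funD; [exact: measurable_id|exact: measurable_cst].
pose mu := measure_function_pushforward__canonical__measure_function_Measure (@lebesgue_measure R) mf.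
apply/esym; apply: (@lebesgue_measure_unique R mu) => // X [[a b] _ <-].
rewrite /mu /= /pushforward.
rewrite (_ : _ @^-1` _ = `]a - c, b - c]%classic); last first.
  by apply/seteqP; split => y /=; rewrite !in_itv/= ltrBlDr lerBrDr.
rewrite !lebesgue_measure_itv /= !lte_fin ltrD2r; case: ifP => // _.
by rewrite -!EFinB; congr EFin; ring.
Qed.

Lemma rV_cons_add n (y : R) (v : 'rV[R]_n) (c : 'rV[R]_n.+1) :
  rV_cons (y, v) + c = rV_cons (y + c ord0 ord0, v + \row_i c ord0 (lift ord0 i)).
Proof.
apply/rowP => i; rewrite mxE; case: (unliftP ord0 i) => [j|] ->.
  by rewrite !rV_consS /= !mxE.
by rewrite !rV_cons0.
Qed.

Lemma measurable_addr_rV n (c : 'rV[R]_n) : measurable_fun setT (fun x : 'rV[R]_n => x + c).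
Proof.
apply: measurable_to_rV => i; rewrite (_ : (fun x => _) = (fun x : 'rV[R]_n => x ord0 i + c ord0 i)).
  by apply: measurable_funD; [exact: measurable_coor|exact: measurable_cst].
by apply/funext => x; rewrite mxE.
Qed.

(** Induction on the dimension through sections: the shift of the remaining coordinates is removed
    inside the integral, that of the first coordinate by invariance on the line. *)
Lemma lebesgue_rV_shift n (c : 'rV[R]_n) (A : set 'rV[R]_n) : measurable A ->
  lebesgue_rV n ((fun x => x + c) @^-1` A) = lebesgue_rV n A.
Proof.
elim: n c A => [|n IH] c A mA.
  rewrite (_ : _ @^-1` _ = A)//; apply/seteqP.
  by split => x /=; rewrite (_ : x + c = x)//; apply/rowP => -[].
rewrite /= /lebesgue_rV_step /pushforward.
pose A0 := @rV_cons R n @^-1` A.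
have mA0 : measurable A0.
  by rewrite -[X in measurable X]setTI; exact: measurable_rV_cons.
pose c0 := c ord0 ord0; pose c' : 'rV[R]_n := \row_i c ord0 (lift ord0 i).
have mf : measurable_fun setT (fun x : measurableTypeR R => x + c0 : measurableTypeR R).
  by apply: measurable_funD; [exact: measurable_id|exact: measurable_cst].
pose F (y : measurableTypeR R) := lebesgue_rV n (xsection A0 y).
have mF : measurable_fun setT F by exact: measurable_fun_xsection.
transitivity (\int[lebesgue_measure]_y F (y + c0)%R)%E.
  apply: eq_integral => y _ /=; rewrite /F -(IH c' (xsection A0 (y + c0))); last exact: measurable_xsection.
  congr (lebesgue_rV n _); apply/seteqP; split => v; rewrite /xsection /= !inE /A0 /=;
  by rewrite rV_cons_add.
transitivity (\int[lebesgue_measure]_y F y)%E; last by [].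
pose mu := measure_function_pushforward__canonical__measure_function_Measure (@lebesgue_measure R) mf.
have E1 : (\int[mu]_y F y = \int[lebesgue_measure]_y F y)%E.
  by apply: eq_measure_integral => X mX _; exact: lebesgue_shift.
by rewrite -E1 (ge0_integral_pushforward mf).
Qed.

End translation_invariance.

Section merging.
Context {R : realType} {d : nat} (sigma lambda Lambda : R)
  (nu : {measure set 'rV[R]_d -> \bar R}).
Hypotheses (d0 : (0 < d)%N) (s02 : 0 < sigma < 2) (l0 : 0 <= lambda) (L0 : 0 <= Lambda)
  (hnu : levy_measure sigma lambda Lambda nu).

Lemma levy_lower (r : R) (S : set 'rV[R]_d) : 0 < r -> measurable S ->
  (forall z, S z -> 0 < enorm z <= r) ->
  ((lambda / r `^ (d%:R + sigma))%:E * lebesgue_rV d S <= nu S)%E.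
Proof.
move=> r0 mS hS; have [_ [g [mg ng hg]]] := hnu.
have e0 : 0 <= d%:R + sigma by case/andP: s02 => s0 _; rewrite addr_ge0// ltW.
have m0 : 0 <= lambda / r `^ (d%:R + sigma) by rewrite divr_ge0 ?powR_ge0.
have gm z : S z -> lambda / r `^ (d%:R + sigma) <= g z.
  move=> Sz; have /andP[z0 zr] := hS z Sz.
  have zn0 : z != 0 by rewrite -enorm_eq0 gt_eqF.
  apply: le_trans (hg z zn0).1; rewrite ler_wpM2l// lef_pV2 ?posrE ?powR_gt0//.
  by apply: ge0_ler_powR => //; rewrite nnegrE ltW.
rewrite ng// -integral_cst//; apply: ge0_le_integral => //.
exact/measurable_EFinP/measurable_funTS.
Qed.

(* A unit cube on which the jumps from any two points of the ball of radius r0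
   can be made to land. *)
Definition landing (r0 : R) : set 'rV[R]_d := [set w | forall i, r0 + 2 <= w ord0 i <= r0 + 3].

Definition landing_radius (r0 : R) : R := d.+1%:R * (r0 + 3) + r0.

Definition merging_rate (r0 : R) : R := lambda / landing_radius r0 `^ (d%:R + sigma).

Lemma landing_dist r0 w x : 0 <= r0 -> landing r0 w -> enorm x <= r0 -> 2 <= enorm (w - x) <= landing_radius r0.
Proof.
move=> r00 hw xr; apply/andP; split.
  pose i := Ordinal d0; have /andP[w1 _] := hw i.
  have := coord_le_enorm (w - x) i; have := coord_le_enorm x i; rewrite !mxE.
  by rewrite !ler_norml => /andP[_ h1] /andP[_ h2]; lra.
apply: le_trans (enormB _ _) _; apply: lerD => //.
apply: le_trans (enorm_le_mxnorm _) _; rewrite ler_wpM2l// /Num.norm /= mx_normrE.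
apply/bigmax_leP; split; first by rewrite addr_ge0.
move=> [i j] _ /=; rewrite ord1; have /andP[w1 w2] := hw j.
by rewrite ger0_norm//; lra.
Qed.

Lemma measurable_landing r0 : measurable (landing r0).
Proof. exact: measurable_box. Qed.

Lemma lebesgue_landing r0 : lebesgue_rV d (landing r0) = 1%E.
Proof.
rewrite (lebesgue_rV_box (a := fun=> r0 + 2) (b := fun=> r0 + 3)); last by move=> i; lra.
by rewrite (eq_bigr (fun=> 1)) ?big1// => i _; ring.
Qed.

(** Here [a] and [b] are the slacks of the maximum at landing points. Where they add up to D, one of
    them is at least D / 2, so each point of the cube is charged to a jump from x or to a jump from
    y. No joint law of the two jumps is built: the two shifted sets together have mass at least that
    of the cube. The cube lies at distance at least 2 from both points, so small jumps and their
    gradient corrections are not involved. *)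
Lemma merging (r0 D : R) (a b : 'rV[R]_d -> R) x y : 0 <= r0 -> 0 <= D -> continuous a -> continuous b ->
  (forall w, 0 <= a w) -> (forall w, 0 <= b w) -> (forall w, landing r0 w -> D <= a w + b w) ->
  enorm x <= r0 -> enorm y <= r0 ->
  exists e1 e2 : 'rV[R]_d -> R,
    [/\ [/\ measurable_fun setT e1, forall z, 0 <= e1 z <= 1, forall z, enorm z <= 1 -> e1 z = 0 &
          forall z, D / 2 * e1 z <= a (x + z)],
        [/\ measurable_fun setT e2, forall z, 0 <= e2 z <= 1, forall z, enorm z <= 1 -> e2 z = 0 &
          forall z, D / 2 * e2 z <= b (y + z)] &
        merging_rate r0 <= \int[nu]_z e1 z + \int[nu]_z e2 z].
Proof.
move=> r00 D0 ca cb a0 b0 hab xr yr.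
have lr0 : 0 < landing_radius r0 by rewrite /landing_radius ltr_wpDr// mulr_gt0 ?ltr0n//; lra.
have mr0 : 0 <= merging_rate r0 by rewrite /merging_rate divr_ge0 ?powR_ge0.
pose E (f : 'rV[R]_d -> R) := landing r0 `&` [set w | D / 2 <= f w].
have mE f : continuous f -> measurable (E f).
  move=> cf; apply: measurableI; first exact: measurable_landing.
  rewrite (_ : [set w | _] = f @^-1` `[D / 2, +oo[); last first.
    by apply/seteqP; split => w /=; rewrite in_itv/= andbT.
  by rewrite -[X in measurable X]setTI; apply: measurable_continuous_rV.
pose Ex f v := (fun z : 'rV[R]_d => z + v) @^-1` E f.
have mEx f v : continuous f -> measurable (Ex f v).
  move=> cf; rewrite -[X in measurable X]setTI; apply: measurable_addr_rV => //; exact: mE.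
have Exd f v z : enorm v <= r0 -> Ex f v z -> 2 <= enorm z <= landing_radius r0.
  by move=> vr [h _]; have := landing_dist r00 h vr; rewrite addrK.
pose e f v := (\1_(Ex f v) : 'rV[R]_d -> R).
have e01 f v z : 0 <= e f v z <= 1 by rewrite /e indicE; case: (_ \in _); rewrite /= ?lexx ?ler01.
have low f v : continuous f -> enorm v <= r0 -> ((merging_rate r0)%:E * lebesgue_rV d (E f) <= nu (Ex f v))%E.
  move=> cf vr; rewrite -(lebesgue_rV_shift v (mE f cf)); apply: levy_lower => //; first exact: mEx.
  move=> z /(Exd f v z vr)/andP[z1 ->]; rewrite andbT; lra.
have props (f : 'rV[R]_d -> R) v : continuous f -> (forall w, 0 <= f w) -> enorm v <= r0 ->
  [/\ measurable_fun setT (e f v), forall z, 0 <= e f v z <= 1, forall z, enorm z <= 1 -> e f v z = 0 &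
          forall z, D / 2 * e f v z <= f (v + z)].
  move=> cf f0 vr; split=> //.
  - by apply: measurable_indic; exact: mEx.
  - move=> z z1; rewrite /e indicE memNset// => /(Exd f v z vr)/andP[z2 _].
    by exfalso; lra.
  - move=> z; rewrite /e indicE; case: (boolP (z \in Ex f v)) => [|_]; last by rewrite mulr0.
    by rewrite inE => -[_ /=]; rewrite mulr1 addrC.
have int (f : 'rV[R]_d -> R) v : continuous f -> (forall w, 0 <= f w) -> enorm v <= r0 ->
   nu (Ex f v) = (\int[nu]_z e f v z)%:E.
  move=> cf f0 vr; have [me h1 h2 _] := props f v cf f0 vr.
  have m0s : 0 <= (0 : R) < sigma by case/andP: s02 => -> _; rewrite lexx.
  have ie : nu.-integrable setT (EFin \o e f v).
    apply: (integrable_dom s02 l0 L0 hnu (C := 1) m0s) => // z; rewrite mul1r.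
    have [z1|z1] := leP (enorm z) 1; first by rewrite h2// normr0 lw_ge0.
    by rewrite lw_out// powRr0 ger0_norm; case/andP: (h1 z).
  rewrite /Rintegral fineK ?integrable_fin_num// integral_indic ?setIT//; exact: mEx.
exists (e a x), (e b y); split; [exact: props|exact: props|].
rewrite -lee_fin EFinD -!int//; apply: le_trans (leeD (low a x ca xr) (low b y cb yr)).
rewrite -muleDr ?ge0_adde_def ?inE//; rewrite -[leLHS]mule1 lee_wpmul2l ?lee_fin//.
rewrite -(lebesgue_landing r0); apply: le_trans (measureU2 _ (mE a ca) (mE b cb)).
apply: le_measure; rewrite ?inE; [exact: measurable_landing|by apply: measurableU; exact: mE|].
move=> w hw; have := hab w hw; have [h|h] := leP (D / 2) (a w).
  by move=> _; left; split.
by move=> h2; right; split => //=; lra.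
Qed.

End merging.

(** * Comparison with a doubled weight *)

Section max_arithmetic.
Context {R : realType}.

Lemma diff_le (a c A C V V' M : R) : `|a| <= A -> `|c| <= C -> A <= V + M -> C <= V' + M ->
  a - c <= V + V' + 2 * M.
Proof. by rewrite !ler_norml => /andP[_ ?] /andP[? _] *; lra. Qed.

Lemma diff_le_absorb (a c A C V V' M : R) : `|a| <= A -> `|c| <= C -> A <= V + M -> C <= V' + M ->
  A + M <= V \/ C + M <= V' -> a - c <= V + V'.
Proof. by rewrite !ler_norml => /andP[_ ?] /andP[? _] ? ? [] *; lra. Qed.

Lemma penalized_le (q w v e t P Q : R) : 0 <= e * t ->
  q - (w + e * (v + t) + P + Q) <= q - (w + e * v) - P - Q.
Proof. by rewrite mulrDr => *; lra. Qed.

Lemma max_arith1 (om q w v M P Q : R) : om <= q - (w + v) - P - Q -> q <= v + 2 * M -> 0 <= w ->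
  0 <= P -> 0 <= om -> Q <= 2 * M.
Proof. by move=> *; lra. Qed.

Lemma max_arith2 (om q w v M P Q : R) : om <= q - (w + v) - P - Q -> q <= v + 2 * M -> 0 <= w ->
  0 <= Q -> 0 < om -> P < 2 * M.
Proof. by move=> *; lra. Qed.

End max_arithmetic.

Section penalized_maximum.
Context {R : realType} {d : nat}.
Implicit Types (x y : 'rV[R]_d) (u : R -> 'rV[R]_d -> R).

Local Notation pt := ((R * 'rV[R]_d) * (R * 'rV[R]_d))%type.

(** Extends functions of time beyond [0, T], so that the maximized expression is continuous on the
    whole space and compactness of a product applies directly. *)
Definition clamp (T t : R) : R := Num.max 0 (Num.min t T).

Lemma clamp_in T t : 0 <= T -> 0 <= clamp T t <= T.
Proof. by move=> T0; rewrite /clamp le_max lexx ge_max T0 ge_min lexx orbT. Qed.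

Lemma clamp_id T t : 0 <= t <= T -> clamp T t = t.
Proof.
move=> /andP[t0 tT]; rewrite /clamp.
by have -> : Num.min t T = t by [apply/min_idPl]; apply/max_idPr.
Qed.

Lemma max0_lip (a c : R) : `|Num.max 0 a - Num.max 0 c| <= `|a - c|.
Proof.
rewrite ler_norml; have := ler_norm (a - c); have := ler_norm (c - a); rewrite distrC.
by case: (leP 0 a) => ha; case: (leP 0 c) => hc h1 h2; apply/andP; split; lra.
Qed.

Lemma min_lip (a c t : R) : `|Num.min a t - Num.min c t| <= `|a - c|.
Proof.
rewrite ler_norml; have := ler_norm (a - c); have := ler_norm (c - a); rewrite distrC.
by case: (leP a t) => ha; case: (leP c t) => hc h1 h2; apply/andP; split; lra.
Qed.

Lemma clamp_lip T t s : `|clamp T t - clamp T s| <= `|t - s|.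
Proof.
apply: le_trans (max0_lip _ _) _; exact: min_lip.
Qed.

Lemma continuous_clamped T u : 0 <= T ->
  {within `[0, T] `*` setT, continuous (fun q => u q.1 q.2)} ->
  continuous (fun p : R * 'rV[R]_d => u (clamp T p.1) p.2).
Proof.
move=> T0 cu p; apply: continuous_pairP => e e0.
have [r r0 hr] := unif_continuous_time (enorm p.2 + 1) cu e0.
exists (Num.min r 1); first by rewrite lt_min r0 ltr01.
move=> s y; rewrite !lt_min => /andP[s1 _] /andP[y1 y2]; apply: hr => //=; rewrite ?clamp_in//.
- by have := enorm_le_add y p.2; lra.
- by rewrite lerDl.
- exact: le_lt_trans (clamp_lip _ _ _) s1.
Qed.

Lemma continuous_lip_clamped T (f : R -> R) c : 0 <= T ->
  (forall t s, 0 <= t <= T -> 0 <= s <= T -> `|f t - f s| <= c * `|t - s|) ->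
  continuous (fun t => f (clamp T t)).
Proof.
move=> T0 hf t; apply/cvgrPdist_lt => e e0.
have c0 : 0 < `|c| + 1 by rewrite ltr_wpDl.
apply/nbhs_ballP; exists (e / (`|c| + 1)); first by rewrite /= divr_gt0.
move=> s; rewrite /ball /= ltr_pdivlMr// => ts.
apply: le_lt_trans (hf _ _ (clamp_in _ T0) (clamp_in _ T0)) _.
apply: le_lt_trans ts; apply: (@le_trans _ _ ((`|c| + 1) * `|clamp T t - clamp T s|)).
  by rewrite ler_wpM2r//; have := ler_norm c; lra.
by rewrite mulrC ler_wpM2r ?(ltW c0)// clamp_lip.
Qed.

Lemma compact_product_max (F : pt -> R) (T L : R) : 0 <= T -> 0 <= L -> continuous F ->
  exists t s x y, [/\ 0 <= t <= T, 0 <= s <= T, enorm x <= L, enorm y <= L &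
    forall t' s' x' y', 0 <= t' <= T -> 0 <= s' <= T -> enorm x' <= L -> enorm y' <= L ->
      F ((t', x'), (s', y')) <= F ((t, x), (s, y))].
Proof.
move=> T0 L0 cF.
have cB := compact_setX (@segment_compact _ 0 T) (@compact_enorm_le R d L).
have cBB := compact_setX cB cB.
have [|[[t x] [s y]] pB hp] := @compact_EVT_max _ R F _ _ cBB (continuous_subspaceT cF).
  by exists ((0, 0), (0, 0)); split; split; rewrite /= ?in_itv /= ?lexx ?T0 ?enorm0.
move: pB; rewrite inE => -[[/= t1 t2] [/= s1 s2]].
exists t, s, x, y; split => //.
move=> t' s' x' y' h1 h2 h3 h4; apply: hp; rewrite inE.
by split; split => //=; rewrite in_itv.
Qed.

Definition pos (a : R) : R := Num.max a 0.

Lemma pos_sqr_increment a h : pos (a + h) ^+ 2 <= pos a ^+ 2 + 2 * pos a * h + h ^+ 2.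
Proof.
rewrite /pos; case: (leP a 0) => a0; case: (leP (a + h) 0) => ah.
- by rewrite expr0n !mulr0 mul0r !addr0 add0r sqr_ge0.
- rewrite expr0n mulr0 mul0r !add0r; have : (a + h) ^+ 2 <= h ^+ 2 by rewrite lerXn2r ?nnegrE; lra.
  by [].
- by rewrite expr0n (_ : a ^+ 2 + _ + _ = (a + h) ^+ 2) ?sqr_ge0//; ring.
- by rewrite sqrrD le_eqVlt; apply/orP; left; apply/eqP; ring.
Qed.

(** The roles of the terms: [e] times V forces a maximum to exist, and C' t pays for the effect of
    the equation on that penalty; N pos(t - t1)^2 keeps t below T with a time slope of the
    favourable sign; n (t - s)^2 separates the two times. *)
Definition penalized (T t1 C' : R) u (dl : R -> R) (W : 'rV[R]_d -> 'rV[R]_d -> R)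
    (V : 'rV[R]_d -> R) (e N n t s : R) x y : R :=
  u t x - u s y - (dl t * W x y + e * (V x + V y + C' * t) + N * pos (t - t1) ^+ 2 + n * (t - s) ^+ 2).

Lemma continuous_penalized (T t1 C' c e N n : R) u (dl : R -> R) (W : 'rV[R]_d -> 'rV[R]_d -> R)
    (V : 'rV[R]_d -> R) : 0 <= T ->
  {within `[0, T] `*` setT, continuous (fun q => u q.1 q.2)} -> continuous V ->
  continuous (fun p : pt => W p.1.2 p.2.2) ->
  (forall t s, 0 <= t <= T -> 0 <= s <= T -> `|dl t - dl s| <= c * `|t - s|) ->
  continuous (fun p : pt => u (clamp T p.1.1) p.1.2 - u (clamp T p.2.1) p.2.2 -
    (dl (clamp T p.1.1) * W p.1.2 p.2.2 + e * (V p.1.2 + V p.2.2 + C' * p.1.1) +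
     N * pos (p.1.1 - t1) ^+ 2 + n * (p.1.1 - p.2.1) ^+ 2)).
Proof.
move=> T0 cu cV cW dlL.
have cfst (f : R * 'rV[R]_d -> R) : continuous f -> continuous (fun p : pt => f p.1).
  by move=> cf p; apply: (continuous_comp (f := @fst (R * 'rV[R]_d) (R * 'rV[R]_d))); [exact: cvg_fst|exact: cf].
have csnd (f : R * 'rV[R]_d -> R) : continuous f -> continuous (fun p : pt => f p.2).
  by move=> cf p; apply: (continuous_comp (f := @snd (R * 'rV[R]_d) (R * 'rV[R]_d))); [exact: cvg_snd|exact: cf].
have c1 := cfst _ (continuous_clamped T0 cu); have c2 := csnd _ (continuous_clamped T0 cu).
have c3 := cfst _ (@continuous_fstf R d _ (continuous_lip_clamped T0 dlL)).
have c4 := cfst _ (@continuous_sndf R d _ cV); have c5 := csnd _ (@continuous_sndf R d _ cV).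
have cid : continuous (fun t : R => t) by move=> t; exact: cvg_id.
have c6 := cfst _ (@continuous_fstf R d _ cid); have c7 := csnd _ (@continuous_fstf R d _ cid).
have cp : continuous (fun t : R => pos (t - t1)).
  move=> t; apply: (@continuous_max _ _ (fun t => t - t1) (cst 0)); last exact: cvg_cst.
  by apply: cvgB; [exact: cvg_id|exact: cvg_cst].
have c8 := cfst _ (@continuous_fstf R d _ cp).
move=> p; apply: cvgB; first by apply: cvgB; [exact: c1|exact: c2].
apply: cvgD; last by apply: cvgM; [exact: cvg_cst|apply: cvgM; (apply: cvgB; [exact: c6|exact: c7])].
apply: cvgD; last by apply: cvgM; [exact: cvg_cst|apply: cvgM; exact: c8].
apply: cvgD; first by apply: cvgM; [exact: c3|exact: cW].
apply: cvgM; first exact: cvg_cst.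
apply: cvgD; last by apply: cvgM; [exact: cvg_cst|exact: c6].
by apply: cvgD; [exact: c4|exact: c5].
Qed.

(** A violation at one time t1 produces interior contact points. [e], [N], [L] and [tau] do not
    depend on [eta], so t - s can be made small after every other bound, including those on the
    drift over [tau, T], has been fixed. *)
Lemma penalized_maximum (T t1 C m C' c : R) u (dl : R -> R) (W : 'rV[R]_d -> 'rV[R]_d -> R)
    (V : 'rV[R]_d -> R) x1 y1 :
  {within `[0, T] `*` setT, continuous (fun q => u q.1 q.2)} ->
  (forall t x, 0 <= t <= T -> `|u t x| <= C * japanese x `^ m) ->
  continuous V -> (forall x, 0 <= V x) ->
  (forall e, 0 < e -> exists M L : R, [/\ 0 <= M, forall x, C * japanese x `^ m <= e * V x + M &
     forall x, L <= enorm x -> C * japanese x `^ m + M <= e * V x]) ->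
  continuous (fun p : pt => W p.1.2 p.2.2) -> (forall x y, 0 <= W x y) ->
  (forall L, exists WL, forall x y, enorm x <= L -> enorm y <= L -> W x y <= WL) ->
  0 <= c -> (forall t, 0 <= t <= T -> 0 <= dl t) ->
  (forall t s, 0 <= t <= T -> 0 <= s <= T -> `|dl t - dl s| <= c * `|t - s|) ->
  (forall x y, u 0 x - u 0 y <= dl 0 * W x y) ->
  0 <= C' -> 0 < t1 < T -> dl t1 * W x1 y1 < u t1 x1 - u t1 y1 ->
  exists e N L tau : R, [/\ 0 < e, 0 <= N, 0 < tau & forall eta, 0 < eta ->
    exists n t s x y, [/\ 0 <= n, enorm x <= L /\ enorm y <= L, tau <= t < T /\ tau <= s < T, `|t - s| <= eta &
      [/\ dl t * W x y <= u t x - u t y, dl t * W x y + e * (V x + V y) <= u t x - u s y &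
       forall t' s' x' y', 0 <= t' <= T -> 0 <= s' <= T ->
         penalized T t1 C' u dl W V e N n t' s' x' y' <= penalized T t1 C' u dl W V e N n t s x y]]].
Proof.
move=> cu uC cV V0 hV cW W0 hWL c0 dl0 dlL hinit C'0 /andP[t10 t1T] gap.
have T0 : 0 < T by exact: lt_trans t1T.
have t1T2 : 0 <= t1 <= T by rewrite !ltW.
pose om := (u t1 x1 - u t1 y1 - dl t1 * W x1 y1) / 2.
have om0 : 0 < om by rewrite divr_gt0// subr_gt0.
pose v1 := V x1 + V y1 + C' * t1.
have v10 : 0 <= v1 by rewrite !addr_ge0// mulr_ge0// ltW.
(* The penalty then uses at most half of the gap at (t1, x1, y1), and the maximum is at least [om],
   the other half. *)
pose e := om / (v1 + 1).
have e0 : 0 < e by rewrite divr_gt0// ltr_wpDl.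
have ev : e * v1 <= om by rewrite /e mulrAC ler_pdivrMr ?ltr_wpDl// ler_wpM2l ?(ltW om0)// lerDl.
have [M [L [M0 hM hL0]]] := hV e e0.
pose L1 := Num.max L (Num.max 1 (Num.max (enorm x1) (enorm y1))).
have L10 : 0 <= L1 by rewrite !le_max ler01 !orbT.
have hL x : L1 <= enorm x -> C * japanese x `^ m + M <= e * V x.
  by move=> xL; apply: hL0; apply: le_trans xL; rewrite le_max lexx.
pose T2 := (t1 + T) / 2; have T2t : 0 < T2 - t1 by rewrite /T2; lra.
have T2T : T2 < T by rewrite /T2; lra.
(* At T2, strictly between t1 and T, the barrier reaches 2M, more than a maximum can afford. *)
pose N := 2 * M / (T2 - t1) ^+ 2.
have N0 : 0 <= N by apply: divr_ge0; [exact: mulr_ge0|exact: sqr_ge0].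
have [WL hWL1] := hWL L1.
pose WL1 := `|WL| + 1; have WL10 : 0 < WL1 by rewrite ltr_wpDl.
have hW x y : enorm x <= L1 -> enorm y <= L1 -> W x y <= WL1.
  by move=> h1 h2; apply: le_trans (hWL1 x y h1 h2) _; rewrite /WL1; have := ler_norm WL; lra.
have om80 : 0 < om / 8 by rewrite divr_gt0.
have [rt rt0 hrt] := unif_continuous_time L1 cu om80.
pose tau := Num.min (rt / 2) (om / 8 / (c * WL1 + 1)).
have cW1 : 0 < c * WL1 + 1 by rewrite ltr_wpDl// mulr_ge0// ltW.
have tau0 : 0 < tau by rewrite lt_min; apply/andP; split; exact: divr_gt0.
have taurt : tau < rt.
  apply: (@le_lt_trans _ _ (rt / 2)); first by rewrite ge_min lexx.
  by rewrite ltr_pdivrMr// ltr_pMr// ltr1n.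
have tauW : c * tau * WL1 <= om / 8.
  apply: (@le_trans _ _ ((c * WL1 + 1) * tau)); first by rewrite mulrAC ler_wpM2r ?(ltW tau0)// lerDl.
  by rewrite mulrC -ler_pdivlMr// ge_min lexx orbT.
exists e, N, L1, (tau / 2); split => //; first by rewrite divr_gt0.
move=> eta eta0.
pose eta' := Num.min eta (Num.min (rt / 2) (Num.min (tau / 2) ((T - T2) / 2))).
have eta'0 : 0 < eta' by rewrite !lt_min eta0 !divr_gt0// subr_gt0.
pose n := 2 * M / eta' ^+ 2 + 1.
have n0 : 0 <= n by apply: addr_ge0 => //; apply: divr_ge0; [exact: mulr_ge0|exact: sqr_ge0].
pose F (p : pt) := u (clamp T p.1.1) p.1.2 - u (clamp T p.2.1) p.2.2 -
  (dl (clamp T p.1.1) * W p.1.2 p.2.2 + e * (V p.1.2 + V p.2.2 + C' * p.1.1) +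
   N * pos (p.1.1 - t1) ^+ 2 + n * (p.1.1 - p.2.1) ^+ 2).
have cF : continuous F by apply: (continuous_penalized (c := c)) => //; exact: ltW.
have [t [s [x [y [tT sT xL yL hmax]]]]] := compact_product_max (ltW T0) L10 cF.
have FE t' s' x' y' : 0 <= t' <= T -> 0 <= s' <= T ->
  F ((t', x'), (s', y')) = penalized T t1 C' u dl W V e N n t' s' x' y'.
  by move=> h1 h2; rewrite /F /= !clamp_id.
have x1L : enorm x1 <= L1 by rewrite !le_max lexx !orbT.
have y1L : enorm y1 <= L1 by rewrite !le_max lexx !orbT.
have low : om <= penalized T t1 C' u dl W V e N n t s x y.
  rewrite -FE//; apply: le_trans (hmax t1 t1 x1 y1 t1T2 t1T2 x1L y1L); rewrite FE//.
  rewrite /penalized !subrr /pos maxxx expr0n !mulr0 !addr0 -/v1.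
  by move: ev; rewrite /om; clear; lra.
have upper t' s' x' y' : 0 <= t' <= T -> 0 <= s' <= T -> u t' x' - u s' y' <= e * (V x' + V y') + 2 * M.
  by move=> h1 h2; rewrite mulrDr; exact: diff_le (uC _ _ h1) (uC _ _ h2) (hM _) (hM _).
have upper2 t' s' x' y' : 0 <= t' <= T -> 0 <= s' <= T -> L1 <= enorm x' \/ L1 <= enorm y' ->
    u t' x' - u s' y' <= e * (V x' + V y').
  move=> h1 h2 h3; rewrite mulrDr; apply: (diff_le_absorb (uC _ _ h1) (uC _ _ h2) (hM _) (hM _)).
  by case: h3 => /hL; [left|right].
have le_pen t' s' x' y' : 0 <= t' <= T -> penalized T t1 C' u dl W V e N n t' s' x' y' <=
    u t' x' - u s' y' - (dl t' * W x' y' + e * (V x' + V y')) - N * pos (t' - t1) ^+ 2 - n * (t' - s') ^+ 2.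
  by move=> /andP[h1 _]; apply: penalized_le; rewrite mulr_ge0 ?(ltW e0)// mulr_ge0.
have dW t' x' y' : 0 <= t' <= T -> 0 <= dl t' * W x' y' by move=> h; rewrite mulr_ge0// dl0.
have sq0 (a : R) : 0 <= n * a ^+ 2 by rewrite mulr_ge0// sqr_ge0.
have Nsq0 (a : R) : 0 <= N * a ^+ 2 by rewrite mulr_ge0// sqr_ge0.
have low2 := le_trans low (le_pen t s x y tT).
have up := upper t s x y tT sT; have Wt := dW t x y tT.
have n_ts : n * (t - s) ^+ 2 <= 2 * M by exact: max_arith1 low2 up Wt (Nsq0 _) (ltW om0).
have N_t1 : N * pos (t - t1) ^+ 2 < 2 * M by exact: max_arith2 low2 up Wt (sq0 _) om0.
have ts : `|t - s| <= eta'.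
  rewrite leNgt; apply/negP => h; have := n_ts; apply/negP; rewrite -ltNge.
  apply: (@lt_le_trans _ _ (n * eta' ^+ 2)).
    have -> : n * eta' ^+ 2 = 2 * M + eta' ^+ 2.
      by rewrite /n mulrDl mul1r divfK// expf_neq0// gt_eqF.
    by rewrite ltrDl exprn_gt0.
  rewrite ler_wpM2l// -(real_normK (num_real (t - s))) lerXn2r ?nnegrE ?(ltW eta'0)//.
  exact: ltW.
have tT2 : t < T2.
  rewrite ltNge; apply/negP => h; have := N_t1; apply/negP; rewrite -leNgt.
  have -> : 2 * M = N * (T2 - t1) ^+ 2 by rewrite /N divfK// expf_neq0// gt_eqF.
  rewrite ler_wpM2l// lerXn2r ?nnegrE ?(ltW T2t)//; first by rewrite le_max lexx orbT.
  by rewrite le_max lerD2r h.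
have et1 : eta' <= eta by rewrite ge_min lexx.
have et2 : eta' <= rt / 2 by rewrite !ge_min lexx !orbT.
have et3 : eta' <= tau / 2 by rewrite !ge_min lexx !orbT.
have et4 : eta' <= (T - T2) / 2 by rewrite !ge_min lexx !orbT.
have st : s <= t + eta' by move: ts; rewrite ler_norml => /andP[h _]; move: h; clear; lra.
have ts' : t - eta' <= s by move: ts; rewrite ler_norml => /andP[_ h]; move: h; clear; lra.
have eV : 0 <= e * (V x + V y) by rewrite mulr_ge0 ?addr_ge0// ltW.
have key : dl t * W x y + e * (V x + V y) + om <= u t x - u s y.
  by move: low2 (Nsq0 (pos (t - t1))) (sq0 (t - s)); clear; lra.
(* Before [tau] both values of u, and the weight, differ from those at time 0 by at most om / 8
   each, and at time 0 the weight dominates; the gain [om] would be left unexplained. *)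
have taut : tau <= t.
  rewrite leNgt; apply/negP => ttau; have /andP[t0 _] := tT; have /andP[s0 _] := sT.
  have tau2 : tau <= rt / 2 by rewrite ge_min lexx.
  have h0T : (0 : R) <= (0 : R) <= T by rewrite lexx ltW.
  have z0 (z : 'rV[R]_d) : enorm (z - z) < rt by rewrite subrr enorm0.
  have h1 : `|u t x - u 0 x| < om / 8.
    by apply: hrt => //; rewrite subr0 ger0_norm// (lt_trans ttau).
  have h2 : `|u s y - u 0 y| < om / 8.
    apply: hrt => //; rewrite subr0 ger0_norm//; apply: le_lt_trans st _.
    by move: ttau tau2 et2; clear; lra.
  have h3 : dl 0 * W x y <= dl t * W x y + om / 8.
    have hd := dlL 0 t h0T tT; rewrite sub0r normrN (ger0_norm t0) in hd.
    have h4 : dl 0 - dl t <= c * tau.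
      by apply: le_trans (le_trans (ler_norm _) hd) _; rewrite ler_wpM2l// ltW.
    have h5 : (dl 0 - dl t) * W x y <= c * tau * WL1.
      apply: (@le_trans _ _ (c * tau * W x y)); first by rewrite ler_wpM2r.
      by rewrite ler_wpM2l ?hW// mulr_ge0// ltW.
    by move: h5 tauW; rewrite mulrBl; clear; lra.
  move: h1 h2; rewrite !ltr_norml => /andP[_ h1] /andP[h2 _].
  by move: h1 h2 h3 key eV om0 (hinit x y); clear; lra.
have usy : `|u s y - u t y| < om / 8.
  have st_rt : `|s - t| < rt.
    rewrite distrC; apply: le_lt_trans ts _; apply: le_lt_trans et2 _.
    by rewrite ltr_pdivrMr// ltr_pMr// ltr1n.
  by apply: hrt => //; rewrite subrr enorm0.
exists n, t, s, x, y; split => //.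
- split; apply/andP; split.
  + by apply: le_trans taut; rewrite ler_pdivrMr// ler_peMr ?ler1n// ltW.
  + exact: lt_trans tT2 T2T.
  + by apply: le_trans ts'; move: taut et3; clear; lra.
  + by apply: le_lt_trans st _; move: tT2 et4 T2T; clear; lra.
- exact: le_trans ts et1.
- split.
  + move: usy; rewrite ltr_norml => /andP[h _].
    by move: h key eV om0; clear; lra.
  + by apply: le_trans key; rewrite lerDl ltW.
  + move=> t' s' x' y' t'T s'T.
    have [x'L|x'L] := leP (enorm x') L1; last first.
      apply: le_trans (le_trans _ (ltW om0)) low; apply: le_trans (le_pen _ _ _ _ t'T) _.
      have := upper2 t' s' x' y' t'T s'T (or_introl (ltW x'L)).
      by move: (dW t' x' y' t'T) (Nsq0 (pos (t' - t1))) (sq0 (t' - s')); clear; lra.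
    have [y'L|y'L] := leP (enorm y') L1; last first.
      apply: le_trans (le_trans _ (ltW om0)) low; apply: le_trans (le_pen _ _ _ _ t'T) _.
      have := upper2 t' s' x' y' t'T s'T (or_intror (ltW y'L)).
      by move: (dW t' x' y' t'T) (Nsq0 (pos (t' - t1))) (sq0 (t' - s')); clear; lra.
    by rewrite -!FE//; exact: hmax.
Qed.

End penalized_maximum.

(** * The inequality at a contact point *)

Section increment_arithmetic.
Context {R : realType}.

Lemma cross_term_le (c L mu ta h k a w : R) : 0 < mu -> 0 <= c -> 0 <= L -> 0 <= h -> 0 <= k ->
  `|a| <= c * `|ta| -> `|w| <= L * (h + k) ->
  a * w <= mu * (h ^+ 2 + k ^+ 2) + (c * L) ^+ 2 / (2 * mu) * ta ^+ 2.
Proof.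
move=> mu0 c0 L0 h0 k0 ac wL.
apply: le_trans (ler_norm _) _; rewrite normrM.
apply: le_trans (ler_pM (normr_ge0 _) (normr_ge0 _) ac wL) _.
rewrite -(real_normK (num_real ta)); move: (`|ta|) (normr_ge0 ta) => q q0.
have -> : c * q * (L * (h + k)) = c * L * q * (h + k) by ring.
move: (c * L) (mulr_ge0 c0 L0) => M M0; rewrite -subr_ge0.
have -> : mu * (h ^+ 2 + k ^+ 2) + M ^+ 2 / (2 * mu) * q ^+ 2 - M * q * (h + k) =
  mu * ((h - M * q / (2 * mu)) ^+ 2 + (k - M * q / (2 * mu)) ^+ 2) by field; rewrite gt_eqF.
by rewrite mulr_ge0 ?(ltW mu0)// addr_ge0// sqr_ge0.
Qed.

(** A product of a time factor and a space factor has a mixed second-order increment. Young's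
    inequality splits it: the time square only enlarges a constant that does not survive the
    doubling, and the space square carries a factor [mu] that is sent to 0 at the end. *)
Lemma product_increment_le (dl dl' d1 Cd ta W W' lin quad c L mu h k : R) : 0 < mu -> 0 <= c -> 0 <= L ->
  0 <= h -> 0 <= k -> 0 <= dl -> 0 <= W -> `|dl' - dl| <= c * `|ta| ->
  dl' <= dl + d1 * ta + Cd * ta ^+ 2 -> W' <= W + lin + quad -> `|W' - W| <= L * (h + k) ->
  dl' * W' - dl * W <= d1 * W * ta + (Cd * W + (c * L) ^+ 2 / (2 * mu)) * ta ^+ 2
    + dl * (lin + quad) + mu * (h ^+ 2 + k ^+ 2).
Proof.
move=> mu0 c0 L0 h0 k0 dl0 W0 dlL dlT WT WL.
have h1 := cross_term_le mu0 c0 L0 h0 k0 dlL WL.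
have h2 : (dl' - dl) * W <= (d1 * ta + Cd * ta ^+ 2) * W by rewrite ler_wpM2r//; lra.
have h3 : dl * (W' - W) <= dl * (lin + quad) by rewrite ler_wpM2l//; lra.
have -> : dl' * W' - dl * W = (dl' - dl) * W + dl * (W' - W) + (dl' - dl) * (W' - W) by ring.
move: h1 h2 h3; rewrite mulrDl; set X := _ / _; move: X => X h1 h2 h3.
have -> : (Cd * W + X) * ta ^+ 2 = Cd * ta ^+ 2 * W + X * ta ^+ 2 by ring.
have -> : d1 * W * ta = d1 * ta * W by ring.
lra.
Qed.

Lemma time_penalty_le (N n t t1 s ta sa : R) : 0 <= N -> 0 <= n ->
  N * pos (t + ta - t1) ^+ 2 + n * (t + ta - (s + sa)) ^+ 2 - (N * pos (t - t1) ^+ 2 + n * (t - s) ^+ 2)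
  <= (2 * N * pos (t - t1) + 2 * n * (t - s)) * ta - 2 * n * (t - s) * sa
     + (N + 2 * n) * (ta ^+ 2 + sa ^+ 2).
Proof.
move=> N0 n0; have h1 := pos_sqr_increment (t - t1) ta.
have -> : t + ta - t1 = t - t1 + ta by ring.
have h2 := ler_wpM2l N0 h1.
have h3 : n * (t + ta - (s + sa)) ^+ 2 <= n * ((t - s) ^+ 2 + 2 * (t - s) * (ta - sa) + 2 * (ta ^+ 2 + sa ^+ 2)).
  by rewrite ler_wpM2l//; have := sqr_ge0 (ta + sa); nra.
have h4 : 0 <= N * sa ^+ 2 by rewrite mulr_ge0// sqr_ge0.
by move: h2 h3 h4; rewrite !mulrDr; nra.
Qed.

Lemma norm_three_increments (a a' b b' c c' L K M h k : R) : 0 <= K -> 0 <= M -> 0 <= h -> 0 <= k ->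
  `|a - a'| <= L * (h + k) -> `|b - b'| <= K * h -> `|c - c'| <= M * k ->
  `|a + b + c - (a' + b' + c')| <= (L + K + M) * (h + k).
Proof.
move=> K0 M0 h0 k0 e1 e2 e3; have -> : a + b + c - (a' + b' + c') = (a - a') + (b - b') + (c - c') by ring.
apply: le_trans (ler_normD _ _) _; apply: le_trans (lerD (ler_normD _ _) (lexx _)) _.
apply: le_trans (lerD (lerD e1 e2) e3) _; rewrite !mulrDl !mulrDr.
by have := mulr_ge0 K0 k0; have := mulr_ge0 M0 h0; lra.
Qed.

Lemma three_taylor (a b c a' b' c' g g1 g2 q K h k : R) : a' <= a + g + q ->
  b' <= b + g1 + K * h -> c' <= c + g2 + K * k ->
  a' + b' + c' <= a + b + c + (g + g1 + g2) + (q + K * (h + k)).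
Proof. by rewrite mulrDr => *; lra. Qed.

Lemma penalized_step (u v u' v' D W D' W' e C' t ta sa V1 V2 V1' V2' P Q P' Q' A1 B1 f1 f2 g1 g2 k1 k2 q H1 H2
    K mu a2 a3 B2 : R) : 0 <= e -> 0 <= B1 * sa ^+ 2 ->
  u' - v' - (D' * W' + e * (V1' + V2' + C' * (t + ta)) + P' + Q') <=
    u - v - (D * W + e * (V1 + V2 + C' * t) + P + Q) ->
  D' * W' - D * W <= A1 * ta + B1 * ta ^+ 2 + D * (f1 - f2 + g1 + g2 + (2^-1 * q + K * (H1 + H2))) + mu * (H1 + H2) ->
  V1' <= V1 + k1 + K * H1 -> V2' <= V2 + k2 + K * H2 ->
  P' + Q' - (P + Q) <= a2 * ta - a3 * sa + B2 * (ta ^+ 2 + sa ^+ 2) ->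
  u' + - v' <= u + - v + (A1 + e * C' + a2) * ta + (- a3) * sa + (B1 + B2) * (ta ^+ 2 + sa ^+ 2)
    + (D * (f1 + g1) + e * k1) + (D * (- f2 + g2) + e * k2)
    + 2^-1 * (2 * (D * K + e * K + mu) * H1 + 2 * (D * K + e * K + mu) * H2 + D * q).
Proof.
move=> e0 B0 hp hD h1 h2 hQ.
have h3 : e * V1' <= e * V1 + e * k1 + e * K * H1 by rewrite -!mulrA -!mulrDr ler_wpM2l.
have h4 : e * V2' <= e * V2 + e * k2 + e * K * H2 by rewrite -!mulrA -!mulrDr ler_wpM2l.
rewrite !mulrDr in hp; rewrite -subr_ge0.
set L := (X in 0 <= X).
have -> : L = (u - v - (D * W + (e * V1 + e * V2 + e * (C' * t)) + P + Q)
      - (u' - v' - (D' * W' + (e * V1' + e * V2' + (e * (C' * t) + e * (C' * ta))) + P' + Q')))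
  + (A1 * ta + B1 * ta ^+ 2 + D * (f1 - f2 + g1 + g2 + (2^-1 * q + K * (H1 + H2))) + mu * (H1 + H2) - (D' * W' - D * W))
  + (e * V1 + e * k1 + e * K * H1 - e * V1') + (e * V2 + e * k2 + e * K * H2 - e * V2')
  + (a2 * ta - a3 * sa + B2 * (ta ^+ 2 + sa ^+ 2) - (P' + Q' - (P + Q))) + B1 * sa ^+ 2.
  by rewrite /L; field.
rewrite -subr_ge0 in hp; rewrite -subr_ge0 in hD; rewrite -subr_ge0 in h3; rewrite -subr_ge0 in h4.
rewrite -subr_ge0 in hQ.
exact: addr_ge0 (addr_ge0 (addr_ge0 (addr_ge0 (addr_ge0 hp hD) h3) h4) hQ) B0.
Qed.

End increment_arithmetic.

Section doubled_weight.
Context {R : realType} {d : nat} (rad : R) (rad0 : 0 < rad).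
Implicit Types x y v h z : 'rV[R]_d.

Local Notation CV := (15 + 12 * rad ^+ 2).
Local Notation lyap := (lyap rad).
Local Notation glyap := (glyap rad).

Lemma refl_taylor_near c th v : 0 <= c -> 0 <= th -> 0 < enorm v ->
  exists2 rho : R, 0 < rho & forall h, enorm h <= rho ->
    refl_dist c th (v + h) <= refl_dist c th v + dotv (refl_grad c th v) h
      + 2^-1 * qf (refl_hess c th v) h h.
Proof.
move=> c0; rewrite le_eqVlt => /predU1P[<- v0|th0 v0].
  exists 1 => // h _; rewrite /refl_dist !mul0r oppr0 expR0 /refl_grad mulr0 mul0r scale0r dotv0l.
  rewrite /refl_hess !mulr0 !mul0r expr0n mul0r add0r mul0r scale0r subr0 qfZm qf_scalar.
  by rewrite mul0r !mulr0 !addr0.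
exists (Num.min (enorm v / 2) th^-1); first by rewrite lt_min divr_gt0//= invr_gt0.
move=> h; rewrite le_min => /andP[h1 h2]; apply: refl_taylor => //.
by rewrite mulrC -ler_pdivlMr// mul1r.
Qed.

Lemma enorm_glyap_le kap x : 0 < kap <= 2 -> enorm (glyap kap x) <= 2 * enorm x ^+ 5.
Proof.
move=> /andP[k0 k2]; have x0 := enorm_ge0 x.
have e0 := excess_ge0 rad x.
have e1 : excess rad x <= enorm x ^+ 2 by rewrite /excess ge_max sqr_ge0 andbT gerBl sqr_ge0.
have h1 : lbase rad x `^ (kap / 6 - 1) <= 1.
  rewrite -[leRHS](powRr0 (lbase rad x)) ler_powR ?lbase_ge1//.
  by rewrite subr_le0 ler_pdivrMr// mul1r; lra.
rewrite enormZ ger0_norm; last by rewrite !mulr_ge0 ?powR_ge0 ?sqr_ge0// ltW.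
have h2 : kap * lbase rad x `^ (kap / 6 - 1) <= 2 * 1 by apply: ler_pM; rewrite ?powR_ge0// ltW.
have h3 : excess rad x ^+ 2 <= (enorm x ^+ 2) ^+ 2 by rewrite lerXn2r// nnegrE sqr_ge0.
have -> : 2 * enorm x ^+ 5 = 2 * 1 * (enorm x ^+ 2) ^+ 2 * enorm x by ring.
by rewrite ler_wpM2r// ler_pM ?sqr_ge0// mulr_ge0 ?powR_ge0// ltW.
Qed.

Lemma lyap_lip kap x : 0 < kap <= 2 -> exists2 K : R, 0 <= K &
  forall h, enorm h <= 1 -> `|lyap kap (x + h) - lyap kap x| <= K * enorm h.
Proof.
move=> k02; pose G := 2 * (enorm x + 1) ^+ 5; have x0 := enorm_ge0 x.
have CV0 : 0 <= CV by rewrite addr_ge0// mulr_ge0// sqr_ge0.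
have G0 : 0 <= G by rewrite mulr_ge0// exprn_ge0// addr_ge0.
exists (G + CV); first by rewrite addr_ge0.
move=> h h1; have h0 := enorm_ge0 h.
have gG y : enorm y <= enorm x + 1 -> enorm (glyap kap y) <= G.
  move=> yx; apply: le_trans (enorm_glyap_le _ k02) _; rewrite ler_wpM2l// lerXn2r ?nnegrE ?enorm_ge0//.
  by rewrite addr_ge0.
have dG y w : enorm y <= enorm x + 1 -> enorm w = enorm h ->
    dotv (glyap kap y) w + CV * enorm w ^+ 2 <= (G + CV) * enorm h.
  move=> yx wh; rewrite (mulrDl G); apply: lerD; rewrite ?wh.
    apply: le_trans (dotv_le _ _) _; rewrite wh ler_wpM2r//; exact: gG.
  by rewrite ler_wpM2l// expr2 ler_piMr.
rewrite ler_norml; apply/andP; split.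
  have := lyap_taylor rad (x + h) (- h) k02; rewrite addrK => h2.
  have := dG (x + h) (- h) _ (enormN h); have := enormD x h => h4 h3.
  have xh : enorm (x + h) <= enorm x + 1 by move: h4 h1; clear -rad0; lra.
  by move: h2 (h3 xh); clear -rad0; lra.
have xx : enorm x <= enorm x + 1 by rewrite lerDl.
by move: (lyap_taylor rad x h k02) (dG x h xx erefl); clear -rad0; lra.
Qed.

Definition doubled_weight A th kap x y := refl_dist A th (x - y) + lyap kap x + lyap kap y.

Lemma doubled_weight_ge A th kap x y : 0 <= A -> 0 <= th -> A <= doubled_weight A th kap x y.
Proof.
move=> A0 th0; have /andP[h _] := refl_dist_bounds (x - y) A0 th0.
by rewrite /doubled_weight -addrA; apply: le_trans h _; rewrite lerDl addr_ge0// ltW// lyap_gt0.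
Qed.

Lemma doubled_weight_lip A th kap x y : 0 <= A -> 0 <= th -> 0 < kap <= 2 ->
  exists2 L : R, 0 <= L & forall h k, enorm h <= 1 -> enorm k <= 1 ->
    `|doubled_weight A th kap (x + h) (y + k) - doubled_weight A th kap x y| <= L * (enorm h + enorm k).
Proof.
move=> A0 th0 k02; have [K1 K10 hK1] := lyap_lip x k02; have [K2 K20 hK2] := lyap_lip y k02.
have At0 : 0 <= A * th by rewrite mulr_ge0.
exists (A * th + K1 + K2); first by rewrite !addr_ge0.
move=> h k h1 k1; have h0 := enorm_ge0 h; have k0 := enorm_ge0 k.
rewrite /doubled_weight; have -> : x + h - (y + k) = x - y + (h - k) by rewrite opprD addrACA.
have e1 := refl_dist_lip (x - y) (h - k) A0 th0.
have e2 := le_trans e1 (ler_wpM2l At0 (enormB h k)).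
exact: norm_three_increments (hK1 h h1) (hK2 k k1).
Qed.

Lemma doubled_weight_taylor A th kap x y : 0 <= A -> 0 <= th -> 0 < kap <= 2 -> 0 < enorm (x - y) ->
  exists2 rho : R, 0 < rho & forall h k, enorm h <= rho -> enorm k <= rho ->
    doubled_weight A th kap (x + h) (y + k) <= doubled_weight A th kap x y +
      (dotv (refl_grad A th (x - y)) (h - k) + dotv (glyap kap x) h + dotv (glyap kap y) k) +
      (2^-1 * qf (refl_hess A th (x - y)) (h - k) (h - k) + CV * (enorm h ^+ 2 + enorm k ^+ 2)).
Proof.
move=> A0 th0 k02 xy0; have [rho rho0 hrho] := refl_taylor_near A0 th0 xy0.
exists (rho / 2); first by rewrite divr_gt0.
move=> h k h1 k1; rewrite /doubled_weight.
have -> : x + h - (y + k) = x - y + (h - k) by rewrite opprD addrACA.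
apply: three_taylor; [apply: hrho|exact: lyap_taylor|exact: lyap_taylor].
by apply: le_trans (enormB h k) _; lra.
Qed.

(** Space gradients of the penalty in x and in y. The second point carries -u, so both vectors are
    slopes of functions with the subsolution property. *)
Definition upper_slope (D e A th kap m : R) x y : 'rV[R]_d :=
  D *: (refl_grad A th (x - y) + glyap kap x) + e *: glyap m x.

Definition lower_slope (D e A th kap m : R) x y : 'rV[R]_d :=
  D *: (- refl_grad A th (x - y) + glyap kap y) + e *: glyap m y.

Lemma penalized_increment (T t1 C' c N n e A th kap m mu d1 Cd t s : R) u (dl : R -> R) x y :
  0 <= A -> 0 <= th -> 0 < kap <= 2 -> 0 < m <= 2 -> 0 < enorm (x - y) -> 0 < mu -> 0 <= c ->
  0 <= N -> 0 <= n -> 0 <= e -> 0 <= dl t -> 0 <= Cd ->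
  (forall t', 0 <= t' <= T -> `|dl t' - dl t| <= c * `|t' - t|) ->
  (forall t', 0 <= t' <= T -> dl t' <= dl t + d1 * (t' - t) + Cd * (t' - t) ^+ 2) ->
  (forall t' s' x' y', 0 <= t' <= T -> 0 <= s' <= T ->
     penalized T t1 C' u dl (doubled_weight A th kap) (lyap m) e N n t' s' x' y' <=
     penalized T t1 C' u dl (doubled_weight A th kap) (lyap m) e N n t s x y) ->
  exists rho Ca : R, [/\ 0 < rho, 0 <= Ca & forall ta sa h k,
    `|ta| <= rho -> `|sa| <= rho -> enorm h <= rho -> enorm k <= rho -> 0 < t + ta < T -> 0 < s + sa < T ->
    u (t + ta) (x + h) + - u (s + sa) (y + k) <= u t x + - u s y
      + (d1 * doubled_weight A th kap x y + e * C' + (2 * N * pos (t - t1) + 2 * n * (t - s))) * ta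
      + (- (2 * n * (t - s))) * sa + Ca * (ta ^+ 2 + sa ^+ 2)
      + dotv (upper_slope (dl t) e A th kap m x y) h + dotv (lower_slope (dl t) e A th kap m x y) k
      + 2^-1 * qf2 (2 * (dl t * CV + e * CV + mu)) (2 * (dl t * CV + e * CV + mu))
                   (dl t *: refl_hess A th (x - y)) h k].
Proof.
move=> A0 th0 k02 m02 xy0 mu0 c0 N0 n0 e0 dl0 Cd0 dlL dlT hmax.
have [L L0 hL] := doubled_weight_lip x y A0 th0 k02.
have [rho rho0 hrho] := doubled_weight_taylor A0 th0 k02 xy0.
set W := doubled_weight A th kap x y.
have W0 : 0 <= W by apply: le_trans A0 (doubled_weight_ge _ _ _ A0 th0).
pose B1 := Cd * W + (c * L) ^+ 2 / (2 * mu).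
have B10 : 0 <= B1.
  by apply: addr_ge0; [exact: mulr_ge0|apply: divr_ge0; [exact: sqr_ge0|exact: (ltW (mulr_gt0 _ mu0))]].
exists (Num.min rho 1), (B1 + (N + 2 * n)); split.
- by rewrite lt_min rho0 ltr01.
- by apply: addr_ge0 => //; apply: addr_ge0 => //; exact: mulr_ge0.
move=> ta sa h k; rewrite !le_min => /andP[_ _] /andP[_ _] /andP[h1 h2] /andP[k1 k2] /andP[t0 tT] /andP[s0 sT].
have tI : 0 <= t + ta <= T by rewrite !ltW.
have sI : 0 <= s + sa <= T by rewrite !ltW.
have dtE : t + ta - t = ta by rewrite addrAC subrr add0r.
have hD := product_increment_le mu0 c0 L0 (enorm_ge0 h) (enorm_ge0 k) dl0 W0
  (dlL _ tI) (dlT _ tI) (hrho h k h1 k1) (hL h k h2 k2).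
rewrite dtE in hD.
have hp := hmax (t + ta) (s + sa) (x + h) (y + k) tI sI.
have := penalized_step e0 (mulr_ge0 B10 (sqr_ge0 sa)) hp _ (lyap_taylor rad x h m02) (lyap_taylor rad y k m02)
  (time_penalty_le t t1 s ta sa N0 n0).
rewrite /qf2 qfZm /upper_slope /lower_slope !dotvDl !dotvZl !dotvDl dotvNl.
by apply; rewrite -dotvBr.
Qed.

End doubled_weight.

Section lyapunov_absorption.
Context {R : realType} {d : nat} (rad : R) (rad0 : 0 < rad).
Implicit Types x : 'rV[R]_d.

Lemma lyap_young om mu (c e : R) : 0 <= om < mu -> 0 <= c -> 0 < e ->
  exists2 C : R, 0 <= C & forall x, c * lyap rad om x <= e * lyap rad mu x + C.
Proof.
move=> /andP[om0 ommu] c0 e0; have q0 : 0 < mu - om by rewrite subr_gt0.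
pose S := (c / e + 1) `^ (mu - om)^-1.
have S0 : 0 <= S by exact: powR_ge0.
exists (c * S `^ om); first by rewrite mulr_ge0// powR_ge0.
move=> x; have l0 := ltW (lyap_gt0 rad 1 x).
have [xS|Sx] := leP (lyap rad 1 x) S.
  apply: (@le_trans _ _ (c * S `^ om)); last by rewrite lerDr mulr_ge0// ltW// lyap_gt0.
  by rewrite ler_wpM2l// lyap_powE ge0_ler_powR.
apply: (@le_trans _ _ (e * lyap rad mu x)); last by rewrite lerDl mulr_ge0// powR_ge0.
have -> : mu = om + (mu - om) by ring.
rewrite lyapD mulrCA mulrC ler_wpM2l ?(ltW (lyap_gt0 _ _ _))//.
rewrite mulrC -ler_pdivrMr// (lyap_powE _ (mu - om)); apply: (@le_trans _ _ (c / e + 1)); first by rewrite lerDl.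
have -> : c / e + 1 = S `^ (mu - om).
  by rewrite /S -powRrM mulVf ?gt_eqF// powRr1// addr_ge0// divr_ge0// ltW.
by rewrite ge0_ler_powR ?nnegrE// ltW.
Qed.

Lemma lyap_large kap (K e : R) : 0 < kap -> 0 <= K -> 0 < e ->
  exists2 L : R, 0 < L & forall x, L <= enorm x -> K <= e * lyap rad kap x.
Proof.
move=> k0 K0 e0; have B0 : 0 < (2 + rad) `^ kap by rewrite powR_gt0// addr_gt0.
have ok : (0 : R) <= (0 : R) < kap by rewrite lexx.
have [L L0 hL] := @weight_absorb R d K (e / (2 + rad) `^ kap) 0 kap ok K0 (divr_gt0 e0 B0).
exists L => // x Lx; have := hL x Lx; rewrite powRr0 mulr1 => h; apply: le_trans h _.
rewrite mulrAC -mulrA ler_wpM2l ?(ltW e0)// ler_pdivrMr// mulrC.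
by apply: japanese_le_lyap => //; exact: ltW.
Qed.

End lyapunov_absorption.

Section jump_sum.
Context {R : realType} {d : nat} (sigma lambda Lambda : R)
  (nu : {measure set 'rV[R]_d -> \bar R}).
Hypotheses (s02 : 0 < sigma < 2) (l0 : 0 <= lambda) (L0 : 0 <= Lambda)
  (hnu : levy_measure sigma lambda Lambda nu).

Lemma integrable_cutoff (f : 'rV[R]_d -> R) : measurable_fun setT f ->
  (forall z, 0 <= f z <= 1) -> (forall z, enorm z <= 1 -> f z = 0) ->
  nu.-integrable setT (EFin \o f).
Proof.
move=> mf f01 f0; apply: (integrable_dom s02 l0 L0 hnu (m := 0) (C := 1)) => //.
  by rewrite lexx; case/andP: s02.
move=> z; have /andP[h0 h1] := f01 z; rewrite ger0_norm// mul1r.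
have [z1|z1] := leP (enorm z) 1; first by rewrite f0// lw_ge0.
by rewrite lw_out// powRr0.
Qed.

(** The integrands are added before integration, because a maximum controls only their sum. Below
    the cut-off radius the integrand is 0 and so is the gain, since [e1] and [e2] vanish for small
    jumps. *)
Lemma jump_sum_le (f1 f2 : 'rV[R]_d -> R) x y p p' r (m C k1 k2 K1 K2 D : R) (e1 e2 : 'rV[R]_d -> R) :
  continuous f1 -> continuous f2 -> 0 < m < sigma -> 0 <= C ->
  (forall x, `|f1 x| <= C * japanese x `^ m) -> (forall x, `|f2 x| <= C * japanese x `^ m) ->
  0 < r <= 1 -> 0 <= k1 < sigma -> 0 <= k2 < sigma -> 0 <= K1 -> 0 <= K2 ->
  measurable_fun setT e1 -> (forall z, 0 <= e1 z <= 1) -> (forall z, enorm z <= 1 -> e1 z = 0) ->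
  measurable_fun setT e2 -> (forall z, 0 <= e2 z <= 1) -> (forall z, enorm z <= 1 -> e2 z = 0) ->
  (forall z, f1 (x + z) - f1 x - dotv p z * (enorm z <= 1)%R%:R +
             (f2 (y + z) - f2 y - dotv p' z * (enorm z <= 1)%R%:R) <=
     K1 * lw k1 z + K2 * lw k2 z - D / 2 * (e1 z + e2 z)) ->
  jump nu f1 x p r + jump nu f2 y p' r <=
    K1 * @levy_mass R d sigma Lambda k1 + K2 * @levy_mass R d sigma Lambda k2
    - D / 2 * (\int[nu]_z e1 z + \int[nu]_z e2 z).
Proof.
move=> cf1 cf2 /andP[m0 ms] C0 fC1 fC2 r01 k1s k2s K10 K20 me1 e101 e10 me2 e201 e20 hle.
have m0s : 0 <= m < sigma by rewrite (ltW m0).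
have ji f q w : continuous f -> (forall x, `|f x| <= C * japanese x `^ m) ->
    nu.-integrable setT (EFin \o jump_integrand f w q r).
  move=> cf fC; have [C' C'0 hC'] := jump_integrand_dom w q (ltW m0) r01 C0 fC.
  exact: (integrable_dom s02 l0 L0 hnu m0s (measurable_jump_integrand _ _ _ cf) hC').
have i1 := ji f1 p x cf1 fC1; have i2 := ji f2 p' y cf2 fC2.
have j1 := integrable_cutoff me1 e101 e10; have j2 := integrable_cutoff me2 e201 e20.
have w1 := integrable_lw s02 l0 L0 hnu k1s; have w2 := integrable_lw s02 l0 L0 hnu k2s.
rewrite /jump -(RintegralD measurableT i1 i2).
have h := Rintegral_le_combination (f := fun z => jump_integrand f1 x p r z + jump_integrand f2 y p' r z)
  (f1 := lw k1) (f2 := fun z => K2 * lw k2 z) (f3 := fun z => e1 z + e2 z) (c1 := K1) (c3 := - (D / 2))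
  (integrable_add i1 i2) w1 (integrable_scale K2 w2) (integrable_add j1 j2) _.
apply: le_trans (h _) _.
  move=> z; rewrite /jump_integrand; have [rz|rz] := leP r (enorm z).
    by rewrite !mul1r mulNr; exact: hle.
  rewrite !mul0r addr0 e10 ?e20; last 2 first.
  - by apply: ltW (lt_le_trans rz _); case/andP: r01.
  - by apply: ltW (lt_le_trans rz _); case/andP: r01.
  by rewrite addr0 mulr0 addr0 addr_ge0// mulr_ge0// lw_ge0.
rewrite mulNr (RintegralD measurableT j1 j2) (RintegralZl K2 measurableT w2).
apply: lerB => //; apply: lerD; rewrite ler_wpM2l//; exact: Rintegral_lw s02 l0 L0 hnu _ _.
Qed.

End jump_sum.

Section reflected_frames.
Context {R : realType} {d l : nat} (lambda0 sigma0 sigma1 : R) (Sigma : 'rV[R]_d -> 'M[R]_(d, l)).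

(** Identity frame at x and reflected frame at y for the isotropic noise, synchronous columns of
    Sigma for the rest; both have the Gram matrices prescribed by the equation. *)
Lemma coupled_frames_le x y A th c D : 0 <= lambda0 -> bounded_lipschitz sigma0 sigma1 Sigma ->
  0 <= A -> 0 <= th -> 0 <= c -> 0 <= D -> 0 < enorm (x - y) ->
  exists B B' : 'M[R]_(d + l, d),
    [/\ B^T *m B = gram lambda0 Sigma x, B'^T *m B' = gram lambda0 Sigma y &
      \sum_i qf2 c c (D *: refl_hess A th (x - y)) (row i B) (row i B') <=
      2 * c * (lambda0 * d%:R + sigma0 ^+ 2) + D * (A * expR (- (th * enorm (x - y))) * th *
        (4 * sigma1 ^+ 2 + 16 * sigma0 ^+ 2 - 2 * lambda0 * th))].
Proof.
move=> l00 hS A0 th0 c0 D0 xy0; have [hS1 hS2] := hS.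
exists (frame (Num.sqrt lambda0) 1%:M (Sigma x)), (frame (Num.sqrt lambda0) (reflection (x - y)) (Sigma y)).
have g1 : (frame (Num.sqrt lambda0) 1%:M (Sigma x))^T *m frame (Num.sqrt lambda0) 1%:M (Sigma x) =
    gram lambda0 Sigma x.
  by rewrite frame_gram sqr_sqrtr// trmx1 mul1mx /gram scalemx1.
have g2 : (frame (Num.sqrt lambda0) (reflection (x - y)) (Sigma y))^T *m
    frame (Num.sqrt lambda0) (reflection (x - y)) (Sigma y) = gram lambda0 Sigma y.
  by rewrite frame_gram sqr_sqrtr// reflection_orthogonal// /gram scalemx1.
split => //; rewrite sum_qf2_rows g1 g2 -scalemxAr mxtraceZ; apply: lerD; last first.
  rewrite ler_wpM2l// -[X in 2 * X * th]sqr_sqrtr//.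
  by apply: reflection_sum_le.
have /andP[_ h1] := trace_gram_le lambda0 x hS; have /andP[_ h2] := trace_gram_le lambda0 y hS.
by rewrite -mulrA mulrCA -mulrDr ler_wpM2l//; lra.
Qed.

End reflected_frames.

Section contact.
Context {R : realType} {d : nat} (rad : R) (rad0 : 0 < rad).
Implicit Types x y z : 'rV[R]_d.

Local Notation CJ := (15 + 12 * rad ^+ 2 + 4 * (2 + rad) ^+ 2).
Local Notation lyap := (lyap rad).
Local Notation glyap := (glyap rad).

Lemma sync_arith (u1 u2 u1' u2' D e P Q P' Q' w1 w2 v1 v2 w1' w2' v1' v2' a1 a2 c1 c2 i k1 k2 L1 L2 g : R) :
  0 <= D -> 0 <= e ->
  u1' - u2' <= u1 - u2 + D * (w1' - w1 + (w2' - w2)) + e * (v1' - v1 + (v2' - v2)) - g ->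
  w1' - w1 - a1 * i <= k1 * P * L1 -> w2' - w2 - a2 * i <= k1 * Q * L1 ->
  v1' - v1 - c1 * i <= k2 * P' * L2 -> v2' - v2 - c2 * i <= k2 * Q' * L2 ->
  u1' - u1 - (D * a1 + e * c1) * i + (- u2' - - u2 - (D * a2 + e * c2) * i) <=
  D * (k1 * (P + Q)) * L1 + e * (k2 * (P' + Q')) * L2 - g.
Proof.
move=> D0 e0 hu h1 h2 h3 h4.
have g1 := ler_wpM2l D0 (lerD h1 h2); have g2 := ler_wpM2l e0 (lerD h3 h4).
rewrite -subr_ge0 in hu; rewrite -subr_ge0 in g1; rewrite -subr_ge0 in g2.
rewrite -subr_ge0; apply: le_trans (addr_ge0 (addr_ge0 hu g1) g2) _.
by rewrite le_eqVlt; apply/orP; left; apply/eqP; ring.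
Qed.

Lemma sync_gradient_cancel (a b D e q g1 g2 h1 h2 i c : R) :
  a - (D * g1 + e * h1) * i + (b - (D * g2 + e * h2) * i) <= c ->
  a - (D * (q + g1) + e * h1) * i + (b - (D * (- q + g2) + e * h2) * i) <= c.
Proof.
move=> h; apply: le_trans h; rewrite le_eqVlt; apply/orP; left; apply/eqP; ring.
Qed.

Lemma dotv_upper_slope D e A th kap m x y w : dotv (upper_slope rad D e A th kap m x y) w =
  D * (dotv (refl_grad A th (x - y)) w + dotv (glyap kap x) w) + e * dotv (glyap m x) w.
Proof. by rewrite /upper_slope dotvDl (dotvZl D) dotvDl (dotvZl e). Qed.

Lemma dotv_lower_slope D e A th kap m x y w : dotv (lower_slope rad D e A th kap m x y) w =
  D * (- dotv (refl_grad A th (x - y)) w + dotv (glyap kap y) w) + e * dotv (glyap m y) w.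
Proof. by rewrite /lower_slope dotvDl (dotvZl D) dotvDl dotvNl (dotvZl e). Qed.

Lemma contact_arith (W1 E P q X Y S J1 J2 G c eps r Z T1 K1 K2 : R) : 0 <= P ->
  W1 + E + (P + q) + - q + X + Y <= S + J1 + J2 + r -> r <= eps ->
  S <= 2 * (2 * (c + eps)) * G + T1 -> J1 + J2 <= K1 + K2 - Z ->
  W1 + E + X + Y <= 4 * c * G + T1 + K1 + K2 - Z + eps * (4 * G + 1).
Proof.
move=> P0 h1 h2 h3 h4.
have -> : 4 * c * G + T1 + K1 + K2 - Z + eps * (4 * G + 1) = 2 * (2 * (c + eps)) * G + T1 + (K1 + K2 - Z) + eps.
  ring.
lra.
Qed.

Lemma sync_jump_le (f1 f2 : 'rV[R]_d -> R) D e A th kap m x y z g : 0 <= D -> 0 <= e ->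
  0 < kap <= 2 -> 0 < m <= 2 ->
  f1 (x + z) - f2 (y + z) <= f1 x - f2 y + D * (lyap kap (x + z) - lyap kap x + (lyap kap (y + z) - lyap kap y))
    + e * (lyap m (x + z) - lyap m x + (lyap m (y + z) - lyap m y)) - g ->
  f1 (x + z) - f1 x - dotv (upper_slope rad D e A th kap m x y) z * (enorm z <= 1)%R%:R +
    (- f2 (y + z) - - f2 y - dotv (lower_slope rad D e A th kap m x y) z * (enorm z <= 1)%R%:R) <=
  D * (CJ * (lyap (Num.max 0 (kap - 1)) x + lyap (Num.max 0 (kap - 1)) y)) * lw kap z +
  e * (CJ * (lyap (Num.max 0 (m - 1)) x + lyap (Num.max 0 (m - 1)) y)) * lw m z - g.
Proof.
move=> D0 e0 k02 m02 h.
rewrite !dotv_upper_slope !dotv_lower_slope.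
have := sync_arith D0 e0 h (lyap_jump rad0 x z k02) (lyap_jump rad0 y z k02)
  (lyap_jump rad0 x z m02) (lyap_jump rad0 y z m02).
exact: sync_gradient_cancel.
Qed.

End contact.

Section contact_inequality.
Context {R : realType} {d l : nat} (sigma lambda Lambda lambda0 sigma0 sigma1 T rad : R)
  (nu : {measure set 'rV[R]_d -> \bar R}) (Sigma : 'rV[R]_d -> 'M[R]_(d, l))
  (b : R -> 'rV[R]_d -> 'rV[R]_d).
Hypotheses (d0 : (0 < d)%N) (s02 : 0 < sigma < 2) (l0 : 0 <= lambda) (l00 : 0 <= lambda0) (L0 : 0 <= Lambda)
  (hnu : levy_measure sigma lambda Lambda nu) (hS : bounded_lipschitz sigma0 sigma1 Sigma)
  (cb : {in [set p : R * 'rV[R]_d | 0 < p.1], continuous (fun p => b p.1 p.2)})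
  (rad0 : 0 < rad).

Local Notation CV := (15 + 12 * rad ^+ 2).
Local Notation CJ := (15 + 12 * rad ^+ 2 + 4 * (2 + rad) ^+ 2).
Local Notation lyap := (lyap rad).
Local Notation glyap := (glyap rad).
Local Notation mass := (@levy_mass R d sigma Lambda).
Local Notation tail m x y := (CJ * (lyap (Num.max 0 (m - 1)) x + lyap (Num.max 0 (m - 1)) y)).

Lemma contact_inequality u mu0 C0 (t1 C' c N n e A th kap m d1 Cd t s : R) (dl : R -> R) x y
    (D : R) (e1 e2 : 'rV[R]_d -> R) :
  sep_sub sigma lambda0 T nu Sigma b u -> sep_sub sigma lambda0 T nu Sigma b (fun t x => - u t x) ->
  growth sigma T mu0 C0 u -> 0 < t < T -> 0 < s < T ->
  0 <= A -> 0 <= th -> 0 < kap <= 2 -> 0 < m <= 2 -> kap < sigma -> m < sigma -> 0 < enorm (x - y) ->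
  0 <= c -> 0 <= N -> 0 <= n -> 0 <= e -> 0 <= dl t -> 0 <= Cd ->
  (forall t', 0 <= t' <= T -> `|dl t' - dl t| <= c * `|t' - t|) ->
  (forall t', 0 <= t' <= T -> dl t' <= dl t + d1 * (t' - t) + Cd * (t' - t) ^+ 2) ->
  (forall t' s' x' y', 0 <= t' <= T -> 0 <= s' <= T ->
     penalized T t1 C' u dl (doubled_weight rad A th kap) (lyap m) e N n t' s' x' y' <=
     penalized T t1 C' u dl (doubled_weight rad A th kap) (lyap m) e N n t s x y) ->
  measurable_fun setT e1 -> (forall z, 0 <= e1 z <= 1) -> (forall z, enorm z <= 1 -> e1 z = 0) ->
  measurable_fun setT e2 -> (forall z, 0 <= e2 z <= 1) -> (forall z, enorm z <= 1 -> e2 z = 0) ->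
  (forall z, u t (x + z) - u s (y + z) <= u t x - u s y
    + dl t * (lyap kap (x + z) - lyap kap x + (lyap kap (y + z) - lyap kap y))
    + e * (lyap m (x + z) - lyap m x + (lyap m (y + z) - lyap m y)) - D / 2 * (e1 z + e2 z)) ->
  d1 * doubled_weight rad A th kap x y + e * C' +
    dotv (b t x) (upper_slope rad (dl t) e A th kap m x y) +
    dotv (b s y) (lower_slope rad (dl t) e A th kap m x y) <=
  4 * (dl t * CV + e * CV) * (lambda0 * d%:R + sigma0 ^+ 2) +
  dl t * (A * expR (- (th * enorm (x - y))) * th * (4 * sigma1 ^+ 2 + 16 * sigma0 ^+ 2 - 2 * lambda0 * th)) +
  dl t * tail kap x y * mass kap + e * tail m x y * mass m
  - D / 2 * (\int[nu]_z e1 z + \int[nu]_z e2 z).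
Proof.
move=> hu hv gu tT sT A0 th0 k02 m02 ks ms xy0 c0 N0 n0 e0 dl0 Cd0 dlL dlT hmax me1 e101 e10 me2 e201 e20 hz.
set G := lambda0 * d%:R + sigma0 ^+ 2; have G0 : 0 <= G by rewrite addr_ge0 ?sqr_ge0// mulr_ge0.
have CV0 : 0 <= CV by rewrite addr_ge0// mulr_ge0// sqr_ge0.
have CJ0 : 0 <= CJ by rewrite addr_ge0// mulr_ge0// sqr_ge0.
have tail0 k : 0 <= tail k x y by rewrite mulr_ge0// addr_ge0// ltW// lyap_gt0.
have [mu0s C00 cu uC] := gu.
have gv : growth sigma T mu0 C0 (fun t x => - u t x).
  split => //; last by move=> t' x' h; rewrite normrN uC.
  by move=> p; apply: cvgN; exact: cu.
have tI : 0 <= t <= T by case/andP: tT => /ltW -> /ltW ->.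
have sI : 0 <= s <= T by case/andP: sT => /ltW -> /ltW ->.
have csl t' : 0 <= t' <= T -> continuous (u t') by move=> h; exact: continuous_slice h cu.
(* [eps] serves both as the coefficient of the mixed time-space terms and as the bound for the jumps
   below r. *)
apply: (@le_of_small_error _ _ _ (4 * G + 1)) => eps eps0.
have [rho [Ca [rho0 Ca0 hinc]]] := penalized_increment A0 th0 k02 m02 xy0 eps0 c0 N0 n0 e0 dl0 Cd0 dlL dlT hmax.
set c1 := 2 * (dl t * CV + e * CV + eps) in hinc.
have c10 : 0 <= c1 by rewrite mulr_ge0// !addr_ge0 ?mulr_ge0// ltW.
have [B [B' [g1 g2 hB]]] := coupled_frames_le l00 hS A0 th0 c10 dl0 xy0.
have dl_pos : (0 < d + l)%N by rewrite addn_gt0 d0.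
have [r0 /andP[r00 r01] [M hM]] := doubling s02 l0 L0 hnu hS cb dl_pos hu hv gu gv tT sT rho0 Ca0 g1 g2 hinc.
have s2 : 0 < 2 - sigma by rewrite subr_gt0; case/andP: s02.
have [h0 h00 hh] := small_powR M s2 eps0.
(* [M] depends on [eps], so r is chosen after it. *)
pose r := Num.min r0 h0.
have rr : 0 < r <= r0 by rewrite lt_min r00 h00 ge_min lexx.
have r1 : 0 < r <= 1 by case/andP: rr => -> h; exact: le_trans h r01.
have hr : M * r `^ (2 - sigma) <= eps by apply: hh; [case/andP: rr|rewrite ge_min lexx orbT].
have K1 : 0 <= dl t * tail kap x y by rewrite mulr_ge0.
have K2 : 0 <= e * tail m x y by rewrite mulr_ge0.
have ks' : 0 <= kap < sigma by case/andP: k02 => /ltW ->.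
have ms' : 0 <= m < sigma by case/andP: m02 => /ltW ->.
have csN : continuous (fun y' : 'rV[R]_d => - u s y') by move=> y'; exact: continuousN (csl s sI y').
have uN x' : `|- u s x'| <= C0 * japanese x' `^ mu0 by rewrite normrN; exact: uC.
have hj := jump_sum_le s02 l0 L0 hnu (csl _ tI) csN mu0s C00 (fun x => uC t x tI) uN r1 ks' ms' K1 K2 me1 e101 e10 me2 e201 e20
  (fun z => sync_jump_le rad0 A th dl0 e0 k02 m02 (hz z)).
have Np : 0 <= 2 * N * pos (t - t1) by rewrite !mulr_ge0// le_max lexx orbT.
exact: contact_arith Np (hM r rr) hr hB hj.
Qed.

End contact_inequality.

Section comparison_tools.
Context {R : realType} {d : nat}.
Implicit Types x y w z : 'rV[R]_d.

Lemma drift_time_modulus (b : R -> 'rV[R]_d -> 'rV[R]_d) (tau T L e : R) :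
  {in [set p : R * 'rV[R]_d | 0 < p.1], continuous (fun p => b p.1 p.2)} -> 0 < tau -> 0 < e ->
  exists2 r : R, 0 < r & forall t s y, tau <= t <= T -> tau <= s <= T -> enorm y <= L -> `|t - s| < r ->
    enorm (b t y - b s y) <= e.
Proof.
move=> cb tau0 e0; have D0 : 0 < d.+1%:R :> R by rewrite ltr0n.
have e'0 : 0 < e / d.+1%:R by rewrite divr_gt0.
have cA := compact_setX (@segment_compact _ tau T) (@compact_enorm_le R d L).
have ci i : {within `[tau, T] `*` [set x | enorm x <= L], continuous (fun p : R * 'rV[R]_d => b p.1 p.2 ord0 i)}.
  apply/subspace_continuousP => p [/= pt _]; apply: cvg_within_filter.
  have p0 : 0 < p.1 by move: pt; rewrite in_itv /= => /andP[h _]; exact: lt_le_trans h.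
  exact: (continuous_comp (cb p (mem_set p0)) (@coord_continuous _ _ _ ord0 i (b p.1 p.2))).
have [|i _|r r0 hr] := @common_radius R _ (enum 'I_d)
  (fun i r => forall t s y, tau <= t <= T -> tau <= s <= T -> enorm y <= L -> `|t - s| < r ->
    `|b t y ord0 i - b s y ord0 i| < e / d.+1%:R).
- by move=> i r r' r'0 rr' h t s y tT sT yL ts; apply: h => //; exact: lt_le_trans ts rr'.
- have [r r0 h] := heine_cantor cA (ci i) e'0; exists r => // t s y tT sT yL ts.
  apply: (h (t, y) (s, y)); [by split => //=; rewrite in_itv..|].
  by split => //=; exact: ballxx.
exists r => // t s y tT sT yL ts; apply: le_trans (enorm_le_mxnorm _) _.
rewrite mulrC -ler_pdivlMr// ltW// /Num.norm/= mx_normrE.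
apply/bigmax_ltP; split => // ij _ /=; rewrite !mxE (ord1 ij.1); apply: hr => //.
by rewrite mem_enum.
Qed.

Lemma lyap_absorb_growth (rad C mu0 m e : R) : 0 < rad -> 0 <= mu0 < m -> 0 <= C -> 0 < e ->
  exists M L : R, [/\ 0 <= M, forall x, C * japanese x `^ mu0 <= e * lyap rad m x + M &
     forall x, L <= enorm x -> C * japanese x `^ mu0 + M <= e * lyap rad m x].
Proof.
move=> rad0 mm C0 e0; have /andP[mu00 mm'] := mm; have m0 : 0 < m by exact: le_lt_trans mm'.
have c0 : 0 <= C * (2 + rad) `^ mu0 by rewrite mulr_ge0// powR_ge0.
have e20 : 0 < e / 2 by rewrite divr_gt0.
have e40 : 0 < e / 4 by rewrite divr_gt0.
have [M M0 hM] := @lyap_young R d rad mu0 m _ _ mm c0 e20.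
have [L L0 hL] := @lyap_large R d rad rad0 m M (e / 4) m0 M0 e40.
have h x : C * japanese x `^ mu0 <= e / 2 * lyap rad m x + M.
  by apply: le_trans (hM x); rewrite -mulrA ler_wpM2l// japanese_le_lyap.
have l0 x : 0 <= e * lyap rad m x by rewrite mulr_ge0 ?(ltW e0)// ltW// lyap_gt0.
exists M, L; split => //.
  by move=> x; apply: le_trans (h x) _; move: (l0 x); rewrite mulrAC; clear; lra.
move=> x /hL; move: (h x) (l0 x); rewrite [e / 2 * _]mulrAC [e / 4 * _]mulrAC; clear; lra.
Qed.

Lemma continuous_refl_dist (A th : R) : continuous (@refl_dist R d A th).
Proof.
apply: (@continuous_compf R d (@enorm R d) (fun r => A * (2 - expR (- (th * r))))).
  exact: continuous_enorm.
move=> v; apply: cvgM; first exact: cvg_cst.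
apply: cvgB; first exact: cvg_cst.
apply: (continuous_comp (f := fun r => - (th * r))); last exact: continuous_expR.
by apply: cvgN; apply: cvgM; [exact: cvg_cst|exact: cvg_id].
Qed.

Lemma continuous_lyap (rad kap : R) : 0 < kap <= 2 -> continuous (@lyap R d rad kap).
Proof. by move=> k02; have [H [hC _]] := @C2_lyap R d rad _ k02; case: hC. Qed.

Lemma continuous_doubled_weight (rad A th kap : R) : 0 < kap <= 2 ->
  continuous (fun p : (R * 'rV[R]_d) * (R * 'rV[R]_d) => doubled_weight rad A th kap p.1.2 p.2.2).
Proof.
move=> k02 p.
have c1 : {for p, continuous (fun p : (R * 'rV[R]_d) * (R * 'rV[R]_d) => p.1.2)}.
  by apply: (continuous_comp (f := @fst (R * 'rV[R]_d) (R * 'rV[R]_d))); [exact: cvg_fst|exact: cvg_snd].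
have c2 : {for p, continuous (fun p : (R * 'rV[R]_d) * (R * 'rV[R]_d) => p.2.2)}.
  by apply: (continuous_comp (f := @snd (R * 'rV[R]_d) (R * 'rV[R]_d))); [exact: cvg_snd|exact: cvg_snd].
apply: cvgD; first apply: cvgD.
- apply: (continuous_comp (f := fun p : (R * 'rV[R]_d) * (R * 'rV[R]_d) => p.1.2 - p.2.2)).
    by apply: cvgB; [exact: c1|exact: c2].
  exact: continuous_refl_dist.
- by apply: (continuous_comp c1); exact: continuous_lyap.
- by apply: (continuous_comp c2); exact: continuous_lyap.
Qed.

Lemma doubled_weight_bounded (rad A th kap L : R) : 0 <= A -> 0 <= th -> 0 < kap <= 2 ->
  exists B, forall x y, enorm x <= L -> enorm y <= L -> doubled_weight rad A th kap x y <= B.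
Proof.
move=> A0 th0 k02; have [M M0 hM] := continuous_bounded L (@continuous_lyap rad _ k02).
exists (2 * A + M + M) => x y xL yL; rewrite /doubled_weight.
have /andP[_ h] := refl_dist_bounds (x - y) A0 th0.
have h1 := le_trans (ler_norm _) (hM x xL); have h2 := le_trans (ler_norm _) (hM y yL).
exact: lerD (lerD h h1) h2.
Qed.

(** The same jump at both points leaves x - y, hence phi, unchanged, and only the Lyapunov terms
    move. The vanishing last term is the general gain with D = 0. *)
Lemma sync_of_max T t1 C' e N n A th rad kap m t s u (dl : R -> R) x y :
  0 <= t <= T -> 0 <= s <= T ->
  (forall t' s' x' y', 0 <= t' <= T -> 0 <= s' <= T ->
     penalized T t1 C' u dl (doubled_weight rad A th kap) (lyap rad m) e N n t' s' x' y' <=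
     penalized T t1 C' u dl (doubled_weight rad A th kap) (lyap rad m) e N n t s x y) ->
  forall z, u t (x + z) - u s (y + z) <= u t x - u s y
    + dl t * (lyap rad kap (x + z) - lyap rad kap x + (lyap rad kap (y + z) - lyap rad kap y))
    + e * (lyap rad m (x + z) - lyap rad m x + (lyap rad m (y + z) - lyap rad m y)) - 0 / 2 * (0 + 0).
Proof.
move=> tT sT h z; have := h t s (x + z) (y + z) tT sT; rewrite /penalized /doubled_weight.
have -> : x + z - (y + z) = x - y by rewrite opprD addrACA subrr addr0.
move: (refl_dist _ _ _) (lyap rad kap) (lyap rad m) => r k k'; clear; rewrite mul0r mul0r subr0 !mulrDr !mulrN; lra.
Qed.

(** For th = 0 the weight is a function of x plus a function of y, so each point can be varied alone
    in the maximum; this permits different jumps at the two points. *)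
Lemma slack_of_max T t1 C' e N n A rad kap m t s u (dl : R -> R) x y :
  let g := fun w => dl t * lyap rad kap w + e * lyap rad m w in
  0 <= t <= T -> 0 <= s <= T ->
  (forall t' s' x' y', 0 <= t' <= T -> 0 <= s' <= T ->
     penalized T t1 C' u dl (doubled_weight rad A 0 kap) (lyap rad m) e N n t' s' x' y' <=
     penalized T t1 C' u dl (doubled_weight rad A 0 kap) (lyap rad m) e N n t s x y) ->
  (forall w, 0 <= u t x - g x + g w - u t w) /\ (forall w, 0 <= u s w + g w - (u s y + g y)).
Proof.
move=> g tT sT h; split=> w; have := h t s; rewrite /penalized /doubled_weight /refl_dist !mul0r oppr0 expR0.
- move=> /(_ w y tT sT); rewrite !mul0r oppr0 expR0 /g.
  by move: (lyap rad kap) (lyap rad m) => k k'; clear; rewrite !mulrDr; lra.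
- move=> /(_ x w tT sT); rewrite !mul0r oppr0 expR0 /g.
  by move: (lyap rad kap) (lyap rad m) => k k'; clear; rewrite !mulrDr; lra.
Qed.

End comparison_tools.

Section comparison_arithmetic.
Context {R : realType}.

Lemma absorb_tail (CJ M w k P C : R) : 0 <= CJ -> 0 <= w -> CJ * `|M| * w <= k * P + C -> CJ * w * M <= k * P + C.
Proof.
move=> CJ0 w0; apply: le_trans; rewrite mulrAC -!mulrA ler_wpM2l// ler_wpM2r//; exact: ler_norm.
Qed.

(** The choice of C' makes the sum of all terms with factor [e] favourable, so they drop out and the
    outcome no longer depends on the penalty or on its exponent m. *)
Lemma core_arith (W1 e C' q1 q2 gx gy mx my dl CV G0 G T CJ wx wy wx' wy' Mk Mm Z ka ma Px Py Px' Py' C2 C3 : R) :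
  0 <= dl -> 0 <= e -> 0 <= CV -> G0 <= G ->
  W1 + e * C' + (dl * (q1 + gx) + e * mx) + (dl * (- q2 + gy) + e * my) <=
    4 * (dl * CV + e * CV) * G0 + dl * T + dl * (CJ * (wx + wy)) * Mk + e * (CJ * (wx' + wy')) * Mm - Z ->
  ka / 2 * Px - ka <= gx -> ka / 2 * Py - ka <= gy -> ma / 2 * Px' - ma <= mx -> ma / 2 * Py' - ma <= my ->
  CJ * wx * Mk <= ka / 8 * Px + C2 -> CJ * wy * Mk <= ka / 8 * Py + C2 ->
  CJ * wx' * Mm <= ma / 2 * Px' + C3 -> CJ * wy' * Mm <= ma / 2 * Py' + C3 ->
  2 * ma + 4 * CV * G + 2 * C3 <= C' ->
  W1 + dl * (q1 - q2) + dl * (3 * ka / 8 * (Px + Py)) + Z <= dl * (2 * ka + 4 * CV * G + 2 * C2 + T).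
Proof.
move=> dl0 e0 CV0 GG H h1 h2 h3 h4 h5 h6 h7 h8 h9.
have g : CV * G0 <= CV * G by rewrite ler_wpM2l.
have a1 : 0 <= dl * (gx + gy + 4 * CV * G - 4 * CV * G0 - CJ * wx * Mk - CJ * wy * Mk
    - 3 * ka / 8 * (Px + Py) + 2 * ka + 2 * C2).
  by rewrite mulr_ge0//; move: h1 h2 h5 h6 g; clear; lra.
have a2 : 0 <= e * (C' + mx + my - 4 * CV * G0 - CJ * wx' * Mm - CJ * wy' * Mm).
  by rewrite mulr_ge0//; move: h3 h4 h7 h8 h9 g; clear; lra.
rewrite -subr_ge0 in H; rewrite -subr_ge0; apply: le_trans (addr_ge0 (addr_ge0 H a1) a2) _.
by rewrite le_eqVlt; apply/orP; left; apply/eqP; field.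
Qed.

(** The budget, in multiples of [kap * alpha]: the drift yields 1/2 of the powers; the jumps have
    taken 1/8, the decay of the time factor takes 1/4, and the last 1/8 competes with the constant
    [K]. *)
Lemma contact_contradiction (dl W1 X T ka Px Py K Z : R) : 0 < dl ->
  W1 + dl * X + dl * (3 * ka / 8 * (Px + Py)) + Z <= dl * (K + T) ->
  - W1 <= dl * (ka / 4 * (Px + Py)) ->
  dl * (K + 2^-1) <= dl * (X - T + ka / 8 * (Px + Py)) + Z -> False.
Proof.
move=> dl0; rewrite !mulrDr !mulrN => h1 h2 h3.
have : dl * 2^-1 <= 0.
  have E : dl * (3 * ka / 8 * Px + 3 * ka / 8 * Py) = dl * (ka / 4 * Px + ka / 4 * Py) + dl * (ka / 8 * Px + ka / 8 * Py).
    by field.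
  move: h1 h2 h3; rewrite -!mulrDr in E *; lra.
by rewrite leNgt mulr_gt0// invr_gt0.
Qed.

End comparison_arithmetic.

Section core_inequality.
Context {R : realType} {d l : nat} (alpha gamma sigma lambda Lambda lambda0 sigma0 sigma1 T rad : R)
  (nu : {measure set 'rV[R]_d -> \bar R}) (Sigma : 'rV[R]_d -> 'M[R]_(d, l))
  (b : R -> 'rV[R]_d -> 'rV[R]_d).
Hypotheses (d0 : (0 < d)%N) (s02 : 0 < sigma < 2) (l0 : 0 <= lambda) (l00 : 0 <= lambda0) (L0 : 0 <= Lambda)
  (hnu : levy_measure sigma lambda Lambda nu) (hS : bounded_lipschitz sigma0 sigma1 Sigma)
  (cb : {in [set p : R * 'rV[R]_d | 0 < p.1], continuous (fun p => b p.1 p.2)})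
  (rad0 : 0 < rad) (al0 : 0 < alpha) (g12 : 1 < gamma < 2) (hb : coercive_drift alpha gamma rad b).

Local Notation CV := (15 + 12 * rad ^+ 2).
Local Notation CJ := (15 + 12 * rad ^+ 2 + 4 * (2 + rad) ^+ 2).
Local Notation lyap := (lyap rad).
Local Notation mass := (@levy_mass R d sigma Lambda).

Lemma core_inequality u mu0 C0 (t1 C' c N n e A th kap m d1 Cd t s G C2 C3 : R) (dl : R -> R) x y
    (D : R) (e1 e2 : 'rV[R]_d -> R) :
  sep_sub sigma lambda0 T nu Sigma b u -> sep_sub sigma lambda0 T nu Sigma b (fun t x => - u t x) ->
  growth sigma T mu0 C0 u -> 0 < t < T -> 0 < s < T ->
  0 <= A -> 0 <= th -> 2 - gamma < kap < sigma -> 2 - gamma < m < sigma -> 0 < enorm (x - y) ->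
  0 <= c -> 0 <= N -> 0 <= n -> 0 <= e -> 0 <= dl t -> 0 <= Cd ->
  (forall t', 0 <= t' <= T -> `|dl t' - dl t| <= c * `|t' - t|) ->
  (forall t', 0 <= t' <= T -> dl t' <= dl t + d1 * (t' - t) + Cd * (t' - t) ^+ 2) ->
  (forall t' s' x' y', 0 <= t' <= T -> 0 <= s' <= T ->
     penalized T t1 C' u dl (doubled_weight rad A th kap) (lyap m) e N n t' s' x' y' <=
     penalized T t1 C' u dl (doubled_weight rad A th kap) (lyap m) e N n t s x y) ->
  measurable_fun setT e1 -> (forall z, 0 <= e1 z <= 1) -> (forall z, enorm z <= 1 -> e1 z = 0) ->
  measurable_fun setT e2 -> (forall z, 0 <= e2 z <= 1) -> (forall z, enorm z <= 1 -> e2 z = 0) ->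
  (forall z, u t (x + z) - u s (y + z) <= u t x - u s y
    + dl t * (lyap kap (x + z) - lyap kap x + (lyap kap (y + z) - lyap kap y))
    + e * (lyap m (x + z) - lyap m x + (lyap m (y + z) - lyap m y)) - D / 2 * (e1 z + e2 z)) ->
  lambda0 * d%:R + sigma0 ^+ 2 <= G ->
  (forall x : 'rV[R]_d, CJ * `|mass kap| * lyap (Num.max 0 (kap - 1)) x <=
     kap * alpha / 8 * lyap (kap - (2 - gamma)) x + C2) ->
  (forall x : 'rV[R]_d, CJ * `|mass m| * lyap (Num.max 0 (m - 1)) x <=
     m * alpha / 2 * lyap (m - (2 - gamma)) x + C3) ->
  2 * (m * alpha) + 4 * CV * G + 2 * C3 <= C' ->
  d1 * doubled_weight rad A th kap x y +
    dl t * (dotv (b t x) (refl_grad A th (x - y)) - dotv (b s y) (refl_grad A th (x - y))) +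
    dl t * (3 * (kap * alpha) / 8 * (lyap (kap - (2 - gamma)) x + lyap (kap - (2 - gamma)) y)) +
    D / 2 * (\int[nu]_z e1 z + \int[nu]_z e2 z) <=
  dl t * (2 * (kap * alpha) + 4 * CV * G + 2 * C2 +
    A * expR (- (th * enorm (x - y))) * th * (4 * sigma1 ^+ 2 + 16 * sigma0 ^+ 2 - 2 * lambda0 * th)).
Proof.
move=> hu hv gu tT sT A0 th0 ks ms xy0 c0 N0 n0 e0 dl0 Cd0 dlL dlT hmax me1 e101 e10 me2 e201 e20 hz GG h2 h3 hC'.
have b0 : 0 < 2 - gamma by rewrite subr_gt0; case/andP: g12.
have /andP[kb ksig] := ks; have /andP[mb msig] := ms.
have s2 : sigma < 2 by case/andP: s02.
have k02 : 0 < kap <= 2 by rewrite (lt_trans b0 kb) (ltW (lt_trans ksig s2)).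
have m02 : 0 < m <= 2 by rewrite (lt_trans b0 mb) (ltW (lt_trans msig s2)).
have kb2 : 2 - gamma < kap <= 2 by rewrite kb; case/andP: k02.
have mb2 : 2 - gamma < m <= 2 by rewrite mb; case/andP: m02.
have := contact_inequality d0 s02 l0 l00 L0 hnu hS cb rad0 hu hv gu tT sT A0 th0 k02 m02 ksig msig xy0
  c0 N0 n0 e0 dl0 Cd0 dlL dlT hmax me1 e101 e10 me2 e201 e20 hz.
rewrite (dotvC (b t x)) dotv_upper_slope (dotvC (b s y)) dotv_lower_slope => H.
have t0 : 0 < t by case/andP: tT.
have s0 : 0 < s by case/andP: sT.
have dr k q w : 2 - gamma < k <= 2 -> 0 < q ->
    k * alpha / 2 * lyap (k - (2 - gamma)) w - k * alpha <= dotv (glyap rad k w) (b q w).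
  by move=> hk q0; rewrite dotvC; apply: lyap_drift => // hw; exact: hb.
have CV0 : 0 <= CV by rewrite addr_ge0// mulr_ge0// sqr_ge0.
have CJ0 : 0 <= CJ by rewrite addr_ge0// mulr_ge0// sqr_ge0.
rewrite (dotvC (b t x)) (dotvC (b s y)).
exact: (core_arith dl0 e0 CV0 GG H (dr _ _ _ kb2 t0) (dr _ _ _ kb2 s0) (dr _ _ _ mb2 t0) (dr _ _ _ mb2 s0)
  (absorb_tail CJ0 (ltW (lyap_gt0 _ _ _)) (h2 x)) (absorb_tail CJ0 (ltW (lyap_gt0 _ _ _)) (h2 y))
  (absorb_tail CJ0 (ltW (lyap_gt0 _ _ _)) (h3 x)) (absorb_tail CJ0 (ltW (lyap_gt0 _ _ _)) (h3 y)) hC').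
Qed.

End core_inequality.

Section contact_contradictions.
Context {R : realType} {d : nat}.
Implicit Types v w : 'rV[R]_d.

(** The one-sided Lipschitz bound loses [c0] times the slope A th exp(- th r) of phi, a loss
    proportional to the reflection gain; with [L1] at most - c0 - 1 a full slope is left over. The
    error 1/2 is for the drift at two different times. *)
Lemma reflection_drift_le (A th c0 L1 : R) v (bx bty by' : 'rV[R]_d) : 0 <= A -> 0 <= th -> 0 < enorm v ->
  - c0 * enorm v <= dotv (bx - bty) v -> enorm (bty - by') * (A * th) <= 2^-1 -> c0 + L1 + 1 <= 0 ->
  A * th * expR (- (th * enorm v)) - 2^-1 <=
  dotv bx (refl_grad A th v) - dotv by' (refl_grad A th v) - A * expR (- (th * enorm v)) * th * L1.
Proof.
move=> A0 th0 v0 h1 h2 h3; set E := expR _; have E0 : 0 <= E by exact: expR_ge0.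
have E1 : E <= 1 by rewrite /E -expR0 ler_expR oppr_le0 mulr_ge0// enorm_ge0.
have a0 : 0 <= A * E * th by rewrite !mulr_ge0.
have At0 : 0 <= A * th by rewrite mulr_ge0.
have -> : dotv bx (refl_grad A th v) - dotv by' (refl_grad A th v) =
    dotv (bx - bty) (refl_grad A th v) + dotv (bty - by') (refl_grad A th v).
  by rewrite !dotvBl addrA subrK.
have g1 : - (A * E * th * c0) <= dotv (bx - bty) (refl_grad A th v).
  rewrite /refl_grad dotvZr -/E.
  apply: (@le_trans _ _ (A * E * th / enorm v * (- c0 * enorm v))); last by rewrite ler_wpM2l// divr_ge0// ltW.
  by rewrite le_eqVlt; apply/orP; left; apply/eqP; field; rewrite gt_eqF.
have g2 : - 2^-1 <= dotv (bty - by') (refl_grad A th v).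
  apply: le_trans (dotv_ge _ _); rewrite lerN2; apply: le_trans h2; rewrite ler_wpM2l ?enorm_ge0//.
  rewrite /refl_grad -/E enormZ ger0_norm; last by rewrite divr_ge0// ltW.
  by rewrite divfK ?gt_eqF// mulrAC ler_piMr.
have g3 : A * E * th * (c0 + L1 + 1) <= 0 by rewrite mulr_ge0_le0.
move: g1 g2 g3; rewrite (mulrAC A th E) !mulrDr mulr1; lra.
Qed.

Lemma slope_arith (a c e q : R) : a + c + e + 1 <= q -> e + (a + c - q) + 1 <= 0.
Proof. by move=> *; lra. Qed.

Lemma slack_sum_ge (ut us gx gy gw utw usw DA err : R) : DA + (gx + gy) <= ut - us ->
  `|utw - usw| <= err -> 0 <= gw -> DA - err <= ut - gx + gw - utw + (usw + gw - (us + gy)).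
Proof. by rewrite ler_norml => ? /andP[_ ?] ?; lra. Qed.

Lemma constant_weight (A D e k1 k2 m1 m2 : R) :
  D * (A * (2 - 1) + k1 + k2) + e * (m1 + m2) = D * A + (D * k1 + e * m1 + (D * k2 + e * m2)).
Proof. by ring. Qed.

Lemma slack_jump (ut us ux uy D1 D2 e kx kx' ky ky' vx vx' vy vy' a1 a2 : R) :
  D2 * a1 <= ux - (D1 * kx + e * vx) + (D1 * kx' + e * vx') - ut ->
  D2 * a2 <= us + (D1 * ky' + e * vy') - (uy + (D1 * ky + e * vy)) ->
  ut - us <= ux - uy + D1 * (kx' - kx + (ky' - ky)) + e * (vx' - vx + (vy' - vy)) - D2 * (a1 + a2).
Proof. by rewrite !mulrDr !mulrN => *; lra. Qed.

Lemma far_or_near_reflection (K P X T AE : R) : AE - 2^-1 <= X - T -> 0 <= AE -> 0 <= P ->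
  K + 1 <= P \/ K + 1 <= AE -> K + 2^-1 <= X - T + P.
Proof. by move=> h1 h2 h3 [h|h]; lra. Qed.

Lemma merging_gain (dl A err rate I K P : R) : 0 <= err -> err * rate <= dl -> 2 * (K + 1) <= A * rate -> 0 <= rate ->
  rate <= I -> 0 <= dl -> 0 <= P -> err <= dl * A ->
  dl * (K + 2^-1) <= dl * (0 - 0 + P) + (dl * A - err) / 2 * I.
Proof.
move=> err0 h1 h2 r0 rI dl0 P0 h4.
have g1 : (dl * A - err) / 2 * rate <= (dl * A - err) / 2 * I by rewrite ler_wpM2l// divr_ge0// subr_ge0.
have g2 := ler_wpM2l dl0 h2; have g3 : 0 <= dl * P by rewrite mulr_ge0.
have E1 : (dl * A - err) / 2 * rate = dl * (A * rate) / 2 - err * rate / 2 by field.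
have E2 : dl * (2 * (K + 1)) = 2 * (dl * (K + 2^-1)) + dl by field.
rewrite subrr add0r; rewrite E1 in g1; rewrite E2 in g2; lra.
Qed.

End contact_contradictions.

(** * Exclusion of contact points *)

Section contact_point.
Context {R : realType} {d l : nat}.
Variables (alpha gamma sigma lambda Lambda lambda0 sigma0 sigma1 T rad : R)
  (nu : {measure set 'rV[R]_d -> \bar R}) (Sigma : 'rV[R]_d -> 'M[R]_(d, l))
  (b : R -> 'rV[R]_d -> 'rV[R]_d).
Hypotheses (d0 : (0 < d)%N) (s02 : 0 < sigma < 2) (l0 : 0 <= lambda) (l00 : 0 <= lambda0) (L0 : 0 <= Lambda)
  (hnu : levy_measure sigma lambda Lambda nu) (hS : bounded_lipschitz sigma0 sigma1 Sigma)
  (cb : {in [set p : R * 'rV[R]_d | 0 < p.1], continuous (fun p => b p.1 p.2)})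
  (rad0 : 0 < rad) (al0 : 0 < alpha) (g12 : 1 < gamma < 2) (hb : coercive_drift alpha gamma rad b).

Local Notation CV := (15 + 12 * rad ^+ 2).
Local Notation CJ := (15 + 12 * rad ^+ 2 + 4 * (2 + rad) ^+ 2).
Local Notation lyap := (lyap rad).
Local Notation mass := (@levy_mass R d sigma Lambda).

Variables (u : R -> 'rV[R]_d -> R) (mu0 C0 t1 C' c N n e A th kap m d1 Cd t s G C2 C3 : R)
  (dl : R -> R) (x y : 'rV[R]_d).
Hypotheses (hu : sep_sub sigma lambda0 T nu Sigma b u)
  (hv : sep_sub sigma lambda0 T nu Sigma b (fun t x => - u t x))
  (gu : growth sigma T mu0 C0 u) (tT : 0 < t < T) (sT : 0 < s < T)
  (A0 : 0 <= A) (th0 : 0 <= th) (ks : 2 - gamma < kap < sigma) (ms : 2 - gamma < m < sigma)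
  (xy0 : 0 < enorm (x - y)) (c0 : 0 <= c) (N0 : 0 <= N) (n0 : 0 <= n) (e0 : 0 <= e)
  (dl0 : 0 < dl t) (Cd0 : 0 <= Cd)
  (dlL : forall t', 0 <= t' <= T -> `|dl t' - dl t| <= c * `|t' - t|)
  (dlT : forall t', 0 <= t' <= T -> dl t' <= dl t + d1 * (t' - t) + Cd * (t' - t) ^+ 2)
  (hmax : forall t' s' x' y', 0 <= t' <= T -> 0 <= s' <= T ->
     penalized T t1 C' u dl (doubled_weight rad A th kap) (lyap m) e N n t' s' x' y' <=
     penalized T t1 C' u dl (doubled_weight rad A th kap) (lyap m) e N n t s x y)
  (GG : lambda0 * d%:R + sigma0 ^+ 2 <= G)
  (hC2 : forall x : 'rV[R]_d, CJ * `|mass kap| * lyap (Num.max 0 (kap - 1)) x <=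
     kap * alpha / 8 * lyap (kap - (2 - gamma)) x + C2)
  (hC3 : forall x : 'rV[R]_d, CJ * `|mass m| * lyap (Num.max 0 (m - 1)) x <=
     m * alpha / 2 * lyap (m - (2 - gamma)) x + C3)
  (hC' : 2 * (m * alpha) + 4 * CV * G + 2 * C3 <= C')
  (hd1 : - (d1 * doubled_weight rad A th kap x y) <=
     dl t * (kap * alpha / 4 * (lyap (kap - (2 - gamma)) x + lyap (kap - (2 - gamma)) y))).

Local Notation K := (2 * (kap * alpha) + 4 * CV * G + 2 * C2).
Local Notation P := (kap * alpha / 8 * (lyap (kap - (2 - gamma)) x + lyap (kap - (2 - gamma)) y)).

Let tI : 0 <= t <= T. Proof. by case/andP: tT => /ltW -> /ltW ->. Qed.
Let sI : 0 <= s <= T. Proof. by case/andP: sT => /ltW -> /ltW ->. Qed.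

Let P0 : 0 <= P.
Proof.
have k0 : 0 < kap by case/andP: ks => + _; apply: lt_trans; rewrite subr_gt0; case/andP: g12.
apply: mulr_ge0; first by apply: divr_ge0 => //; exact: mulr_ge0 (ltW k0) (ltW al0).
by apply: addr_ge0; exact: ltW (lyap_gt0 _ _ _).
Qed.

Let core D e1 e2 me1 e101 e10 me2 e201 e20 hz := @core_inequality _ _ _ _ _ _ _ _ _ _ _ _ rad _ _ b
  d0 s02 l0 l00 L0 hnu hS cb rad0 al0 g12 hb _ _ _ t1 _ _ _ _ _ _ _ _ _ _ _ _ _ _ _ _ _ _ _ D e1 e2
  hu hv gu tT sT A0 th0 ks ms xy0 c0 N0 n0 e0 (ltW dl0) Cd0 dlL dlT hmax me1 e101 e10 me2 e201 e20 hz GG hC2 hC3 hC'.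

Let core_sync : d1 * doubled_weight rad A th kap x y +
    dl t * (dotv (b t x) (refl_grad A th (x - y)) - dotv (b s y) (refl_grad A th (x - y))) +
    dl t * (3 * (kap * alpha) / 8 * (lyap (kap - (2 - gamma)) x + lyap (kap - (2 - gamma)) y)) + 0 <=
  dl t * (K + A * expR (- (th * enorm (x - y))) * th * (4 * sigma1 ^+ 2 + 16 * sigma0 ^+ 2 - 2 * lambda0 * th)).
Proof.
have z01 (z : 'rV[R]_d) : (0 : R) <= (0 : R) <= 1 by rewrite lexx ler01.
have z0 (z : 'rV[R]_d) : enorm z <= 1 -> (0 : R) = 0 by [].
have mz : measurable_fun setT (fun _ : 'rV[R]_d => 0 : R) by exact: measurable_cst.
have := core mz z01 z0 mz z01 z0 (sync_of_max tI sI hmax).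
by rewrite !mul0r.
Qed.

(** Two sources can beat [K]: the dissipation by the drift when a point is far out, and the slope
    left over by the reflection when both points are in a bounded region. *)
Lemma no_contact_reflection cb0 :
  - cb0 * enorm (x - y) <= dotv (b t x - b t y) (x - y) ->
  enorm (b t y - b s y) * (A * th) <= 2^-1 ->
  4 * sigma1 ^+ 2 + 16 * sigma0 ^+ 2 + cb0 + 1 <= 2 * lambda0 * th ->
  K + 1 <= P \/ K + 1 <= A * th * expR (- (th * enorm (x - y))) -> False.
Proof.
move=> h1 h2 h3 h4.
have h3' : cb0 + (4 * sigma1 ^+ 2 + 16 * sigma0 ^+ 2 - 2 * lambda0 * th) + 1 <= 0 by exact: slope_arith.
have g := reflection_drift_le A0 th0 xy0 h1 h2 h3'.
apply: (contact_contradiction dl0 core_sync hd1).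
rewrite addr0 ler_wpM2l ?(ltW dl0)//.
by apply: far_or_near_reflection g _ P0 h4; rewrite !mulr_ge0// expR_ge0.
Qed.

Hypothesis thE : th = 0.

Let drift_free : dotv (b t x) (refl_grad A th (x - y)) - dotv (b s y) (refl_grad A th (x - y)) = 0 - 0.
Proof. by rewrite thE /refl_grad mulr0 mul0r scale0r !dotv0r. Qed.

Let trace_free :
  A * expR (- (th * enorm (x - y))) * th * (4 * sigma1 ^+ 2 + 16 * sigma0 ^+ 2 - 2 * lambda0 * th) = 0.
Proof. by rewrite [X in _ * X * _ = _]thE mulr0 mul0r. Qed.

Lemma no_contact_far : K + 1 <= P -> False.
Proof.
move=> h; have := core_sync; rewrite drift_free trace_free => H.
apply: (contact_contradiction dl0 H hd1); rewrite addr0 ler_wpM2l ?(ltW dl0)// !subr0 add0r.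
by apply: le_trans h; rewrite lerD2l invf_le1// ler1n.
Qed.

(** The gap at the maximum is at least [dl t * A], and merging jumps realize a fixed fraction of it
    at the merging rate; for large A this beats [K]. *)
Lemma no_contact_merging R0 err : 0 <= R0 -> enorm x <= R0 -> enorm y <= R0 -> 0 <= err ->
  err <= dl t * A -> err * @merging_rate R d sigma lambda R0 <= dl t ->
  2 * (K + 1) <= A * @merging_rate R d sigma lambda R0 ->
  (forall w, landing R0 w -> `|u t w - u s w| <= err) ->
  dl t * doubled_weight rad A th kap x y + e * (lyap m x + lyap m y) <= u t x - u s y -> False.
Proof.
move=> R00 xR yR err0 errA errr hA hw hgap.
pose g (w : 'rV[R]_d) := dl t * lyap kap w + e * lyap m w.
have hmax0 := hmax; rewrite thE in hmax0.
have [sl1 sl2] := slack_of_max tI sI hmax0.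
have g0 w : 0 <= g w by apply: addr_ge0; apply: mulr_ge0; rewrite ?(ltW dl0)// ltW// lyap_gt0.
have b0 : 0 < 2 - gamma by rewrite subr_gt0; case/andP: g12.
have s2 : sigma < 2 by case/andP: s02.
have range k : 2 - gamma < k < sigma -> 0 < k <= 2.
  by move=> /andP[kb ksig]; rewrite (lt_trans b0 kb) (ltW (lt_trans ksig s2)).
have kap02 := range _ ks; have m02 := range _ ms.
have hgap' : dl t * A + (g x + g y) <= u t x - u s y.
  apply: le_trans hgap; rewrite /doubled_weight thE /refl_dist mul0r oppr0 expR0.
  by rewrite constant_weight.
have rate0 : 0 <= @merging_rate R d sigma lambda R0 by rewrite /merging_rate divr_ge0// powR_ge0.
have [_ _ cu _] := gu.
have cut : continuous (u t) by exact: continuous_slice tI cu.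
have cus : continuous (u s) by exact: continuous_slice sI cu.
have cg : continuous g.
  apply: continuousDf; apply: continuousMf; [exact: cst_continuous|exact: continuous_lyap|exact: cst_continuous|exact: continuous_lyap].
have ca : continuous (fun w => u t x - g x + g w - u t w).
  apply: continuousDf; last by move=> w; exact: continuousN (cut w).
  by apply: continuousDf; [exact: cst_continuous|exact: cg].
have cb' : continuous (fun w => u s w + g w - (u s y + g y)).
  by apply: continuousDf; [exact: continuousDf|exact: cst_continuous].
(* At a common landing point the two values of u differ only through t and s, so the slacks add up
   to the whole gap, less [err]. *)
have hD w : landing R0 w -> dl t * A - err <= u t x - g x + g w - u t w + (u s w + g w - (u s y + g y)).
  by move=> lw; apply: slack_sum_ge hgap' (hw w lw) (g0 w).
have D0 : 0 <= dl t * A - err by rewrite subr_ge0.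
have [e1 [e2 [[m1 e101 e10 ha] [m2 e201 e20 hb'] hI]]] :=
  merging d0 s02 l0 L0 hnu R00 D0 ca cb' sl1 sl2 hD xR yR.
have := core m1 e101 e10 m2 e201 e20 (fun z => slack_jump (ha z) (hb' z)).
rewrite drift_free trace_free => H.
apply: (contact_contradiction dl0 H hd1).
rewrite (subr0 (0 - 0)); exact: merging_gain err0 errr hA rate0 hI (ltW dl0) P0 errA.
Qed.

End contact_point.

Section comparison.
Context {R : realType} {d : nat}.

Local Notation CJ rad := (15 + 12 * rad ^+ 2 + 4 * (2 + rad) ^+ 2).

Lemma three_terms_ge0 (a v g c : R) : 0 <= a -> 0 <= v -> 0 <= g -> 0 <= c -> 0 <= 2 * a + 4 * v * g + 2 * c.
Proof. by move=> *; rewrite !addr_ge0// !mulr_ge0. Qed.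

(** A maximum principle for a time-dependent multiple of the weight. [A] precedes the operator, [th]
    depends on it, and the time factor [dl] comes last, so the same [A] serves constant and decaying
    factors. The last condition on [dl] is imposed only where the bound is attained or exceeded,
    which allows a priori information to enter. *)
Lemma comparison (alpha gamma sigma kappa0 sigma0 sigma1 Lambda cb0 rad kap : R) : (0 < d)%N ->
  0 < sigma < 2 -> 1 < gamma < 2 -> 0 < alpha -> 0 < rad -> 0 < kappa0 -> 0 <= Lambda -> 0 < cb0 ->
  2 - gamma < kap < sigma ->
  exists2 A : R, 0 < A & forall l lambda0 lambda (Sigma : 'rV[R]_d -> 'M[R]_(d, l))
    (nu : {measure set 'rV[R]_d -> \bar R}) (b : R -> 'rV[R]_d -> 'rV[R]_d) T u mu0 C0,
  0 <= lambda0 -> 0 <= lambda -> lambda + lambda0 = kappa0 -> bounded_lipschitz sigma0 sigma1 Sigma ->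
  levy_measure sigma lambda Lambda nu ->
  {in [set p : R * 'rV[R]_d | 0 < p.1], continuous (fun p => b p.1 p.2)} ->
  coercive_drift alpha gamma rad b ->
  drift_cond_i lambda0 sigma cb0 b \/ drift_cond_ii lambda0 sigma cb0 b ->
  sep_sub sigma lambda0 T nu Sigma b u -> sep_sub sigma lambda0 T nu Sigma b (fun t x => - u t x) ->
  growth sigma T mu0 C0 u ->
  exists2 th : R, 0 <= th & forall (dl d1 : R -> R) (c Cd dmin : R), 0 <= c -> 0 <= Cd -> 0 < dmin ->
    (forall t, 0 <= t <= T -> dmin <= dl t) ->
    (forall t s, 0 <= t <= T -> 0 <= s <= T -> `|dl t - dl s| <= c * `|t - s|) ->
    (forall t s, 0 <= t <= T -> 0 <= s <= T -> dl s <= dl t + d1 t * (s - t) + Cd * (s - t) ^+ 2) ->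
    (forall x y, u 0 x - u 0 y <= dl 0 * doubled_weight rad A th kap x y) ->
    (forall t x y, 0 < t < T -> dl t * doubled_weight rad A th kap x y <= u t x - u t y ->
      - (d1 t * doubled_weight rad A th kap x y) <= dl t * (kap * alpha / 4 *
         (lyap rad (kap - (2 - gamma)) x + lyap rad (kap - (2 - gamma)) y))) ->
    forall t x y, 0 < t < T -> u t x - u t y <= dl t * doubled_weight rad A th kap x y.
Proof.
move=> d0 s02 g12 al0 rad0 ka0 L0 cb00 ks.
have b0 : 0 < 2 - gamma by rewrite subr_gt0; case/andP: g12.
have b1 : 2 - gamma < 1 by rewrite ltrBlDr -ltrBlDl; case/andP: g12 => h _; move: h; clear; lra.
have /andP[kb ksig] := ks; have s2 : sigma < 2 by case/andP: s02.
have k0 : 0 < kap := lt_trans b0 kb.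
have CV0 : 0 <= 15 + 12 * rad ^+ 2 by rewrite addr_ge0// mulr_ge0// sqr_ge0.
have CJ0 : 0 <= CJ rad by rewrite addr_ge0// mulr_ge0// sqr_ge0.
(* Here gamma > 1 acts: it makes 2 - gamma smaller than 1, so the power produced by jumps is
   strictly below the power gained from the drift. *)
have om k : 2 - gamma < k -> 0 <= Num.max 0 (k - 1) < k - (2 - gamma).
  by move=> h; rewrite le_max lexx gt_max subr_gt0 h ltrD2l ltrN2.
have young k q : 2 - gamma < k -> 0 < q -> exists2 C : R, 0 <= C & forall x : 'rV[R]_d,
    CJ rad * `|@levy_mass R d sigma Lambda k| * lyap rad (Num.max 0 (k - 1)) x <= q * lyap rad (k - (2 - gamma)) x + C.
  by move=> h q0; apply: lyap_young => //; [exact: om|rewrite mulr_ge0].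
pose G := kappa0 * d%:R + sigma0 ^+ 2.
have G0 : 0 <= G by rewrite addr_ge0 ?sqr_ge0// mulr_ge0// ltW.
have ka8 : 0 < kap * alpha / 8 by rewrite divr_gt0// mulr_gt0.
have [C2 C20 hC2] := young kap (kap * alpha / 8) kb ka8.
pose K := 2 * (kap * alpha) + 4 * (15 + 12 * rad ^+ 2) * G + 2 * C2.
have K0 : 0 <= K by apply: three_terms_ge0 => //; exact: ltW (mulr_gt0 k0 al0).
have K10 : 0 < K + 1 by rewrite ltr_wpDl.
have kb' : 0 < kap - (2 - gamma) by rewrite subr_gt0.
have [R0 R00 hR0] := @lyap_large R d rad rad0 (kap - (2 - gamma)) (K + 1) (kap * alpha / 8) kb' (ltW K10) ka8.
(* With lambda0 at least half of kappa0, 2 lambda0 th1 covers the anisotropic noise, the drift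
   defect and one further unit. *)
pose th1 := (4 * sigma1 ^+ 2 + 16 * sigma0 ^+ 2 + cb0 + 1) / kappa0.
have th10 : 0 < th1.
  by rewrite divr_gt0// ltr_wpDl// !addr_ge0 ?(ltW cb00)// mulr_ge0// sqr_ge0.
pose E1 := th1 * expR (- (th1 * (2 * R0))).
have E10 : 0 < E1 by rewrite mulr_gt0// expR_gt0.
pose rho := @landing_radius R d R0 `^ (d%:R + sigma).
have rho0 : 0 < rho.
  rewrite powR_gt0// /landing_radius ltr_pwDl//.
  - by rewrite mulr_gt0// ltr_pwDr// ltW.
  - exact: ltW.
have rate10 : 0 < kappa0 / 2 / rho by rewrite !divr_gt0.
(* One summand for each coupling: [E1] is the least slope factor of phi over |x - y| <= 2 R0, and
   kappa0 / 2 / rho is a lower bound of the merging rate when lambda is at least kappa0 / 2. *)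
pose A := (K + 1) / E1 + 2 * (K + 1) / (kappa0 / 2 / rho).
have A10 : 0 < (K + 1) / E1 by rewrite divr_gt0.
have A20 : 0 < 2 * (K + 1) / (kappa0 / 2 / rho) by rewrite divr_gt0// mulr_gt0.
have A0 : 0 < A by rewrite addr_gt0.
exists A => // l lambda0 lambda Sigma nu b T u mu0 C0 l00 l0 lam hS hnu cb hb hcond hu hv gu.
(* Enough jump intensity selects merging, with a constant phi; otherwise lambda0 exceeds kappa0 / 2
   and reflection is used. *)
pose th := if kappa0 / 2 <= lambda then 0 else th1.
have th0 : 0 <= th by rewrite /th; case: ifP => // _; exact: ltW.
exists th => // dl d1 c Cd dmin c0 Cd0 dmin0 dlmin dlL dlT hinit hd1 t1 x1 y1 t1T.
rewrite leNgt; apply/negP => gap.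
have [/andP[mu00 mus] C00 cu uC] := gu.
(* Strictly above the growth of u and the exponent of the weight, so that the penalty is coercive;
   strictly below sigma, so that its jumps are integrable. *)
pose m := (Num.max mu0 kap + sigma) / 2.
have mx : Num.max mu0 kap < sigma by rewrite gt_max mus.
have [mm1 mm2] : mu0 <= Num.max mu0 kap /\ kap <= Num.max mu0 kap by rewrite !le_max !lexx orbT.
have mmu : mu0 < m by apply: le_lt_trans mm1 _; move: mx; rewrite /m; clear; lra.
have mk : kap < m by apply: le_lt_trans mm2 _; move: mx; rewrite /m; clear; lra.
have msig : m < sigma by move: mx; rewrite /m; clear; lra.
have ms : 2 - gamma < m < sigma by rewrite (lt_trans kb mk).
have m0 : 0 < m := lt_trans k0 mk.
have k02 : 0 < kap <= 2 by rewrite k0 (ltW (lt_trans ksig s2)).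
have m02 : 0 < m <= 2 by rewrite m0 (ltW (lt_trans msig s2)).
have ma2 : 0 < m * alpha / 2 by rewrite divr_gt0// mulr_gt0.
have [C3 C30 hC3] := young m (m * alpha / 2) (lt_trans kb mk) ma2.
pose C' := 2 * (m * alpha) + 4 * (15 + 12 * rad ^+ 2) * G + 2 * C3.
have C'0 : 0 <= C' by apply: three_terms_ge0 => //; exact: ltW (mulr_gt0 m0 al0).
have GG : lambda0 * d%:R + sigma0 ^+ 2 <= G.
  by rewrite lerD2r ler_wpM2r//; move: lam l0; clear; lra.
have mum : 0 <= mu0 < m by rewrite (ltW mu00).
have V0 (x : 'rV[R]_d) : 0 <= lyap rad m x by exact: ltW (lyap_gt0 _ _ _).
have W0 (x y : 'rV[R]_d) : 0 <= doubled_weight rad A th kap x y.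
  by apply: le_trans (ltW A0) (doubled_weight_ge rad kap x y (ltW A0) th0).
have dl_gt t : 0 <= t <= T -> 0 < dl t by move=> h; exact: lt_le_trans dmin0 (dlmin t h).
have [e [N [L [tau [e0 N0 tau0 H]]]]] := penalized_maximum cu uC (@continuous_lyap R d rad m m02) V0
  (fun e e0 => @lyap_absorb_growth R d rad C0 mu0 m e rad0 mum C00 e0)
  (@continuous_doubled_weight R d rad A th kap k02) W0
  (fun L => doubled_weight_bounded rad L (ltW A0) th0 k02) c0 (fun t h => ltW (dl_gt t h)) dlL hinit C'0 t1T gap.
have T0 : 0 < T by case/andP: t1T; exact: lt_trans.
have interior t : tau <= t < T -> 0 < t < T by move=> /andP[h1 ->]; rewrite (lt_le_trans tau0 h1).
have apart t x y : 0 < t < T -> dl t * doubled_weight rad A th kap x y <= u t x - u t y -> 0 < enorm (x - y).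
  move=> tT h; rewrite lt_def enorm_ge0 andbT enorm_eq0 subr_eq0; apply/negP => /eqP E.
  move: h; rewrite E subrr leNgt mulr_gt0//.
    by apply: dl_gt; case/andP: tT => /ltW -> /ltW ->.
  by apply: lt_le_trans A0 (doubled_weight_ge rad kap y y (ltW A0) th0).
have far (x y : 'rV[R]_d) : R0 <= enorm x \/ R0 <= enorm y ->
    K + 1 <= kap * alpha / 8 * (lyap rad (kap - (2 - gamma)) x + lyap rad (kap - (2 - gamma)) y).
  have p w : 0 <= kap * alpha / 8 * lyap rad (kap - (2 - gamma)) w :> R.
    by rewrite mulr_ge0 ?(ltW ka8)// ltW// lyap_gt0.
  by rewrite mulrDr => -[/hR0|/hR0] h; apply: le_trans h _; [rewrite lerDl; exact: p|rewrite lerDr; exact: p].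
have dlLt t t' : 0 < t < T -> 0 <= t' <= T -> `|dl t' - dl t| <= c * `|t' - t|.
  by move=> /andP[/ltW a1 /ltW a2] h; apply: dlL => //; rewrite a1.
have dlTt t t' : 0 < t < T -> 0 <= t' <= T -> dl t' <= dl t + d1 t * (t' - t) + Cd * (t' - t) ^+ 2.
  by move=> /andP[/ltW a1 /ltW a2] h; apply: dlT => //; rewrite a1.
have dl_pos t : 0 < t < T -> 0 < dl t by move=> /andP[/ltW a1 /ltW a2]; apply: dl_gt; rewrite a1.
have [lb|lb] := leP (kappa0 / 2) lambda.
  have thE : th = 0 by rewrite /th lb.
  pose rate := @merging_rate R d sigma lambda R0.
  have rate_low : kappa0 / 2 / rho <= rate by rewrite ler_wpM2r// invr_ge0 ltW.
  have rate0 : 0 <= rate := le_trans (ltW rate10) rate_low.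
  have rate1 : 0 < rate + 1 by rewrite ltr_wpDl.
  (* The first bound keeps the gap nonnegative after the change of time on the landing cube, the
     second keeps the lost gain below [dl t], where the + 1 avoids division by 0. *)
  pose err := Num.min (dmin * A) (dmin / (rate + 1)).
  have err0 : 0 < err by rewrite lt_min mulr_gt0// divr_gt0.
  have [r r0 hr] := unif_continuous_time (@landing_radius R d R0) cu err0.
  have [n [t [s [x [y [n0 _ [tt ss] ts [gap1 gap2 hmax]]]]]]] := H (r / 2) (divr_gt0 r0 (ltr0n R 2)).
  have tT := interior t tt; have sT := interior s ss; have xy0 := apart t x y tT gap1.
  have dlt := dl_pos t tT.
  have tI : 0 <= t <= T by case/andP: tT => /ltW -> /ltW ->.
  have sI : 0 <= s <= T by case/andP: sT => /ltW -> /ltW ->.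
  have contra_far := no_contact_far d0 s02 l0 l00 L0 hnu hS cb rad0 al0 g12 hb hu hv gu tT sT (ltW A0) th0 ks ms xy0
      c0 N0 n0 (ltW e0) dlt Cd0 (dlLt t ^~ tT) (dlTt t ^~ tT) hmax GG hC2 hC3 (lexx C') (hd1 t x y tT gap1) thE.
  have [xR|xR] := leP R0 (enorm x); first by apply: contra_far; apply: far; left.
  have [yR|yR] := leP R0 (enorm y); first by apply: contra_far; apply: far; right.
  apply: (no_contact_merging d0 s02 l0 l00 L0 hnu hS cb rad0 al0 g12 hb hu hv gu tT sT (ltW A0) th0 ks ms xy0
      c0 N0 n0 (ltW e0) dlt Cd0 (dlLt t ^~ tT) (dlTt t ^~ tT) hmax GG hC2 hC3 (lexx C') (hd1 t x y tT gap1) thE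
      (ltW R00) (ltW xR) (ltW yR) (ltW err0)) => //.
  - apply: (@le_trans _ _ (dmin * A)); first by rewrite ge_min lexx.
    by rewrite ler_wpM2r ?(ltW A0)// dlmin.
  - apply: (@le_trans _ _ (dmin / (rate + 1) * (rate + 1))); last by rewrite divfK ?dlmin// gt_eqF.
    by apply: ler_pM => //; [exact: ltW|rewrite ge_min lexx orbT|rewrite lerDl].
  - apply: (@le_trans _ _ (2 * (K + 1) / (kappa0 / 2 / rho) * (kappa0 / 2 / rho))); first by rewrite divfK// gt_eqF.
    by apply: ler_pM => //; [exact: ltW|exact: ltW|rewrite lerDr ltW].
  - move=> w lw; have wR : enorm w <= @landing_radius R d R0.
      have := landing_dist d0 (ltW R00) lw (x := 0); rewrite enorm0 subr0 => h.
      by case/andP: (h (ltW R00)).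
    apply/ltW/hr => //.
    + by apply: le_lt_trans ts _; rewrite ltr_pdivrMr// ltr_pMr// ltr1n.
    + by rewrite subrr enorm0.
have thE : th = th1 by rewrite /th leNgt lb.
have lam0 : kappa0 / 2 <= lambda0 by move: lam lb; clear; lra.
(* In this branch lambda0 is positive, which excludes the second alternative for the drift. *)
have hi : forall t x y, 0 < t -> - cb0 * enorm (x - y) <= dotv (b t x - b t y) (x - y).
  case: hcond => [[_ //]|[h _ _]].
  by move: lam0; rewrite h leNgt divr_gt0.
have Ath0 : 0 <= A * th by rewrite mulr_ge0// ltW.
have ep0 : 0 < 2^-1 / (A * th + 1) by rewrite divr_gt0 ?invr_gt0// ltr_wpDl.
have [r r0 hr] := drift_time_modulus T L cb tau0 ep0.
have [n [t [s [x [y [n0 [_ yL] [tt ss] ts [gap1 gap2 hmax]]]]]]] := H (r / 2) (divr_gt0 r0 (ltr0n R 2)).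
have tT := interior t tt; have sT := interior s ss; have xy0 := apart t x y tT gap1.
have dlt := dl_pos t tT; have t0 : 0 < t by case/andP: tT.
apply: (no_contact_reflection d0 s02 l0 l00 L0 hnu hS cb rad0 al0 g12 hb hu hv gu tT sT (ltW A0) th0 ks ms xy0
      c0 N0 n0 (ltW e0) dlt Cd0 (dlLt t ^~ tT) (dlTt t ^~ tT) hmax GG hC2 hC3 (lexx C') (hd1 t x y tT gap1)
      (hi t x y t0)).
- have h : enorm (b t y - b s y) <= 2^-1 / (A * th + 1).
    apply: hr => //; [by case/andP: tt => -> /ltW ->|by case/andP: ss => -> /ltW ->|].
    by apply: le_lt_trans ts _; rewrite ltr_pdivrMr// ltr_pMr// ltr1n.
  apply: (@le_trans _ _ (2^-1 / (A * th + 1) * (A * th + 1))); last by rewrite divfK// gt_eqF// ltr_wpDl.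
  by apply: ler_pM => //; [exact: enorm_ge0|rewrite lerDl].
- have -> : 4 * sigma1 ^+ 2 + 16 * sigma0 ^+ 2 + cb0 + 1 = kappa0 * th by rewrite thE /th1 [RHS]mulrC divfK// gt_eqF.
  by rewrite ler_wpM2r//; move: lam0; clear; lra.
- have [xR|xR] := leP R0 (enorm x); first by left; apply: far; left.
  have [yR|yR] := leP R0 (enorm y); first by left; apply: far; right.
  right; rewrite thE.
  apply: (@le_trans _ _ ((K + 1) / E1 * E1)); first by rewrite divfK// gt_eqF.
  rewrite -(mulrA A); apply: ler_pM; [exact: ltW|exact: ltW|by rewrite lerDl ltW|].
  rewrite ler_wpM2l ?(ltW th10)// ler_expR lerN2 ler_wpM2l ?(ltW th10)//.
  by apply: le_trans (enormB x y) _; move: xR yR; clear; lra.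
Qed.

End comparison.

(** * Decay of the weighted oscillation *)

Section time_weight.
Context {R : realType}.

(** Convexity of r^(- q), read off from exp x >= 1 + x and ln (1 + x) <= x after scaling by r. *)
Lemma powRN_tangent (q r s : R) : 0 <= q -> 0 < r -> 0 < s ->
  r `^ (- q) - q * r `^ (- q - 1) * (s - r) <= s `^ (- q).
Proof.
move=> q0 r0 s0; have sr0 : 0 < s / r by rewrite divr_gt0.
have h : 1 - q * (s / r - 1) <= (s / r) `^ (- q).
  rewrite /powR gt_eqF//; apply: le_trans (expR_ge1Dx _); rewrite lerD2l mulNr lerN2 ler_wpM2l//.
  have h0 := @le_ln1Dx R (s / r - 1); have E : 1 + (s / r - 1) = s / r by rewrite addrC subrK.
  by rewrite E in h0; apply: h0; rewrite ltrBrDl subrr.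
have E : s `^ (- q) = r `^ (- q) * (s / r) `^ (- q).
  by rewrite -powRM ?(ltW r0) ?(ltW sr0)// mulrCA divff ?mulr1// gt_eqF.
rewrite E; apply: le_trans (ler_wpM2l (powR_ge0 _ _) h).
rewrite powRD ?(gt_eqF r0) ?implybT// powR_inv1 ?(ltW r0)//.
by rewrite le_eqVlt; apply/orP; left; apply/eqP; field; rewrite gt_eqF.
Qed.

Lemma powRN_lip (q r s : R) : 0 <= q -> 1 <= r -> 1 <= s -> `|r `^ (- q) - s `^ (- q)| <= q * `|r - s|.
Proof.
move=> q0 r1 s1; have r0 := lt_le_trans ltr01 r1; have s0 := lt_le_trans ltr01 s1.
have p1 a : 1 <= a -> a `^ (- q - 1) <= 1.
  by move=> a1; rewrite -[leRHS](powRr0 a) ler_powR// -opprD oppr_le0 addr_ge0.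
have side a c : 1 <= a -> 1 <= c -> a `^ (- q) - c `^ (- q) <= q * `|a - c|.
  move=> a1 c1; have := powRN_tangent q0 (lt_le_trans ltr01 a1) (lt_le_trans ltr01 c1).
  have h : q * a `^ (- q - 1) * (c - a) <= q * `|a - c|.
    rewrite -mulrA ler_wpM2l// distrC; apply: le_trans (ler_wpM2l (powR_ge0 _ _) (ler_norm _)) _.
    by rewrite ler_piMl// p1.
  by move: h; clear; lra.
rewrite ler_norml lerNl opprB; apply/andP; split; last exact: side.
by rewrite distrC side.
Qed.

(** The tangent at s bounds s^(- q) with the slope at s; replacing it by the slope at r costs the
    Lipschitz constant q + 1 of r^(- q - 1). *)
Lemma powRN_taylor (q r s : R) : 0 <= q -> 1 <= r -> 1 <= s ->
  s `^ (- q) <= r `^ (- q) - q * r `^ (- q - 1) * (s - r) + q * (q + 1) * (s - r) ^+ 2.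
Proof.
move=> q0 r1 s1; have q10 : 0 <= q + 1 by rewrite addr_ge0.
have h1 := powRN_tangent q0 (lt_le_trans ltr01 s1) (lt_le_trans ltr01 r1).
have := powRN_lip q10 r1 s1; rewrite opprD => h2.
have h3 : q * ((r `^ (- q - 1) - s `^ (- q - 1)) * (s - r)) <= q * ((q + 1) * (s - r) ^+ 2).
  rewrite ler_wpM2l//; apply: le_trans (ler_norm _) _; rewrite normrM.
  apply: le_trans (ler_wpM2r (normr_ge0 _) h2) _.
  by rewrite -mulrA [`|r - s|]distrC -expr2 real_normK// num_real.
have E : q * ((r `^ (- q - 1) - s `^ (- q - 1)) * (s - r)) =
  q * r `^ (- q - 1) * (s - r) + q * s `^ (- q - 1) * (r - s) by ring.
rewrite E in h3; move: h1 h3; rewrite mulrA; clear; lra.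
Qed.

Lemma powRN_anti (q r s : R) : 0 <= q -> 0 < r -> r <= s -> s `^ (- q) <= r `^ (- q).
Proof.
move=> q0 r0 rs; rewrite !powRN lef_pV2 ?posrE ?powR_gt0//; last exact: lt_le_trans rs.
by rewrite ge0_ler_powR// nnegrE ltW// (lt_le_trans r0).
Qed.

(** For the larger of the two numbers, the sum of lower powers is at most twice its own; the bound
    then passes to the smaller one by monotonicity. *)
Lemma two_point_growth (c e p r a b : R) : 0 <= c -> 0 <= p <= r -> 1 <= a -> 1 <= b ->
  c * (a `^ r + b `^ r) <= e * (a `^ p + b `^ p) -> c * a `^ (r - p) <= 2 * e.
Proof.
move=> c0 /andP[p0 pr]; wlog ba : a b / b <= a => [H a1 b1 h|a1 b1 h].
  have [ba|ab] := leP b a; first exact: H ba a1 b1 h.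
  apply: le_trans (H b a (ltW ab) b1 a1 _); last by rewrite addrC [X in e * X]addrC.
  rewrite ler_wpM2l// ge0_ler_powR ?subr_ge0 ?nnegrE ?(ltW ab)//; first by lra.
  by lra.
have a0 : 0 < a := lt_le_trans ltr01 a1.
have e0 : 0 <= e.
  have s0 : 0 < a `^ p + b `^ p by rewrite ltr_pwDl ?powR_ge0 ?powR_gt0.
  have h0 : 0 <= c * (a `^ r + b `^ r) by rewrite mulr_ge0// addr_ge0// powR_ge0.
  by have := le_trans h0 h; rewrite pmulr_lge0.
have P0 : 0 < a `^ p by rewrite powR_gt0.
rewrite -(ler_pM2r P0) -mulrA -powRD ?(gt_eqF a0) ?implybT// subrK.
apply: (@le_trans _ _ (c * (a `^ r + b `^ r))); first by rewrite ler_wpM2l// lerDl powR_ge0.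
apply: le_trans h _; rewrite [2 * e]mulrC -mulrA ler_wpM2l//.
have : b `^ p <= a `^ p by rewrite ge0_ler_powR ?nnegrE//; lra.
by lra.
Qed.

Lemma weight_cancel (q T A P c : R) : 0 < q -> 0 < T -> 0 < A -> q / T * (A * (P * (c / (q * A) * T))) = c * P.
Proof. by move=> q0 T0 A0; field; rewrite !gt_eqF. Qed.

End time_weight.

Section weight_bounds.
Context {R : realType} {d : nat} (rad : R) (rad0 : 0 < rad).
Implicit Types x y : 'rV[R]_d.

Lemma doubled_weight_le A th kap x y : 0 <= A -> 0 <= th -> 0 <= kap ->
  doubled_weight rad A th kap x y <= (A + 1) * (lyap rad kap x + lyap rad kap y).
Proof.
move=> A0 th0 k0; have /andP[_ h] := refl_dist_bounds (x - y) A0 th0.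
have h1 := lyap_ge1 rad x k0; have h2 := lyap_ge1 rad y k0.
have : A * 2 <= A * (lyap rad kap x + lyap rad kap y) by rewrite ler_wpM2l//; lra.
rewrite /doubled_weight mulrDl mul1r; move: h; move: (refl_dist _ _ _) (lyap _ _ x) (lyap _ _ y) => r a b.
by clear; lra.
Qed.

Lemma lyap_sum_le_weight A th kap x y : 0 <= A -> 0 <= th ->
  lyap rad kap x + lyap rad kap y <= doubled_weight rad A th kap x y.
Proof.
move=> A0 th0; have /andP[h _] := refl_dist_bounds (x - y) A0 th0.
by rewrite /doubled_weight; lra.
Qed.

(* At a point where the weight D (1 + t)^(-q) W is reached, the bound with the smaller exponent forces
   lyap 1 to be at most of order (1 + t)^(1 / beta); there the decay of the weight is slower than the
   dissipation by the drift. *)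
Lemma decay_absorbed (A1 A2 th k kb be t q B c2 Dt : R) x y : 0 <= A2 -> 0 <= th ->
  0 < k < kb -> 0 < be -> 0 <= t -> q = (kb - k) / be -> 0 <= Dt -> 0 <= A1 -> 0 < B -> 0 < c2 ->
  2 * (A1 + 1) <= B * (c2 / (q * (A2 + 1))) `^ q ->
  B * (1 + t) `^ (- q) * (lyap rad kb x + lyap rad kb y) <= (A1 + 1) * (lyap rad k x + lyap rad k y) ->
  q / (1 + t) * Dt * doubled_weight rad A2 th kb x y <=
    Dt * (c2 * (lyap rad (kb - be) x + lyap rad (kb - be) y)).
Proof.
move=> A20 th0 /andP[k0 kkb] be0 t0 qE D0 A10 B0 c20 hB h.
have q0 : 0 < q by rewrite qE divr_gt0// subr_gt0.
have kb0 : 0 <= kb by rewrite ltW// (lt_trans k0).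
have T0 : 0 < 1 + t by rewrite ltr_pwDl.
have qA : 0 < q * (A2 + 1) by rewrite mulr_gt0// ltr_wpDl.
pose eta := c2 / (q * (A2 + 1)); have eta0 : 0 < eta by rewrite divr_gt0.
have c0 : 0 <= B * (1 + t) `^ (- q) by rewrite mulr_ge0 ?powR_ge0// ltW.
have one x' : 1 <= lyap rad 1 x' by exact: lyap_ge1.
have range : 0 <= k <= kb by rewrite !ltW.
have step x' y' : B * (1 + t) `^ (- q) * (lyap rad kb x' + lyap rad kb y') <= (A1 + 1) * (lyap rad k x' + lyap rad k y') ->
    lyap rad be x' <= eta * (1 + t).
  rewrite !(lyap_powE rad kb) !(lyap_powE rad k) => h'.
  have := two_point_growth c0 range (one x') (one y') h' => h2.
  have h3 := le_trans h2 hB; rewrite -mulrA ler_pM2l// powRN mulrC ler_pdivrMr ?powR_gt0// in h3.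
  rewrite -powRM ?(ltW eta0) ?(ltW T0)// in h3.
  (* This is where the exponent q originates: taking q-th roots turns the bound on the power kb - k
     into a bound on the power be that is linear in 1 + t. *)
  have E : kb - k = be * q by rewrite qE mulrC divfK// gt_eqF.
  rewrite E powRrM -lyap_powE in h3.
  rewrite leNgt; apply/negP => lt; move: h3; apply/negP; rewrite -ltNge gt0_ltr_powR// ?nnegrE.
    by rewrite mulr_ge0 ?(ltW eta0)// ltW.
  by exact: ltW (lyap_gt0 _ _ _).
have hx := step x y h.
have hy : lyap rad be y <= eta * (1 + t) by apply: (step y x); rewrite (addrC (lyap rad kb y)) (addrC (lyap rad k y)).
have cut (z : 'rV[R]_d) : lyap rad be z <= eta * (1 + t) ->
    lyap rad kb z <= lyap rad (kb - be) z * (eta * (1 + t)).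
  have -> : lyap rad kb z = lyap rad (kb - be) z * lyap rad be z by rewrite -lyapD subrK.
  by move=> hz; rewrite ler_wpM2l// ltW// lyap_gt0.
have W := doubled_weight_le x y A20 th0 kb0.
have := lerD (cut x hx) (cut y hy); rewrite -mulrDl; move: (lyap rad kb x + lyap rad kb y) (lyap rad (kb - be) x + _) W => S P W SP.
have P0 : q / (1 + t) * ((A2 + 1) * (P * (eta * (1 + t)))) = c2 * P.
  by rewrite /eta weight_cancel// ltr_wpDl.
rewrite -P0 mulrAC -[leRHS]mulrC ler_wpM2r// ler_wpM2l//; first by rewrite divr_ge0// ltW.
by apply: le_trans W _; rewrite ler_wpM2l// addr_ge0.
Qed.

End weight_bounds.

Section oscillation_decay.
Context {R : realType} {d : nat}.

Lemma decay_conclusion (u D1 B p A L W J M K w e : R) : 0 <= D1 -> 0 <= B -> 0 <= p -> 0 <= A ->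
  u <= B * D1 * p * W -> W <= (A + 1) * L -> L <= J -> D1 = (w + e) * K -> M = B * K * (A + 1) ->
  u <= M * p * w * J + e * (M * p * J).
Proof.
move=> D10 B0 p0 A0 h1 h2 h3 E1 E2; apply: le_trans h1 _.
have c0 : 0 <= B * D1 * p by rewrite !mulr_ge0.
apply: le_trans (ler_wpM2l c0 (le_trans h2 (ler_wpM2l _ h3))) _; first by rewrite addr_ge0.
by rewrite le_eqVlt; apply/orP; left; apply/eqP; rewrite E1 E2; ring.
Qed.

(** The comparison is used for k with a constant factor and for kb with a decaying one; the first
    result supplies the information required at contact points of the second. The bound is
    one-sided, for all ordered pairs, hence it controls the absolute value. *)
Lemma oscillation_decay (alpha gamma sigma kappa0 sigma0 sigma1 Lambda cb0 rad k kb : R) : (0 < d)%N ->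
  0 < sigma < 2 -> 1 < gamma < 2 -> 0 < alpha -> 0 < rad -> 0 < kappa0 -> 0 <= Lambda -> 0 < cb0 ->
  2 - gamma < k -> k < kb < sigma ->
  exists2 M : R, 0 < M & forall l lambda0 lambda (Sigma : 'rV[R]_d -> 'M[R]_(d, l))
    (nu : {measure set 'rV[R]_d -> \bar R}) (b : R -> 'rV[R]_d -> 'rV[R]_d) T u mu0 C0,
  0 <= lambda0 -> 0 <= lambda -> lambda + lambda0 = kappa0 -> bounded_lipschitz sigma0 sigma1 Sigma ->
  levy_measure sigma lambda Lambda nu ->
  {in [set p : R * 'rV[R]_d | 0 < p.1], continuous (fun p => b p.1 p.2)} ->
  coercive_drift alpha gamma rad b ->
  drift_cond_i lambda0 sigma cb0 b \/ drift_cond_ii lambda0 sigma cb0 b ->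
  sep_sub sigma lambda0 T nu Sigma b u -> sep_sub sigma lambda0 T nu Sigma b (fun t x => - u t x) ->
  growth sigma T mu0 C0 u -> forall w, 0 <= w ->
  (forall x y, u 0 x - u 0 y <= w * (japanese x `^ k + japanese y `^ k)) ->
  forall t x y, 0 < t < T ->
    u t x - u t y <= M * (1 + t) `^ (- ((kb - k) / (2 - gamma))) * w * (japanese x `^ kb + japanese y `^ kb).
Proof.
move=> d0 s02 g12 al0 rad0 ka0 L0 cb00 bk /andP[kkb kbs].
have b0 : 0 < 2 - gamma by rewrite subr_gt0; case/andP: g12.
have k0 : 0 < k := lt_trans b0 bk; have kb0 : 0 < kb := lt_trans k0 kkb.
have ks : 2 - gamma < k < sigma by rewrite bk (lt_trans kkb kbs).
have kbs' : 2 - gamma < kb < sigma by rewrite (lt_trans bk kkb).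
have [A1 A10 H1] := comparison sigma0 sigma1 d0 s02 g12 al0 rad0 ka0 L0 cb00 ks.
have [A2 A20 H2] := comparison sigma0 sigma1 d0 s02 g12 al0 rad0 ka0 L0 cb00 kbs'.
set q := (kb - k) / (2 - gamma).
have q0 : 0 < q by rewrite divr_gt0// subr_gt0.
pose c2 := kb * alpha / 4; have c20 : 0 < c2 by rewrite divr_gt0// mulr_gt0.
pose eta := c2 / (q * (A2 + 1)).
have eta0 : 0 < eta by rewrite divr_gt0// mulr_gt0// addr_gt0.
have eq0 : 0 < eta `^ q by rewrite powR_gt0.
(* The summand 1 makes the decaying bound valid at time 0; the other makes the region reached by
   contact points so small that the drift dominates the decay of the factor. *)
pose B := 1 + 2 * (A1 + 1) / eta `^ q.
have B1 : 1 <= B by rewrite lerDl divr_ge0 ?(ltW eq0)// mulr_ge0// addr_ge0// ltW.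
have B0 : 0 < B := lt_le_trans ltr01 B1.
have hB : 2 * (A1 + 1) <= B * (c2 / (q * (A2 + 1))) `^ q.
  have -> : B * (c2 / (q * (A2 + 1))) `^ q = eta `^ q + 2 * (A1 + 1) by rewrite /B mulrDl mul1r divfK// gt_eqF.
  by rewrite lerDr ltW.
pose Kk := (2 + rad) `^ k; have Kk0 : 0 < Kk by rewrite powR_gt0// addr_gt0.
exists (B * Kk * (A2 + 1)); first by rewrite !mulr_gt0// addr_gt0.
move=> l lambda0 lambda Sigma nu b T u mu0 C0 l00 l0 lam hS hnu cb hb hcond hu hv gu w w0 hw.
have [th1 th10 {}H1] := H1 _ _ _ _ _ _ _ _ _ _ l00 l0 lam hS hnu cb hb hcond hu hv gu.
have [th2 th20 {}H2] := H2 _ _ _ _ _ _ _ _ _ _ l00 l0 lam hS hnu cb hb hcond hu hv gu.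
move=> t x y tT; have T0 : 0 < T by case/andP: tT; exact: lt_trans.
set J := japanese x `^ kb + japanese y `^ kb; set p := (1 + t) `^ (- q).
apply: (@le_of_small_error _ _ _ (B * Kk * (A2 + 1) * p * J)) => e e0.
(* The comparison needs a strictly positive factor even if the initial oscillation is 0; [e] is
   removed at the end. [Kk] converts the Japanese weight into the Lyapunov function. *)
pose D1 := (w + e) * Kk; have we : 0 < w + e by rewrite ltr_wpDl.
have D10 : 0 < D1 by rewrite mulr_gt0.
have lyap0 kap x' : 0 <= lyap rad kap x' by exact: ltW (lyap_gt0 _ _ _).
have hu0 x' y' : u 0 x' - u 0 y' <= D1 * (lyap rad k x' + lyap rad k y').
  apply: le_trans (hw x' y') _; rewrite /D1 -mulrA; apply: ler_pM => //.
  - by rewrite addr_ge0// powR_ge0.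
  - by rewrite lerDl ltW.
  - by rewrite mulrDr lerD// japanese_le_lyap// ltW.
(* The non-decaying bound, with time slope 0, so that the condition at contact points is trivial. *)
have {}H1 t' x' y' : 0 < t' < T -> u t' x' - u t' y' <= D1 * ((A1 + 1) * (lyap rad k x' + lyap rad k y')).
  move=> t'T; apply: (@le_trans _ _ (D1 * doubled_weight rad A1 th1 k x' y')); last first.
    by rewrite ler_wpM2l ?(ltW D10)// doubled_weight_le// ltW.
  apply: (H1 (fun=> D1) (fun=> 0) 0 0 D1) => //.
  - by move=> t1 s1 _ _; rewrite subrr normr0 mul0r.
  - by move=> t1 s1 _ _; rewrite !mul0r !addr0.
  - move=> x1 y1; apply: le_trans (hu0 x1 y1) _; rewrite ler_wpM2l ?(ltW D10)//.
    by apply: lyap_sum_le_weight => //; exact: ltW.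
  - move=> t1 x1 y1 _ _; rewrite mul0r oppr0 mulr_ge0 ?(ltW D10)// mulr_ge0 ?addr_ge0//.
    by rewrite divr_ge0// mulr_ge0// ltW.
pose dl s := B * D1 * (1 + s) `^ (- q).
have BD0 : 0 < B * D1 by rewrite mulr_gt0.
have ge1 s : 0 <= s <= T -> 1 <= 1 + s by move=> /andP[h _]; rewrite lerDl.
have key : u t x - u t y <= dl t * doubled_weight rad A2 th2 kb x y.
  (* The slope of the factor is - q / (1 + s) times itself; its Lipschitz and second-order constants
     are those of (1 + s)^(- q) on 1 + s >= 1, and its least value is at T. *)
  apply: (H2 dl (fun s => - (q / (1 + s) * dl s)) (B * D1 * q) (B * D1 * (q * (q + 1))) (dl T)) => //.
  - by rewrite mulr_ge0 ?(ltW BD0)// ltW.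
  - by rewrite mulr_ge0 ?(ltW BD0)// mulr_ge0 ?addr_ge0// ltW.
  - by rewrite mulr_gt0// powR_gt0// addr_gt0.
  - move=> s sT; rewrite ler_wpM2l ?(ltW BD0)//; apply: powRN_anti; first exact: ltW.
      exact: lt_le_trans (ge1 _ sT).
    by rewrite lerD2l; case/andP: sT.
  - move=> t1 s1 /ge1 t11 /ge1 s11; rewrite -mulrBr normrM gtr0_norm// -mulrA ler_wpM2l ?(ltW BD0)//.
    by apply: le_trans (powRN_lip (ltW q0) t11 s11) _; rewrite opprD addrACA subrr add0r.
  - move=> t1 s1 /ge1 t11 /ge1 s11; have h := powRN_taylor (ltW q0) t11 s11.
    have t1p : 0 < 1 + t1 := lt_le_trans ltr01 t11.
    have E : 1 + s1 - (1 + t1) = s1 - t1 by rewrite opprD addrACA subrr add0r.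
    rewrite E powRD ?(gt_eqF t1p) ?implybT// powR_inv1 ?(ltW t1p)// in h.
    apply: le_trans (ler_wpM2l (ltW BD0) h) _; rewrite /dl le_eqVlt; apply/orP; left; apply/eqP; ring.
  - move=> x1 y1; rewrite /dl addr0 powR1 mulr1; apply: le_trans (hu0 x1 y1) _.
    rewrite (mulrC B) -(mulrA D1) ler_wpM2l ?(ltW D10)//.
    apply: (@le_trans _ _ (lyap rad kb x1 + lyap rad kb y1)).
      by apply: lerD; apply: ler_lyap; exact: ltW.
    apply: le_trans (lyap_sum_le_weight rad kb x1 y1 (ltW A20) th20) _.
    by rewrite ler_peMl// (le_trans (ltW A20))// doubled_weight_ge// ltW.
  - move=> t1 x1 y1 t1T hgap; rewrite mulNr opprK.
    have t10 : 0 <= t1 by case/andP: t1T => /ltW.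
    have kk : 0 < k < kb by rewrite k0.
    apply: (decay_absorbed (ltW A20) th20 kk b0 t10 erefl _ (ltW A10) B0 c20 hB).
      by rewrite mulr_ge0 ?(ltW BD0)// powR_ge0.
    rewrite -(ler_pM2l D10); apply: le_trans (H1 t1 x1 y1 t1T); apply: le_trans hgap.
    have -> : D1 * (B * (1 + t1) `^ (- q) * (lyap rad kb x1 + lyap rad kb y1)) =
        dl t1 * (lyap rad kb x1 + lyap rad kb y1) by rewrite /dl; ring.
    have dlt1 : 0 <= dl t1 := mulr_ge0 (ltW BD0) (powR_ge0 _ _).
    exact: ler_wpM2l dlt1 _ _ (lyap_sum_le_weight rad kb x1 y1 (ltW A20) th20).
apply: (decay_conclusion (ltW D10) (ltW B0) (powR_ge0 _ _) (ltW A20) key _ _ erefl erefl).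
  by apply: doubled_weight_le => //; exact: ltW.
by apply: lerD; apply: lyap_le_japanese; exact: ltW.
Qed.

End oscillation_decay.

Section weighted_oscillation.
Context {R : realType} {d : nat}.
Implicit Type f : 'rV[R]_d -> R.

Lemma japanese_sum_gt0 k (x y : 'rV[R]_d) : 0 < japanese x `^ k + japanese y `^ k.
Proof. by rewrite addr_gt0// powR_gt0// japanese_gt0. Qed.

Lemma wosc_ge0 k f : (0 <= wosc k f)%E.
Proof. by apply: ereal_sup_ubound; exists (0, 0) => //=; rewrite subrr normr0 mul0r. Qed.

Lemma wosc_ub k f (r : R) x y : wosc k f = r%:E -> f x - f y <= r * (japanese x `^ k + japanese y `^ k).
Proof.
move=> E; have : ((`|f x - f y| / (japanese x `^ k + japanese y `^ k))%:E <= wosc k f)%E.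
  by apply: ereal_sup_ubound; exists (x, y).
rewrite E lee_fin ler_pdivrMr ?japanese_sum_gt0//; exact: le_trans (ler_norm _).
Qed.

Lemma wosc_le k f (r : R) :
  (forall x y, f x - f y <= r * (japanese x `^ k + japanese y `^ k)) -> (wosc k f <= r%:E)%E.
Proof.
move=> h; apply: ge_ereal_sup => _ [[x y] _ <-] /=.
rewrite lee_fin ler_pdivrMr ?japanese_sum_gt0// ler_norml h andbT lerNl opprB.
by rewrite (addrC (_ `^ k)); exact: h.
Qed.

Lemma growth_of_subcritical T sigma (u : R -> 'rV[R]_d -> R) : 0 < T ->
  {within `[0, T] `*` setT, continuous (fun p => u p.1 p.2)} ->
  subcritical_growth sigma `[0, T] u -> exists m C, growth sigma T m C u.
Proof.
move=> T0 cu [m [C [ms uC]]]; have C0 : 0 <= C.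
  have := uC 0 0; rewrite /= in_itv /= lexx (ltW T0) => /(_ isT) h.
  have := le_trans (normr_ge0 _) h; rewrite pmulr_lge0//.
  by rewrite powR_gt0// japanese_gt0.
by exists m, C; split => // t x tT; apply: uC; rewrite /= in_itv.
Qed.

End weighted_oscillation.

(** The quantifier order expresses the dependence of M: lambda and lambda0 enter only through their
    sum [kappa], and the dimension l of the noise, the coefficients, T and the solution come after
    M. *)
Theorem theorem3p10 (R : realType) (d : nat)
    (alpha gamma sigma kappa sigma0 sigma1 Lambda c0 radius k kbar : R)
    (hd : (0 < d)%N)
    (hsigma : 0 < sigma < 2)
    (hgamma : 2 - sigma < gamma < 2) (hgamma1 : 1 < gamma)
    (halpha : 0 < alpha) (hradius : 0 < radius) (hkappa : 0 < kappa)
    (hLambda : 0 <= Lambda) (hc0 : 0 < c0)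
    (hk : 0 < k < sigma) (hkgamma : 2 - gamma < k)
    (hkbar : k < kbar < sigma) :
  exists2 M : R, 0 < M &
  forall (l : nat) (lambda0 lambda : R) (Sigma : 'rV[R]_d -> 'M[R]_(d, l))
    (nu : {measure set 'rV[R]_d -> \bar R})
    (b : R -> 'rV[R]_d -> 'rV[R]_d) (T : R)
    (u0 : 'rV[R]_d -> R) (u : R -> 'rV[R]_d -> R),
  0 <= lambda0 -> 0 <= lambda -> lambda + lambda0 = kappa ->
  bounded_lipschitz sigma0 sigma1 Sigma ->
  levy_measure sigma lambda Lambda nu ->
  {in [set p : R * 'rV[R]_d | 0 < p.1], continuous (fun p => b p.1 p.2)} ->
  coercive_drift alpha gamma radius b ->
  drift_cond_i lambda0 sigma c0 b \/ drift_cond_ii lambda0 sigma c0 b ->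
  0 < T ->
  continuous u0 ->
  viscosity_solution T sigma (op_L lambda0 Sigma nu) b u0 u ->
  (exists m C : R, [/\ 0 < m < sigma, 0 < C &
     forall (t : R) (x : 'rV[R]_d), 0 <= t <= T -> `|u t x| <= C * (1 + enorm x) `^ m]) ->
  weighted_Linfty k u0 ->
  forall t : R, 0 < t < T ->
  (wosc kbar (u t) <=
     (M * (1 + t) `^ (- ((kbar - k) / (2 - gamma))))%:E * wosc k u0)%E.
Proof.
have g12 : 1 < gamma < 2 by rewrite hgamma1; case/andP: hgamma.
have /andP[k0 ks] := hk; have /andP[kkb kbs] := hkbar.
have [M M0 HM] := oscillation_decay sigma0 sigma1 hd hsigma g12 halpha hradius hkappa hLambda hc0 hkgamma hkbar.
exists M => // l lambda0 lambda Sigma nu b T u0 u l00 l0 lam hS hnu cb hb hcond T0 _ hvisc _ _ t tT.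
have [hu hv] := viscosity_sep_sub hsigma l0 hLambda hnu T0 hvisc.
have [cu hgr u0E _ _] := hvisc.
have [m [C gu]] := growth_of_subcritical T0 cu hgr.
have p0 : 0 < (1 + t) `^ (- ((kbar - k) / (2 - gamma))).
  by rewrite powR_gt0// addr_gt0//; case/andP: tT.
have := wosc_ge0 k u0; case E : (wosc k u0) => [w| |] //.
  rewrite lee_fin => w0; apply: wosc_le => x y.
  apply: (HM _ _ _ _ _ _ _ _ _ _ l00 l0 lam hS hnu cb hb hcond hu hv gu w w0 _ t x y tT).
  by move=> x' y'; rewrite !u0E; exact: wosc_ub.
(* An infinite initial oscillation makes the right-hand side infinite because its factor is
   positive. *)
by move=> _; rewrite gt0_muley ?lte_fin ?mulr_gt0// leey.
Qed.
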